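(* Let $k\geq 4$ be an even integer, $N\geq 1$, and let $f\in S_k(\Gamma_0(N))$ be a newform with root number $\epsilon(f)\in\{\pm1\}$. Define the zeta-polynomial $Z_f(s)$ as in the context. Then: (1) for all $s\in\mathbb{C}$ we have $Z_f(s)=\epsilon(f)\,Z_f(1-s)$; (2) if $Z_f(\rho)=0$, then $\mathrm{Re}(\rho)=1/2$.
   Context: For a newform $f\in S_k(\Gamma_0(N))$, its $L$-function $L(f,s)$ is normalized so that the completed $L$-function $\Lambda(f,s):=\left(\frac{\sqrt N}{2\pi}\right)^s\Gamma(s)L(f,s)$ satisfies $\Lambda(f,s)=\epsilon(f)\Lambda(f,k-s)$ with $\epsilon(f)=\pm1$. For integers $m\geq 0$ define the weighted moments $$M_f(m):=\sum_{j=0}^{k-2}\left(\frac{\sqrt N}{2\pi}\right)^{j+1}\frac{L(f,j+1)}{(k-2-j)!}j^m=\frac{1}{(k-2)!}\sum_{j=0}^{k-2}\binom{k-2}{j}\Lambda(f,j+1)j^m$$ (with $0^0=1$). The signed Stirling numbers of the first kind $s(n,m)$ are defined by $x(x-1)\cdots(x-n+1)=\sum_{m=0}^n s(n,m)x^m$. Define $$Z_f(s):=\epsilon(f)\sum_{h=0}^{k-2}(-s)^h\sum_{m=0}^{k-2-h}\binom{m+h}{h}\, s(k-2,m+h)\, M_f(m).$$ *)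

(* Defs.v *)
From HB Require Import structures.
From mathcomp Require Import all_boot all_order all_algebra.
From mathcomp Require Import complex.
From mathcomp Require Import all_classical all_reals all_analysis.

Set Implicit Arguments.
Unset Strict Implicit.
Unset Printing Implicit Defensive.
Import Order.TTheory GRing.Theory Num.Theory.
Import numFieldNormedType.Exports.
Local Open Scope classical_set_scope.
Local Open Scope complex_scope.
Local Open Scope ring_scope.

(* The complex numbers are [R[i]]; [R[i]^o] is the same type, seen as a normed *)
(* space over itself, which is where its topology lives. Modular forms are     *)
(* total functions on [R[i]] of which only the values on the upper half-plane  *)
(* are ever constrained.                                                       *)

Section Complex.
Variable R : realType.

Definition cexp (z : R[i]) : R[i] :=
  (expR (complex.Re z))%:C * (cos (complex.Im z) +i* sin (complex.Im z)).

(* x ^ s for a positive real base x. *)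
Definition cpow (x : R) (s : R[i]) : R[i] := cexp (s * (ln x)%:C).

(* Complex differentiability: the difference quotients run over complex h. *)
Definition cdifferentiable (F : R[i] -> R[i]) (z : R[i]) : Prop :=
  derivable (F : R[i]^o -> R[i]^o) z 1.

Definition entire (F : R[i] -> R[i]) : Prop := forall z, cdifferentiable F z.

Definition csum_to (u : nat -> R[i]) (l : R[i]) : Prop :=
  series (u : nat -> R[i]^o) @ \oo --> (l : R[i]^o).

(* Euler's limit formula; it gives the meromorphic continuation of Gamma at    *)
(* every s other than its poles 0, -1, -2, ...                                 *)
Definition Gamma (s : R[i]) : R[i] :=
  lim ((fun n : nat => (n`!%:R * cpow n%:R s / \prod_(i < n.+1) (s + i%:R)
                         : R[i]^o)) @ \oo).

Definition Gamma_pole (s : R[i]) : Prop := exists n : nat, s = - n%:R.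

End Complex.

Section ModularForms.
Variable R : realType.
Implicit Types (f g : R[i] -> R[i]) (a : nat -> R[i]) (z s : R[i])
  (M : 'M[int]_2) (k N : nat).

Definition upper z : Prop := 0 < complex.Im z.

Definition SL2Z M : Prop := \det M = 1.

Definition Gamma0 N M : Prop := SL2Z M /\ (N%:Z %| M 1%R 0%R)%Z.

Definition autfactor M z : R[i] := (M 1 0)%:~R * z + (M 1 1)%:~R.

Definition mobius M z : R[i] :=
  ((M 0 0)%:~R * z + (M 0 1)%:~R) / autfactor M z.

Definition slash k M f z : R[i] := autfactor M z ^- k * f (mobius M z).

(* Vanishing of f|M at i*oo for every M in SL2(Z) is vanishing of f at every   *)
(* cusp.                                                                       *)
Definition cusp_form k N f : Prop :=
  [/\ forall z, upper z -> cdifferentiable f z,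
      forall M z, Gamma0 N M -> upper z -> slash k M f z = f z
    & forall M, SL2Z M -> forall e : R, 0 < e -> exists A : R,
        forall z, upper z -> A < complex.Im z -> `|slash k M f z| < e%:C].

Definition fourier_expansion f a : Prop :=
  forall z, upper z ->
    csum_to (fun n => a n * cexp ((2 * pi * n%:R)%:C * 'i * z)) (f z).

(* The Ford fundamental domain of Gamma_0(N): the points of largest imaginary  *)
(* part in their orbit, cut down to a strip of width 1 by the translations     *)
(* z |-> z + 1. For N = 1 it is the usual domain |Re z| <= 1/2, |z| >= 1.      *)
Definition ford_domain N : set (R * R) :=
  [set p | [/\ 0 < p.2, `|p.1| <= 2^-1
    & forall M, Gamma0 N M -> 1 <= `|autfactor M (p.1 +i* p.2)|]].

(* Unnormalized Petersson product: the integral of f(z) conj(g(z)) y^k against *)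
(* the invariant measure dx dy / y^2.                                          *)
Definition petersson k N f g : R[i] :=
  let mu := (@lebesgue_measure R \x @lebesgue_measure R)%E in
  let F (p : R * R) : R[i] :=
    f (p.1 +i* p.2) * (g (p.1 +i* p.2))^* * (p.2 ^+ k / p.2 ^+ 2)%:C in
  Rintegral mu (ford_domain N) (fun p => complex.Re (F p))
  +i* Rintegral mu (ford_domain N) (fun p => complex.Im (F p)).

(* Orthogonality to the generators z |-> g(d z) of the space of oldforms.      *)
Definition orthogonal_to_oldforms k N f : Prop :=
  forall (N' d : nat) g, (N' < N)%N -> (d * N' %| N)%N -> cusp_form k N' g ->
    petersson k N f (fun z => g (d%:R * z)) = 0.

(* T_n f (z) = n^(k-1) sum_(d e = n, (e, N) = 1) d^(-k) sum_(b mod d)          *)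
(*               f((e z + b) / d);                                             *)
(* for a prime n dividing N this is the operator often written U_n.            *)
Definition hecke k N (n : nat) f z : R[i] :=
  n%:R ^+ k.-1 *
  \sum_(d <- divisors n | coprime (n %/ d) N)
    d%:R ^- k * \sum_(b < d) f (((n %/ d)%:R * z + b%:R) / d%:R).

Definition newform k N f : Prop :=
  [/\ cusp_form k N f,
      orthogonal_to_oldforms k N f,
      forall n : nat, (0 < n)%N -> exists lambda : R[i],
        forall z, upper z -> hecke k N n f z = lambda * f z
    & exists2 a, fourier_expansion f a & a 1%N = 1].

(* L(f, s): the Dirichlet series of f, which converges for Re s > k/2 + 1, and *)
(* its (unique) continuation to an entire function.                            *)
Definition is_Lfunction k f (L : R[i] -> R[i]) : Prop :=
  entire L /\ exists2 a, fourier_expansion f a &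
    forall s, k%:R / 2 + 1 < complex.Re s ->
      csum_to (fun n => a n.+1 * cpow n.+1%:R (- s)) (L s).

Definition Lambda N (L : R[i] -> R[i]) s : R[i] :=
  cpow (Num.sqrt N%:R / (2 * pi)) s * Gamma s * L s.

Definition is_root_number k N (L : R[i] -> R[i]) (eps : R[i]) : Prop :=
  (eps = 1 \/ eps = -1) /\
  forall s, ~ Gamma_pole s -> ~ Gamma_pole (k%:R - s) ->
    Lambda N L s = eps * Lambda N L (k%:R - s).

Definition Mf k N (L : R[i] -> R[i]) (m : nat) : R[i] :=
  \sum_(0 <= j < k.-1)
    ((Num.sqrt N%:R / (2 * pi)) ^+ j.+1)%:C * (L j.+1%:R / ((k - 2 - j)`!)%:R)
    * j%:R ^+ m.

Definition stirling1 (n m : nat) : int :=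
  (\prod_(0 <= i < n) ('X - i%:Z%:P) : {poly int})`_m.

Definition Zf k N (L : R[i] -> R[i]) (eps s : R[i]) : R[i] :=
  eps * \sum_(0 <= h < k.-1) (- s) ^+ h *
    \sum_(0 <= m < (k - 2 - h).+1)
      ('C(m + h, h))%:R * (stirling1 (k - 2) (m + h))%:~R * Mf k N L m.

End ModularForms.

(* Main.v *)
(* Put k = 2K and Xi(w) = Lambda(f, K + w), which is real on the real axis.     *)
(*                                                                              *)
(* Zeros. For |z| > 1 let F_0(w) = Xi(w + 1/2) and                              *)
(* F_(n+1)(w) = F_n(w - 1/2) + z F_n(w + 1/2). The Euler product keeps F_0 away *)
(* from 0 on Re w > 0. Comparing F_n with its reflection in a vertical line, by *)
(* the functional equation and Phragmen-Lindelof in a half-plane, one finds     *)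
(* |F_n(w - 1/2)| <= |F_n(w + 1/2)| for Re w > 0, and so inductively            *)
(* |F_(n+1)(w)| >= (|z| - 1) |F_n(w + 1/2)| > 0. In the limit                   *)
(* w = 0 this says that sum_j C(k-2, j) Lambda(f, j + 1) z^j has no zero with   *)
(* |z| > 1, and by the functional equation all its zeros have |z| = 1. The zeta *)
(* polynomial is, up to a factor, the image of this polynomial under            *)
(* z^j |-> (s - j)(s - j + 1)...(s - j + k - 3); adjoining one unimodular root  *)
(* at a time moves the zeros of the image to the critical line                  *)
(* (Rodriguez-Villegas).                                                        *)
(*                                                                              *)
(* Realness. For p not dividing N, let z run through the half-plane modulo      *)
(* Gamma_0(N) and M through the integral matrices of determinant p and level N. *)
(* The flux Im((f|M)(z) conj(f(z)) y^k) from z to Mz is antisymmetric, so its   *)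
(* total outflow is 0; but the outflow from z is a multiple of                  *)
(* Im(a_p) |f(z)|^2 y^k, and therefore a_p is real. For p | N, comparing the    *)
(* functional equations of L(f, s) and of its conjugate shows that the finite   *)
(* Euler product E(s) over these primes and its conjugate E' satisfy            *)
(* E(s) E'(k - s) = E'(s) E(k - s), and the zeros of the factor at p must then  *)
(* occur among those of the other side, which forces a_p to be real.            *)

From HB Require Import structures.
Require Import Defs.
From mathcomp Require Import all_boot all_order all_algebra.
From mathcomp Require Import complex.
From mathcomp Require Import all_classical all_reals all_analysis.
From mathcomp Require Import measurable_realfun.
From mathcomp Require Import ring lra zify.
Import Order.TTheory GRing.Theory Num.Theory.
Import numFieldNormedType.Exports.
Set Implicit Arguments.
Unset Strict Implicit.
Unset Printing Implicit Defensive.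
Local Open Scope classical_set_scope.
Local Open Scope ring_scope.
Local Open Scope complex_scope.

(** The Stirling numbers in [Zf] only encode falling factorials. With k = 2K and Xi(w) = Lambda(f, K
    + w), [Zf_zeta_sum] rewrites Z_f(s) as a nonzero multiple of the sum over j of C(k-2, j) Xi(j -
    (k-2)/2) (s-j)(s-j+1)...(s-j+k-3). The functional equation Xi(-w) = eps Xi(w) and the reversal
    of j give the symmetry of Z_f. So it is enough to exclude zeros with Re s > 1/2, which is
    [zeta_sum_neq0].

    Let U(z) be the polynomial with coefficients C(k-2, j) Xi(j - (k-2)/2), and T the shift s -> s -
    1. The displayed sum is U(T) applied to a rising factorial. If all roots of U have modulus at
    least 1, the factors T - zeta can be applied one at a time, and each confines the zeros of the
    cofactor to a half-plane ([pact_neq0]).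

    That U has no root inside the unit disc is [xi_poly_inner]; by reciprocity it amounts to
    [xi_poly_outer]. There U(z) = A(z) + z P(z), where P has degree k - 3 and uses the values of Xi
    shifted by 1/2, and A is P reversed. Once the roots of P lie in the closed disc, a Blaschke
    comparison gives |A| <= |P| < |z P| for |z| > 1. The roots of P are controlled by
    [binomial_transform_neq0]: the functions [shifted] satisfy |F_m(w - 1/2)| <= |F_m(w + 1/2)| for
    Re w > 0 ([shifted_compare]), by Phragmen-Lindelof applied to F_m divided into its reflection.
    The properties of Xi that this uses are collected in [xi_like].

    The start of that iteration needs Xi to be nonzero for Re w > 1/2. Mean square bounds for the
    coefficients give absolute convergence of the L-series in exactly that region ([dirichlet_abs]),
    and the Euler product then bounds L away from 0 ([Lseries_lower]).

    The reflection needs Xi(conj w) = conj Xi(w), that is, real coefficients. For p not dividing N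
    this is [hecke_eigenvalue_real], a mass transport argument with an invariant integral on the
    half-plane. For p dividing N it follows from comparing the functional equations of L and of its
    conjugate ([bad_euler_symm], [ramified_real]). *)

Local Notation ii := (Complex 0 1).
Local Notation cj := conjc.

(** * Modulus, continuity and differentiability on the complex plane *)

Section ComplexBasics.
Variable R : realType.
Local Notation C := R[i].
Local Notation Re := complex.Re.
Local Notation Im := complex.Im.
Implicit Types (z w : C) (F G : C -> C).

(** The norm of R[i] takes values in R[i]; this real-valued copy puts the estimates within reach of
    real linear arithmetic. *)
Definition cabs z : R := Re `|z|.

Lemma cabsE z : `|z| = (cabs z)%:C.
Proof. by rewrite /cabs normc_def. Qed.

Lemma cabs_sqrt z : cabs z = Num.sqrt (Re z ^+ 2 + Im z ^+ 2).
Proof. by rewrite /cabs normc_def. Qed.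

Lemma cabs_ge0 z : 0 <= cabs z.
Proof. by rewrite cabs_sqrt sqrtr_ge0. Qed.

Lemma cabs_sq z : cabs z ^+ 2 = Re z ^+ 2 + Im z ^+ 2.
Proof. by rewrite cabs_sqrt sqr_sqrtr// addr_ge0 ?sqr_ge0. Qed.

Lemma cabsM z w : cabs (z * w) = cabs z * cabs w.
Proof. by apply: complexI; rewrite rmorphM -!cabsE normrM. Qed.

Lemma cabsD z w : cabs (z + w) <= cabs z + cabs w.
Proof. by rewrite -lecR rmorphD -!cabsE ler_normD. Qed.

Lemma cabsN z : cabs (- z) = cabs z.
Proof. by rewrite /cabs normrN. Qed.

Lemma cabsB z w : cabs (z - w) <= cabs z + cabs w.
Proof. by rewrite -(cabsN w) cabsD. Qed.

Lemma cabs_distC z w : cabs (z - w) = cabs (w - z).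
Proof. by rewrite -cabsN opprB. Qed.

Lemma cabsB_ge z w : cabs z - cabs w <= cabs (z - w).
Proof. by rewrite lerBlDr (le_trans _ (cabsD _ _))// subrK. Qed.

Lemma cabsV z : cabs z^-1 = (cabs z)^-1.
Proof. by apply: complexI; rewrite [RHS]fmorphV/= -!cabsE normfV. Qed.

Lemma cabs0 : cabs 0 = 0.
Proof. by rewrite /cabs normr0. Qed.

Lemma cabs1 : cabs 1 = 1.
Proof. by rewrite /cabs normr1. Qed.

Lemma cabs_eq0 z : (cabs z == 0) = (z == 0).
Proof. by rewrite -[RHS]normr_eq0 cabsE -(inj_eq (@complexI R)). Qed.

Lemma cabs_gt0 z : (0 < cabs z) = (z != 0).
Proof. by rewrite lt_def cabs_ge0 cabs_eq0 andbT. Qed.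

Lemma cabsX z n : cabs (z ^+ n) = cabs z ^+ n.
Proof. by elim: n => [|n IH]; rewrite ?expr0 ?cabs1// !exprS cabsM IH. Qed.

Lemma cabs_real (x : R) : cabs x%:C = `|x|.
Proof. by rewrite cabs_sqrt/= expr0n addr0 sqrtr_sqr. Qed.

Lemma cabs_i : cabs ii = 1.
Proof. by rewrite cabs_sqrt/= expr0n add0r expr1n sqrtr1. Qed.

Lemma cabs_nat n : cabs n%:R = n%:R.
Proof. by rewrite -(rmorph_nat (real_complex R)) cabs_real normr_nat. Qed.

Lemma cabs_Re z : `|Re z| <= cabs z.
Proof.
rewrite -(ler_pXn2r (ltn0Sn 1)) ?nnegrE ?cabs_ge0 ?normr_ge0//.
by rewrite real_normK ?num_real// cabs_sq lerDl sqr_ge0.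
Qed.

Lemma cabs_Im z : `|Im z| <= cabs z.
Proof.
rewrite -(ler_pXn2r (ltn0Sn 1)) ?nnegrE ?cabs_ge0 ?normr_ge0//.
by rewrite real_normK ?num_real// cabs_sq lerDr sqr_ge0.
Qed.

Lemma cabs_le z : cabs z <= `|Re z| + `|Im z|.
Proof.
rewrite {1}[z]complexE (le_trans (cabsD _ _))// cabsM cabs_i mul1r.
by rewrite !cabs_real.
Qed.

Lemma cabs_conj z : cabs (cj z) = cabs z.
Proof. by rewrite /cabs normcJ. Qed.

Lemma cabs_sum (I : Type) (r : seq I) (P : pred I) (u : I -> C) :
  cabs (\sum_(i <- r | P i) u i) <= \sum_(i <- r | P i) cabs (u i).
Proof.
elim/big_ind2: _ => [|x a y b h1 h2|//]; first by rewrite cabs0.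
by rewrite (le_trans (cabsD _ _))// lerD.
Qed.

Lemma cabs_prod (I : Type) (r : seq I) (P : pred I) (u : I -> C) :
  cabs (\prod_(i <- r | P i) u i) = \prod_(i <- r | P i) cabs (u i).
Proof. by elim/big_ind2: _ => [|x a y b <- <-|//]; rewrite ?cabs1 ?cabsM. Qed.

Lemma ReM z w : Re (z * w) = Re z * Re w - Im z * Im w.
Proof. by case: z w => [a b] [c d]. Qed.

Lemma ImM z w : Im (z * w) = Re z * Im w + Im z * Re w.
Proof. by case: z w => [a b] [c d]. Qed.

Lemma ReD z w : Re (z + w) = Re z + Re w.
Proof. by case: z w => [a b] [c d]. Qed.

Lemma ImD z w : Im (z + w) = Im z + Im w.
Proof. by case: z w => [a b] [c d]. Qed.

Lemma ReN z : Re (- z) = - Re z.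
Proof. by case: z. Qed.

Lemma ImN z : Im (- z) = - Im z.
Proof. by case: z. Qed.

Lemma Re_nat n : Re (n%:R : C) = n%:R.
Proof. by rewrite -(rmorph_nat (real_complex R)). Qed.

Lemma Im_nat n : Im (n%:R : C) = 0.
Proof. by rewrite -(rmorph_nat (real_complex R)). Qed.

Lemma Im_sum (I : Type) (r : seq I) (P : pred I) (u : I -> C) :
  Im (\sum_(i <- r | P i) u i) = \sum_(i <- r | P i) Im (u i).
Proof. by elim/big_ind2: _ => // x a y b <- <-; rewrite ImD. Qed.

Lemma ReJ z : Re (cj z) = Re z. Proof. by case: z. Qed.

Lemma ImJ z : Im (cj z) = - Im z. Proof. by case: z. Qed.

Lemma ReZ (x : R) z : Re (x%:C * z) = x * Re z.
Proof. by rewrite ReM/= mul0r subr0. Qed.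

Lemma ImZ (x : R) z : Im (x%:C * z) = x * Im z.
Proof. by rewrite ImM/= mul0r addr0. Qed.

Lemma complex_eqP z w : Re z = Re w -> Im z = Im w -> z = w.
Proof. by case: z w => [a b] [c d]/= -> ->. Qed.

Definition ccont F z := forall e : R, 0 < e -> exists2 d : R, 0 < d &
  forall w, cabs (w - z) < d -> cabs (F w - F z) <= e.

(** Differentiability in product form: w = z is no exception, so composition requires no case
    distinction. *)
Definition cderiv F z D := forall e : R, 0 < e -> exists2 d : R, 0 < d &
  forall w, cabs (w - z) < d -> cabs (F w - F z - D * (w - z)) <= e * cabs (w - z).

Definition cdiff F z := exists D, cderiv F z D.

Lemma cderiv_lip F z D : cderiv F z D -> exists2 d : R, 0 < d &
  forall w, cabs (w - z) < d -> cabs (F w - F z) <= (cabs D + 1) * cabs (w - z).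
Proof.
move=> /(_ 1 ltr01)[d d0 h]; exists d => // w /h; rewrite mul1r => hw.
rewrite -[F w - F z](subrK (D * (w - z))) (le_trans (cabsD _ _))// cabsM.
by rewrite mulrDl mul1r addrC lerD2l.
Qed.

Lemma cdiff_cont F z : cdiff F z -> ccont F z.
Proof.
move=> [D /cderiv_lip[d d0 h]] e e0.
have D1 : 0 < cabs D + 1 by rewrite ltr_wpDl ?cabs_ge0.
exists (Num.min d (e / (cabs D + 1))); first by rewrite lt_min d0 divr_gt0.
move=> w; rewrite lt_min => /andP[/h hw]; rewrite ltr_pdivlMr// => h2.
by rewrite (le_trans hw)// mulrC ltW.
Qed.

Lemma ccont_cst (c : C) z : ccont (fun=> c) z.
Proof. by move=> e e0; exists 1 => // w _; rewrite subrr cabs0 ltW. Qed.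

Lemma ccont_id z : ccont id z.
Proof. by move=> e e0; exists e => // w /ltW. Qed.

Lemma ccontD F G z : ccont F z -> ccont G z -> ccont (fun w => F w + G w) z.
Proof.
move=> hF hG e e0; have e2 : 0 < e / 2 by rewrite divr_gt0.
have [d1 d10 h1] := hF _ e2; have [d2 d20 h2] := hG _ e2.
exists (Num.min d1 d2); first by rewrite lt_min d10.
move=> w; rewrite lt_min => /andP[/h1 a1 /h2 a2].
rewrite opprD addrACA (le_trans (cabsD _ _))//.
by rewrite [leRHS](splitr e) lerD.
Qed.

Lemma ccont_bd F z : ccont F z -> exists2 d : R, 0 < d &
  forall w, cabs (w - z) < d -> cabs (F w) <= cabs (F z) + 1.
Proof.
move=> /(_ 1 ltr01)[d d0 h]; exists d => // w /h hw.
by rewrite -[F w](subrK (F z)) (le_trans (cabsD _ _))// addrC lerD2l.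
Qed.

Lemma ccontM F G z : ccont F z -> ccont G z -> ccont (fun w => F w * G w) z.
Proof.
move=> hF hG e e0; have [d0 d00 h0] := ccont_bd hG.
set K := cabs (G z) + 1 + cabs (F z) in h0 *.
have K0 : 0 < K by rewrite /K -addrA (ltr_wpDl (cabs_ge0 _))// ltr_wpDr// cabs_ge0.
have e2 : 0 < e / (2 * K) by rewrite divr_gt0// mulr_gt0.
have [d1 d10 h1] := hF _ e2; have [d2 d20 h2] := hG _ e2.
exists (Num.min d0 (Num.min d1 d2)); first by rewrite !lt_min d00 d10.
move=> w; rewrite !lt_min => /andP[/h0 a0 /andP[/h1 a1 /h2 a2]].
have -> : F w * G w - F z * G z = (F w - F z) * G w + F z * (G w - G z) by ring.
rewrite (le_trans (cabsD _ _))// !cabsM.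
have b1 : cabs (F w - F z) * cabs (G w) <= e / (2 * K) * K.
  apply: ler_pM; rewrite ?cabs_ge0//; apply: le_trans a0 _.
  by rewrite lerDl cabs_ge0.
have b2 : cabs (F z) * cabs (G w - G z) <= K * (e / (2 * K)).
  apply: ler_pM; rewrite ?cabs_ge0// /K lerDr addr_ge0 ?cabs_ge0//.
apply: le_trans (lerD b1 b2) _.
rewrite le_eqVlt; apply/orP; left; apply/eqP; field.
by rewrite gt_eqF.
Qed.

Lemma ccontV F z : ccont F z -> F z != 0 -> ccont (fun w => (F w)^-1) z.
Proof.
move=> hF Fz e e0; set m := cabs (F z).
have m0 : 0 < m by rewrite cabs_gt0.
have e1 : 0 < Num.min (m / 2) (e * m ^+ 2 / 2).
  by rewrite lt_min !divr_gt0 ?mulr_gt0// exprn_gt0.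
have [d d0 h] := hF _ e1; exists d => // w /h; rewrite le_min => /andP[h1 h2].
have mw : m / 2 <= cabs (F w).
  have := cabsB_ge (F z) (F w); rewrite cabs_distC -/m => h3; lra.
have Fw : F w != 0 by rewrite -cabs_gt0; lra.
have -> : (F w)^-1 - (F z)^-1 = (F z - F w) / (F w * F z).
  by field; rewrite Fw Fz.
rewrite cabsM cabsV cabsM -/m cabs_distC ler_pdivrMr; last first.
  by rewrite mulr_gt0// cabs_gt0.
apply: le_trans h2 _.
have -> : e * m ^+ 2 / 2 = e * ((m / 2) * m) by field.
by rewrite ler_pM2l// ler_pM2r.
Qed.

Lemma ccont_ext F G z (r : R) : 0 < r -> (forall w, cabs (w - z) < r -> F w = G w) ->
  ccont F z -> ccont G z.
Proof.
move=> r0 hr hF e /hF[d d0 hd]; exists (Num.min r d); first by rewrite lt_min r0.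
move=> w; rewrite lt_min => /andP[/hr <- /hd]; rewrite -(hr z)// subrr cabs0//.
Qed.

Lemma cderiv_cst (c : C) z : cderiv (fun=> c) z 0.
Proof.
move=> e e0; exists 1 => // w _; rewrite subrr mul0r subrr cabs0.
by rewrite mulr_ge0 ?cabs_ge0// ltW.
Qed.

Lemma cderiv_id z : cderiv id z 1.
Proof.
move=> e e0; exists 1 => // w _; rewrite mul1r subrr cabs0.
by rewrite mulr_ge0 ?cabs_ge0// ltW.
Qed.

Lemma cderivD F G z D E : cderiv F z D -> cderiv G z E ->
  cderiv (fun w => F w + G w) z (D + E).
Proof.
move=> hF hG e e0; have e2 : 0 < e / 2 by rewrite divr_gt0.
have [d1 d10 h1] := hF _ e2; have [d2 d20 h2] := hG _ e2.
exists (Num.min d1 d2); first by rewrite lt_min d10.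
move=> w; rewrite lt_min => /andP[/h1 a1 /h2 a2].
have -> : F w + G w - (F z + G z) - (D + E) * (w - z) =
  (F w - F z - D * (w - z)) + (G w - G z - E * (w - z)) by ring.
rewrite (le_trans (cabsD _ _))//.
by rewrite [e in leRHS]splitr mulrDl lerD.
Qed.

Lemma cderivM F G z D E : cderiv F z D -> cderiv G z E ->
  cderiv (fun w => F w * G w) z (D * G z + F z * E).
Proof.
move=> hF hG e e0.
have [d0 d00 h0] := ccont_bd (cdiff_cont (ex_intro _ _ hG)).
set K := cabs (G z) + 1 + cabs (F z) + cabs D.
have K0 : 0 < K.
  by rewrite /K -!addrA (ltr_wpDl (cabs_ge0 _))// ltr_pwDl// addr_ge0 ?cabs_ge0.
have e3 : 0 < e / (3 * K) by rewrite divr_gt0// mulr_gt0.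
have [d1 d10 h1] := hF _ e3; have [d2 d20 h2] := hG _ e3.
have [d3 d30 h3] := cdiff_cont (ex_intro _ _ hG) e3.
exists (Num.min (Num.min d0 d3) (Num.min d1 d2)).
  by rewrite !lt_min d00 d10 d30.
move=> w; rewrite !lt_min => /andP[/andP[/h0 a0 /h3 a3] /andP[/h1 a1 /h2 a2]].
have -> : F w * G w - F z * G z - (D * G z + F z * E) * (w - z) =
  (F w - F z - D * (w - z)) * G w + F z * (G w - G z - E * (w - z))
   + D * (G w - G z) * (w - z) by ring.
rewrite (le_trans (cabsD _ _))//.
have b1 : cabs ((F w - F z - D * (w - z)) * G w) <= e / (3 * K) * cabs (w - z) * K.
  rewrite cabsM; apply: ler_pM; rewrite ?cabs_ge0//; apply: le_trans a0 _.
  by rewrite /K -addrA lerDl addr_ge0 ?cabs_ge0.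
have b2 : cabs (F z * (G w - G z - E * (w - z))) <= K * (e / (3 * K) * cabs (w - z)).
  rewrite cabsM; apply: ler_pM; rewrite ?cabs_ge0// /K addrAC lerDr.
  by rewrite !addr_ge0 ?cabs_ge0.
have b3 : cabs (D * (G w - G z) * (w - z)) <= K * (e / (3 * K)) * cabs (w - z).
  rewrite !cabsM; apply: ler_wpM2r; rewrite ?cabs_ge0//.
  apply: ler_pM; rewrite ?cabs_ge0// /K lerDr.
  by rewrite !addr_ge0 ?cabs_ge0.
apply: le_trans (lerD (le_trans (cabsD _ _) (lerD b1 b2)) b3) _.
rewrite le_eqVlt; apply/orP; left; apply/eqP; field.
by rewrite gt_eqF.
Qed.

Lemma cderiv_comp F G z D E : cderiv F z D -> cderiv G (F z) E ->
  cderiv (fun w => G (F w)) z (E * D).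
Proof.
move=> hF hG e e0.
have [d0 d00 h0] := cderiv_lip hF.
set K := cabs D + 1 + cabs E.
have K0 : 0 < K by rewrite /K -addrA (ltr_wpDl (cabs_ge0 _))// ltr_wpDr// cabs_ge0.
have e2 : 0 < e / (2 * K) by rewrite divr_gt0// mulr_gt0.
have [d1 d10 h1] := hF _ e2; have [d2 d20 h2] := hG _ e2.
exists (Num.min (Num.min d0 d1) (d2 / K)); first by rewrite !lt_min d00 d10 divr_gt0.
move=> w; rewrite !lt_min => /andP[/andP[/h0 a0 /h1 a1]].
rewrite ltr_pdivlMr// => hw.
have a0' : cabs (F w - F z) <= K * cabs (w - z).
  by apply: le_trans a0 _; rewrite ler_wpM2r ?cabs_ge0// /K lerDl cabs_ge0.
have a2 : cabs (G (F w) - G (F z) - E * (F w - F z)) <= e / (2 * K) * cabs (F w - F z).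
  by apply: h2; apply: le_lt_trans a0' _; rewrite mulrC.
rewrite -[_ - _ - _](_ : (G (F w) - G (F z) - E * (F w - F z)) +
   E * (F w - F z - D * (w - z)) = _); last by ring.
rewrite (le_trans (cabsD _ _))//.
have b1 : cabs (G (F w) - G (F z) - E * (F w - F z)) <= e / (2 * K) * (K * cabs (w - z)).
  by apply: le_trans a2 _; rewrite ler_wpM2l// ltW.
have b2 : cabs (E * (F w - F z - D * (w - z))) <= K * (e / (2 * K) * cabs (w - z)).
  rewrite cabsM; apply: ler_pM; rewrite ?cabs_ge0// /K lerDr.
  by rewrite !addr_ge0 ?cabs_ge0.
apply: le_trans (lerD b1 b2) _.
rewrite le_eqVlt; apply/orP; left; apply/eqP; field.
by rewrite gt_eqF.
Qed.

Lemma cderiv_inv z : z != 0 -> cderiv (fun w => w^-1) z (- z ^- 2).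
Proof.
move=> z0 e e0; have zp : 0 < cabs z by rewrite cabs_gt0.
exists (Num.min (cabs z / 2) (e * cabs z ^+ 3 / 2)).
  by rewrite lt_min !divr_gt0// mulr_gt0// exprn_gt0.
move=> w; rewrite lt_min => /andP[h1 h2].
have mw : cabs z / 2 <= cabs w.
  have := cabsB_ge z w; rewrite cabs_distC => h3; lra.
have w0 : w != 0 by rewrite -cabs_gt0; lra.
have -> : w^-1 - z^-1 - - z ^- 2 * (w - z) = (w - z) * ((w - z) / (z ^+ 2 * w)).
  by field; rewrite w0 z0.
rewrite cabsM mulrC ler_wpM2r ?cabs_ge0// cabsM cabsV cabsM cabsX.
have wp : 0 < cabs w by rewrite cabs_gt0.
rewrite ler_pdivrMr; last by apply: mulr_gt0 => //; apply: exprn_gt0.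
apply: le_trans (ltW h2) _.
have -> : e * cabs z ^+ 3 / 2 = e * (cabs z ^+ 2 * (cabs z / 2)) by field.
by rewrite ler_pM2l// ler_pM2l// exprn_gt0.
Qed.

Lemma cderiv_ext F G z D (r : R) : 0 < r ->
  (forall w, cabs (w - z) < r -> F w = G w) -> cderiv F z D -> cderiv G z D.
Proof.
move=> r0 hr hF e /hF[d d0 hd]; exists (Num.min r d); first by rewrite lt_min r0.
move=> w; rewrite lt_min => /andP[/hr <- /hd]; rewrite -(hr z)// subrr cabs0//.
Qed.

Lemma cdiff_ext F G z (r : R) : 0 < r ->
  (forall w, cabs (w - z) < r -> F w = G w) -> cdiff F z -> cdiff G z.
Proof. by move=> r0 h [D hD]; exists D; exact: cderiv_ext r0 h hD. Qed.

Lemma cdiff_cst (c : C) z : cdiff (fun=> c) z.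
Proof. by exists 0; exact: cderiv_cst. Qed.

Lemma cdiff_id z : cdiff id z.
Proof. by exists 1; exact: cderiv_id. Qed.

Lemma cdiffD F G z : cdiff F z -> cdiff G z -> cdiff (fun w => F w + G w) z.
Proof. by move=> [D hD] [E hE]; exists (D + E); exact: cderivD. Qed.

Lemma cdiffM F G z : cdiff F z -> cdiff G z -> cdiff (fun w => F w * G w) z.
Proof. by move=> [D hD] [E hE]; eexists; apply: (cderivM hD hE). Qed.

Lemma cdiff_comp F G z : cdiff F z -> cdiff G (F z) -> cdiff (fun w => G (F w)) z.
Proof. by move=> [D hD] [E hE]; eexists; apply: (cderiv_comp hD hE). Qed.

Lemma cdiffV F z : cdiff F z -> F z != 0 -> cdiff (fun w => (F w)^-1) z.
Proof.
by move=> hF Fz; apply: (cdiff_comp hF); eexists; apply: cderiv_inv.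
Qed.

Lemma cdiffN F z : cdiff F z -> cdiff (fun w => - F w) z.
Proof.
move=> hF; apply: (@cdiff_ext (fun w => -1 * F w) _ _ 1) => //.
  by move=> w _; rewrite mulN1r.
exact: cdiffM (cdiff_cst _ _) hF.
Qed.

Lemma cdiffB F G z : cdiff F z -> cdiff G z -> cdiff (fun w => F w - G w) z.
Proof. by move=> hF /cdiffN; exact: cdiffD. Qed.

Lemma cdiffX F n z : cdiff F z -> cdiff (fun w => F w ^+ n) z.
Proof.
move=> hF; elim: n => [|n IH]; first exact: cdiff_cst.
apply: (@cdiff_ext (fun w => F w * F w ^+ n) _ _ 1) => //.
  by move=> w _; rewrite exprS.
exact: cdiffM.
Qed.

Lemma cdiff_sum (I : Type) (r : seq I) (P : pred I) (u : I -> C -> C) z :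
  (forall i, P i -> cdiff (u i) z) -> cdiff (fun w => \sum_(i <- r | P i) u i w) z.
Proof.
move=> h; elim: r => [|i r IH].
  apply: (@cdiff_ext (fun=> 0) _ _ 1) (cdiff_cst _ _) => // w _.
  by rewrite big_nil.
have [Pi|nPi] := boolP (P i).
  apply: (@cdiff_ext (fun w => u i w + \sum_(j <- r | P j) u j w) _ _ 1) => //.
    by move=> w _; rewrite big_cons Pi.
  by apply: cdiffD => //; exact: h.
apply: (@cdiff_ext _ _ _ 1) IH => // w _.
by rewrite big_cons (negbTE nPi).
Qed.

Lemma cdiff_prod (I : Type) (r : seq I) (P : pred I) (u : I -> C -> C) z :
  (forall i, P i -> cdiff (u i) z) -> cdiff (fun w => \prod_(i <- r | P i) u i w) z.
Proof.
move=> h; elim: r => [|i r IH].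
  apply: (@cdiff_ext (fun=> 1) _ _ 1) (cdiff_cst _ _) => // w _.
  by rewrite big_nil.
have [Pi|nPi] := boolP (P i).
  apply: (@cdiff_ext (fun w => u i w * \prod_(j <- r | P j) u j w) _ _ 1) => //.
    by move=> w _; rewrite big_cons Pi.
  by apply: cdiffM => //; exact: h.
apply: (@cdiff_ext _ _ _ 1) IH => // w _.
by rewrite big_cons (negbTE nPi).
Qed.

Lemma cdiff_conj F z : cdiff F (cj z) -> cdiff (fun w => cj (F (cj w))) z.
Proof.
move=> [D hD]; exists ((cj D)) => e /hD[d d0 hd]; exists d => // w.
have -> : cj (F (cj w)) - cj (F (cj z)) - (cj D) * (w - z) =
    cj (F (cj w) - F (cj z) - D * (cj w - cj z)).
  by rewrite !rmorphB rmorphM rmorphB/= !conjcK.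
by rewrite -(cabs_conj (w - z)) rmorphB cabs_conj; exact: hd.
Qed.

Lemma cdifferentiableP F z : cdifferentiable F z -> cdiff F z.
Proof.
move=> h; exists ('D_1 (F : C^o -> C^o) z) => e e0.
have /cvgrPdist_le/= := h.
have ec : 0 < (e%:C : C) by rewrite ltcR.
move=> /(_ _ ec) => hn.
have [d /= d0 hd] := hn.
have dR : d = (Re d)%:C by rewrite RRe_real// gtr0_real.
exists (Re d); first by rewrite -ltcR -dR.
move=> w hw; have [->|wz] := eqVneq w z.
  by rewrite !subrr mulr0 subrr cabs0 mulr0.
have wz0 : w - z != 0 by rewrite subr_eq0.
have := hd (w - z); rewrite /ball_/= sub0r normrN cabsE dR ltcR => /(_ hw wz0).
rewrite /GRing.scale/= mulr1 subrK cabsE lecR => h2.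
have -> : F w - F z - 'D_1 (F : C^o -> C^o) z * (w - z) =
    - (('D_1 (F : C^o -> C^o) z - (w - z)^-1 * (F w - F z)) * (w - z)).
  by field.
by rewrite cabsN cabsM ler_wpM2r ?cabs_ge0.
Qed.

End ComplexBasics.

(** * Integrals of complex functions over segments *)

Section SegmentIntegral.
Variable R : realType.
Local Notation C := R[i].
Local Notation Re := complex.Re.
Local Notation Im := complex.Im.
Implicit Types (a b : R) (g h : R -> C) (u v : R -> R).

Definition rint a b u : R :=
  Rintegral (@lebesgue_measure R) `[a, b]%classic u.

Definition rcont u a b := forall t, a <= t <= b ->
  forall e, 0 < e -> exists2 d, 0 < d & forall s, `|s - t| < d -> `|u s - u t| <= e.

Lemma rcont_within u a b : rcont u a b -> {within `[a, b]%classic, continuous u}.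
Proof.
move=> hu; apply: continuous_in_subspaceT => t; rewrite inE/= in_itv/= => tab.
apply/cvgrPdist_le => /= e e0; have [d d0 hd] := hu t tab e e0.
exists d => //= s; rewrite /= distrC => /hd; rewrite distrC//.
Qed.

Lemma rcont_integrable u a b : rcont u a b ->
  (@lebesgue_measure R).-integrable `[a, b]%classic (EFin \o u).
Proof.
move=> hu; apply: continuous_compact_integrable; first exact: segment_compact.
exact: rcont_within.
Qed.

Lemma rintD u v a b : rcont u a b -> rcont v a b ->
  rint a b (fun t => u t + v t) = rint a b u + rint a b v.
Proof. by move=> hu hv; rewrite /rint RintegralD//; exact: rcont_integrable. Qed.

Lemma rintZ u (c : R) a b : rcont u a b ->
  rint a b (fun t => c * u t) = c * rint a b u.
Proof. by move=> hu; rewrite /rint RintegralZl//; exact: rcont_integrable. Qed.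

Lemma rcont_cst (c : R) a b : rcont (fun=> c) a b.
Proof. by move=> t _ e e0; exists 1 => // s _; rewrite subrr normr0 ltW. Qed.

Lemma rint_cst (c : R) a b : a <= b -> rint a b (fun=> c) = c * (b - a).
Proof.
move=> ab; rewrite /rint Rintegral_cst//= lebesgue_measure_itv/=.
by rewrite lte_fin; case: ltP => //= ba; rewrite (le_anti (y := b) (x := a)) ?ab// subrr.
Qed.

Lemma le_rint u v a b : rcont u a b -> rcont v a b ->
  (forall t, a <= t <= b -> u t <= v t) -> rint a b u <= rint a b v.
Proof.
move=> hu hv h; apply: le_Rintegral => //; try exact: rcont_integrable.
Qed.

Lemma rint_split u a b c : rcont u a b -> a <= c <= b ->
  rint a b u = rint a c u + rint c b u.
Proof.
move=> hu /andP[ac cb]; apply/eqP; rewrite addrC -subr_eq; apply/eqP.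
rewrite /rint Rintegral_itvB ?bnd_simp//; last exact: rcont_integrable.
apply: Rintegral_itv_obnd_cbnd; apply: integrableS (rcont_integrable hu) => //.
by apply: subset_itvr; rewrite bnd_simp.
Qed.

Lemma rint_pt u a : rint a a u = 0.
Proof. by rewrite /rint set_itv1 Rintegral_set1. Qed.

Lemma eq_rint u v a b : (forall t, a <= t <= b -> u t = v t) -> rint a b u = rint a b v.
Proof.
by move=> h; apply: eq_Rintegral => t; rewrite inE/= in_itv/= => /h.
Qed.

Definition gcont g a b := forall t, a <= t <= b ->
  forall e, 0 < e -> exists2 d, 0 < d & forall s, `|s - t| < d -> cabs (g s - g t) <= e.

Lemma gcont_Re g a b : gcont g a b -> rcont (fun t => Re (g t)) a b.
Proof.
move=> h t /h{}h e /h[d d0 hd]; exists d => // s /hd; apply: le_trans.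
by rewrite -ReN -ReD cabs_Re.
Qed.

Lemma gcont_Im g a b : gcont g a b -> rcont (fun t => Im (g t)) a b.
Proof.
move=> h t /h{}h e /h[d d0 hd]; exists d => // s /hd; apply: le_trans.
by rewrite -ImN -ImD cabs_Im.
Qed.

Definition cint a b g : C :=
  rint a b (fun t => Re (g t)) +i* rint a b (fun t => Im (g t)).

Lemma cint_split g a b c : gcont g a b -> a <= c <= b ->
  cint a b g = cint a c g + cint c b g.
Proof.
move=> hg h; apply: complex_eqP; rewrite ?ReD ?ImD/=; apply: rint_split => //.
  exact: gcont_Re.
exact: gcont_Im.
Qed.

Lemma cint_pt g a : cint a a g = 0.
Proof. by rewrite /cint !rint_pt. Qed.

Lemma cintD g h a b : gcont g a b -> gcont h a b ->
  cint a b (fun t => g t + h t) = cint a b g + cint a b h.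
Proof.
move=> hg hh; apply: complex_eqP; rewrite ?ReD ?ImD/=.
  rewrite -rintD; [|exact: gcont_Re..].
  by apply: eq_rint => t _; rewrite ReD.
rewrite -rintD; [|exact: gcont_Im..].
by apply: eq_rint => t _; rewrite ImD.
Qed.

Lemma rcontZ u (c : R) a b : rcont u a b -> rcont (fun t => c * u t) a b.
Proof.
move=> h t /h{}h e e0; have c1 : 0 < `|c| + 1 by rewrite ltr_wpDl.
have [d d0 hd] := h _ (divr_gt0 e0 c1); exists d => // s /hd.
rewrite ler_pdivlMr// -mulrBr normrM => h1; apply: le_trans h1.
by rewrite mulrC ler_wpM2l// lerDl.
Qed.

Lemma cintZ g (c : C) a b : gcont g a b ->
  cint a b (fun t => c * g t) = c * cint a b g.
Proof.
move=> hg; have hR := gcont_Re hg; have hI := gcont_Im hg.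
apply: complex_eqP.
  rewrite ReM/= -mulNr -!rintZ// -rintD; try exact: rcontZ.
  by apply: eq_rint => t _; rewrite ReM mulNr.
rewrite ImM/= -!rintZ// -rintD; try exact: rcontZ.
by apply: eq_rint => t _; rewrite ImM.
Qed.

Lemma cint_cst (c : C) a b : a <= b -> cint a b (fun=> c) = c * (b - a)%:C.
Proof.
by move=> ab; apply: complex_eqP; rewrite ?ReM ?ImM/= rint_cst//; ring.
Qed.

Lemma eq_cint g h a b : (forall t, a <= t <= b -> g t = h t) -> cint a b g = cint a b h.
Proof. by move=> e; congr (_ +i* _); apply: eq_rint => t /e ->. Qed.

(** The factor 2 comes from bounding the real and the imaginary part separately. *)
Lemma cint_bound g a b (M : R) : a <= b -> gcont g a b ->
  (forall t, a <= t <= b -> cabs (g t) <= M) -> cabs (cint a b g) <= 2 * M * (b - a).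
Proof.
move=> ab hg hM; rewrite (le_trans (cabs_le _))//=.
have key u : rcont u a b -> (forall t, a <= t <= b -> `|u t| <= M) ->
    `|rint a b u| <= M * (b - a).
  move=> hu huM; rewrite ler_norml -mulNr -!rint_cst//; apply/andP; split.
    apply: le_rint => //; first exact: rcont_cst.
    by move=> t /huM; rewrite ler_norml => /andP[].
  apply: le_rint => //; first exact: rcont_cst.
  by move=> t /huM; rewrite ler_norml => /andP[].
have k1 := key _ (gcont_Re hg) (fun t ht => le_trans (cabs_Re _) (hM t ht)).
have k2 := key _ (gcont_Im hg) (fun t ht => le_trans (cabs_Im _) (hM t ht)).
lra.
Qed.

End SegmentIntegral.

(** * Goursat's theorem for rectangles *)

Section Goursat.
Variable R : realType.
Local Notation C := R[i].
Local Notation Re := complex.Re.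
Local Notation Im := complex.Im.
Implicit Types (F G : C -> C) (a b c d : R).

Definition rect a b c d (z : C) := (a <= Re z <= b) && (c <= Im z <= d).

Definition cont_rect F a b c d := forall z, rect a b c d z -> ccont F z.

(** The positively oriented boundary: bottom and right sides forward, top and left sides backward,
    with dz = i dy on the vertical ones. *)
Definition contour F a b c d : C :=
  cint a b (fun x => F (x +i* c)) + ii * cint c d (fun y => F (b +i* y))
  - cint a b (fun x => F (x +i* d)) - ii * cint c d (fun y => F (a +i* y)).

Lemma hcont F a b c d y : cont_rect F a b c d -> c <= y <= d ->
  gcont (fun x => F (x +i* y)) a b.
Proof.
move=> hF hy x hx e e0; have hz : rect a b c d (x +i* y) by rewrite /rect/= hx hy.
have [r r0 hr] := hF _ hz e e0; exists r => // s hs; apply: hr.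
by rewrite cabs_sqrt/= subrr expr0n addr0 sqrtr_sqr.
Qed.

Lemma vcont F a b c d x : cont_rect F a b c d -> a <= x <= b ->
  gcont (fun y => F (x +i* y)) c d.
Proof.
move=> hF hy y hx e e0; have hz : rect a b c d (x +i* y) by rewrite /rect/= hx hy.
have [r r0 hr] := hF _ hz e e0; exists r => // s hs; apply: hr.
by rewrite cabs_sqrt/= subrr expr0n add0r sqrtr_sqr.
Qed.

Lemma cont_rectS F a b c d a' b' c' d' : a <= a' -> b' <= b -> c <= c' -> d' <= d ->
  cont_rect F a b c d -> cont_rect F a' b' c' d'.
Proof.
move=> h1 h2 h3 h4 hF z /andP[/andP[z1 z2] /andP[z3 z4]]; apply: hF.
apply/andP; split; apply/andP; split; lra.
Qed.

Lemma contour_splitx F a b c d x : cont_rect F a b c d -> a <= x <= b -> c <= d ->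
  contour F a b c d = contour F a x c d + contour F x b c d.
Proof.
move=> hF hx cd; rewrite /contour.
rewrite (@cint_split _ (fun t => F (t +i* c)) a b x)//; last first.
  by apply: hcont hF _; rewrite lexx.
rewrite (@cint_split _ (fun t => F (t +i* d)) a b x)//; last first.
  by apply: hcont hF _; rewrite lexx cd.
by ring.
Qed.

Lemma contour_splity F a b c d y : cont_rect F a b c d -> a <= b -> c <= y <= d ->
  contour F a b c d = contour F a b c y + contour F a b y d.
Proof.
move=> hF ab hy; rewrite /contour.
rewrite (@cint_split _ (fun t => F (a +i* t)) c d y)//; last first.
  by apply: vcont hF _; rewrite lexx.
rewrite (@cint_split _ (fun t => F (b +i* t)) c d y)//; last first.
  by apply: vcont hF _; rewrite lexx ab.
by ring.
Qed.

Lemma contour_ptx F a c d : contour F a a c d = 0.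
Proof. by rewrite /contour !cint_pt; ring. Qed.

Lemma contour_pty F a b c : contour F a b c c = 0.
Proof. by rewrite /contour !cint_pt; ring. Qed.

Lemma contour_bound F a b c d (M : R) : a <= b -> c <= d -> cont_rect F a b c d ->
  (forall z, rect a b c d z -> cabs (F z) <= M) ->
  cabs (contour F a b c d) <= 4 * M * ((b - a) + (d - c)).
Proof.
move=> ab cd hF hM.
have H y : c <= y <= d -> cabs (cint a b (fun x => F (x +i* y))) <= 2 * M * (b - a).
  move=> hy; apply: cint_bound => //; first exact: hcont hF hy.
  by move=> t ht; apply: hM; rewrite /rect/= ht hy.
have V x : a <= x <= b -> cabs (ii * cint c d (fun y => F (x +i* y))) <= 2 * M * (d - c).
  move=> hx; rewrite cabsM cabs_i mul1r.
  apply: cint_bound => //; first exact: vcont hF hx.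
  by move=> t ht; apply: hM; rewrite /rect/= ht hx.
have h1 := H c; have h2 := H d; have h3 := V a; have h4 := V b.
rewrite lexx cd in h1; rewrite lexx cd in h2; rewrite lexx ab in h3; rewrite lexx ab in h4.
rewrite /contour.
have t1 := cabsB (cint a b (fun x => F (x +i* c)) + ii * cint c d (fun y => F (b +i* y))
  - cint a b (fun x => F (x +i* d))) (ii * cint c d (fun y => F (a +i* y))).
have t2 := cabsB (cint a b (fun x => F (x +i* c)) + ii * cint c d (fun y => F (b +i* y)))
  (cint a b (fun x => F (x +i* d))).
have t3 := cabsD (cint a b (fun x => F (x +i* c))) (ii * cint c d (fun y => F (b +i* y))).
have := h1 isT; have := h2 isT; have := h3 isT; have := h4 isT; lra.
Qed.

Lemma contourD F G a b c d : a <= b -> c <= d ->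
  cont_rect F a b c d -> cont_rect G a b c d ->
  contour (fun z => F z + G z) a b c d = contour F a b c d + contour G a b c d.
Proof.
move=> ab cd hF hG; rewrite /contour !cintD.
- by ring.
- by apply: (vcont hF); rewrite lexx.
- by apply: (vcont hG); rewrite lexx.
- by apply: (hcont hF); rewrite lexx cd.
- by apply: (hcont hG); rewrite lexx cd.
- by apply: (vcont hF); rewrite lexx ab.
- by apply: (vcont hG); rewrite lexx ab.
- by apply: (hcont hF); rewrite lexx cd.
- by apply: (hcont hG); rewrite lexx cd.
Qed.

(** Direct computation on the four sides. This is what allows [goursat] to subtract the linear
    approximation of F. *)
Lemma contour_affine (p q : C) a b c d : a <= b -> c <= d ->
  contour (fun z => p + q * z) a b c d = 0.
Proof.
move=> ab cd; rewrite /contour.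
have hid y : gcont (fun x : R => x +i* y) a b.
  by apply: (@hcont id _ _ y y) => [z _|]; rewrite ?lexx//; exact: ccont_id.
have vid x : gcont (fun y : R => x +i* y) c d.
  by apply: (@vcont id x x) => [z _|]; rewrite ?lexx//; exact: ccont_id.
have cc (r : C) a' b' : gcont (fun=> r) a' b'.
  by move=> t _ e e0; exists 1 => // s _; rewrite subrr cabs0 ltW.
have haff y : cint a b (fun x => p + q * (x +i* y)) =
    p * (b - a)%:C + q * (cint a b (fun x => x%:C) + (b - a)%:C * (0 +i* y)).
  rewrite cintD//; last first.
    by apply: (@hcont (fun z => q * z) _ _ y y) => [z _|]; rewrite ?lexx//;
      apply: cdiff_cont; apply: cdiffM; [exact: cdiff_cst|exact: cdiff_id].
  rewrite cint_cst// cintZ//; congr (_ + q * _).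
  rewrite (@eq_cint _ _ (fun x => x%:C + (0 +i* y))); last first.
    by move=> t _; apply: complex_eqP; rewrite ?ReD ?ImD/= ?addr0 ?add0r.
  by rewrite cintD// ?cint_cst// 1?mulrC//; exact: hid.
have vaff x : cint c d (fun y => p + q * (x +i* y)) =
    p * (d - c)%:C + q * (cint c d (fun y => 0 +i* y) + (d - c)%:C * x%:C).
  rewrite cintD//; last first.
    by apply: (@vcont (fun z => q * z) x x) => [z _|]; rewrite ?lexx//;
      apply: cdiff_cont; apply: cdiffM; [exact: cdiff_cst|exact: cdiff_id].
  rewrite cint_cst// cintZ//; congr (_ + q * _).
  rewrite (@eq_cint _ _ (fun y => (0 +i* y) + x%:C)); last first.
    by move=> t _; apply: complex_eqP; rewrite ?ReD ?ImD/= ?addr0 ?add0r.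
  by rewrite cintD// ?cint_cst// 1?mulrC//; exact: vid.
rewrite !haff !vaff.
have E y : (0 +i* y) = ii * y%:C :> C by apply: complex_eqP; rewrite ?ReM ?ImM/=; ring.
rewrite !rmorphB/= (E c) (E d); move: (cint a b _) (cint c d _) => X Y.
by move: a%:C b%:C c%:C d%:C (Complex 0 1) => a' b' c' d' j; ring.
Qed.

(* A property of rectangles that passes from the four quarters to the whole and *)
(* holds for all small rectangles holds everywhere.                             *)
Lemma rect_induction (P : R -> R -> R -> R -> Prop) a c w h : 0 <= w -> 0 <= h ->
  (forall a' c' w' h', P a' c' (w' / 2) (h' / 2) -> P (a' + w' / 2) c' (w' / 2) (h' / 2) ->
    P a' (c' + h' / 2) (w' / 2) (h' / 2) ->
    P (a' + w' / 2) (c' + h' / 2) (w' / 2) (h' / 2) -> P a' c' w' h') ->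
  (forall z, rect a (a + w) c (c + h) z -> exists2 r, 0 < r & forall n a' c',
     rect a' (a' + w / 2 ^+ n) c' (c' + h / 2 ^+ n) z ->
     w / 2 ^+ n < r -> h / 2 ^+ n < r -> a <= a' -> a' + w / 2 ^+ n <= a + w ->
     c <= c' -> c' + h / 2 ^+ n <= c + h ->
     P a' c' (w / 2 ^+ n) (h / 2 ^+ n)) ->
  P a c w h.
Proof.
move=> w0 h0 step loc; apply: contrapT => nP.
pose W n := w / 2 ^+ n; pose H n := h / 2 ^+ n.
have W2 n : W n.+1 = W n / 2 by rewrite /W exprS; field; rewrite expf_neq0.
have H2 n : H n.+1 = H n / 2 by rewrite /H exprS; field; rewrite expf_neq0.
have Wge n : 0 <= W n by rewrite divr_ge0// exprn_ge0.
have Hge n : 0 <= H n by rewrite divr_ge0// exprn_ge0.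
(* If P fails on a rectangle, it fails on one of its quarters. Iterating this choice gives the
   nested sequence [S] of lower left corners. *)
have nxt (n : nat) (s : R * R) : exists s' : R * R, ~ P s.1 s.2 (W n) (H n) ->
    ~ P s'.1 s'.2 (W n.+1) (H n.+1) /\
    ((s'.1 = s.1 \/ s'.1 = s.1 + W n / 2) /\ (s'.2 = s.2 \/ s'.2 = s.2 + H n / 2)).
  apply: contrapT => /forallNP hN.
  have q (s' : R * R) : (s'.1 = s.1 \/ s'.1 = s.1 + W n / 2) ->
      (s'.2 = s.2 \/ s'.2 = s.2 + H n / 2) -> P s'.1 s'.2 (W n.+1) (H n.+1).
    move=> e1 e2; apply: contrapT => nP'; apply: (hN s') => _; split=> //.
  apply: (hN s); case; apply: step; rewrite -W2 -H2.
  - by apply: (q (s.1, s.2)); left.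
  - by apply: (q (_, s.2)); [right|left]; rewrite -?W2.
  - by apply: (q (s.1, _)); [left|right]; rewrite -?H2.
  - by apply: (q (_, _)); right; rewrite -?H2 -?W2.
pose f n s := projT1 (cid (nxt n s)).
pose S := fix S n := if n is m.+1 then f m (S m) else (a, c).
have SP n : ~ P (S n).1 (S n).2 (W n) (H n).
  elim: n => [|n IH]; first by rewrite /W /H expr0 !divr1.
  by have /(_ IH)[] := projT2 (cid (nxt n (S n))).
have SS n := (projT2 (cid (nxt n (S n))) (SP n)).2.
have S1 n : (S n).1 <= (S n.+1).1 /\ (S n.+1).1 + W n.+1 <= (S n).1 + W n.
  have [[e|e] _] := SS n; rewrite [(S n.+1).1]e W2; have := Wge n; lra.
have S2 n : (S n).2 <= (S n.+1).2 /\ (S n.+1).2 + H n.+1 <= (S n).2 + H n.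
  have [_ [e|e]] := SS n; rewrite [(S n.+1).2]e H2; have := Hge n; lra.
(* Nested intervals: the supremum of the left endpoints lies in all of them. *)
have mono (x V : nat -> R) : (forall n, 0 <= V n) ->
    (forall n, x n <= x n.+1 /\ x n.+1 + V n.+1 <= x n + V n) ->
    exists t, forall n, x n <= t <= x n + V n.
  move=> V0 hx.
  have up m n : x m <= x (m + n)%N.
    by elim: n => [|n IH]; rewrite ?addn0// addnS (le_trans IH)//; case: (hx (m + n)%N).
  have dn m n : x (m + n)%N + V (m + n)%N <= x m + V m.
    elim: n => [|n IH]; rewrite ?addn0// addnS (le_trans _ IH)//.
    by case: (hx (m + n)%N).
  have ub n : ubound (range x) (x n + V n).
    move=> _ [m _ <-]; have [mn|nm] := leqP m n.
      by rewrite -(subnKC mn); have := up m (n - m)%N; have := V0 (m + (n - m))%N; lra.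
    have := dn n (m - n)%N; rewrite subnKC 1?ltnW//; have := V0 m; lra.
  exists (sup (range x)) => n; apply/andP; split.
    apply: ub_le_sup; first by exists (x 0 + V 0); exact: ub.
    by exists n.
  by apply: ge_sup; [exists (x 0%N); exists 0%N|exact: ub].
have [x hx] := mono (fun n => (S n).1) W Wge S1.
have [y hy] := mono (fun n => (S n).2) H Hge S2.
have a0 n : a <= (S n).1 /\ (S n).1 + W n <= a + w.
  elim: n => [|n [I1 I2]]; first by rewrite /W expr0 divr1 /=.
  by have [h1 h2] := S1 n; split; [exact: le_trans h1|exact: le_trans I2].
have c0 n : c <= (S n).2 /\ (S n).2 + H n <= c + h.
  elim: n => [|n [I1 I2]]; first by rewrite /H expr0 divr1 /=.
  by have [h1 h2] := S2 n; split; [exact: le_trans h1|exact: le_trans I2].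
have [r r0 hr] : exists2 r, 0 < r & forall n, W n < r -> H n < r -> P (S n).1 (S n).2 (W n) (H n).
  have [|r r0 hr] := loc (x +i* y).
    by have := hx 0; have := hy 0; rewrite /rect/= /W /H expr0 !divr1 => -> ->.
  exists r => // n Wr Hr; have [a1 a2] := a0 n; have [c1 c2] := c0 n.
  by apply: hr => //; rewrite /rect/= hx hy.
have [N hN] : exists N : nat, (w + h) / r < 2 ^+ N.
  exists (Num.truncn ((w + h) / r)).+1; apply: lt_le_trans (truncnS_gt _) _.
  by rewrite -natrX ler_nat ltnW// ltn_expl.
have p2 : (0 : R) < 2 ^+ N by rewrite exprn_gt0.
move: hN; rewrite ltr_pdivrMr// => hN.
have pr : (w + h) / 2 ^+ N < r by rewrite ltr_pdivrMr// mulrC.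
apply: (SP N); apply: hr; apply: le_lt_trans pr; rewrite ler_pM2r ?invr_gt0//; lra.
Qed.

(** The estimate |contour| <= e (4 (w + h)^2) passes from four quarters to the whole, because the
    right-hand side of a quarter is a quarter of that of the whole. It holds for small rectangles
    because subtracting the affine approximation leaves an integrand of size e (w + h). Then e tends
    to 0. *)
Lemma goursat F a b c d : a <= b -> c <= d ->
  (forall z, rect a b c d z -> cdiff F z) -> contour F a b c d = 0.
Proof.
move=> ab cd hF; have hc : cont_rect F a b c d by move=> z /hF /cdiff_cont.
apply/eqP; rewrite -cabs_eq0; apply/eqP/le_anti; rewrite cabs_ge0 andbT.
apply/ler_addgt0Pr => e e0; rewrite add0r.
pose P a' c' w h := a <= a' -> a' + w <= b -> c <= c' -> c' + h <= d ->
   0 <= w -> 0 <= h -> cabs (contour F a' (a' + w) c' (c' + h)) <= e * (4 * (w + h) ^+ 2).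
suff: forall e', 0 < e' -> cabs (contour F a b c d) <= e' * (4 * ((b - a) + (d - c)) ^+ 2).
  move=> H; set K := 4 * _ in H.
  have K0 : 0 <= K by rewrite mulr_ge0// exprn_ge0; lra.
  have K1 : 0 < K + 1 by rewrite ltr_wpDl.
  have := H (e / (K + 1)); rewrite divr_gt0// => /(_ isT) h; apply: le_trans h _.
  have hK : K / (K + 1) <= 1 by rewrite ler_pdivrMr// mul1r lerDl.
  rewrite -[_ / _ * K]mulrA [_^-1 * K]mulrC.
  by apply: le_trans (ler_wpM2l (ltW e0) hK) _; rewrite mulr1.
move=> {P}e' e'0.
pose P a' c' w h := a <= a' -> a' + w <= b -> c <= c' -> c' + h <= d ->
   0 <= w -> 0 <= h -> cabs (contour F a' (a' + w) c' (c' + h)) <= e' * (4 * (w + h) ^+ 2).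
have : P a c (b - a) (d - c).
  apply: (@rect_induction P); try lra.
    move=> a' c' w h P1 P2 P3 P4 h1 h2 h3 h4 w0 h0.
    have w2 : 0 <= w / 2 by rewrite divr_ge0.
    have h2' : 0 <= h / 2 by rewrite divr_ge0.
    have eW : a' + w / 2 + w / 2 = a' + w by field.
    have eH : c' + h / 2 + h / 2 = c' + h by field.
    have x1 : a' + w / 2 <= b by lra.
    have x2 : a <= a' + w / 2 by lra.
    have y1 : c' + h / 2 <= d by lra.
    have y2 : c <= c' + h / 2 by lra.
    have x3 : a' <= a' + w / 2 <= a' + w by lra.
    have y3 : c' <= c' + h / 2 <= c' + h by lra.
    have {}P1 := P1 h1 x1 h3 y1 w2 h2'.
    have x4 : a' + w / 2 + w / 2 <= b by rewrite eW.
    have y4 : c' + h / 2 + h / 2 <= d by rewrite eH.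
    have {}P2 := P2 x2 x4 h3 y1 w2 h2'.
    have {}P3 := P3 h1 x1 y2 y4 w2 h2'.
    have {}P4 := P4 x2 x4 y2 y4 w2 h2'.
    rewrite !eW !eH in P2 P3 P4.
    have hc' : cont_rect F a' (a' + w) c' (c' + h) by exact: cont_rectS h1 h2 h3 h4 hc.
    have cw : c' <= c' + h by rewrite lerDl.
    have wl : a' + w / 2 <= a' + w by case/andP: x3.
    have hl : a' <= a' + w / 2 by case/andP: x3.
    rewrite (@contour_splitx _ _ _ _ _ (a' + w / 2))//.
    rewrite (@contour_splity _ a' _ _ _ (c' + h / 2))//; last first.
      by apply: cont_rectS hc'.
    rewrite (@contour_splity _ (a' + w / 2) _ _ _ (c' + h / 2))//; last first.
      by apply: cont_rectS hc'.
    have q : e' * (4 * (w + h) ^+ 2) = 4 * (e' * (4 * (w / 2 + h / 2) ^+ 2)) by field.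
    rewrite q; move: P1 P2 P3 P4; move: (e' * _) => Q; clear.
    move: (contour _ _ _ _ _) (contour _ (a' + w / 2) _ _ _) => X1 X2.
    move: (contour _ _ _ _ _) (contour _ (a' + w / 2) _ _ _) => X3 X4 P1 P2 P3 P4.
    have := cabsD (X1 + X3) (X2 + X4).
    have := cabsD X1 X3; have := cabsD X2 X4; lra.
  have -> : a + (b - a) = b by ring.
  have -> : c + (d - c) = d by ring.
  move=> z hz; have [D hD] := hF z hz.
  have [r r0 hr] := hD e' e'0; exists (r / 2); first by rewrite divr_gt0.
  move=> n a' c'; set w := (b - a) / _; set h := (d - c) / _ => hz' wr hrr _ _ _ _.
  move=> h1 h2 h3 h4 w0 h0.
  (* [G] is F minus its affine approximation at z; its contour integral is that of F by
     [contour_affine]. *)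
  pose G z' := F z' + ((- F z + D * z) + (- D) * z').
  have hG : cont_rect G a' (a' + w) c' (c' + h).
    move=> z' hz0; apply: ccontD; first by apply: (cont_rectS h1 h2 h3 h4 hc hz0).
    apply: ccontD; first exact: ccont_cst.
    by apply: ccontM; [exact: ccont_cst|exact: ccont_id].
  have -> : contour F a' (a' + w) c' (c' + h) = contour G a' (a' + w) c' (c' + h).
    rewrite /G contourD ?contour_affine ?addr0//; try lra.
      exact: cont_rectS h1 h2 h3 h4 hc.
    move=> z' _; apply: ccontD; first exact: ccont_cst.
    by apply: ccontM; [exact: ccont_cst|exact: ccont_id].
  have -> : e' * (4 * (w + h) ^+ 2) = 4 * (e' * (w + h)) * ((a' + w - a') + (c' + h - c')).
    by ring.
  apply: contour_bound => //; try lra.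
  move=> z' /andP[/andP[x1 x2] /andP[x3 x4]].
  have /andP[/andP[y1 y2] /andP[y3 y4]] := hz'.
  have dz : cabs (z' - z) <= w + h.
    apply: le_trans (cabs_le _) _; rewrite ReD ReN ImD ImN.
    by apply: lerD; rewrite ler_norml; apply/andP; split; lra.
  have -> : G z' = F z' - F z - D * (z' - z) by rewrite /G; ring.
  apply: le_trans (hr z' _) _; first by apply: le_lt_trans dz _; lra.
  by rewrite ler_pM2l.
rewrite /P => /(_ (lexx _)); have -> : a + (b - a) = b by ring.
have -> : c + (d - c) = d by ring.
by apply => //; lra.
Qed.

End Goursat.

(** * The maximum principle and uniform limits of holomorphic functions *)

Section MaximumPrinciple.
Variable R : realType.
Local Notation C := R[i].
Local Notation Re := complex.Re.
Local Notation Im := complex.Im.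
Implicit Types (F G : C -> C) (a b c d : R) (s : seq C) (z p : C).

(** The points of [s], where only continuity is known, are removed one at a time: p is enclosed in a
    small rectangle on which F is bounded by M, and the rest of the domain is cut into rectangles
    that avoid p. *)
Lemma goursat_except F s a b c d : a <= b -> c <= d -> cont_rect F a b c d ->
  (forall z, rect a b c d z -> z \notin s -> cdiff F z) -> contour F a b c d = 0.
Proof.
elim: s a b c d => [|p s IH] a b c d ab cd hc hF.
  by apply: goursat => // z hz; exact: hF.
have side a' b' c' d' : a' <= b' -> c' <= d' -> a <= a' -> b' <= b -> c <= c' ->
    d' <= d -> ~~ rect a' b' c' d' p -> contour F a' b' c' d' = 0.
  move=> ab' cd' h1 h2 h3 h4 np; apply: IH => //; first exact: cont_rectS hc.
  move=> z hz zs; apply: hF.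
    by move: hz => /andP[/andP[? ?] /andP[? ?]]; rewrite /rect; apply/andP; split; lra.
  by rewrite inE negb_or zs andbT; apply: contraNneq np => <-.
have [hp|] := boolP (rect a b c d p); last by move=> ?; apply: side.
have [r r0 hr] := ccont_bd (hc _ hp); set M := cabs (F p) + 1 in hr.
have M0 : 0 < M by rewrite ltr_wpDl ?cabs_ge0.
have /andP[/andP[p1 p2] /andP[p3 p4]] := hp.
apply/eqP; rewrite -cabs_eq0; apply/eqP/le_anti; rewrite cabs_ge0 andbT.
apply/ler_addgt0Pr => e e0; rewrite add0r.
(* The enclosing rectangle has sides at most 2h, so its contour integral is at most 4 M (4 h) = 16 M
   h <= e; h <= r/3 keeps it where F is bounded by M. *)
pose h := Num.min (r / 3) (e / (16 * M)).
have h0 : 0 < h by rewrite lt_min !divr_gt0// mulr_gt0.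
have hr3 : h <= r / 3 by rewrite ge_min lexx.
have he : 16 * M * h <= e by rewrite mulrC -ler_pdivlMr ?mulr_gt0// ge_min lexx orbT.
pose a' := Num.max a (Re p - h); pose b' := Num.min b (Re p + h).
pose c' := Num.max c (Im p - h); pose d' := Num.min d (Im p + h).
have aa : a <= a' by rewrite le_max lexx.
have cc : c <= c' by rewrite le_max lexx.
have bb : b' <= b by rewrite ge_min lexx.
have dd : d' <= d by rewrite ge_min lexx.
have a1 : a' <= Re p by rewrite ge_max p1 gerBl ltW.
have b1 : Re p <= b' by rewrite le_min p2 lerDl ltW.
have c1 : c' <= Im p by rewrite ge_max p3 gerBl ltW.
have d1 : Im p <= d' by rewrite le_min p4 lerDl ltW.
have a2 : Re p - h <= a' by rewrite le_max lexx orbT.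
have b2 : b' <= Re p + h by rewrite ge_min lexx orbT.
have c2 : Im p - h <= c' by rewrite le_max lexx orbT.
have d2 : d' <= Im p + h by rewrite ge_min lexx orbT.
have ab' : a' <= b' := le_trans a1 b1.
have cd' : c' <= d' := le_trans c1 d1.
have L : contour F a a' c d = 0.
  have [->|ne] := eqVneq a' a; first exact: contour_ptx.
  apply: side => //; first exact: le_trans bb.
  have -> : a' = Re p - h by move: ne; rewrite /a'; case: ltP => //; rewrite eqxx.
  by rewrite /rect lerBrDr gerDl (lt_geF h0) andbF.
have Rt : contour F b' b c d = 0.
  have [->|ne] := eqVneq b' b; first exact: contour_ptx.
  apply: side => //; first exact: le_trans ab'.
  have -> : b' = Re p + h by move: ne; rewrite /b'; case: ltP => //; rewrite eqxx.
  by rewrite /rect gerDl (lt_geF h0).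
have B : contour F a' b' c c' = 0.
  have [->|ne] := eqVneq c' c; first exact: contour_pty.
  apply: side => //; first exact: le_trans dd.
  have -> : c' = Im p - h by move: ne; rewrite /c'; case: ltP => //; rewrite eqxx.
  by rewrite /rect lerBrDr gerDl (lt_geF h0) !andbF.
have T : contour F a' b' d' d = 0.
  have [->|ne] := eqVneq d' d; first exact: contour_pty.
  apply: side => //; first exact: le_trans cd'.
  have -> : d' = Im p + h by move: ne; rewrite /d'; case: ltP => //; rewrite eqxx.
  by rewrite /rect gerDl (lt_geF h0) andbF.
have a'b : a' <= b := le_trans ab' bb.
have c'd : c' <= d := le_trans cd' dd.
rewrite (@contour_splitx _ _ a b c d a') ?aa//.
rewrite (@contour_splitx _ _ a' b c d b') ?ab' ?bb//; last exact: cont_rectS hc.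
rewrite (@contour_splity _ _ a' b' c d c') ?cc//; last exact: cont_rectS hc.
rewrite (@contour_splity _ _ a' b' c' d d') ?cd' ?dd//; last exact: cont_rectS hc.
rewrite L Rt B T !add0r !addr0.
apply: le_trans (@contour_bound _ F a' b' c' d' M ab' cd' _ _) _.
- exact: cont_rectS hc.
- move=> z /andP[/andP[z1 z2] /andP[z3 z4]]; apply: hr.
  apply: le_lt_trans (cabs_le _) _; rewrite ReD ImD ReN ImN.
  have : `|Re z - Re p| <= h.
    by rewrite ler_distl (le_trans a2 z1) (le_trans z2 b2).
  have : `|Im z - Im p| <= h.
    by rewrite ler_distl (le_trans c2 z3) (le_trans z4 d2).
  by move: hr3 r0; clear; lra.
have : 4 * M * (b' - a' + (d' - c')) <= 4 * M * (4 * h).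
  by rewrite ler_pM2l ?mulr_gt0//; move: a2 b2 c2 d2; clear; lra.
by move: he; clear; lra.
Qed.

(** For a unit vector u, Re(u conj v) is the component of v along u. If it is positive then Re(u /
    v) is positive, and this survives the perturbation of 1 by a small h, with an explicit bound. *)
Lemma Re_div_pos (u h v : C) (de K : R) : cabs u = 1 -> 0 < de -> de <= Re (u * cj v) ->
  0 < K -> cabs v <= K -> cabs h <= de / (2 * K) ->
  de / (2 * K ^+ 2) <= Re (u * ((1 - h) / v)).
Proof.
move=> u1 de0 hde K0 vK hh.
have v0 : v != 0.
  by apply: contraTneq hde => ->; rewrite conjc0 mulr0 /= -ltNge.
have vp : 0 < cabs v by rewrite cabs_gt0.
have nv : cj v * v = (cabs v ^+ 2)%:C.
  rewrite cabs_sq; case: v {hde vK v0 vp} => x y.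
  by apply: complex_eqP => /=; ring.
have -> : u * ((1 - h) / v) = (cabs v ^- 2)%:C * (u * cj v - u * h * cj v).
  have cv0 : cj v != 0 by rewrite conjc_eq0.
  by rewrite fmorphV/= -nv; field; rewrite v0.
rewrite ReZ [leRHS]mulrC ler_pdivlMr ?exprn_gt0// ReD ReN.
have h1 : Re (u * h * cj v) <= de / 2.
  apply: le_trans (ler_norm _) _; apply: le_trans (cabs_Re _) _.
  rewrite !cabsM u1 mul1r cabs_conj.
  apply: le_trans (ler_pM (cabs_ge0 _) (cabs_ge0 _) hh vK) _.
  by rewrite le_eqVlt; apply/orP; left; apply/eqP; field; rewrite gt_eqF.
have h2 : de / (2 * K ^+ 2) * cabs v ^+ 2 <= de / 2.
  rewrite mulrAC ler_pdivrMr ?mulr_gt0 ?exprn_gt0//.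
  have -> : de / 2 * (2 * K ^+ 2) = de * K ^+ 2 by field.
  by rewrite ler_pM2l// ler_pXn2r// nnegrE ?cabs_ge0// ltW.
lra.
Qed.

Lemma expr_small (q e : R) : 0 <= q -> q < 1 -> 0 < e -> exists n : nat, q ^+ n <= e.
Proof.
move=> q0 q1 e0; have := @cvg_expr R q; rewrite ger0_norm// => /(_ q1).
move=> /cvgrPdist_le /(_ e e0)[N _ /(_ N)]/= h; exists N.
by have := h (leqnn N); rewrite sub0r normrN ger0_norm// exprn_ge0.
Qed.

Lemma quot_cont F z D : cderiv F z D ->
  ccont (fun w => if w == z then D else (F w - F z) / (w - z)) z.
Proof.
move=> hD e e0; have [r r0 hr] := hD e e0; exists r => // w hw.
rewrite eqxx; have [_|wz] := eqVneq w z; first by rewrite subrr cabs0 ltW.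
have wz0 : w - z != 0 by rewrite subr_eq0.
have -> : (F w - F z) / (w - z) - D = (F w - F z - D * (w - z)) / (w - z) by field.
by rewrite cabsM cabsV ler_pdivrMr ?cabs_gt0//; exact: hr.
Qed.

Lemma quot_diff F z D w : w != z -> cdiff F w ->
  cdiff (fun w => if w == z then D else (F w - F z) / (w - z)) w.
Proof.
move=> wz hF; apply: (@cdiff_ext _ (fun w => (F w - F z) / (w - z)) _ _ (cabs (w - z))).
- by rewrite cabs_gt0 subr_eq0.
- by move=> v; have [->|//] := eqVneq v z; rewrite cabs_distC ltxx.
apply: cdiffM; first exact: cdiffB hF (cdiff_cst _ _).
apply: cdiffV; first exact: cdiffB (cdiff_id _) (cdiff_cst _ _).
by rewrite subr_eq0.
Qed.

Lemma quot_ccont F z D w : w != z -> ccont F w ->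
  ccont (fun w => if w == z then D else (F w - F z) / (w - z)) w.
Proof.
move=> wz hF.
have wz0 : w - z != 0 by rewrite subr_eq0.
apply: (@ccont_ext _ (fun w => (F w - F z) / (w - z)) _ _ (cabs (w - z))).
- by rewrite cabs_gt0.
- by move=> v; have [->|//] := eqVneq v z; rewrite cabs_distC ltxx.
apply: ccontM; first exact: ccontD hF (ccont_cst _ _).
apply: (@ccontV _ (fun w => w - z)) => //.
exact: ccontD (ccont_id _) (ccont_cst _ _).
Qed.

Lemma ccontX F n z : ccont F z -> ccont (fun w => F w ^+ n) z.
Proof.
move=> hF; elim: n => [|n IH]; first exact: ccont_cst.
apply: (@ccont_ext _ (fun w => F w * F w ^+ n) _ _ 1) => //.
  by move=> w _; rewrite exprS.
exact: ccontM.
Qed.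

(** Suppose |F(z0)| > M. A high power H of F / F(z0) is negligible on the boundary, while H(z0) = 1.
    The difference quotient of H at z0 has contour integral 0 by [goursat_except]. On the boundary,
    however, it is close to -1/(z - z0), and all four sides then contribute to the imaginary part of
    the integral with the same sign. *)
Lemma max_principle F s a b c d z0 (M : R) : a < Re z0 < b -> c < Im z0 < d ->
  cont_rect F a b c d -> (forall z, rect a b c d z -> z \notin s -> cdiff F z) ->
  z0 \notin s ->
  (forall z, rect a b c d z -> [|| Re z == a, Re z == b, Im z == c | Im z == d] ->
     cabs (F z) <= M) ->
  cabs (F z0) <= M.
Proof.
move=> /andP[az zb] /andP[cz zd] hc hF z0s hM; rewrite leNgt; apply/negP => MA.
have ab : a <= b by lra.
have cd : c <= d by lra.
have rz0 : rect a b c d z0 by rewrite /rect; apply/andP; split; lra.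
have M0 : 0 <= M.
  apply: le_trans (cabs_ge0 (F (a +i* c))) (hM _ _ _); rewrite /rect/= ?eqxx//.
  by rewrite !lexx ab cd.
set A := cabs (F z0) in MA; have A0 : 0 < A by lra.
have Fz0 : F z0 != 0 by rewrite -cabs_gt0.
pose de := Num.min (Num.min (Re z0 - a) (b - Re z0)) (Num.min (Im z0 - c) (d - Im z0)).
have de0 : 0 < de by rewrite !lt_min; lra.
have [[de1 de2] [de3 de4]] : ((de <= Re z0 - a) * (de <= b - Re z0)) *
    ((de <= Im z0 - c) * (de <= d - Im z0)).
  by rewrite !ge_min !lexx ?orbT.
pose K := (b - a) + (d - c); have K0 : 0 < K by rewrite /K; lra.
have [n hn] : exists n, (M / A) ^+ n <= de / (2 * K).
  apply: expr_small; first by rewrite divr_ge0// ltW.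
    by rewrite ltr_pdivrMr// mul1r.
  by rewrite divr_gt0// mulr_gt0.
pose H z := (F z / F z0) ^+ n.
have Hd z : cdiff F z -> cdiff H z.
  by move=> h; apply: cdiffX; apply: cdiffM h (cdiff_cst _ _).
have Hc z : ccont F z -> ccont H z.
  by move=> h; apply: ccontX; apply: ccontM h (ccont_cst _ _).
have Hz0 : H z0 = 1 by rewrite /H mulfV// expr1n.
have [D hD] : cdiff H z0 by apply: Hd; exact: hF.
pose G z := if z == z0 then D else (H z - H z0) / (z - z0).
have Gc : cont_rect G a b c d.
  move=> z hz; have [->|zz] := eqVneq z z0; first exact: quot_cont.
  by apply: quot_ccont => //; apply: Hc; exact: hc.
have G0 : contour G a b c d = 0.
  apply: (@goursat_except G (z0 :: s)) => // z hz; rewrite inE negb_or => /andP[zz zs].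
  by apply: quot_diff => //; apply: Hd; exact: hF.
pose m := de / (2 * K ^+ 2).
have m0 : 0 < m by rewrite divr_gt0// mulr_gt0// exprn_gt0.
(* [u] will be the outward unit normal of a side, so that Re(u conj(z - z0)) is the distance from z0
   to that side. *)
have key u z : rect a b c d z -> [|| Re z == a, Re z == b, Im z == c | Im z == d] ->
    cabs u = 1 -> de <= Re (u * cj (z - z0)) -> Re (u * G z) <= - m.
  move=> hz hz' u1 hu.
  have zz : z != z0.
    by apply: contraTneq hu => ->; rewrite subrr conjc0 mulr0 /= -ltNge.
  have zz0 : z - z0 != 0 by rewrite subr_eq0.
  have -> : u * G z = - (u * ((1 - H z) / (z - z0))).
    by rewrite /G (negbTE zz) Hz0; field.
  rewrite ReN lerN2; apply: Re_div_pos => //.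
    move: hz => /andP[/andP[x1 x2] /andP[x3 x4]]; apply: le_trans (cabs_le _) _.
    rewrite ReD ImD ReN ImN /K; apply: lerD; rewrite ler_norml; apply/andP.
      by split; move: az zb x1 x2; clear; lra.
    by split; move: cz zd x3 x4; clear; lra.
  rewrite cabsX cabsM cabsV -/A; apply: le_trans hn.
  apply: lerXn2r; rewrite ?nnegrE ?divr_ge0 ?cabs_ge0//; try exact: ltW.
  by rewrite ler_pM2r ?invr_gt0//; exact: hM.
have hI : Im (contour G a b c d) = 0 by rewrite G0.
move: hI; rewrite /contour !(ImD, ImN) !ImM /= !mul0r !mul1r !add0r.
have cH y : c <= y <= d -> gcont (fun x => G (x +i* y)) a b by exact: hcont Gc.
have cV x : a <= x <= b -> gcont (fun y => G (x +i* y)) c d by exact: vcont Gc.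
have mi (X : C) : Re (- ii * X) = Im X by rewrite ReM/= oppr0 mul0r sub0r mulN1r opprK.
have pi' (X : C) : Re (ii * X) = - Im X by rewrite ReM/= mul0r sub0r mul1r.
have i1 : cabs (- ii : C) = 1 by rewrite cabsN cabs_i.
have B1 : rint a b (fun x => Im (G (x +i* c))) <= - m * (b - a).
  rewrite -rint_cst//; apply: le_rint; [|exact: rcont_cst|].
    by apply: gcont_Im; apply: cH; rewrite lexx.
  move=> t ht.
  have := @key (- ii) (t +i* c); rewrite /rect/= ht lexx cd eqxx !orbT => /(_ isT isT i1).
  by rewrite !mi ImJ ImD ImN/= opprD opprK addrC; apply.
have T1 : m * (b - a) <= rint a b (fun x => Im (G (x +i* d))).
  rewrite -rint_cst//; apply: le_rint; [exact: rcont_cst| |].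
    by apply: gcont_Im; apply: cH; rewrite lexx cd.
  move=> t ht.
  have := @key ii (t +i* d); rewrite /rect/= ht lexx cd eqxx !orbT.
  move=> /(_ isT isT (cabs_i R)).
  by rewrite !pi' ImJ ImD ImN/= opprK => /(_ de4); rewrite lerN2.
have R1 : rint c d (fun y => Re (G (b +i* y))) <= - m * (d - c).
  rewrite -rint_cst//; apply: le_rint; [|exact: rcont_cst|].
    by apply: gcont_Re; apply: cV; rewrite lexx ab.
  move=> t ht.
  have := @key 1 (b +i* t); rewrite /rect/= ht lexx ab eqxx !orbT.
  move=> /(_ isT isT (cabs1 R)).
  by rewrite !mul1r ReJ ReD ReN/=; apply.
have L1 : m * (d - c) <= rint c d (fun y => Re (G (a +i* y))).
  rewrite -rint_cst//; apply: le_rint; [exact: rcont_cst| |].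
    by apply: gcont_Re; apply: cV; rewrite lexx ab.
  move=> t ht; have i2 : cabs (- 1 : C) = 1 by rewrite cabsN cabs1.
  have := @key (-1) (a +i* t); rewrite /rect/= ht lexx ab eqxx.
  move=> /(_ isT isT i2).
  by rewrite !mulN1r !ReN ReJ ReD ReN/= opprD opprK addrC => /(_ de1); rewrite lerN2.
have P1 : 0 < m * (b - a) by rewrite mulr_gt0// subr_gt0 (lt_trans az).
have P2 : 0 < m * (d - c) by rewrite mulr_gt0// subr_gt0 (lt_trans cz).
by move: B1 T1 R1 L1 P1 P2; clear; lra.
Qed.

(** The maximum principle for the difference quotient at p: on the boundary of the square |w - p| >=
    r, and the numerator is at most 2M. *)
Lemma quot_bound F s p (r M : R) z : 0 < r ->
  cont_rect F (Re p - r) (Re p + r) (Im p - r) (Im p + r) ->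
  (forall w, rect (Re p - r) (Re p + r) (Im p - r) (Im p + r) w -> w \notin s -> cdiff F w) ->
  p \notin s -> z \notin s ->
  (forall w, rect (Re p - r) (Re p + r) (Im p - r) (Im p + r) w -> cabs (F w) <= M) ->
  Re p - r < Re z < Re p + r -> Im p - r < Im z < Im p + r ->
  cabs (F z - F p) <= 2 * M / r * cabs (z - p).
Proof.
move=> r0 hc hF ps zs hM hz1 hz2.
have rp : rect (Re p - r) (Re p + r) (Im p - r) (Im p + r) p.
  by rewrite /rect; apply/andP; split; lra.
have [->|zp] := eqVneq z p; first by rewrite !subrr cabs0 mulr0.
have [D hD] := hF p rp ps.
pose G w := if w == p then D else (F w - F p) / (w - p).
have zp0 : z - p != 0 by rewrite subr_eq0.
suff : cabs (G z) <= 2 * M / r.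
  by rewrite /G (negbTE zp) cabsM cabsV ler_pdivrMr ?cabs_gt0.
apply: (@max_principle G (p :: s) (Re p - r) (Re p + r) (Im p - r) (Im p + r)) => //.
- move=> w hw; have [->|wp] := eqVneq w p; first exact: quot_cont.
  by apply: quot_ccont => //; exact: hc.
- move=> w hw; rewrite inE negb_or => /andP[wp ws].
  by apply: quot_diff => //; exact: hF.
- by rewrite inE negb_or zp.
move=> w hw hb.
have hr : r <= cabs (w - p).
  case/or4P: hb => /eqP e; [have := cabs_Re (w - p)|have := cabs_Re (w - p)|
    have := cabs_Im (w - p)|have := cabs_Im (w - p)];
  rewrite ?ReD ?ReN ?ImD ?ImN e; apply: le_trans; rewrite ler_normr; apply/orP;
  [right|left|right|left]; lra.
have wp : w != p by apply: contraTneq hr => ->; rewrite subrr cabs0 -ltNge.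
rewrite /G (negbTE wp) cabsM cabsV; apply: ler_pM; rewrite ?invr_ge0 ?cabs_ge0//.
  apply: le_trans (cabsB _ _) _; rewrite [2]mulr2n mulrDl mul1r; apply: lerD; exact: hM.
by rewrite lef_pV2// posrE (lt_le_trans r0).
Qed.

(* Dividing by (z - p)^n costs nothing at p, where F vanishes identically, and *)
(* makes the maximum over the boundary of the square negligible.               *)
Lemma vanish_near F p (r e : R) z : 0 < e ->
  (forall w, cabs (w - p) < e -> F w = 0) ->
  (forall w, rect (Re p - r) (Re p + r) (Im p - r) (Im p + r) w -> cdiff F w) ->
  (exists M, forall w, rect (Re p - r) (Re p + r) (Im p - r) (Im p + r) w -> cabs (F w) <= M) ->
  cabs (z - p) < r -> F z = 0.
Proof.
move=> e0 h0 hF [M hM] zr.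
have r0 : 0 < r := le_lt_trans (cabs_ge0 _) zr.
have [->|zp] := eqVneq z p; first by rewrite h0// subrr cabs0.
have zp0 : 0 < cabs (z - p) by rewrite cabs_gt0 subr_eq0.
have M0 : 0 <= M.
  apply: le_trans (cabs_ge0 (F p)) (hM _ _).
  by rewrite /rect; apply/andP; split; lra.
apply/eqP; rewrite -cabs_eq0; apply/eqP/le_anti; rewrite cabs_ge0 andbT.
apply/ler_addgt0Pr => d d0; rewrite add0r.
have q1 : cabs (z - p) / r < 1 by rewrite ltr_pdivrMr// mul1r.
have q0 : 0 <= cabs (z - p) / r by rewrite divr_ge0 ?cabs_ge0// ltW.
have M1 : 0 < M + 1 by rewrite ltr_wpDl.
have [n hn] := expr_small q0 q1 (divr_gt0 d0 M1).
pose G w := F w / (w - p) ^+ n.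
have Gd w : rect (Re p - r) (Re p + r) (Im p - r) (Im p + r) w -> cdiff G w.
  move=> hw; have [->|wp] := eqVneq w p.
    apply: (@cdiff_ext _ (fun=> 0) _ _ e) (cdiff_cst _ _) => // v hv.
    by rewrite /G h0// mul0r.
  apply: cdiffM; first exact: hF.
  apply: cdiffV; last by rewrite expf_neq0// subr_eq0.
  by apply: cdiffX; apply: cdiffB (cdiff_id _) (cdiff_cst _ _).
have hz1 : `|Re z - Re p| < r.
  by apply: le_lt_trans zr; rewrite -ReN -ReD cabs_Re.
have hz2 : `|Im z - Im p| < r.
  by apply: le_lt_trans zr; rewrite -ImN -ImD cabs_Im.
move: hz1 hz2; rewrite !ltr_norml => /andP[z1 z2] /andP[z3 z4].
have : cabs (G z) <= M / r ^+ n.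
  apply: (@max_principle G [::] (Re p - r) (Re p + r) (Im p - r) (Im p + r)) => //; try lra.
  - by move=> w /Gd /cdiff_cont.
  - by move=> w hw _; exact: Gd.
  move=> w hw hb.
  have hr : r <= cabs (w - p).
    case/or4P: hb => /eqP ew; [have := cabs_Re (w - p)|have := cabs_Re (w - p)|
      have := cabs_Im (w - p)|have := cabs_Im (w - p)];
    rewrite ?ReD ?ReN ?ImD ?ImN ew; apply: le_trans; rewrite ler_normr; apply/orP;
    [right|left|right|left]; lra.
  rewrite /G cabsM cabsV cabsX; apply: ler_pM; rewrite ?invr_ge0 ?exprn_ge0 ?cabs_ge0//.
    exact: hM.
  rewrite lef_pV2 ?posrE ?exprn_gt0//; last exact: lt_le_trans hr.
  by rewrite lerXn2r// nnegrE ?cabs_ge0// ltW.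
rewrite /G cabsM cabsV cabsX ler_pdivrMr ?exprn_gt0// => h; apply: le_trans h _.
rewrite mulrAC -mulrA -expr_div_n; move: hn; rewrite ler_pdivlMr// => hn.
apply: le_trans hn; rewrite mulrC ler_wpM2l ?exprn_ge0// lerDl//.
Qed.

(** [quot_bound] applied to f n - f m shows that the difference quotients at p form a Cauchy
    sequence, uniformly in z. Hence the derivatives at p converge, and their limit is the derivative
    of F. *)
Lemma weierstrass (f : nat -> C -> C) F p (r : R) : 0 < r ->
  (forall n w, rect (Re p - r) (Re p + r) (Im p - r) (Im p + r) w -> cdiff (f n) w) ->
  (forall e : R, 0 < e -> exists N, forall n, (N <= n)%N -> forall w,
     rect (Re p - r) (Re p + r) (Im p - r) (Im p + r) w -> cabs (f n w - F w) <= e) ->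
  cdiff F p.
Proof.
move=> r0 hf hu.
have hq n m e : (forall w, rect (Re p - r) (Re p + r) (Im p - r) (Im p + r) w ->
     cabs (f n w - f m w) <= e) -> forall z, cabs (z - p) < r ->
     cabs ((f n z - f m z) - (f n p - f m p)) <= 2 * e / r * cabs (z - p).
  move=> he z zr.
  have hz1 : `|Re z - Re p| < r.
    by apply: le_lt_trans zr; rewrite -ReN -ReD cabs_Re.
  have hz2 : `|Im z - Im p| < r.
    by apply: le_lt_trans zr; rewrite -ImN -ImD cabs_Im.
  move: hz1 hz2; rewrite !ltr_norml => /andP[z1 z2] /andP[z3 z4].
  have hd w : rect (Re p - r) (Re p + r) (Im p - r) (Im p + r) w ->
      cdiff (fun w => f n w - f m w) w.
    by move=> hw; apply: cdiffB; exact: hf.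
  apply: (@quot_bound (fun w => f n w - f m w) [::]) => //; try lra.
  - by move=> w /hd /cdiff_cont.
  - by move=> w hw _; exact: hd.
have rp : rect (Re p - r) (Re p + r) (Im p - r) (Im p + r) p.
  by rewrite /rect; apply/andP; split; lra.
have /choice[D hD] : forall n, exists D, cderiv (f n) p D by move=> n; exact: hf.
have cau e : 0 < e -> exists N, forall n m, (N <= n)%N -> (N <= m)%N ->
    (forall z, cabs (z - p) < r -> cabs ((f n z - f m z) - (f n p - f m p)) <= e * cabs (z - p))
    /\ cabs (D n - D m) <= e.
  move=> e0; have e1 : 0 < e * r / 4 by rewrite divr_gt0// mulr_gt0.
  have [N hN] := hu _ e1; exists N => n m nN mN.
  have h : forall z, cabs (z - p) < r ->
      cabs ((f n z - f m z) - (f n p - f m p)) <= e * cabs (z - p).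
    have -> : e = 2 * (e * r / 2) / r by field; rewrite gt_eqF.
    apply: hq => w hw; have := hN n nN w hw; have := hN m mN w hw.
    rewrite cabs_distC => h1 h2.
    have := cabsD (f n w - F w) (F w - f m w).
    have -> : f n w - F w + (F w - f m w) = f n w - f m w by ring.
    lra.
  (* Otherwise the derivative of f n - f m at p, tested at p + t for a small real t > 0, contradicts
     the bound on quotients. *)
  split => //; rewrite leNgt; apply/negP => hlt.
  have : cderiv (fun w => f n w + -1 * f m w) p (D n + (0 * f m p + -1 * D m)).
    by apply: cderivD => //; apply: cderivM => //; exact: cderiv_cst.
  pose eta := (cabs (D n - D m) - e) / 2.
  have eta0 : 0 < eta by rewrite divr_gt0// subr_gt0.
  move=> /(_ eta eta0)[d d0 hd].
  pose t := Num.min (d / 2) (r / 2).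
  have t0 : 0 < t by rewrite lt_min !divr_gt0.
  have ct : cabs (p + t%:C - p) = t.
    by rewrite addrC addKr cabs_real ger0_norm// ltW.
  have td : t < d by rewrite gt_min; apply/orP; left; lra.
  have tr : t < r by rewrite gt_min; apply/orP; right; lra.
  have := hd (p + t%:C); have := h (p + t%:C); rewrite ct => /(_ tr) h1 /(_ td) h2.
  set X := f n (p + t%:C) - f m (p + t%:C) - (f n p - f m p) in h1.
  have e2 : (D n - D m) * t%:C = X - (f n (p + t%:C) + -1 * f m (p + t%:C) -
    (f n p + -1 * f m p) - (D n + (0 * f m p + -1 * D m)) * (p + t%:C - p)).
    by rewrite /X; ring.
  have := cabsB X (f n (p + t%:C) + -1 * f m (p + t%:C) -
    (f n p + -1 * f m p) - (D n + (0 * f m p + -1 * D m)) * (p + t%:C - p)).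
  rewrite -e2 cabsM cabs_real (ger0_norm (ltW t0)) => h3.
  have : cabs (D n - D m) * t <= (e + eta) * t by rewrite mulrDl; lra.
  by rewrite ler_pM2r// /eta; lra.
have re1 n m : `|Re (D n) - Re (D m)| <= cabs (D n - D m).
  by rewrite -ReN -ReD cabs_Re.
have im1 n m : `|Im (D n) - Im (D m)| <= cabs (D n - D m).
  by rewrite -ImN -ImD cabs_Im.
have lim1 (u : nat -> R) : (forall n m, `|u n - u m| <= cabs (D n - D m)) ->
    exists l, forall e : R, 0 < e -> exists N, forall n, (N <= n)%N -> `|u n - l| <= e.
  move=> hu'.
  have /cvg_ex[l hl] : cvgn u.
    apply: R_complete; apply: cauchy_exP => e e0.
    have [N hN] := cau (e / 2) (divr_gt0 e0 (ltr0Sn _ 1)).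
    exists (u N); exists N => // n /= nN; rewrite /ball/=.
    apply: le_lt_trans (hu' N n) _; apply: le_lt_trans (hN _ _ (leqnn N) nN).2 _.
    by rewrite ltr_pdivrMr// ltr_pMr// ltr1n.
  exists l => e e0; have /cvgrPdist_le/(_ e e0)[N _ hN] := hl.
  by exists N => n nN; rewrite distrC; exact: hN.
have [x hx] := lim1 _ re1; have [y hy] := lim1 _ im1.
exists (x +i* y) => e e0; have e4 : 0 < e / 4 by rewrite divr_gt0.
have [N1 h1] := cau _ e4; have [N2 h2] := hx _ (divr_gt0 e4 (ltr0Sn _ 1)).
have [N3 h3] := hy _ (divr_gt0 e4 (ltr0Sn _ 1)).
pose n := maxn N1 (maxn N2 N3).
have n1 : (N1 <= n)%N by rewrite leq_maxl.
have n2 : (N2 <= n)%N by rewrite /n maxnC -maxnA leq_maxl.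
have n3 : (N3 <= n)%N by rewrite /n maxnA leq_maxr.
have [d d0 hd] := hD n _ e4.
exists (Num.min d r); first by rewrite lt_min d0.
move=> w; rewrite lt_min => /andP[/hd a1 wr].
(* The Cauchy estimate in which m tends to infinity, with h as the remaining error. *)
have a2 : cabs (f n w - F w - (f n p - F p)) <= e / 4 * cabs (w - p).
  apply/ler_addgt0Pr => h h0.
  have hh : 0 < h / 2 by rewrite divr_gt0.
  have [N4 h4] := hu _ hh; pose m := maxn N1 N4.
  have m4 : (N4 <= m)%N by rewrite leq_maxr.
  have := (h1 n m n1 (leq_maxl _ _)).1 w wr.
  have rw : rect (Re p - r) (Re p + r) (Im p - r) (Im p + r) w.
    have := le_lt_trans (cabs_Re _) wr; have := le_lt_trans (cabs_Im _) wr.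
    rewrite ReD ReN ImD ImN !ltr_distl /rect => /andP[? ?] /andP[? ?].
    by rewrite !ltW.
  have := h4 m m4 w rw; have := h4 m m4 p rp.
  have := cabsD (f n w - f m w - (f n p - f m p)) (f m w - F w - (f m p - F p)).
  have := cabsB (f m w - F w) (f m p - F p).
  have -> : f n w - f m w - (f n p - f m p) + (f m w - F w - (f m p - F p)) =
    f n w - F w - (f n p - F p) by ring.
  by clear; lra.
have a3 : cabs (D n - (x +i* y)) <= e / 4.
  apply: le_trans (cabs_le _) _; rewrite ReD ImD ReN ImN/=.
  by have := h2 n n2; have := h3 n n3; clear; lra.
have -> : F w - F p - (x +i* y) * (w - p) = (f n w - f n p - D n * (w - p)) -
   (f n w - F w - (f n p - F p)) + (D n - (x +i* y)) * (w - p) by ring.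
apply: le_trans (cabsD _ _) _; rewrite cabsM.
have a4 : cabs (D n - (x +i* y)) * cabs (w - p) <= e / 4 * cabs (w - p).
  by rewrite ler_wpM2r ?cabs_ge0.
have a5 := cabsB (f n w - f n p - D n * (w - p)) (f n w - F w - (f n p - F p)).
have a6 : 0 <= e * cabs (w - p) by rewrite mulr_ge0 ?cabs_ge0// ltW.
by move: a1 a2 a4 a5 a6; clear; lra.
Qed.

End MaximumPrinciple.

(** * Boundedness on rectangles and the identity theorem *)

Section IdentityTheorem.
Variable R : realType.
Local Notation C := R[i].
Local Notation Re := complex.Re.
Local Notation Im := complex.Im.
Implicit Types (F G : C -> C) (z p s : C).

(** Local boundedness propagates by [rect_induction]: the sum of the bounds on the quarters serves
    for the whole. *)
Lemma rect_bounded F a b c d : a <= b -> c <= d -> cont_rect F a b c d ->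
  exists2 M : R, 0 < M & forall z, rect a b c d z -> cabs (F z) <= M.
Proof.
move=> ab cd hF.
pose P a' c' w h := exists2 M : R, 0 < M & forall z, rect a' (a' + w) c' (c' + h) z ->
  cabs (F z) <= M.
have : P a c (b - a) (d - c).
  apply: (@rect_induction _ P); rewrite ?subr_ge0//.
    move=> a' c' w h [M1 m1 h1] [M2 m2 h2] [M3 m3 h3] [M4 m4 h4].
    exists (M1 + M2 + M3 + M4); first by rewrite !addr_gt0.
    move=> z /andP[/andP[x1 x2] /andP[y1 y2]].
    have ew : a' + w / 2 + w / 2 = a' + w by field.
    have eh : c' + h / 2 + h / 2 = c' + h by field.
    have [xl|/ltW xl] := leP (Re z) (a' + w / 2);
    have [yl|/ltW yl] := leP (Im z) (c' + h / 2).
    - have := h1 z; rewrite /rect x1 xl y1 yl => /(_ isT).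
      by move: m1 m2 m3 m4; clear; lra.
    - have := h3 z; rewrite /rect x1 xl yl eh y2 => /(_ isT).
      by move: m1 m2 m3 m4; clear; lra.
    - have := h2 z; rewrite /rect xl y1 yl ew x2 => /(_ isT).
      by move: m1 m2 m3 m4; clear; lra.
    - have := h4 z; rewrite /rect xl yl ew eh x2 y2 => /(_ isT).
      by move: m1 m2 m3 m4; clear; lra.
  move=> z; rewrite -/(rect _ _ _ _ _) !subrKC => hz.
  have [r r0 hr] := ccont_bd (hF z hz); exists (r / 2); first by rewrite divr_gt0.
  move=> n a' c' /andP[/andP[x1 x2] /andP[y1 y2]] wr h_r _ _ _ _.
  exists (cabs (F z) + 1); first by rewrite ltr_wpDl ?cabs_ge0.
  move=> v /andP[/andP[v1 v2] /andP[v3 v4]]; apply: hr.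
  apply: le_lt_trans (cabs_le _) _; rewrite ReD ImD ReN ImN.
  have e1 : `|Re v - Re z| <= (b - a) / 2 ^+ n.
    by rewrite ler_norml; move: x1 x2 v1 v2; clear; lra.
  have e2 : `|Im v - Im z| <= (d - c) / 2 ^+ n.
    by rewrite ler_norml; move: y1 y2 v3 v4; clear; lra.
  by move: e1 e2 wr h_r; clear; lra.
by rewrite /P !subrKC.
Qed.

(** One application of [vanish_near], on a square centred far to the right of z on its horizontal
    line, where F vanishes, and just large enough to contain z. *)
Lemma identity_halfplane F (K K' : R) : (forall s, K < Re s -> cdiff F s) ->
  (forall s, K' < Re s -> F s = 0) -> forall s, K < Re s -> F s = 0.
Proof.
move=> hF h0 z Kz.
pose T := `|K'| + `|Re z| + 1; have T0 : 0 < T by rewrite ltr_wpDl// addr_ge0.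
have TK : K' + 1 <= Re z + T.
  have := ler_norm K'; have := ler_norm (- Re z); rewrite normrN /T.
  by clear; lra.
(* The square of half-side T + e around z + T has its left edge at Re z - e, still to the right of
   K. *)
pose e := (Re z - K) / 2; have e0 : 0 < e by rewrite divr_gt0// subr_gt0.
pose p := z + T%:C.
have Rp : Re p = Re z + T by rewrite ReD.
have Ip : Im p = Im z by rewrite ImD addr0.
have hd w : rect (Re p - (T + e)) (Re p + (T + e)) (Im p - (T + e)) (Im p + (T + e)) w ->
    cdiff F w.
  move=> /andP[/andP[w1 _] _]; apply: hF; move: w1; rewrite Rp /e.
  by move: Kz; clear; lra.
apply: (@vanish_near _ F p (T + e) 1) => //.
- move=> w hw; apply: h0; have := le_lt_trans (cabs_Re _) hw.
  by rewrite ReD ReN Rp ltr_distl; move: TK; clear; lra.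
- have [||w /hd /cdiff_cont//|M _ hM] := @rect_bounded F (Re p - (T + e)) (Re p + (T + e))
    (Im p - (T + e)) (Im p + (T + e)); last by exists M.
  + by move: T0 e0; clear; lra.
  + by move: T0 e0; clear; lra.
by rewrite opprD addNKr cabsN cabs_real (gtr0_norm T0) ltrDl.
Qed.

Lemma identity_entire F p (e : R) : (forall s, cdiff F s) -> 0 < e ->
  (forall s, cabs (s - p) < e -> F s = 0) -> forall s, F s = 0.
Proof.
move=> hF e0 h0 z; pose r := cabs (z - p) + 1.
have r0 : 0 < r by rewrite ltr_wpDl ?cabs_ge0.
apply: (@vanish_near _ F p r e) => //; last by rewrite ltrDl.
have [||w _|M _ hM] := @rect_bounded F (Re p - r) (Re p + r) (Im p - r) (Im p + r);
  last by exists M.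
- by move: r0; clear; lra.
- by move: r0; clear; lra.
- exact: cdiff_cont.
Qed.

End IdentityTheorem.

(** * The complex exponential and complex powers of positive reals *)

Section Exponential.
Variable R : realType.
Local Notation C := R[i].
Local Notation Re := complex.Re.
Local Notation Im := complex.Im.
Implicit Types (z w s : C) (x y : R).

Lemma cexpD z w : cexp (z + w) = cexp z * cexp w.
Proof.
rewrite /cexp ReD ImD expRD rmorphM/= mulrACA; congr (_ * _).
by apply: complex_eqP; rewrite ?ReM ?ImM/= ?cosD ?sinD//; ring.
Qed.

Lemma cexp0 : cexp 0 = 1 :> C.
Proof. by rewrite /cexp/= expR0 cos0 sin0 mul1r. Qed.

Lemma cabs_cexp z : cabs (cexp z) = expR (Re z).
Proof.
rewrite cabsM cabs_real ger0_norm ?expR_ge0//.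
by rewrite cabs_sqrt/= cos2Dsin2 sqrtr1 mulr1.
Qed.

Lemma cexp_neq0 z : cexp z != 0.
Proof. by rewrite -cabs_gt0 cabs_cexp expR_gt0. Qed.

Lemma cexpN z : cexp (- z) = (cexp z)^-1.
Proof.
by apply: (mulfI (cexp_neq0 z)); rewrite -cexpD subrr cexp0 mulfV// cexp_neq0.
Qed.

Lemma cexpMn z n : cexp (z * n%:R) = cexp z ^+ n.
Proof.
elim: n => [|n IH]; first by rewrite mulr0 cexp0.
by rewrite exprS -IH -cexpD mulrSr mulrDr mulr1 addrC.
Qed.

Lemma cexp_real x : cexp x%:C = (expR x)%:C.
Proof. by rewrite /cexp/= cos0 sin0 mulr1. Qed.

Lemma cexp_conj z : cexp (cj z) = cj (cexp z).
Proof.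
rewrite /cexp ReJ ImJ cosN sinN.
by apply: complex_eqP; rewrite ?ReJ ?ImJ ?ReM ?ImM/=; ring.
Qed.

Lemma sin_le x : `|sin x| <= `|x|.
Proof.
wlog x0 : x / 0 <= x.
  move=> h; have [x0|x0] := leP 0 x; first exact: h.
  by rewrite -normrN -sinN -[leRHS]normrN; apply: h; rewrite oppr_ge0 ltW.
rewrite (ger0_norm x0); have [->|xn] := eqVneq x 0; first by rewrite sin0 normr0.
have xp : 0 < x by rewrite lt_def xn.
have [c _] := @MVT R sin cos 0 x xp (fun y _ => is_derive_sin y)
  (continuous_subspaceT (@continuous_sin R)).
rewrite sin0 !subr0 => ->; rewrite normrM (ger0_norm x0) ler_piMl//.
by rewrite ler_norml cos_geN1 cos_le1.
Qed.

Lemma cos_sub1 x : `|1 - cos x| <= x ^+ 2.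
Proof.
have -> : 1 - cos x = 2 * sin (x / 2) ^+ 2.
  have := cosD (x / 2) (x / 2); rewrite -splitr => ->.
  by have := cos2Dsin2 (x / 2); move: (cos _) (sin _) => a b; clear; nra.
rewrite normrM normrX normr_nat.
have h := sin_le (x / 2); have h0 := normr_ge0 (sin (x / 2)).
have e : `|x / 2| ^+ 2 = x ^+ 2 / 4 by rewrite real_normK ?num_real//; field.
have : `|sin (x / 2)| ^+ 2 <= `|x / 2| ^+ 2 by rewrite lerXn2r// nnegrE.
by rewrite e; have := sqr_ge0 x; clear; lra.
Qed.

Lemma sin_sub x : `|x| <= 1 -> `|sin x - x| <= x ^+ 2.
Proof.
wlog x0 : x / 0 <= x.
  move=> h; have [x0|x0] := leP 0 x; first exact: h.
  move=> x1; have := h (- x); rewrite oppr_ge0 (ltW x0) normrN sinN sqrrN.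
  by move=> /(_ isT x1); rewrite -opprD normrN.
rewrite (ger0_norm x0) => x1.
have [->|xn] := eqVneq x 0; first by rewrite sin0 subrr normr0 expr0n.
have xp : 0 < x by rewrite lt_def xn.
have [c] := @MVT R sin cos 0 x xp (fun y _ => is_derive_sin y)
  (continuous_subspaceT (@continuous_sin R)).
rewrite in_itv/= => /andP[c0 cx]; rewrite sin0 !subr0 => ->.
have -> : cos c * x - x = - ((1 - cos c) * x) by ring.
rewrite normrN normrM (ger0_norm x0) expr2 ler_wpM2r//.
apply: le_trans (cos_sub1 c) _.
by move: c0 cx x1 x0; clear; nra.
Qed.

Lemma expR_sub1 x : `|x| <= 1 / 2 -> `|expR x - 1 - x| <= 2 * x ^+ 2.
Proof.
rewrite ler_norml => /andP[x1 x2].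
have h1 := expR_ge1Dx x; have h2 := expR_ge1Dx (- x).
have h3 : expR x * (1 - x) <= 1.
  by apply: le_trans (ler_wpM2l (expR_ge0 x) h2) _; rewrite expRxMexpNx_1.
rewrite ger0_norm; last by move: h1; clear; lra.
have x1' : 0 < 1 - x by move: x2; clear; lra.
rewrite -(ler_pM2r x1'); apply: (@le_trans _ _ (1 - (1 + x) * (1 - x))).
  by move: h3; clear; nra.
have -> : 1 - (1 + x) * (1 - x) = x ^+ 2 by ring.
by have := sqr_ge0 x; move: x2; clear; nra.
Qed.

Lemma cexp_sub1 z : cabs z <= 1 / 2 -> cabs (cexp z - 1 - z) <= 10 * cabs z ^+ 2.
Proof.
move=> hz; have hx := le_trans (cabs_Re z) hz; have hy := le_trans (cabs_Im z) hz.
rewrite cabs_sq; apply: le_trans (cabs_le _) _.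
rewrite /cexp !ReD !ImD !ReN !ImN ReM ImM /= oppr0 !mul0r !addr0 subr0.
move: (Re z) (Im z) hx hy => x y hx hy.
have h1 := expR_sub1 hx; have h2 := cos_sub1 y.
have h3 : `|sin y - y| <= y ^+ 2.
  by apply: sin_sub; move: hy; clear; lra.
have e0 := expR_gt0 x.
have x2 : x ^+ 2 <= 1 / 4.
  by have : `|x| ^+ 2 <= (1 / 2) ^+ 2 by [rewrite lerXn2r// ?nnegrE//; lra];
     rewrite real_normK ?num_real//; clear; lra.
have e2 : expR x <= 2.
  by move: h1 hx; rewrite !ler_norml; move: x2; clear; lra.
have a1 : `|expR x * cos y - 1 - x| <= 2 * x ^+ 2 + 2 * y ^+ 2.
  have -> : expR x * cos y - 1 - x = (expR x - 1 - x) - expR x * (1 - cos y) by ring.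
  apply: le_trans (ler_normB _ _) _; apply: lerD => //.
  by rewrite normrM (gtr0_norm e0) ler_pM// ltW.
have a2 : `|expR x - 1| <= 2 * `|x|.
  have -> : expR x - 1 = (expR x - 1 - x) + x by ring.
  apply: le_trans (ler_normD _ _) _.
  have : 2 * x ^+ 2 <= `|x|.
    rewrite -(real_normK (num_real x)).
    by move: hx (normr_ge0 x); move: `|x| => u; clear; nra.
  by move: h1; clear; lra.
have a3 : `|expR x * sin y - y| <= 2 * y ^+ 2 + 2 * (`|x| * `|y|).
  have -> : expR x * sin y - y = expR x * (sin y - y) + (expR x - 1) * y by ring.
  apply: le_trans (ler_normD _ _) _; rewrite !normrM (gtr0_norm e0) mulrA.
  by apply: lerD; [rewrite ler_pM// ltW|rewrite ler_wpM2r].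
have a4 : 2 * (`|x| * `|y|) <= x ^+ 2 + y ^+ 2.
  rewrite -(real_normK (num_real x)) -(real_normK (num_real y)).
  by have := sqr_ge0 (`|x| - `|y|); move: `|x| `|y| => u v; clear; nra.
by have := sqr_ge0 x; have := sqr_ge0 y; move: a1 a3 a4; clear; lra.
Qed.

Lemma cderiv_cexp z : cderiv (@cexp R) z (cexp z).
Proof.
move=> e e0; have e1 := expR_gt0 (Re z).
exists (Num.min (1 / 2) (e / (10 * expR (Re z)))).
  by rewrite lt_min !divr_gt0// mulr_gt0.
move=> w; rewrite lt_min => /andP[/ltW h1]; rewrite ltr_pdivlMr ?mulr_gt0// => h2.
have -> : cexp w - cexp z - cexp z * (w - z) = cexp z * (cexp (w - z) - 1 - (w - z)).
  by have -> : cexp w = cexp (w - z) * cexp z by [rewrite -cexpD subrK]; ring.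
rewrite cabsM cabs_cexp; have := cexp_sub1 h1.
move=> h3; apply: le_trans (ler_wpM2l (ltW e1) h3) _.
have -> : expR (Re z) * (10 * cabs (w - z) ^+ 2) =
  cabs (w - z) * (10 * expR (Re z)) * cabs (w - z) by ring.
by rewrite ler_wpM2r ?cabs_ge0// ltW.
Qed.

Lemma cdiff_cexp z : cdiff (@cexp R) z.
Proof. by eexists; exact: cderiv_cexp. Qed.

Lemma cdiff_cpow x s : cdiff (cpow x) s.
Proof.
apply: (cdiff_comp _ (cdiff_cexp _)).
by apply: cdiffM; [exact: cdiff_id|exact: cdiff_cst].
Qed.

Lemma cabs_cpow x s : 0 < x -> cabs (cpow x s) = powR x (Re s).
Proof.
move=> x0; rewrite /cpow cabs_cexp ReM/= mulr0 subr0 /powR.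
by rewrite gt_eqF.
Qed.

Lemma cpowD x s w : cpow x (s + w) = cpow x s * cpow x w.
Proof. by rewrite /cpow mulrDl cexpD. Qed.

Lemma cpow0 x : cpow x 0 = 1.
Proof. by rewrite /cpow mul0r cexp0. Qed.

Lemma cpow_neq0 x s : cpow x s != 0.
Proof. exact: cexp_neq0. Qed.

Lemma cpowN x s : cpow x (- s) = (cpow x s)^-1.
Proof. by rewrite /cpow mulNr cexpN. Qed.

Lemma cpowM x y s : 0 < x -> 0 < y -> cpow (x * y) s = cpow x s * cpow y s.
Proof. by move=> x0 y0; rewrite /cpow lnM ?posrE// rmorphD mulrDr cexpD. Qed.

Lemma cpow1 s : cpow 1 s = 1.
Proof. by rewrite /cpow ln1 mulr0 cexp0. Qed.

Lemma cpow_nat x n : 0 < x -> cpow x n%:R = (x ^+ n)%:C.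
Proof.
move=> x0; rewrite /cpow mulrC cexpMn cexp_real lnK ?posrE//.
by rewrite rmorphXn.
Qed.

Lemma cpow_conj x s : cpow x (cj s) = cj (cpow x s).
Proof. rewrite /cpow -cexp_conj; congr cexp.
by apply: complex_eqP; rewrite !(ReM, ImM, ReJ, ImJ)/= !mulr0; ring. Qed.

End Exponential.

(** * Convergence of complex series and the M-test *)

Section Series.
Variable R : realType.
Local Notation C := R[i].
Local Notation Re := complex.Re.
Local Notation Im := complex.Im.
Implicit Types (u v : nat -> C) (b : nat -> R) (l : C).

Definition csum u l := forall e : R, 0 < e -> exists N, forall n, (N <= n)%N ->
  cabs (\sum_(i < n) u i - l) <= e.

(** One-sided, as suits series of nonnegative terms: T serves directly as a majorant of all partial
    sums. *)
Definition rsum b (T : R) := (forall n, \sum_(i < n) b i <= T) /\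
  forall e : R, 0 < e -> exists N, forall n, (N <= n)%N -> T - \sum_(i < n) b i <= e.

Lemma csum_toP u l : csum_to u l -> csum u l.
Proof.
move=> /cvgrPdist_le/= h e e0.
have ec : 0 < (e%:C : C) by rewrite ltcR.
have [N _ hN] := h _ ec; exists N => n nN.
have := hN n nN; rewrite /series/= cabsE lecR big_mkord cabs_distC; exact.
Qed.

Lemma csum_unique u l l' : csum u l -> csum u l' -> l = l'.
Proof.
move=> h h'; apply/eqP; rewrite -subr_eq0 -cabs_eq0; apply/eqP/le_anti.
rewrite cabs_ge0 andbT; apply/ler_addgt0Pr => e e0; rewrite add0r.
have e2 : 0 < e / 2 by rewrite divr_gt0.
have [N1 h1] := h _ e2; have [N2 h2] := h' _ e2.
have := h1 _ (leq_maxl N1 N2); have := h2 _ (leq_maxr N1 N2).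
move: (\sum_(i < _) u i) => s a1 a2.
have := cabsB (s - l') (s - l).
have -> : s - l' - (s - l) = l - l' by ring.
by move: a1 a2; clear; lra.
Qed.

Lemma csumD u v l l' : csum u l -> csum v l' -> csum (fun n => u n + v n) (l + l').
Proof.
move=> h h' e e0; have e2 : 0 < e / 2 by rewrite divr_gt0.
have [N1 h1] := h _ e2; have [N2 h2] := h' _ e2.
exists (maxn N1 N2) => n; rewrite geq_max => /andP[/h1 a1 /h2 a2].
rewrite big_split/= opprD addrACA; apply: le_trans (cabsD _ _) _.
by move: a1 a2; clear; lra.
Qed.

Lemma csumZ u l (c : C) : csum u l -> csum (fun n => c * u n) (c * l).
Proof.
move=> h e e0; have c1 : 0 < cabs c + 1 by rewrite ltr_wpDl ?cabs_ge0.
have [N hN] := h _ (divr_gt0 e0 c1); exists N => n /hN.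
rewrite -mulr_sumr -mulrBr cabsM ler_pdivlMr// mulrC; apply: le_trans.
by rewrite ler_wpM2r ?cabs_ge0// lerDl.
Qed.

Lemma csum_ext u v l : (forall n, u n = v n) -> csum u l -> csum v l.
Proof.
move=> uv h e /h[N hN]; exists N => n /hN; congr (_ <= _); congr cabs.
by congr (_ - _); apply: eq_bigr.
Qed.

Lemma csum_conj u l : csum u l -> csum (fun n => cj (u n)) (cj l).
Proof.
move=> h e /h[N hN]; exists N => n /hN.
by rewrite -raddf_sum -rmorphB/= cabs_conj.
Qed.

Lemma csum_bound u l (B : R) : csum u l -> (forall n, cabs (\sum_(i < n) u i) <= B) ->
  cabs l <= B.
Proof.
move=> h hB; apply/ler_addgt0Pr => e /h[N hN].
have := hN N (leqnn N); have := hB N; move: (\sum_(i < N) u i) => s a1 a2.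
have := cabsB s (s - l); rewrite opprB addrC subrK.
by move: a1 a2; clear; lra.
Qed.

Lemma csum0 : csum (fun=> 0) 0.
Proof.
by move=> e e0; exists 0 => n _; rewrite big1// subrr cabs0 ltW.
Qed.

Lemma csum_term u l : csum u l -> exists2 M : R, 0 < M & forall n, cabs (u n) <= M.
Proof.
move=> /(_ 1 ltr01)[N hN].
exists (2 + \sum_(i < N) cabs (u i)).
  by rewrite ltr_wpDr// sumr_ge0// => i _; rewrite cabs_ge0.
move=> n; have [nN|Nn] := ltnP n N.
  rewrite (bigD1 (Ordinal nN))//= addrCA lerDl addr_ge0// sumr_ge0// => i _.
  by rewrite cabs_ge0.
have := hN n.+1 (leqW Nn); have := hN n Nn; rewrite big_ord_recr/=.
move: (\sum_(i < n) u i) => s a1 a2.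
have := cabsB (s + u n - l) (s - l).
have -> : s + u n - l - (s - l) = u n by ring.
have : 0 <= \sum_(i < N) cabs (u i) by apply: sumr_ge0 => i _; rewrite cabs_ge0.
by move: a1 a2; clear; lra.
Qed.

Lemma csum_shift u l : csum u l -> csum (fun n => u n.+1) (l - u 0%N).
Proof.
move=> h e /h[N hN]; exists N => n nN.
have := hN n.+1 (leqW nN); rewrite big_ord_recl/=.
by congr (_ <= _); congr cabs; rewrite opprB addrCA addrA; congr (_ - _); rewrite addrC.
Qed.

Lemma rsum_ex b : (forall n, 0 <= b n) -> (exists B, forall n, \sum_(i < n) b i <= B) ->
  exists T, rsum b T.
Proof.
move=> b0 [B hB]; pose S n := \sum_(i < n) b i.
have mono m n : (m <= n)%N -> S m <= S n.
  move=> mn; rewrite -(subnKC mn); elim: (n - m)%N => [|j IH]; rewrite ?addn0//.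
  by rewrite addnS /S big_ord_recr/=; apply: le_trans IH _; rewrite lerDl.
have hs : has_sup (range S).
  by split; [exists (S 0%N); exists 0%N|exists B => _ [n _ <-]; exact: hB].
exists (sup (range S)); split.
  by move=> n; apply: ub_le_sup; [case: hs|exists n].
move=> e e0; have [_ [N _ <-] hN] := sup_adherent e0 hs.
exists N => n nN; have := mono _ _ nN; move: hN; rewrite -/(S n).
by clear; lra.
Qed.

Lemma rsum_ge0 b T : (forall n, 0 <= b n) -> rsum b T -> 0 <= T.
Proof. by move=> b0 [/(_ 0%N)]; rewrite big_ord0. Qed.

Lemma csum_ex u : (forall e : R, 0 < e -> exists N, forall m n, (N <= m)%N -> (N <= n)%N ->
    cabs (\sum_(i < m) u i - \sum_(i < n) u i) <= e) -> exists l, csum u l.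
Proof.
move=> h; pose S n := \sum_(i < n) u i.
have lim1 (f : nat -> R) : (forall n m, `|f n - f m| <= cabs (S n - S m)) ->
    exists t : R, forall e : R, 0 < e -> exists N, forall n, (N <= n)%N -> `|f n - t| <= e.
  move=> hu'.
  have /cvg_ex[t hl] : cvgn f.
    apply: R_complete; apply: cauchy_exP => e e0.
    have [N hN] := h (e / 2) (divr_gt0 e0 (ltr0Sn _ 1)).
    exists (f N); exists N => // n /= nN; rewrite /ball/=.
    apply: le_lt_trans (hu' N n) _; apply: le_lt_trans (hN _ _ (leqnn N) nN) _.
    by rewrite ltr_pdivrMr// ltr_pMr// ltr1n.
  exists t => e e0; have /cvgrPdist_le/(_ e e0)[N _ hN] := hl.
  by exists N => n nN; rewrite distrC; exact: hN.
have [n m|x hx] := lim1 (fun n => Re (S n)); first by rewrite -ReN -ReD cabs_Re.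
have [n m|y hy] := lim1 (fun n => Im (S n)); first by rewrite -ImN -ImD cabs_Im.
exists (x +i* y) => e e0; have e2 : 0 < e / 2 by rewrite divr_gt0.
have [N1 h1] := hx _ e2; have [N2 h2] := hy _ e2.
exists (maxn N1 N2) => n; rewrite geq_max => /andP[/h1 a1 /h2 a2].
apply: le_trans (cabs_le _) _; rewrite ReD ImD ReN ImN -/(S n)/=.
by move: a1 a2; clear; lra.
Qed.

Lemma mtest u b T : (forall n, cabs (u n) <= b n) -> rsum b T ->
  exists2 l, csum u l & forall n, cabs (l - \sum_(i < n) u i) <= T - \sum_(i < n) b i.
Proof.
move=> ub [hT1 hT2].
have dif m n : (m <= n)%N -> cabs (\sum_(i < n) u i - \sum_(i < m) u i) <=
    \sum_(i < n) b i - \sum_(i < m) b i.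
  move=> mn; rewrite -(subnKC mn); elim: (n - m)%N => [|j IH].
    by rewrite addn0 !subrr cabs0.
  rewrite addnS !big_ord_recr/= addrAC [leRHS]addrAC.
  by apply: le_trans (cabsD _ _) _; rewrite lerD.
have [e /hT2[N hN]|l hl] := @csum_ex u.
  exists N => m n nm nn; wlog mn : m n nm nn / (m <= n)%N.
    by move=> H; have [/H|/ltnW /H] := leqP m n; [apply|rewrite cabs_distC; apply].
  rewrite cabs_distC; apply: le_trans (dif _ _ mn) _.
  by have := hN _ nm; have := hT1 n; clear; lra.
exists l => // n; apply/ler_addgt0Pr => e /hl[N hN].
have := hN _ (leq_maxl N n); have := dif _ _ (leq_maxr N n); have := hT1 (maxn N n).
move: (\sum_(i < maxn N n) u i) (\sum_(i < n) u i) => s s' a1 a2 a3.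
have := cabsB (s - s') (s - l); have -> : s - s' - (s - l) = l - s' by ring.
by move: a1 a2 a3; clear; lra.
Qed.

Lemma mtest_bound u b T l : (forall n, cabs (u n) <= b n) -> rsum b T -> csum u l ->
  cabs l <= T.
Proof.
move=> ub hT hl; have [l' hl' /(_ 0%N)] := mtest ub hT.
by rewrite (csum_unique hl hl') !big_ord0 !subr0.
Qed.

Lemma csum_diff (u : nat -> C -> C) (F : C -> C) b T p (r : R) : 0 < r ->
  (forall n w, rect (Re p - r) (Re p + r) (Im p - r) (Im p + r) w -> cdiff (u n) w) ->
  (forall n w, rect (Re p - r) (Re p + r) (Im p - r) (Im p + r) w -> cabs (u n w) <= b n) ->
  rsum b T ->
  (forall w, rect (Re p - r) (Re p + r) (Im p - r) (Im p + r) w -> csum (u^~ w) (F w)) ->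
  cdiff F p.
Proof.
move=> r0 hu hb hT hF.
apply: (@weierstrass _ (fun n w => \sum_(i < n) u i w) F p r r0).
  by move=> n w hw; apply: cdiff_sum => i _; exact: hu.
move=> e /(hT.2)[N hN]; exists N => n /hN hn w hw.
have [l hl hl'] := mtest (fun n => hb n w hw) hT.
by rewrite (csum_unique (hF w hw) hl) cabs_distC; exact: le_trans (hl' n) hn.
Qed.

End Series.

(** * Integral two-by-two matrices and congruence classes modulo N *)

Section IntegerMatrices.
Implicit Types (M A B : 'M[int]_2) (N : nat).

Lemma ord2_1 : lift ord0 ord0 = 1 :> 'I_2.
Proof. exact: val_inj. Qed.

Lemma ord2P (i : 'I_2) : (i == 0) || (i == 1).
Proof. by case: i => [[|[|]]]. Qed.

Lemma mul22E A B i j : (A *m B) i j = A i 0 * B 0 j + A i 1 * B 1 j.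
Proof. by rewrite mxE !big_ord_recl big_ord0 addr0 ord2_1. Qed.

Lemma det22 M : \det M = M 0 0 * M 1 1 - M 0 1 * M 1 0.
Proof.
rewrite (expand_det_row _ 0) !big_ord_recl big_ord0 addr0 ord2_1 /cofactor.
rewrite /= expr0 expr1 !det_mx11 !mxE.
have e1 : lift 0 0 = 1 :> 'I_2 by exact: val_inj.
have e2 : lift 1 0 = 0 :> 'I_2 by exact: val_inj.
by rewrite ?ord2_1 ?e1 ?e2 mul1r mulN1r mulrN.
Qed.

Definition mx2 (a b c d : int) : 'M[int]_2 :=
  \matrix_(i, j) (if i == 0 then (if j == 0 then a else b) else (if j == 0 then c else d)).

Lemma mx2E a b c d : ((mx2 a b c d 0 0 = a) * (mx2 a b c d 0 1 = b)) *
  ((mx2 a b c d 1 0 = c) * (mx2 a b c d 1 1 = d)).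
Proof. by rewrite !mxE. Qed.

Lemma mx2P A B : A 0 0 = B 0 0 -> A 0 1 = B 0 1 -> A 1 0 = B 1 0 -> A 1 1 = B 1 1 -> A = B.
Proof.
move=> h1 h2 h3 h4; apply/matrixP => i j.
by case/orP: (ord2P i) => /eqP ->; case/orP: (ord2P j) => /eqP ->.
Qed.

Lemma det_mx2 a b c d : \det (mx2 a b c d) = a * d - b * c.
Proof. by rewrite det22 !mx2E. Qed.

Definition adj2 M := mx2 (M 1 1) (- M 0 1) (- M 1 0) (M 0 0).

Lemma adj2_det M : \det (adj2 M) = \det M.
Proof. by rewrite [LHS]det_mx2 [RHS]det22; ring. Qed.

Lemma adj2K M : adj2 (adj2 M) = M.
Proof. by apply: mx2P; rewrite !mx2E ?opprK. Qed.

Lemma mul_adj2 M : M *m adj2 M = mx2 (\det M) 0 0 (\det M).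
Proof. by apply: mx2P; rewrite !mul22E !mx2E ?det22; ring. Qed.

Lemma adj2_mul M : adj2 M *m M = mx2 (\det M) 0 0 (\det M).
Proof. by apply: mx2P; rewrite !mul22E !mx2E ?det22; ring. Qed.

Lemma mx2_1 : mx2 1 0 0 1 = 1%:M.
Proof. by apply: mx2P; rewrite !mxE. Qed.

Lemma SL2Z_mul A B : SL2Z A -> SL2Z B -> SL2Z (A *m B).
Proof. by rewrite /SL2Z det_mulmx => -> ->; rewrite mulr1. Qed.

Lemma SL2Z_adj A : SL2Z A -> SL2Z (adj2 A).
Proof. by rewrite /SL2Z adj2_det. Qed.

Lemma SL2Z_mulV A : SL2Z A -> A *m adj2 A = 1%:M.
Proof. by move=> h; rewrite mul_adj2 h mx2_1. Qed.

Lemma SL2Z_Vmul A : SL2Z A -> adj2 A *m A = 1%:M.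
Proof. by move=> h; rewrite adj2_mul h mx2_1. Qed.

Lemma Gamma0_mul N A B : Gamma0 N A -> Gamma0 N B -> Gamma0 N (A *m B).
Proof.
move=> [a1 a2] [b1 b2]; split; first exact: SL2Z_mul.
by rewrite mul22E; apply: rpredD; [exact: dvdz_mulr|exact: dvdz_mull].
Qed.

Lemma Gamma0_adj N A : Gamma0 N A -> Gamma0 N (adj2 A).
Proof.
by move=> [a1 a2]; split; [exact: SL2Z_adj|rewrite mx2E rpredN].
Qed.

Definition congr_mod N A B := forall i j, (A i j = B i j %[mod N%:Z])%Z.

(** Modulo N the product A adj(B) is B adj(B) = 1, so its lower left entry is divisible by N. Hence
    f|A depends only on the residues of A. *)
Lemma congr_Gamma0 N A B : congr_mod N A B -> SL2Z A -> SL2Z B ->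
  Gamma0 N (A *m adj2 B) /\ Gamma0 N (adj2 B *m A).
Proof.
move=> h hA hB.
have dv i j : exists q, A i j = B i j + q * N%:Z.
  have /eqP := h i j; rewrite eqz_mod_dvd => /dvdzP[q hq]; exists q.
  by rewrite -hq addrC subrK.
have [q0 e0] := dv 0 0; have [q2 e2] := dv 1 0; have [q3 e3] := dv 1 1.
split; split; try by apply: SL2Z_mul => //; exact: SL2Z_adj.
  rewrite mul22E !mx2E e2 e3; apply/dvdzP.
  by exists (q2 * B 1 1 - q3 * B 1 0); ring.
rewrite mul22E !mx2E e0 e2; apply/dvdzP.
by exists (q2 * B 0 0 - q0 * B 1 0); ring.
Qed.

(** The entries modulo N as an element of a finite type, so that SL2(Z) falls into finitely many
    classes. *)
Definition residue N M : ('I_N.+1 * 'I_N.+1) * ('I_N.+1 * 'I_N.+1) :=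
  let r i j := inord `|(M i j %% N%:Z)%Z|%N in ((r 0 0, r 0 1), (r 1 0, r 1 1)).

Lemma residue_congr N A B : (0 < N)%N -> residue N A = residue N B -> congr_mod N A B.
Proof.
move=> N0 [] h1 h2 h3 h4.
have key (x y : int) : inord `|(x %% N%:Z)%Z|%N = inord `|(y %% N%:Z)%Z|%N :> 'I_N.+1 ->
    (x = y %[mod N%:Z])%Z.
  have b (t : int) : (0 <= (t %% N%:Z)%Z) /\ (`|(t %% N%:Z)%Z| < N.+1)%N.
    have h0 : 0 <= (t %% N%:Z)%Z by apply: modz_ge0; rewrite eqz_nat -lt0n.
    by split=> //; rewrite ltnS ltnW// -ltz_nat gez0_abs// ltz_pmod.
  have [x0 x1] := b x; have [y0 y1] := b y.
  move=> /(congr1 val); rewrite /= !inordK// => e.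
  by rewrite -(gez0_abs x0) -(gez0_abs y0) e.
by move=> i j; case/orP: (ord2P i) => /eqP ->; case/orP: (ord2P j) => /eqP ->; apply: key.
Qed.

End IntegerMatrices.

(** * The action on the upper half-plane and reduction modulo SL2(Z) *)

Section Moebius.
Variable R : realType.
Local Notation C := R[i].
Local Notation Re := complex.Re.
Local Notation Im := complex.Im.
Implicit Types (f g : C -> C) (z w : C) (M A B : 'M[int]_2) (k N : nat).

Lemma Re_int (n : int) : Re (n%:~R : C) = n%:~R.
Proof. by rewrite -(rmorph_int (real_complex R)). Qed.

Lemma Im_int (n : int) : Im (n%:~R : C) = 0.
Proof. by rewrite -(rmorph_int (real_complex R)). Qed.

Lemma autfactor_neq0 M z : \det M != 0 -> upper z -> autfactor M z != 0.
Proof.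
rewrite /upper => dM z0; apply: contraNneq dM => h.
have := congr1 (@complex.Im R) h; rewrite /autfactor ImD ImM Re_int !Im_int mul0r !addr0/=.
move=> /eqP; rewrite mulf_eq0 (gt_eqF z0) orbF intr_eq0 => /eqP c0.
have := congr1 (@complex.Re R) h; rewrite /autfactor c0 mul0r add0r Re_int/= => /eqP.
by rewrite intr_eq0 => /eqP d0; rewrite det22 c0 d0 !mulr0 subrr.
Qed.

Lemma Im_mobius M z : \det M != 0 -> upper z ->
  Im (mobius M z) = (\det M)%:~R * Im z / cabs (autfactor M z) ^+ 2.
Proof.
move=> dM z0; have j0 := autfactor_neq0 dM z0.
have jj : autfactor M z * cj (autfactor M z) = (cabs (autfactor M z) ^+ 2)%:C.
  rewrite cabs_sq; case: (autfactor M z) => x y.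
  by apply: complex_eqP => /=; ring.
have cj0 : cj (autfactor M z) != 0 by rewrite conjc_eq0.
have -> : mobius M z = (cabs (autfactor M z) ^- 2)%:C *
   (((M 0 0)%:~R * z + (M 0 1)%:~R) * cj (autfactor M z)).
  by rewrite fmorphV/= -jj /mobius; field; rewrite j0 cj0.
rewrite ImZ mulrC; congr (_ / _); rewrite det22 rmorphB !rmorphM/=.
rewrite ImM ReJ ImJ /autfactor !(ReD, ImD, ReM, ImM) !Re_int !Im_int; ring.
Qed.

Lemma upper_mobius M z : 0 < \det M -> upper z -> upper (mobius M z).
Proof.
move=> dM z0; have dM0 : \det M != 0 by rewrite gt_eqF.
rewrite /upper Im_mobius// divr_gt0//; first by rewrite mulr_gt0// ltr0z.
by rewrite exprn_gt0// cabs_gt0 autfactor_neq0.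
Qed.

Lemma autfactor_mul A B z : \det B != 0 -> upper z ->
  autfactor (A *m B) z = autfactor A (mobius B z) * autfactor B z.
Proof.
move=> dB z0; have jB := autfactor_neq0 dB z0.
rewrite /mobius {1 3}/autfactor mulrDl !mulrA divfK// /autfactor !mul22E.
by rewrite !rmorphD !rmorphM/=; ring.
Qed.

Lemma mobius_mul A B z : \det A != 0 -> 0 < \det B -> upper z ->
  mobius (A *m B) z = mobius A (mobius B z).
Proof.
move=> dA dB z0; have dB0 : \det B != 0 by rewrite gt_eqF.
have jB := autfactor_neq0 dB0 z0.
have jA := autfactor_neq0 dA (upper_mobius dB z0).
rewrite {1}/mobius autfactor_mul//.
have -> : ((A *m B) 0 0)%:~R * z + ((A *m B) 0 1)%:~R =
    ((A 0 0)%:~R * mobius B z + (A 0 1)%:~R) * autfactor B z.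
  rewrite /mobius mulrDl !mulrA divfK// /autfactor !mul22E.
  by rewrite !rmorphD !rmorphM/=; ring.
have -> : mobius A (mobius B z) = ((A 0 0)%:~R * mobius B z + (A 0 1)%:~R) /
  autfactor A (mobius B z) by [].
by field; rewrite jA jB.
Qed.

Lemma slash_mul k A B f z : \det A != 0 -> 0 < \det B -> upper z ->
  slash k (A *m B) f z = slash k B (slash k A f) z.
Proof.
move=> dA dB z0; have dB0 : \det B != 0 by rewrite gt_eqF.
rewrite /slash autfactor_mul// mobius_mul// exprMn invfM mulrA.
by rewrite [_ ^- k * _]mulrC.
Qed.

Lemma slash1 k f z : slash k 1%:M f z = f z.
Proof.
by rewrite /slash /mobius /autfactor !mxE/= mul0r !mul1r addr0 add0r divr1 expr1n invr1 mul1r.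
Qed.

Lemma mobius1 z : mobius 1%:M z = z.
Proof. by rewrite /mobius /autfactor !mxE/= mul0r !mul1r addr0 add0r divr1. Qed.

Lemma slash_ext k M f g z : 0 < \det M -> upper z ->
  (forall w, upper w -> f w = g w) -> slash k M f z = slash k M g z.
Proof. by move=> dM z0 h; rewrite /slash h//; exact: upper_mobius. Qed.

Lemma cdiff_mobius M z : \det M != 0 -> upper z -> cdiff (mobius M) z.
Proof.
have aff (a b : C) : cdiff (fun w => a * w + b) z.
  by apply: cdiffD (cdiffM (cdiff_cst _ _) (cdiff_id _)) (cdiff_cst _ _).
by move=> dM z0; apply: cdiffM; [exact: aff|apply: cdiffV; [exact: aff|exact: autfactor_neq0]].
Qed.

Lemma cdiff_slash k M f z : 0 < \det M -> upper z -> (forall w, upper w -> cdiff f w) ->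
  cdiff (slash k M f) z.
Proof.
move=> dM z0 hf; have dM0 : \det M != 0 by rewrite gt_eqF.
have aff (a b : C) : cdiff (fun w => a * w + b) z.
  by apply: cdiffD (cdiffM (cdiff_cst _ _) (cdiff_id _)) (cdiff_cst _ _).
apply: cdiffM.
  apply: cdiffV; first by apply: cdiffX; exact: aff.
  by rewrite expf_neq0// autfactor_neq0.
apply: (cdiff_comp (cdiff_mobius dM0 z0)); apply: hf; exact: upper_mobius.
Qed.

(* The weight-k invariant |f| y^(k/2), for even k. *)
Lemma slash_norm K M f z : 0 < \det M -> upper z ->
  cabs (f (mobius M z)) * Im (mobius M z) ^+ K =
  ((\det M)%:~R) ^+ K * (cabs (slash K.*2 M f z) * Im z ^+ K).
Proof.
move=> dM z0; have dM0 : \det M != 0 by rewrite gt_eqF.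
have j0 := autfactor_neq0 dM0 z0.
rewrite Im_mobius// /slash cabsM cabsV cabsX -muln2 mulnC exprM.
rewrite !exprMn exprVn -exprM mulnC exprM.
have : cabs (autfactor M z) ^+ K != 0 by rewrite expf_neq0// cabs_eq0.
by move: (_ ^+ K) => t t0; rewrite expr2; field.
Qed.

(** Minimise |cz + d| over nonzero integral pairs. The minimising pair is coprime, so it is the
    bottom row of a matrix in SL2(Z); a translation then brings the real part into [-1/2, 1/2], and
    minimality bounds the height from below. *)
Lemma reduction z : upper z -> exists M, [/\ SL2Z M, 1 / 2 <= Im (mobius M z) &
  `|Re (mobius M z)| <= 1 / 2].
Proof.
move=> z0; pose Q (c d : int) : R := cabs (c%:~R * z + d%:~R) ^+ 2.
have QE c d : Q c d = (c%:~R * Re z + d%:~R) ^+ 2 + (c%:~R * Im z) ^+ 2.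
  by rewrite /Q cabs_sq ReD ImD ReM ImM !Re_int !Im_int !mul0r subr0 !addr0.
(* If |cz + d| <= 1 then |c| <= 1 / Im z and |d| <= 1 + |Re z| / Im z, so K bounds both entries. As
   (0, 1) gives the value 1, a minimum over this finite box is a global one. *)
pose K := (Num.truncn ((1 + `|Re z|) / Im z + 1)).+1.
have hK : (1 + `|Re z|) / Im z + 1 < K%:R by apply: truncnS_gt.
have box c d : Q c d <= 1 -> (`|c| <= K)%N /\ (`|d| <= K)%N.
  rewrite QE => h; move: (z0); rewrite /upper => y0.
  have x0 := normr_ge0 (Re z).
  have hc : `|c%:~R| * Im z <= 1.
    rewrite -{1}(ger0_norm (ltW y0)) -normrM -(@ler_pXn2r _ 2)// ?nnegrE//.
    rewrite expr1n real_normK ?num_real//.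
    by have := sqr_ge0 (c%:~R * Re z + d%:~R); move: h; clear; lra.
  have hd : `|c%:~R * Re z + d%:~R| <= 1.
    rewrite -(@ler_pXn2r _ 2)// ?nnegrE// expr1n real_normK ?num_real//.
    by have := sqr_ge0 (c%:~R * Im z); move: h; clear; lra.
  have c1 : `|c%:~R| <= (Im z)^-1 by rewrite -ler_pdivlMr// div1r in hc.
  have d1 : `|d%:~R| <= 1 + (Im z)^-1 * `|Re z|.
    have -> : d%:~R = (c%:~R * Re z + d%:~R) - c%:~R * Re z by ring.
    apply: le_trans (ler_normB _ _) _; apply: lerD => //.
    by rewrite normrM ler_wpM2r.
  have i0 : 0 < (Im z)^-1 by rewrite invr_gt0.
  have e : (1 + `|Re z|) / Im z + 1 = (Im z)^-1 + (Im z)^-1 * `|Re z| + 1 by ring.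
  have i1 : 0 <= (Im z)^-1 * `|Re z| by rewrite mulr_ge0// ltW.
  rewrite e in hK.
  have cK : `|c%:~R| < K%:R :> R by move: c1 i1 hK; clear; lra.
  have dK : `|d%:~R| < K%:R :> R by move: d1 i0 hK; clear; lra.
  move: cK dK; rewrite -!intr_norm -!abszE -!pmulrn !ltr_nat.
  by move=> /ltnW -> /ltnW ->.
pose T := ('I_(K.*2.+1) * 'I_(K.*2.+1))%type.
pose ci (t : T) : int := (t.1 : nat)%:Z - K%:Z.
pose di (t : T) : int := (t.2 : nat)%:Z - K%:Z.
have enc (c d : int) : (`|c| <= K)%N -> (`|d| <= K)%N -> exists t : T, ci t = c /\ di t = d.
  move=> hc hd.
  have e (x : int) : (`|x| <= K)%N -> exists i : 'I_(K.*2.+1), (i : nat)%:Z - K%:Z = x.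
    move=> hx; have b : (`|(x + K%:Z)%R| < K.*2.+1)%N by lia.
    exists (Ordinal b) => /=; lia.
  have [i hi] := e _ hc; have [j hj] := e _ hd; by exists (i, j).
have [t0 [c0 d0]] : exists t, ci t = 0 /\ di t = 1.
  apply: enc => //; rewrite /K//.
pose P (t : T) := (ci t != 0) || (di t != 0).
have P0 : P t0 by rewrite /P d0 orbT.
have [t Pt tmin] := @arg_minP _ R T t0 P (fun t => Q (ci t) (di t)) P0.
pose c := ci t; pose d := di t.
have Qmin c' d' : (c' != 0) || (d' != 0) -> Q c d <= Q c' d'.
  move=> nz; have [h1|h1] := leP (Q c' d') 1.
    have [hc hd] := box _ _ h1; have [t' [e1 e2]] := enc _ _ hc hd.
    by rewrite -e1 -e2; apply: tmin; rewrite /P e1 e2.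
  apply: le_trans (tmin t0 P0) _; rewrite c0 d0; apply: le_trans (ltW h1).
  by rewrite /Q mul0r add0r cabs1 expr1n.
have Q0 c' d' : (c' != 0) || (d' != 0) -> 0 < Q c' d'.
  move=> nz; rewrite exprn_gt0// cabs_gt0; apply: contraTneq nz => h.
  have := congr1 (@complex.Im R) h; rewrite ImD ImM Re_int !Im_int mul0r !addr0/=.
  move=> /eqP; rewrite mulf_eq0 (gt_eqF z0) orbF intr_eq0 => /eqP e.
  have := congr1 (@complex.Re R) h; rewrite e mul0r add0r Re_int/= => /eqP.
  by rewrite intr_eq0 => /eqP ->; rewrite eqxx.
have Qcd := Q0 c d Pt.
pose g := gcdz c d.
have g0 : g != 0 by rewrite gcdz_eq0 negb_and.
have [c' ec] : exists c', c = c' * g by apply/dvdzP; exact: dvdz_gcdl.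
have [d' ed] : exists d', d = d' * g by apply/dvdzP; exact: dvdz_gcdr.
(* Dividing the pair by its gcd g divides the value by g^2, so minimality forces g = 1. *)
have g1 : g = 1.
  have nz : (c' != 0) || (d' != 0).
    move: Pt; rewrite /P -/c -/d; apply: contraTT; rewrite negb_or !negbK.
    by move=> /andP[/eqP e1 /eqP e2]; rewrite ec ed e1 e2 !mul0r eqxx.
  have := Qmin _ _ nz; have Q' := Q0 _ _ nz.
  have -> : Q c d = (g%:~R) ^+ 2 * Q c' d'.
    by rewrite !QE ec ed !rmorphM/=; ring.
  rewrite -[leRHS]mul1r ler_pM2r// -rmorphXn/= -[1]/(1%:~R) ler_int.
  have : 0 <= g by rewrite /g.
  move: g0; clear; nia.
have [u [v uv]] : exists u v, u * d - v * c = 1.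
  have [u [v e]] := Bezoutz c d; exists v, (- u); rewrite -/g g1 in e.
  by rewrite mulNr opprK addrC.
pose M1 := mx2 u v c d.
have hM1 : SL2Z M1 by rewrite /SL2Z det_mx2.
pose z1 := mobius M1 z.
pose n := - Num.floor (Re z1 + 1 / 2).
pose M := mx2 1 n 0 1 *m M1.
have hT : SL2Z (mx2 1 n 0 1) by rewrite /SL2Z det_mx2; ring.
have hM : SL2Z M by exact: SL2Z_mul.
have dM1 : 0 < \det M1 by rewrite hM1.
have eM : mobius M z = z1 + n%:~R.
  rewrite mobius_mul ?hT//; rewrite -/z1 /mobius /autfactor !mx2E.
  by rewrite mul1r mul0r add0r divr1.
have re : `|Re (mobius M z)| <= 1 / 2.
  rewrite eM ReD Re_int rmorphN/=; have := floor_itv (Re z1 + 1 / 2).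
  move=> /andP[]; rewrite intrD/= => f1 f2.
  by rewrite ler_norml; apply/andP; split; move: f1 f2; clear; lra.
exists M; split=> //.
have up : upper (mobius M z) by apply: upper_mobius; rewrite ?hM.
(* |Mz| = |az + b| / |cz + d| >= 1 by minimality, applied to the top row; with |Re| <= 1/2 this
   forces Im >= 1/2. *)
have nm : 1 <= cabs (mobius M z) ^+ 2.
  have jM : autfactor M z = c%:~R * z + d%:~R.
    by rewrite /autfactor !mul22E !mx2E; rewrite !mul0r !add0r !mul1r.
  have tM : mobius M z * (c%:~R * z + d%:~R) = (M 0 0)%:~R * z + (M 0 1)%:~R.
    rewrite /mobius jM divfK//; rewrite -jM autfactor_neq0//; last by rewrite hM.
  have nz : (M 0 0 != 0) || (M 0 1 != 0).
    rewrite -negb_and; apply/negP => /andP[/eqP e1 /eqP e2].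
    by move: hM; rewrite /SL2Z det22 e1 e2 !mul0r subrr.
  have := Qmin _ _ nz; rewrite {2}/Q -tM cabsM exprMn -/(Q c d).
  by rewrite -[leLHS]mul1r ler_pM2r.
move: nm re up; rewrite cabs_sq /upper; move: (Re _) (Im _) => x y; clear.
by rewrite ler_norml => h /andP[]; nra.
Qed.

End Moebius.

(** * Rapid decay of periodic holomorphic functions that vanish at infinity *)

Section PeriodicDecay.
Variable R : realType.
Local Notation C := R[i].
Local Notation Re := complex.Re.
Local Notation Im := complex.Im.
Implicit Types (z w : C) (x y S Y : R).

Definition periodic_vanishing (g : C -> C) (P : R) := [/\ 0 < P,
  forall z, upper z -> cdiff g z, forall z, upper z -> g (z + P%:C) = g z &
  forall e : R, 0 < e -> exists A : R,
    forall z, upper z -> A < Im z -> cabs (g z) <= e].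

Lemma pv_rect g P a b c d : periodic_vanishing g P -> 0 < c ->
  forall z, rect a b c d z -> cdiff g z.
Proof. by move=> [_ gd _ _] c0 z /andP[_ /andP[h _]]; apply: gd; exact: lt_le_trans h. Qed.

(** By Goursat and periodicity the integral over a period does not depend on the height, and it
    tends to 0 at infinity. *)
Lemma mean_zero g P x y : periodic_vanishing g P -> 0 < y -> cint x (x + P) (fun t => g (t +i* y)) = 0.
Proof.
move=> pv y0; have [P0 gd gper gvan] := pv.
have grect := fun a b c d => @pv_rect g P a b c d pv.
have xP : x <= x + P by rewrite lerDl ltW.
have const y' : y <= y' -> cint x (x + P) (fun t => g (t +i* y)) =
    cint x (x + P) (fun t => g (t +i* y')).
  move=> yy.
  have := goursat xP yy (fun z hz => grect x (x + P) y y' y0 z hz).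
  rewrite /contour (@eq_cint _ (fun t => g ((x + P) +i* t)) (fun t => g (x +i* t))).
    move=> e; apply/eqP; rewrite -subr_eq0 -e; apply/eqP.
    by move: (cint _ _ _) (ii * _) (cint _ _ _) => a1 a2 a3; ring.
  move=> t /andP[t1 _]; rewrite -[RHS]gper; last exact: lt_le_trans t1.
  by congr g; apply: complex_eqP; rewrite ?ReD ?ImD/= ?addr0.
apply/eqP; rewrite -cabs_eq0; apply/eqP/le_anti; rewrite cabs_ge0 andbT.
apply/ler_addgt0Pr => e e0; rewrite add0r.
have [A hA] := gvan _ (divr_gt0 e0 (mulr_gt0 (ltr0Sn R 1) P0)).
pose y' := `|A| + y + 1.
have yy : y <= y' by rewrite /y'; have := normr_ge0 A; clear; lra.
have Ay : A < y' by rewrite /y'; have := ler_norm A; move: y0; clear; lra.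
have y'0 : 0 < y' := lt_le_trans y0 yy.
rewrite (const _ yy).
have hc : gcont (fun t => g (t +i* y')) x (x + P).
  apply: (@hcont _ g x (x + P) y' y'); last by rewrite lexx.
  by move=> z /(grect _ _ _ _ y'0) /cdiff_cont.
apply: le_trans (@cint_bound _ _ _ _ (e / (2 * P)) xP hc _) _.
  by move=> t _; apply: hA.
rewrite addrAC subrr add0r le_eqVlt; apply/orP; left; apply/eqP; field.
by rewrite gt_eqF.
Qed.

(** Since the mean over a period is 0, -g(a) is the mean of g - g(a). On a square of half-side 8P
    around a, [quot_bound] gives |g - g(a)| <= 2S/(8P) P = S/4, and the factor 2 of [cint_bound]
    yields S/2. *)
Lemma half_step g P S Y : periodic_vanishing g P -> 0 < Y -> (forall z, Y <= Im z -> cabs (g z) <= S) ->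
  forall z, Y + 8 * P <= Im z -> cabs (g z) <= S / 2.
Proof.
move=> pv Y0 hS a ha; have [P0 gd gper gvan] := pv.
have grect := fun a b c d => @pv_rect g P a b c d pv.
have y0 : 0 < Im a by move: P0 Y0 ha; clear; lra.
pose x := Re a; have xP : x <= x + P by rewrite lerDl ltW.
have S0 : 0 <= S.
  by apply: le_trans (cabs_ge0 (g a)) (hS _ _); move: P0 ha; clear; lra.
have r0 : 0 < 8 * P by rewrite mulr_gt0.
have c0 : 0 < Im a - 8 * P by move: Y0 ha; clear; lra.
have dif t : x <= t <= x + P -> cabs (g (t +i* Im a) + - g a) <= S / 4.
  move=> /andP[t1 t2].
  have := @quot_bound _ g [::] a (8 * P) S (t +i* Im a) r0.
  move=> /(_ (fun z hz => cdiff_cont (grect _ _ _ _ c0 _ hz)) (fun z hz _ => grect _ _ _ _ c0 _ hz) isT isT).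
  have h1 : forall w, rect (Re a - 8 * P) (Re a + 8 * P) (Im a - 8 * P) (Im a + 8 * P) w ->
      cabs (g w) <= S.
    by move=> w /andP[_ /andP[w1 _]]; apply: hS; move: ha w1; clear; lra.
  have h2 : Re a - 8 * P < t < Re a + 8 * P by move: P0 t1 t2; rewrite /x; clear; lra.
  have h3 : Im a - 8 * P < Im a < Im a + 8 * P by move: P0; clear; lra.
  move=> /(_ h1 h2 h3) h; apply: le_trans h _.
  have -> : cabs (t +i* Im a - a) = t - x.
    rewrite cabs_sqrt !(ReD, ImD, ReN, ImN)/= subrr expr0n addr0 sqrtr_sqr ger0_norm//.
    by rewrite subr_ge0.
  have -> : 2 * S / (8 * P) * (t - x) = S / 4 * ((t - x) / P) by field; rewrite gt_eqF.
  rewrite -[leRHS]mulr1 ler_wpM2l ?divr_ge0// ler_pdivrMr// mul1r.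
  by move: t2; clear; lra.
have hc : gcont (fun t => g (t +i* Im a)) x (x + P).
  apply: (@hcont _ g x (x + P) (Im a) (Im a)); last by rewrite lexx.
  by move=> z /(grect _ _ _ _ y0) /cdiff_cont.
have cc : gcont (fun=> - g a) x (x + P).
  by move=> t _ e e0; exists 1 => // s _; rewrite subrr cabs0 ltW.
have h1 : cint x (x + P) (fun t => g (t +i* Im a) + - g a) = - g a * P%:C.
  by rewrite cintD// (mean_zero _ pv)// add0r cint_cst// addrAC subrr add0r.
have hcc : gcont (fun t => g (t +i* Im a) + - g a) x (x + P).
  by move=> t ht e e0; have [d d0 hd] := hc t ht e e0; exists d => // s /hd;
    rewrite opprD addrACA subrr addr0.
have := cint_bound xP hcc dif; rewrite h1 cabsM cabsN cabs_real (gtr0_norm P0).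
have -> : 2 * (S / 4) * (x + P - x) = S / 2 * P by field.
by rewrite ler_pM2r.
Qed.

Lemma pow_le_exp (K : nat) (q : R) : 1 < q -> exists C0 : R, forall n : nat,
  n%:R ^+ K <= C0 * q ^+ n.
Proof.
elim: K q => [|K IH] q q1.
  by exists 1 => n; rewrite expr0 mul1r exprn_ege1// ltW.
have q0 : 0 < q := lt_trans ltr01 q1.
pose p := Num.sqrt q; have p1 : 1 < p by rewrite -sqrtr1 ltr_sqrt.
have pp : p ^+ 2 = q by rewrite sqr_sqrtr// ltW.
have p0 : 0 < p := lt_trans ltr01 p1.
have [c hc] := IH p p1; have d0 : 0 < p - 1 by rewrite subr_gt0.
have lin n : n%:R <= (p - 1)^-1 * p ^+ n.
  rewrite mulrC ler_pdivlMr//; elim: n => [|n IHn]; first by rewrite mul0r expr0.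
  rewrite exprS mulrSr mulrDl mul1r.
  have : 1 <= p ^+ n by rewrite exprn_ege1// ltW.
  by move: IHn d0; move: (p ^+ n) (n%:R) => u v; clear; nra.
exists ((p - 1)^-1 * c) => n.
rewrite exprS -pp -exprM mulnC exprM expr2 mulrACA.
by apply: ler_pM; rewrite ?exprn_ge0.
Qed.

(** High up, [half_step] halves the bound with every step of 8P, and this beats any power of the
    height. The remaining band is covered by one compact rectangle and its translates. *)
Lemma periodic_bound g P (K : nat) (c : R) : periodic_vanishing g P -> 0 < c -> exists2 C0 : R, 0 < C0 &
  forall z, c <= Im z -> cabs (g z) * Im z ^+ K <= C0.
Proof.
move=> pv c0; have [P0 gd gper gvan] := pv.
have grect := fun a b c d => @pv_rect g P a b c d pv.
have [A hA] := gvan _ (@ltr01 R).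
pose Y := `|A| + 1 + c.
have Y0 : 0 < Y by rewrite /Y; have := normr_ge0 A; move: c0; clear; lra.
have hY z : Y <= Im z -> cabs (g z) <= 1.
  move=> h; apply: hA; first exact: lt_le_trans h.
  by have := ler_norm A; move: h c0; rewrite /Y; clear; lra.
pose r := 8 * P; have r0 : 0 < r by rewrite mulr_gt0.
have dec j z : Y + j%:R * r <= Im z -> cabs (g z) <= 2 ^- j.
  elim: j z => [|j IH] z; first by rewrite mul0r addr0 expr0 invr1; exact: hY.
  rewrite mulrSr mulrDl mul1r addrA => h.
  have -> : 2 ^- j.+1 = 2 ^- j / 2 :> R by rewrite exprS invfM mulrC.
  apply: (half_step pv _ IH h).
  by rewrite ltr_pwDl// mulr_ge0// ltW.
have [C1 hC1] := @pow_le_exp K 2 (ltr1n R 2).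
have C10 : 0 <= C1.
  by have := hC1 1%N; rewrite expr1n expr1; clear; lra.
pose B := Y + r.
have B0 : 0 < B by rewrite addr_gt0.
have far z : Y <= Im z -> cabs (g z) * Im z ^+ K <= 2 * B ^+ K * C1.
  move=> hz; pose j := Num.truncn ((Im z - Y) / r).
  have q0 : 0 <= (Im z - Y) / r by rewrite divr_ge0 ?subr_ge0// ltW.
  have /andP[j1 j2] := truncn_itv q0; rewrite -/j in j1 j2.
  rewrite ler_pdivlMr// in j1; rewrite ltr_pdivrMr// in j2.
  have gj := dec j z; rewrite addrC -lerBrDr in gj; have {}gj := gj j1.
  have yj : Im z <= B * j.+1%:R.
    have : Y <= Y * j.+1%:R by rewrite -[leLHS]mulr1 ler_pM2l// ler1n.
    have -> : B * j.+1%:R = Y * j.+1%:R + j.+1%:R * r by rewrite /B; ring.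
    by move: j2; clear; lra.
  have z0 : 0 <= Im z by apply: le_trans (ltW Y0) hz.
  apply: (@le_trans _ _ (2 ^- j * (B * j.+1%:R) ^+ K)).
    apply: ler_pM; rewrite ?cabs_ge0 ?exprn_ge0//.
    by rewrite lerXn2r// nnegrE// mulr_ge0// ltW.
  rewrite mulrC ler_pdivrMr ?exprn_gt0// exprMn.
  have := hC1 j.+1; rewrite exprS => h.
  have -> : 2 * B ^+ K * C1 * 2 ^+ j = B ^+ K * (C1 * (2 * 2 ^+ j)) by ring.
  by rewrite ler_wpM2l// exprn_ge0// ltW.
have cY : c <= Y by rewrite /Y; have := normr_ge0 A; clear; lra.
have [|||M M0 hM] := @rect_bounded _ g 0 P c Y => //; first exact: ltW.
  by move=> z /(grect _ _ _ _ c0) /cdiff_cont.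
have gperZ (n : int) z : upper z -> g (z + (n%:~R * P)%:C) = g z.
  have key (m : nat) w : upper w -> g (w + (m%:R * P)%:C) = g w.
    move=> w0; elim: m => [|m IH]; first by rewrite mul0r addr0.
    rewrite mulrSr mulrDl mul1r rmorphD/= addrA gper//.
    by rewrite /upper ImD/= addr0.
  move=> z0; case: n => m; first by rewrite -pmulrn key.
  rewrite NegzE rmorphN/= -pmulrn -(key m.+1 (z + _)); last by rewrite /upper ImD/= addr0.
  by rewrite -addrA -rmorphD/= mulNr addNr addr0.
exists (M * Y ^+ K + 2 * B ^+ K * C1 + 1).
  have : 0 <= M * Y ^+ K by rewrite mulr_ge0 ?exprn_ge0// ltW.
  have : 0 <= 2 * B ^+ K * C1 by rewrite mulr_ge0// mulr_ge0// exprn_ge0// ltW.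
  by clear; lra.
move=> z cz; have MY : 0 <= M * Y ^+ K by rewrite mulr_ge0 ?exprn_ge0// ltW.
have BC : 0 <= 2 * B ^+ K * C1 by rewrite mulr_ge0// mulr_ge0// exprn_ge0// ltW.
have [hz|hz] := leP Y (Im z); first by have := far z hz; move: MY; clear; lra.
have z0 : 0 < Im z := lt_le_trans c0 cz.
pose n := - Num.floor (Re z / P).
suff : cabs (g z) * Im z ^+ K <= M * Y ^+ K by move: BC; clear; lra.
rewrite -(gperZ n z z0); apply: ler_pM; rewrite ?cabs_ge0 ?exprn_ge0 ?(ltW z0)//; last first.
  by rewrite lerXn2r// ?nnegrE ltW.
apply: hM; rewrite /rect ReD ImD/= addr0 cz (ltW hz) andbT /n rmorphN/= mulNr.
have /andP[f1 f2] := floor_itv (Re z / P).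
rewrite ler_pdivlMr// in f1; rewrite ltr_pdivrMr// intrD mulrDl mul1r in f2.
by move: f1 f2; clear; lra.
Qed.

End PeriodicDecay.

(** * Boundedness of |f| y^(k/2) for cusp forms *)

Section CuspForms.
Variable R : realType.
Local Notation C := R[i].
Local Notation Re := complex.Re.
Local Notation Im := complex.Im.
Implicit Types (f : C -> C) (z w : C) (M A B : 'M[int]_2) (k N K : nat).

Lemma cusp_form_diff k N f z : cusp_form k N f -> upper z -> cdiff f z.
Proof. by move=> [h _ _] /h /cdifferentiableP. Qed.

Lemma cusp_slash_congr k N f A B z : cusp_form k N f -> congr_mod N A B ->
  SL2Z A -> SL2Z B -> upper z -> slash k A f z = slash k B f z.
Proof.
move=> hf AB hA hB z0; have [G _] := congr_Gamma0 AB hA hB.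
have e : A = (A *m adj2 B) *m B by rewrite -mulmxA SL2Z_Vmul// mulmx1.
have dB : 0 < \det B by rewrite hB.
have dG : \det (A *m adj2 B) != 0 by rewrite G.1.
rewrite e slash_mul//; apply: slash_ext => // w w0.
by have [_ h _] := hf; exact: h.
Qed.

(** f|M has period N, because translating by N on the right does not change M modulo N; the cusp
    condition makes it vanish at i oo. *)
Lemma cusp_slash_bound k N f M K (c : R) : (0 < N)%N -> cusp_form k N f -> SL2Z M ->
  0 < c -> exists2 C0 : R, 0 < C0 &
  forall z, c <= Im z -> cabs (slash k M f z) * Im z ^+ K <= C0.
Proof.
move=> N0 hf hM c0.
have dM : 0 < \det M by rewrite hM.
apply: (@periodic_bound _ (slash k M f) N%:R) => //; split.
- by rewrite ltr0n.
- by move=> z z0; apply: cdiff_slash => // w; exact: cusp_form_diff hf.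
- move=> z z0; pose T := mx2 1 N%:Z 0 1.
  have hT : SL2Z T by rewrite /SL2Z det_mx2; ring.
  have dT : 0 < \det T by rewrite hT.
  have dM0 : \det M != 0 by rewrite gt_eqF.
  have -> : slash k M f (z + N%:R%:C) = slash k T (slash k M f) z.
    rewrite [RHS]/slash /mobius /autfactor !mx2E mul0r add0r divr1 expr1n invr1 !mul1r.
    by rewrite -pmulrn rmorph_nat.
  rewrite -slash_mul//; apply: (cusp_slash_congr hf) => //; last exact: SL2Z_mul.
  move=> i j; rewrite mul22E; case/orP: (ord2P j) => /eqP ->; rewrite !mx2E.
    by rewrite mulr1 mulr0 addr0.
  by apply/eqP; rewrite eqz_mod_dvd mulr1 addrK dvdz_mull.
- move=> e e0; have [_ _ /(_ M hM e e0)[A hA]] := hf; exists A => z z0 Az.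
  by have := hA z z0 Az; rewrite cabsE ltcR => /ltW.
Qed.

Lemma SL2Z_upper_exists z : upper z -> exists M w, [/\ SL2Z M, upper w,
  1 / 2 <= Im w, `|Re w| <= 1 / 2 & z = mobius M w].
Proof.
move=> z0; have [M [hM h1 h2]] := reduction z0.
have hA := SL2Z_adj hM.
have dM : 0 < \det M by rewrite hM.
exists (adj2 M), (mobius M z); split=> //; first exact: upper_mobius.
by rewrite -mobius_mul ?hA// SL2Z_Vmul// mobius1.
Qed.

(* Only finitely many slash transforms f|M occur, one for each residue class mod N. *)
Lemma cusp_bound N f K : (0 < N)%N -> cusp_form K.*2 N f -> exists2 C0 : R, 0 < C0 &
  forall z, upper z -> cabs (f z) * Im z ^+ K <= C0.
Proof.
move=> N0 hf; pose T := (('I_N.+1 * 'I_N.+1) * ('I_N.+1 * 'I_N.+1))%type.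
have /choice[B hB] : forall t : T, exists C0 : R, 0 < C0 /\ forall M, SL2Z M ->
    residue N M = t -> forall z, 1 / 2 <= Im z ->
    cabs (slash K.*2 M f z) * Im z ^+ K <= C0.
  move=> t; have [[M [hM rM]]|no] := pselect (exists M, SL2Z M /\ residue N M = t).
    have [|C0 C00 hC] := @cusp_slash_bound K.*2 N f M K (1 / 2) N0 hf hM.
      by rewrite divr_gt0.
    exists C0; split=> // M' hM' rM' z hz.
    have z0 : upper z by apply: lt_le_trans hz; rewrite divr_gt0.
    rewrite (@cusp_slash_congr K.*2 N f M' M)//; first exact: hC.
    by apply: residue_congr => //; rewrite rM rM'.
  by exists 1; split=> // M hM rM; case: no; exists M.
exists (\sum_t B t).
  rewrite (bigD1 (residue N 1%:M))//= ltr_pwDl ?(hB _).1// sumr_ge0// => t _.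
  by rewrite ltW ?(hB _).1.
move=> z z0; have [M [w [hM w0 w1 _ ->]]] := SL2Z_upper_exists z0.
have dM : 0 < \det M by rewrite hM.
rewrite slash_norm// hM expr1n mul1r.
apply: le_trans ((hB (residue N M)).2 M hM erefl w w1) _.
rewrite (bigD1 (residue N M))//= lerDl sumr_ge0// => t _.
by rewrite ltW ?(hB _).1.
Qed.

End CuspForms.

(** * Roots of unity and the discrete Parseval identity *)

Section DiscreteFourier.
Variable R : realType.
Local Notation C := R[i].
Local Notation Re := complex.Re.
Local Notation Im := complex.Im.
Implicit Types (z w : C) (p : {poly C}).

Definition rootu (M : nat) : C := cexp ((2 * pi / M%:R)%:C * ii).

Lemma Re_im (x : R) : Re (x%:C * ii) = 0.
Proof. by rewrite ReZ/= mulr0. Qed.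

Lemma Im_im (x : R) : Im (x%:C * ii) = x.
Proof. by rewrite ImZ/= mulr1. Qed.

Lemma cexp_im (x : R) : cexp (x%:C * ii) = cos x +i* sin x.
Proof. by rewrite /cexp Re_im Im_im expR0 mul1r. Qed.

Lemma cexp_2pi : cexp ((2 * pi)%:C * ii) = 1 :> C.
Proof. by rewrite cexp_im mulrC mulr_natr cos2pi sin2pi. Qed.

Lemma rootu_pow M : (0 < M)%N -> rootu M ^+ M = 1.
Proof.
move=> M0; rewrite -cexpMn -[RHS]cexp_2pi; congr cexp.
rewrite mulrAC -(rmorph_nat (real_complex R)) -rmorphM/=; congr (_%:C * _).
by field; rewrite pnatr_eq0 -lt0n.
Qed.

Lemma rootu_neq1 M m : (0 < m < M)%N -> rootu M ^+ m != 1.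
Proof.
move=> /andP[m0 mM]; have M0 : (0 < M)%N by apply: leq_trans mM.
have MR : (0 : R) < M%:R by rewrite ltr0n.
rewrite -cexpMn mulrAC -(rmorph_nat (real_complex R)) -rmorphM/=.
pose t : R := pi * (m%:R / M%:R); have -> : 2 * pi / M%:R * m%:R = t + t.
  by rewrite /t; field; rewrite gt_eqF.
have t0 : 0 < t by rewrite mulr_gt0 ?pi_gt0// divr_gt0// ltr0n.
have tpi : t < pi by rewrite gtr_pMr ?pi_gt0// ltr_pdivrMr// mul1r ltr_nat.
apply/negP => /eqP /(congr1 (@complex.Re R)).
rewrite cexp_im/= cosD => h.
have s0 : 0 < sin t by apply: sin_gt0_pi; rewrite t0.
by have := cos2Dsin2 t; move: h s0; move: (cos t) (sin t) => c s; clear; nra.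
Qed.

Lemma sum_root_pow M (z : C) : z ^+ M = 1 -> z != 1 -> \sum_(j < M) z ^+ j = 0.
Proof.
move=> zM z1; have z10 : z - 1 != 0 by rewrite subr_eq0.
by apply: (mulfI z10); rewrite mulr0 -subrX1 zM subrr.
Qed.

Lemma cabs_rootu M : cabs (rootu M) = 1.
Proof. by rewrite cabs_cexp Re_im expR0. Qed.

Lemma cabs2E z : (cabs z ^+ 2)%:C = z * cj z.
Proof. by rewrite cabs_sq; case: z => x y; apply: complex_eqP => /=; ring. Qed.

Lemma root_orth M (l m : 'I_M) :
  \sum_(j < M) (rootu M ^+ j) ^+ l * cj ((rootu M ^+ j) ^+ m) = (if l == m then M%:R else 0).
Proof.
have M0 : (0 < M)%N by case: l => l; apply: leq_trans.
have pw (n j : nat) : (rootu M ^+ j) ^+ n = (rootu M ^+ n) ^+ j by rewrite -!exprM mulnC.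
have gen : forall l m : 'I_M, (m <= l)%N ->
    \sum_(j < M) (rootu M ^+ j) ^+ l * cj ((rootu M ^+ j) ^+ m) = (if l == m then M%:R else 0).
  move=> {}l {}m ml.
  have e (j : nat) : (rootu M ^+ j) ^+ l * cj ((rootu M ^+ j) ^+ m) = (rootu M ^+ (l - m)) ^+ j.
    have -> : (rootu M ^+ j) ^+ l = (rootu M ^+ (l - m)) ^+ j * (rootu M ^+ j) ^+ m.
      by rewrite -[in RHS]pw -exprD subnK.
    by rewrite -mulrA -cabs2E !cabsX cabs_rootu !expr1n mulr1.
  under eq_bigr do rewrite e.
  have [->|lm] := eqVneq l m.
    under eq_bigr do rewrite subnn expr0 expr1n.
    by rewrite sumr_const card_ord.
  apply: sum_root_pow; first by rewrite -exprM mulnC exprM rootu_pow// expr1n.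
  apply: rootu_neq1; rewrite subn_gt0 ltn_neqAle ml andbT eq_sym.
  by rewrite (inj_eq val_inj) lm/= (leq_ltn_trans (leq_subr _ _)).
have [ml|/ltnW lm] := leqP m l; first exact: gen.
have := congr1 (@conjc R) (gen m l lm); rewrite rmorph_sum/= eq_sym.
rewrite (_ : cj (if l == m then _ else _) = if l == m then M%:R else 0); last first.
  by case: ifP => _; rewrite ?conjc_nat ?conjc0.
move=> <-; apply: eq_bigr => j _; rewrite rmorphM/= conjcK mulrC//.
Qed.

(** Orthogonality of the characters of Z/M. It is exact as soon as M is at least the size of p. *)
Lemma parseval M p (r : R) : (size p <= M)%N ->
  \sum_(j < M) cabs p.[r%:C * rootu M ^+ j] ^+ 2 =
  M%:R * \sum_(l < M) cabs p`_l ^+ 2 * (r ^+ 2) ^+ l.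
Proof.
move=> sp; apply: (@complexI R); rewrite raddf_sum/=.
transitivity (\sum_(j < M) \sum_(l < M) \sum_(m < M)
   (p`_l * r%:C ^+ l) * cj (p`_m * r%:C ^+ m) *
   ((rootu M ^+ j) ^+ l * cj ((rootu M ^+ j) ^+ m))).
  apply: eq_bigr => j _; rewrite cabs2E (horner_coef_wide _ sp) rmorph_sum big_distrl/=.
  apply: eq_bigr => l _; rewrite big_distrr/=; apply: eq_bigr => m _.
  move: (rootu M ^+ j) => W.
  by rewrite !exprMn ![_`__ * (_ * _)]mulrA [cj (_ * _ * _)]rmorphM/= mulrACA.
rewrite exchange_big/=.
rewrite rmorphM/= rmorph_nat raddf_sum mulr_sumr; apply: eq_bigr => l _.
rewrite exchange_big/= (bigD1 l)//= [X in _ + X]big1 ?addr0; last first.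
  move=> m ml; rewrite -mulr_sumr root_orth eq_sym (negbTE ml) mulr0//.
rewrite -mulr_sumr root_orth eqxx -cabs2E mulrC; congr (_ * _).
by rewrite cabsM exprMn cabsX cabs_real -[(`|r| ^+ l) ^+ 2]exprM mulnC exprM real_normK ?num_real.
Qed.

End DiscreteFourier.

(** * Fourier expansions and mean squares of coefficients *)

Section PowerSeries.
Variable R : realType.
Local Notation C := R[i].
Local Notation Re := complex.Re.
Local Notation Im := complex.Im.
Implicit Types (z w : C) (a : nat -> C) (f : C -> C).

Definition qpar z : C := cexp ((2 * pi)%:C * ii * z).

Lemma cabs_qpar z : cabs (qpar z) = expR (- (2 * pi * Im z)).
Proof.
rewrite cabs_cexp; congr expR; rewrite -mulrA ReZ ReM/= mul0r sub0r mul1r mulrN//.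
Qed.

Lemma qparD z w : qpar (z + w) = qpar z * qpar w.
Proof. by rewrite /qpar mulrDr cexpD. Qed.

Lemma qparMn z n : qpar (z * n%:R) = qpar z ^+ n.
Proof. by rewrite /qpar mulrA cexpMn. Qed.

Lemma fourierP f a : fourier_expansion f a ->
  forall z, upper z -> csum (fun n => a n * qpar z ^+ n) (f z).
Proof.
move=> h z z0; apply: csum_ext (csum_toP (h z z0)) => n; congr (_ * _).
rewrite -qparMn /qpar; congr cexp.
rewrite -complexiE rmorphM/= rmorph_nat; ring.
Qed.

Lemma geom_le (r : R) n : 0 <= r -> r < 1 -> \sum_(i < n) r ^+ i <= (1 - r)^-1.
Proof.
move=> r0 r1; have d : 0 < 1 - r by rewrite subr_gt0.
rewrite -(ler_pM2l d) mulfV ?gt_eqF//.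
have -> : (1 - r) * (\sum_(i < n) r ^+ i) = 1 - r ^+ n.
  by rewrite -opprB mulNr -subrX1 opprB.
by rewrite lerBlDr lerDl exprn_ge0.
Qed.

Lemma upper_qpar (r : R) : 0 < r -> r < 1 -> exists2 y : R, 0 < y &
  forall x, cabs (qpar (x +i* y)) = r.
Proof.
move=> r0 r1; have pp : (0 : R) < 2 * pi by rewrite mulr_gt0// pi_gt0.
exists (- ln r / (2 * pi)); first by rewrite divr_gt0// oppr_gt0 ln_lt0// r0.
move=> x; rewrite cabs_qpar/= -[in RHS](@lnK _ r) ?posrE//; congr expR.
by move: pp; move: (2 * pi) => t t0; field; rewrite gt_eqF.
Qed.

(** The terms are bounded at the larger radius s = (1 + r)/2, which leaves a geometric series of
    ratio r/s. *)
Lemma coef_summable f a (r : R) : fourier_expansion f a -> 0 <= r -> r < 1 ->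
  exists T, rsum (fun n => cabs (a n) * r ^+ n) T.
Proof.
move=> hf r0 r1; pose s := (1 + r) / 2.
have s0 : 0 < s by rewrite /s; move: r0; clear; lra.
have s1 : s < 1 by rewrite /s; move: r1; clear; lra.
have rs : r < s by rewrite /s; move: r1; clear; lra.
have [y y0 hy] := upper_qpar s0 s1.
have uy : upper (0 +i* y) by [].
have [M M0 hM] := csum_term (fourierP hf uy).
apply: rsum_ex; first by move=> n; rewrite mulr_ge0 ?cabs_ge0 ?exprn_ge0.
have q0 : 0 <= r / s by rewrite divr_ge0// ltW.
have q1 : r / s < 1 by rewrite ltr_pdivrMr// mul1r.
exists (M * (1 - r / s)^-1) => n.
apply: (@le_trans _ _ (\sum_(i < n) M * (r / s) ^+ i)); last first.
  by rewrite -mulr_sumr ler_wpM2l ?(ltW M0)// geom_le.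
apply: ler_sum => i _; rewrite expr_div_n mulrA ler_pdivlMr ?exprn_gt0//.
have := hM i; rewrite cabsM cabsX hy => h.
by rewrite mulrAC; apply: ler_wpM2r h; rewrite exprn_ge0.
Qed.

Lemma qpar_root (y : R) M j : (0 < M)%N ->
  qpar ((j%:R / M%:R) +i* y) = (expR (- (2 * pi * y)))%:C * rootu R M ^+ j.
Proof.
move=> M0; have -> : (j%:R / M%:R) +i* y = (0 +i* y) + (M%:R^-1)%:C * j%:R :> C.
  apply: complex_eqP; rewrite ?ReD ?ImD ?ReM ?ImM Re_nat Im_nat/= ?mul0r ?mulr0.
    by rewrite subr0 add0r mulrC.
  by rewrite !addr0.
rewrite qparD qparMn; congr (_ * _ ^+ _); last first.
  by rewrite /qpar /rootu mulrAC -rmorphM.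
rewrite /qpar -cexp_real; congr cexp.
by apply: complex_eqP; rewrite -mulrA ?ReZ ?ImZ ?ReM ?ImM/=; ring.
Qed.

(* Mean square over equally spaced points of a horizontal line; the polynomial *)
(* factor 1 + q + ... + q^(X-1) turns coefficients into their partial sums.    *)
Lemma partial_sums_square f a (y S : R) (X : nat) : fourier_expansion f a -> 0 < y -> 0 <= S ->
  (0 < X)%N -> (forall x : R, cabs (f (x +i* y)) <= S) ->
  \sum_(i < X) cabs (\sum_(n < i.+1) a n) ^+ 2 * (expR (- (2 * pi * y)) ^+ 2) ^+ i
    <= S ^+ 2 * X%:R /\
  \sum_(i < X) cabs (a i) ^+ 2 * (expR (- (2 * pi * y)) ^+ 2) ^+ i <= S ^+ 2.
Proof.
move=> hf y0 S0 X0 hS; set r := expR _.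
have r0 : 0 < r by apply: expR_gt0.
have r1 : r < 1.
  by rewrite -expR0 ltr_expR oppr_lt0 mulr_gt0// mulr_gt0// pi_gt0.
have [T hT] := coef_summable hf (ltW r0) r1.
(* Parseval for the truncated series multiplied by Q; [c] lists the coefficients of the product
   below X. The two claims are Q = 1 + q + ... + q^(X-1) and Q = 1. *)
have main (Q : {poly C}) (B : R) : (size Q <= X)%N ->
    (forall M, (X <= M)%N -> \sum_(l < M) cabs Q`_l ^+ 2 * (r ^+ 2) ^+ l <= B) -> 0 <= B ->
    forall (c : nat -> C), (forall M i, (X <= M)%N -> (i < X)%N ->
       ((\poly_(l < M) a l) * Q)`_i = c i) ->
    \sum_(i < X) cabs (c i) ^+ 2 * (r ^+ 2) ^+ i <= S ^+ 2 * B.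
  move=> sQ hB B0 c hc.
  suff H e : 0 < e -> \sum_(i < X) cabs (c i) ^+ 2 * (r ^+ 2) ^+ i <= (S + e) ^+ 2 * B.
    apply/ler_addgt0Pr => d d0.
    have K0 : 0 < (2 * S + 1) * B + 1 by rewrite ltr_wpDl// mulr_ge0// addr_ge0// mulr_ge0.
    pose e := Num.min 1 (d / ((2 * S + 1) * B + 1)).
    have e0 : 0 < e by rewrite lt_min ltr01 divr_gt0.
    have e1 : e <= 1 by rewrite ge_min lexx.
    have e2 : e * ((2 * S + 1) * B + 1) <= d by rewrite -ler_pdivlMr// ge_min lexx orbT.
    apply: le_trans (H e e0) _; rewrite sqrrD -addrA mulrDl lerD2l.
    apply: le_trans e2.
    have -> : (S * e *+ 2 + e ^+ 2) * B = e * ((2 * S + e) * B) by rewrite mulr2n; ring.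
    rewrite ler_pM2l//; apply: (@le_trans _ _ ((2 * S + 1) * B)); last by rewrite lerDl.
    by rewrite ler_wpM2r// lerD2l.
  move=> e0; have [N hN] := hT.2 e e0.
  have Se : 0 <= S + e by rewrite addr_ge0// ltW.
  (* M makes the tail at radius r smaller than e, and M' bounds the size of the product, so that
     Parseval is exact. *)
  pose M := maxn N X; pose p := \poly_(l < M) a l; pose M' := (M + X)%N.
  have MX : (X <= M)%N by rewrite leq_maxr.
  have M'0 : (0 < M')%N by rewrite addn_gt0 X0 orbT.
  have XM' : (X <= M')%N by rewrite leq_addl.
  have sPQ : (size (p * Q)%R <= M')%N.
    apply: leq_trans (size_polyMleq _ _) _; apply: leq_trans (leq_pred _) _.
    by apply: leq_add sQ; exact: size_poly.
  have sQ' : (size Q <= M')%N := leq_trans sQ XM'.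
  have M'R : (0 : R) < M'%:R by rewrite ltr0n.
  apply: (@le_trans _ _ (\sum_(i < M') cabs (p * Q)`_i ^+ 2 * (r ^+ 2) ^+ i)).
    have E (n : nat) (g : nat -> R) : \sum_(i < n) g i = \sum_(0 <= i < n) g i.
      by rewrite big_mkord.
    rewrite (E X (fun i => cabs (c i) ^+ 2 * (r ^+ 2) ^+ i)).
    rewrite (E M' (fun i => cabs (p * Q)`_i ^+ 2 * (r ^+ 2) ^+ i)).
    rewrite (big_cat_nat (n := X) (p := M'))//=.
    rewrite -[leLHS]addr0 lerD//; last first.
      by apply: sumr_ge0 => i _; rewrite mulr_ge0// exprn_ge0// ?cabs_ge0// exprn_ge0// ltW.
    rewrite !big_mkord; apply: ler_sum => i _; rewrite hc//.
  rewrite -(ler_pM2l M'R) -(parseval r sPQ).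
  apply: (@le_trans _ _ ((S + e) ^+ 2 * \sum_(j < M') cabs Q.[r%:C * rootu R M' ^+ j] ^+ 2)).
    rewrite mulr_sumr; apply: ler_sum => j _; rewrite hornerM cabsM exprMn.
    rewrite ler_wpM2r ?exprn_ge0 ?cabs_ge0// lerXn2r ?nnegrE ?cabs_ge0//.
    set z := (j%:R / M'%:R : R) +i* y.
    have z0 : upper z by [].
    have hu n : cabs (a n * qpar z ^+ n) <= cabs (a n) * r ^+ n.
      by rewrite cabsM cabsX cabs_qpar.
    have [l hl /(_ M) hlM] := mtest hu hT.
    have -> : p.[r%:C * rootu R M' ^+ j] = \sum_(i < M) a i * qpar z ^+ i.
      by rewrite horner_poly; apply: eq_bigr => i _; rewrite qpar_root.
    have lS : cabs l <= S by rewrite (csum_unique hl (fourierP hf z0)); exact: hS.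
    have := hN M (leq_maxl _ _); move: hlM lS.
    set u := (\sum_(i < M) a i * _).
    have := cabsB l (l - u); have -> : l - (l - u) = u by ring.
    by clear; lra.
  by rewrite parseval// mulrCA ler_pM2l// ler_wpM2l ?exprn_ge0// hB.
split.
  pose Q : {poly C} := \poly_(l < X) 1.
  apply: (main Q X%:R _ _ _ (fun i => \sum_(n < i.+1) a n)) => //; first exact: size_poly.
    move=> M XM; rewrite -(big_mkord xpredT (fun l => cabs Q`_l ^+ 2 * (r ^+ 2) ^+ l)).
    rewrite (big_cat_nat (n := X) (p := M))//= [W in _ + W]big_nat [W in _ + W]big1 ?addr0; last first.
      move=> l /andP[Xl _]; rewrite coef_poly ltnNge Xl/= cabs0 expr0n mul0r//.
    rewrite big_mkord; apply: (@le_trans _ _ (\sum_(l < X) 1)); last first.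
      by rewrite sumr_const card_ord.
    apply: ler_sum => l _; rewrite coef_poly ltn_ord cabs1 expr1n mul1r.
    by rewrite exprn_ile1 ?exprn_ge0 ?exprn_ile1// ltW.
  move=> M i XM iX; rewrite coefM; apply: eq_bigr => j _; rewrite !coef_poly.
  have ji : (j <= i)%N by rewrite -ltnS.
  rewrite (leq_ltn_trans ji (leq_trans iX XM)).
  by rewrite (leq_ltn_trans (leq_subr _ _) iX) mulr1.
rewrite -[leRHS]mulr1; apply: (main 1 1 _ _ _ a) => //.
- by rewrite size_poly1.
- case=> [|M] _; first by rewrite big_ord0.
  rewrite big_ord_recl/= coef1 cabs1 expr1n expr0 mulr1 big1 ?addr0// => l _.
  by rewrite coef1 cabs0 expr0n mul0r.
- by move=> M i XM iX; rewrite mulr1 coef_poly (leq_trans iX XM).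
Qed.

(** The difference of the coefficients expands the zero function; [partial_sums_square] with S = 0
    kills each of its terms. *)
Lemma coef_unique f a b : fourier_expansion f a -> fourier_expansion f b -> a = b.
Proof.
move=> ha hb; apply/funext => n.
pose d m := a m - b m.
have hd : fourier_expansion (fun=> 0) d.
  move=> z z0; have h1 := csum_toP (ha z z0); have h2 := csum_toP (hb z z0).
  have h3 := csumD h1 (csumZ (-1) h2).
  apply/cvgrPdist_le => /= e e0.
  have eR : e = (Re e)%:C by rewrite RRe_real// gtr0_real.
  have e0' : 0 < Re e by rewrite -ltcR -eR.
  have [N hN] := h3 _ e0'; exists N => // m /= Nm.
  have := hN m Nm; rewrite cabsE eR lecR cabs_distC mulN1r subrr.
  congr (cabs (_ - _) <= _); rewrite /series/= big_mkord.
  by apply: eq_bigr => i _; rewrite /d mulN1r mulrBl.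
have h (x : R) : cabs (0 : C) <= 0 by rewrite cabs0.
have [_] := @partial_sums_square (fun=> 0) d 1 0 n.+1 hd ltr01 (lexx _) isT h.
set r := expR _ ^+ 2.
have r0 : 0 < r.
  by apply: exprn_gt0; apply: expR_gt0.
rewrite [0 ^+ 2]expr0n/= big_ord_recr/= => hs.
have p0 : 0 <= \sum_(i < n) cabs (d i) ^+ 2 * r ^+ i.
  by apply: sumr_ge0 => i _; rewrite mulr_ge0// exprn_ge0 ?cabs_ge0// ltW.
have : cabs (d n) ^+ 2 * r ^+ n <= 0 by move: hs p0; clear; lra.
have rn : 0 < r ^+ n by apply: exprn_gt0.
rewrite (pmulr_lle0 _ rn) => h2.
have : cabs (d n) ^+ 2 == 0 by rewrite eq_le h2 exprn_ge0// cabs_ge0.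
by rewrite expf_eq0/= cabs_eq0 /d subr_eq0 => /eqP.
Qed.

End PowerSeries.

(** * From mean squares to absolutely convergent Dirichlet series *)

Section DyadicSummation.
Variable R : realType.
Implicit Types (d : nat -> R) (B s : R) (kap : nat).

Lemma powR_nat2 (J : nat) : (2 ^ J)%:R = powR (2 : R) J%:R.
Proof. by rewrite natrX powR_mulrn. Qed.

(** On a dyadic block the mean square bound gives, as in Cauchy-Schwarz, a contribution of order r^J
    with r = 2^((kap + 1)/2 - s), and the geometric series sums these. The constant A does not
    depend on s, so the blow-up at the edge of convergence is explicit. *)
Lemma dyadic_sum d B kap : (forall n, 0 <= d n) -> 0 <= B ->
  (forall X, (0 < X)%N -> \sum_(i < X) d i ^+ 2 <= B * X%:R ^+ kap) ->
  exists2 A : R, 0 < A & forall s, (kap%:R + 1) / 2 < s -> forall n,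
  \sum_(i < n) d i * powR i.+1%:R (- s) <= A / (1 - powR 2 ((kap%:R + 1) / 2 - s)).
Proof.
move=> d0 B0 hB; pose A := B * 2 ^+ kap + 1 + d 0%N.
have A0 : 0 < A.
  by rewrite /A ltr_pwDl// ltr_pwDr// mulr_ge0// exprn_ge0.
exists A => // s hs n; set u := _ - s; set r := powR 2 u.
have u0 : u < 0 by rewrite /u; move: hs; clear; lra.
have r0 : 0 < r by rewrite powR_gt0.
have r1 : r < 1.
  by rewrite /r /powR pnatr_eq0/= -[ltRHS]expR0 ltr_expR nmulr_rlt0// ln_gt0 ?ltr1n.
have term0 i : 0 <= d i * powR i.+1%:R (- s) by rewrite mulr_ge0 ?powR_ge0.
have s0 : 0 < s.
  by apply: lt_trans hs; rewrite divr_gt0// ltr_wpDl.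
have block J : \sum_(2 ^ J <= i < 2 ^ J.+1) d i * powR i.+1%:R (- s) <=
    (B * 2 ^+ kap + 1) * r ^+ J.
  (* In d <= d^2/l + l this choice balances the two block sums: both are of order 2^(J (kap +
     1)/2). *)
  pose l : R := powR 2 (J%:R * (kap%:R - 1) / 2); have l0 : 0 < l by rewrite powR_gt0.
  have h1 i : d i <= d i ^+ 2 / l + l.
    have p1 : 0 <= (d i - l) ^+ 2 by rewrite sqr_ge0.
    have p2 : 0 <= d i * l by rewrite mulr_ge0 ?d0// ltW.
    rewrite -(ler_pM2r l0) mulrDl divfK ?gt_eqF// -expr2.
    by move: p1 p2; rewrite sqrrB mulr2n; clear; lra.
  have tw : (2 : R) != 0 by [].
  apply: (@le_trans _ _ (powR 2 (- (J%:R * s)) * \sum_(2 ^ J <= i < 2 ^ J.+1) d i)).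
    rewrite mulr_sumr; apply: ler_sum_nat => i /andP[i1 i2].
    rewrite mulrC ler_wpM2r//.
    have -> : powR 2 (- (J%:R * s)) = powR (2 ^ J)%:R (- s).
      by rewrite powR_nat2 -powRrM mulrN.
    rewrite !powRN lef_pV2 ?posrE ?powR_gt0 ?ltr0n ?expn_gt0//.
    by apply: ge0_ler_powR; rewrite ?nnegrE ?ler0n ?ler_nat ?(ltW s0) ?(leqW i1).
  apply: (@le_trans _ _ (powR 2 (- (J%:R * s)) *
      (B * (2 ^ J.+1)%:R ^+ kap / l + (2 ^ J)%:R * l))).
    rewrite ler_wpM2l ?powR_ge0//.
    apply: (@le_trans _ _ (\sum_(2 ^ J <= i < 2 ^ J.+1) (d i ^+ 2 / l + l))).
      by apply: ler_sum_nat => i _; exact: h1.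
    rewrite big_split/=; apply: lerD.
      rewrite -mulr_suml ler_pM2r ?invr_gt0//.
      apply: le_trans (hB (2 ^ J.+1)%N _); last by rewrite expn_gt0.
      rewrite -(big_mkord xpredT (fun i => d i ^+ 2)).
      rewrite [leRHS](big_cat_nat (n := (2 ^ J)%N) (p := (2 ^ J.+1)%N))//=; last by rewrite leq_exp2l.
      by rewrite lerDr sumr_ge0// => i _; rewrite sqr_ge0.
    by rewrite sumr_const_nat expnS mul2n -addnn addnK mulr_natl.
  have e1 : (2 ^ J.+1)%:R ^+ kap = 2 ^+ kap * powR 2 (J%:R * kap%:R) :> R.
    by rewrite expnS natrM exprMn powR_nat2 -[(_ `^ _) ^+ kap]powR_mulrn ?powR_ge0// -powRrM.
  rewrite e1 powR_nat2.
  have e2 : powR 2 (J%:R * kap%:R) / l = powR 2 (J%:R * (kap%:R + 1) / 2).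
    by rewrite /l -powRN -powRD ?tw ?implybT//; congr powR; field.
  have e3 : powR 2 J%:R * l = powR 2 (J%:R * (kap%:R + 1) / 2).
    by rewrite /l -powRD ?tw ?implybT//; congr powR; field.
  have -> : B * (2 ^+ kap * powR 2 (J%:R * kap%:R)) / l + powR 2 J%:R * l =
      (B * 2 ^+ kap + 1) * powR 2 (J%:R * (kap%:R + 1) / 2).
    by rewrite e3 mulrDl mul1r; congr (_ + _); rewrite -e2 !mulrA.
  rewrite mulrCA -powRD ?tw ?implybT//.
  rewrite ler_wpM2l//; first by rewrite addr_ge0// mulr_ge0// exprn_ge0.
  rewrite /r -[(_ `^ _) ^+ J]powR_mulrn ?powR_ge0// -powRrM le_eqVlt; apply/orP; left; apply/eqP.
  by congr powR; rewrite /u; field.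
have dy J : \sum_(0 <= i < 2 ^ J) d i * powR i.+1%:R (- s) <=
    d 0%N + (B * 2 ^+ kap + 1) * \sum_(j < J) r ^+ j.
  elim: J => [|J IH].
    by rewrite big_nat1 powR1 mulr1 big_ord0 mulr0 addr0.
  rewrite (big_cat_nat (n := (2 ^ J)%N))//=; last by rewrite leq_exp2l.
  rewrite big_ord_recr/= mulrDr addrA; apply: lerD => //; exact: block.
apply: (@le_trans _ _ (\sum_(0 <= i < 2 ^ n) d i * powR i.+1%:R (- s))).
  rewrite -(big_mkord xpredT (fun i => d i * powR i.+1%:R (- s))).
  rewrite [leRHS](big_cat_nat (n := n))//=; last by rewrite ltnW// ltn_expl.
  by rewrite lerDl sumr_ge0.
apply: le_trans (dy n) _.
have d1 : 0 < 1 - r by rewrite subr_gt0.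
have g := @geom_le R r n (ltW r0) r1.
have c0 : 0 <= B * 2 ^+ kap + 1 by rewrite addr_ge0// mulr_ge0// exprn_ge0.
have h1 : d 0%N <= d 0%N / (1 - r).
  by rewrite ler_pdivlMr// ler_piMr ?d0// gerBl ltW.
have h2 := ler_wpM2l c0 g.
by rewrite /A [_ + d 0%N]addrC [leRHS]mulrDl lerD.
Qed.

End DyadicSummation.

(** * Mean square bounds for Fourier coefficients and their Dirichlet series *)

Section CoefficientBounds.
Variable R : realType.
Local Notation C := R[i].
Local Notation Re := complex.Re.
Local Notation Im := complex.Im.
Implicit Types (f : C -> C) (a : nat -> C).

(** Take the horizontal line at height y = 1/X: there |f| <= C0 X^K, and the weights exp(-4 pi i y)
    with i < X are bounded below by the constant exp(-4 pi). *)
Lemma coef_square_sum f a K (C0 : R) : fourier_expansion f a -> 0 < C0 ->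
  (forall z, upper z -> cabs (f z) * Im z ^+ K <= C0) ->
  exists2 B : R, 0 < B & forall X, (0 < X)%N ->
    \sum_(i < X) cabs (a i) ^+ 2 <= B * X%:R ^+ K.*2 /\
    \sum_(i < X) cabs (\sum_(n < i.+1) a n) ^+ 2 <= B * X%:R ^+ K.*2.+1.
Proof.
move=> hf C00 hC; exists (C0 ^+ 2 * expR (2 * (2 * pi))).
  by rewrite mulr_gt0 ?exprn_gt0 ?expR_gt0.
move=> X X0; have XR : (0 : R) < X%:R by rewrite ltr0n.
pose y : R := X%:R^-1; have y0 : 0 < y by rewrite invr_gt0.
have hS (x : R) : cabs (f (x +i* y)) <= C0 * X%:R ^+ K.
  have := hC (x +i* y) y0; rewrite /= /y exprVn ler_pdivrMr ?exprn_gt0//.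
have [h1 h2] := partial_sums_square hf y0 (mulr_ge0 (ltW C00) (exprn_ge0 K (ltW XR))) X0 hS.
set r := expR _ ^+ 2 in h1 h2.
have er i : (i < X)%N -> 1 <= expR (2 * (2 * pi)) * r ^+ i.
  move=> iX; rewrite /r -!expRM_natl -expRD -[leLHS]expR0 ler_expR.
  have iR : i%:R <= X%:R :> R by rewrite ler_nat ltnW.
  have -> : 2 * (2 * pi) + i%:R * (2%:R * (- (2 * pi * y))) =
    2 * (2 * pi) * (1 - i%:R / X%:R) :> R by rewrite /y; ring.
  rewrite mulr_ge0 ?mulr_ge0 ?pi_ge0// subr_ge0 ler_pdivrMr// mul1r//.
have gen (g : nat -> R) V : \sum_(i < X) g i ^+ 2 * r ^+ i <= V ->
    \sum_(i < X) g i ^+ 2 <= expR (2 * (2 * pi)) * V.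
  move=> hV; apply: le_trans (ler_wpM2l (expR_ge0 _) hV).
  rewrite mulr_sumr; apply: ler_sum => i _; rewrite mulrCA.
  by rewrite ler_peMr ?sqr_ge0// er.
have e : (C0 * X%:R ^+ K) ^+ 2 = C0 ^+ 2 * X%:R ^+ K.*2.
  by rewrite exprMn -exprM muln2.
split.
  have := gen (fun i => cabs (a i)) _ h2; rewrite e; congr (_ <= _).
  by move: (expR _) (_ ^+ K.*2) (C0 ^+ 2) => u v w; ring.
have := gen (fun i => cabs (\sum_(n < i.+1) a n)) _ h1; rewrite e [_ ^+ K.*2.+1]exprSr.
congr (_ <= _).
by move: (expR _) (_ ^+ K.*2) (C0 ^+ 2) => u v w; ring.
Qed.

Lemma shift_square_sum (c : nat -> R) B kap : 0 <= B -> (forall n, 0 <= c n) ->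
  (forall X, (0 < X)%N -> \sum_(i < X) c i ^+ 2 <= B * X%:R ^+ kap) ->
  forall X, (0 < X)%N -> \sum_(i < X) c i.+1 ^+ 2 <= B * 2 ^+ kap * X%:R ^+ kap.
Proof.
move=> B0 c0 h X X0; apply: (@le_trans _ _ (\sum_(i < X.+1) c i ^+ 2)).
  by rewrite big_ord_recl/= lerDr sqr_ge0.
apply: le_trans (h X.+1 isT) _; rewrite -mulrA -exprMn ler_wpM2l// lerXn2r ?nnegrE//.
by rewrite -natrM ler_nat mul2n -addnn -addn1 leq_add2l.
Qed.

Lemma dirichlet_abs f a K : fourier_expansion f a ->
  (exists2 C0 : R, 0 < C0 & forall z, upper z -> cabs (f z) * Im z ^+ K <= C0) ->
  forall s : R, K%:R + 1 / 2 < s ->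
  exists T, rsum (fun n => cabs (a n.+1) * powR n.+1%:R (- s)) T.
Proof.
move=> hf [C0 C00 hC] s hs.
have [B B0 hB] := coef_square_sum hf C00 hC.
have h1 := @shift_square_sum (fun n => cabs (a n)) B K.*2 (ltW B0) (fun n => cabs_ge0 _)
  (fun X X0 => (hB X X0).1).
have [||A A0 hA] := @dyadic_sum R (fun n => cabs (a n.+1)) _ K.*2 _ _ h1.
- by move=> n; exact: cabs_ge0.
- by rewrite mulr_ge0 ?exprn_ge0// ltW.
apply: rsum_ex; first by move=> n; rewrite mulr_ge0 ?cabs_ge0 ?powR_ge0.
eexists; apply: hA; rewrite -muln2 natrM; move: hs; clear; lra.
Qed.

(** The same argument for partial sums of coefficients, with exponent 2K + 1. After Abel summation
    it makes the L-series available for Re s > K, half a unit beyond absolute convergence. *)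
Lemma dirichlet_cond f a K : fourier_expansion f a ->
  (exists2 C0 : R, 0 < C0 & forall z, upper z -> cabs (f z) * Im z ^+ K <= C0) ->
  exists2 A : R, 0 < A & forall s : R, K%:R < s -> forall n,
  \sum_(i < n) cabs (\sum_(m < i.+2) a m) * powR i.+1%:R (- (s + 1)) <=
    A / (1 - powR 2 (K%:R - s)).
Proof.
move=> hf [C0 C00 hC].
have [B B0 hB] := coef_square_sum hf C00 hC.
have h1 := @shift_square_sum (fun i => cabs (\sum_(n < i.+1) a n)) B K.*2.+1 (ltW B0)
  (fun n => cabs_ge0 _) (fun X X0 => (hB X X0).2).
have [||A A0 hA] := @dyadic_sum R (fun i => cabs (\sum_(n < i.+2) a n)) _ K.*2.+1 _ _ h1.
- by move=> n; exact: cabs_ge0.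
- by rewrite mulr_ge0 ?exprn_ge0// ltW.
exists A => // s hs n.
have e : (K.*2.+1%:R + 1) / 2 = K%:R + 1 :> R.
  by rewrite mulrSr -muln2 natrM; field.
have := hA (s + 1) _ n; rewrite e; have -> : K%:R + 1 - (s + 1) = K%:R - s by ring.
by apply; move: hs; clear; lra.
Qed.

Lemma cexp_sub1_left (w : C) : Re w <= 0 -> cabs (cexp w - 1) <= 2 * cabs w.
Proof.
move=> w0; have -> : cexp w - 1 = (expR (Re w) - 1)%:C +
    (expR (Re w))%:C * ((cos (Im w) - 1) +i* sin (Im w)).
  rewrite /cexp; apply: complex_eqP; rewrite !(ReD, ImD, ReM, ImM, ReN, ImN)/=; ring.
apply: le_trans (cabsD _ _) _; rewrite mulr2n mulrDl mul1r; apply: lerD.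
  apply: le_trans (cabs_Re _); rewrite cabs_real distrC ger0_norm; last first.
    by rewrite subr_ge0 -[leRHS]expR0 ler_expR.
  by rewrite ler0_norm//; have := expR_ge1Dx (Re w); clear; lra.
rewrite cabsM cabs_real ger0_norm ?expR_ge0//.
apply: (@le_trans _ _ `|Im w|); last exact: cabs_Im.
rewrite -[leRHS]mul1r; apply: ler_pM; rewrite ?expR_ge0 ?cabs_ge0//.
  by rewrite -[leRHS]expR0 ler_expR.
rewrite -(@ler_pXn2r _ 2)// ?nnegrE ?cabs_ge0// cabs_sq/= real_normK ?num_real//.
set y := Im w.
have -> : (cos y - 1) ^+ 2 + sin y ^+ 2 = 4 * sin (y / 2) ^+ 2.
  have := cosD (y / 2) (y / 2); rewrite -splitr => e1.
  have := sinD (y / 2) (y / 2); rewrite -splitr => e2.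
  have := cos2Dsin2 (y / 2); rewrite e1 e2; move: (cos _) (sin _) => c s e.
  have c2 : c * c = 1 - s * s by move: e; rewrite !expr2; clear; lra.
  transitivity ((c * c - s * s - 1) ^+ 2 + 4 * (c * c) * s ^+ 2); first by ring.
  by rewrite c2; ring.
have := sin_le (y / 2) => h.
have : `|sin (y / 2)| ^+ 2 <= `|y / 2| ^+ 2 by rewrite lerXn2r// nnegrE.
rewrite !real_normK ?num_real// => h2.
have e : (y / 2) ^+ 2 = y ^+ 2 / 4 by field.
by move: h2; rewrite e; clear; lra.
Qed.

(** Consecutive powers differ by a factor exp(-s h) with 0 <= h <= 1/(n + 1), which gains one power
    of n. *)
Lemma cpow_diff (n : nat) (s : C) : 0 <= Re s ->
  cabs (cpow n.+1%:R (- s) - cpow n.+2%:R (- s)) <=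
  2 * cabs s * powR n.+1%:R (- (Re s + 1)).
Proof.
move=> s0; have n1 : (0 : R) < n.+1%:R by rewrite ltr0n.
pose h : R := ln (n.+2%:R / n.+1%:R).
have q1 : 1 <= n.+2%:R / n.+1%:R :> R by rewrite ler_pdivlMr// mul1r ler_nat.
have h0 : 0 <= h by rewrite ln_ge0.
have hn : h <= n.+1%:R^-1.
  rewrite -ler_expR lnK; last by rewrite posrE (lt_le_trans ltr01).
  apply: le_trans (expR_ge1Dx _).
  by rewrite -[n.+2]addn1 natrD mulrDl mulfV ?gt_eqF// mul1r.
have e : cpow n.+2%:R (- s) = cpow n.+1%:R (- s) * cexp (- s * h%:C).
  have -> : n.+2%:R = n.+1%:R * (n.+2%:R / n.+1%:R) :> R.
    by rewrite mulrC divfK// gt_eqF.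
  by rewrite cpowM// (lt_le_trans ltr01).
rewrite e -{1}[cpow _ _]mulr1 -mulrBr cabsM cabs_cpow// ReN.
have hw : Re (- s * h%:C) <= 0.
  by rewrite mulrC ReZ ReN mulrN oppr_le0 mulr_ge0.
have := cexp_sub1_left hw; rewrite cabs_distC cabsM cabsN cabs_real (ger0_norm h0) => h2.
apply: le_trans (ler_wpM2l (powR_ge0 _ _) h2) _.
have -> : powR n.+1%:R (- (Re s + 1)) = powR n.+1%:R (- Re s) * n.+1%:R^-1 :> R.
  rewrite -(powR_inv1 (ltW n1)) opprD powRD//.
  by apply/implyP => _; rewrite gt_eqF.
have p0 : 0 <= powR (n.+1%:R : R) (- Re s) by exact: powR_ge0.
have -> : 2 * cabs s * (powR n.+1%:R (- Re s) * n.+1%:R^-1) =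
  powR n.+1%:R (- Re s) * (2 * (cabs s * n.+1%:R^-1)) by ring.
by rewrite ler_wpM2l// ler_wpM2l// ler_wpM2l ?cabs_ge0.
Qed.

End CoefficientBounds.

(** * The Gamma function from Euler's limit: convergence, functional equation, estimates *)

Section GammaFunction.
Variable R : realType.
Local Notation C := R[i].
Local Notation Re := complex.Re.
Local Notation Im := complex.Im.
Implicit Types (s w : C).

(** Relative increments bounded by the decrements of a sequence [eps] that starts at most at 1/2
    change |u| by at most a factor 2, and [eps n] controls the tail. *)
Lemma product_control (u : nat -> C) (eps : nat -> R) n0 :
  (forall n, 0 <= eps n) -> eps n0 <= 1 / 2 ->
  (forall n, (n0 <= n)%N -> eps n.+1 <= eps n /\
     cabs (u n.+1 - u n) <= (eps n - eps n.+1) * cabs (u n)) ->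
  forall n, (n0 <= n)%N -> [/\ cabs (u n) <= 2 * cabs (u n0),
    cabs (u n0) / 2 <= cabs (u n) &
    forall m, (n <= m)%N -> cabs (u m - u n) <= 2 * cabs (u n0) * eps n].
Proof.
move=> e0 e1 h.
have mono n : (n0 <= n)%N -> eps n <= eps n0.
  move=> nn; rewrite -(subnKC nn); elim: (n - n0)%N => [|j IH]; rewrite ?addn0//.
  by rewrite addnS; apply: le_trans IH; have [] := h (n0 + j)%N (leq_addr _ _).
have key n : (n0 <= n)%N -> cabs (u n) * (1 - (eps n0 - eps n)) <= cabs (u n0) /\
    cabs (u n0) * (1 - (eps n0 - eps n)) <= cabs (u n).
  move=> nn; rewrite -(subnKC nn); elim: (n - n0)%N => [|j [I1 I2]].
    by rewrite addn0 subrr subr0 !mulr1.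
  rewrite addnS; have jn : (n0 <= n0 + j)%N by rewrite leq_addr.
  have [h1 h2] := h _ jn; have m1 := mono _ jn.
  have a1 : cabs (u (n0 + j).+1) <= cabs (u (n0 + j)%N) * (1 + (eps (n0 + j)%N - eps (n0 + j).+1)).
    rewrite -[u _.+1](subrK (u (n0 + j)%N)); apply: le_trans (cabsD _ _) _.
    by move: h2; clear; lra.
  have a2 : cabs (u (n0 + j)%N) * (1 - (eps (n0 + j)%N - eps (n0 + j).+1)) <= cabs (u (n0 + j).+1).
    have := cabsB_ge (u (n0 + j)%N) (u (n0 + j)%N - u (n0 + j).+1).
    have -> : u (n0 + j)%N - (u (n0 + j)%N - u (n0 + j).+1) = u (n0 + j).+1 by ring.
    by rewrite [cabs (u (n0 + j)%N - _)]cabs_distC; move: h2; clear; lra.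
  have c0 := cabs_ge0 (u (n0 + j)%N); have c1 := cabs_ge0 (u n0).
  have p0 := e0 (n0 + j)%N; have p1 := e0 (n0 + j).+1.
  set U := cabs (u (n0 + j).+1) in a1 a2 *; set V := cabs (u (n0 + j)%N) in a1 a2 c0 I1 I2 *.
  set W := cabs (u n0) in c1 I1 I2 *.
  set x := eps (n0 + j)%N in a1 a2 h1 m1 p0 I1 I2 *; set y := eps _.+1 in a1 a2 h1 p1 *.
  set z := eps n0 in e1 m1 I1 I2 *; split.
    apply: le_trans I1; apply: (@le_trans _ _ (V * (1 + (x - y)) * (1 - (z - y)))).
      by apply: ler_wpM2r a1; move: e1 p1; clear; lra.
    by rewrite -mulrA ler_wpM2l//; move: e1 m1 p1 h1; clear; nra.
  apply: le_trans a2; apply: (@le_trans _ _ (W * (1 - (z - x)) * (1 - (x - y)))).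
    by rewrite -mulrA ler_wpM2l//; move: e1 m1 p1 h1; clear; nra.
  by apply: ler_wpM2r I2; move: e1 m1 p1 h1; clear; lra.
have up n : (n0 <= n)%N -> cabs (u n) <= 2 * cabs (u n0).
  move=> nn; have [k1 _] := key n nn; have := e0 n; have := cabs_ge0 (u n).
  by move: e1 k1; move: (cabs _) (cabs _) (eps _) (eps _); clear => a b c d; nra.
move=> n nn; split; first exact: up.
  have [_ k2] := key n nn; have := e0 n; have := cabs_ge0 (u n0).
  by move: e1 k2; move: (cabs _) (cabs _) (eps _) (eps _); clear => a b c d; nra.
move=> m nm.
suff : cabs (u m - u n) <= 2 * cabs (u n0) * (eps n - eps m).
  move=> k; apply: le_trans k _; rewrite ler_wpM2l ?mulr_ge0 ?cabs_ge0//.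
  by rewrite gerBl.
rewrite -(subnKC nm); elim: (m - n)%N => [|j IH].
  by rewrite addn0 !subrr cabs0 mulr0.
have jn : (n0 <= n + j)%N by apply: leq_trans nn (leq_addr _ _).
rewrite addnS; have [h1 h2] := h _ jn; have h3 := up _ jn.
have := cabsD (u (n + j).+1 - u (n + j)%N) (u (n + j)%N - u n).
rewrite addrA subrK.
have : (eps (n + j)%N - eps (n + j).+1) * cabs (u (n + j)%N) <=
   (eps (n + j)%N - eps (n + j).+1) * (2 * cabs (u n0)).
  by rewrite ler_wpM2l ?subr_ge0.
by move: IH h2; clear; lra.
Qed.

Definition gam (n : nat) s : C := n`!%:R * cpow n%:R s / \prod_(i < n.+1) (s + i%:R).

Lemma gam_den s (n : nat) : 0 < Re s -> \prod_(i < n) (s + i%:R) != 0.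
Proof.
move=> s0; apply/prodf_neq0 => i _; apply: contraTneq s0 => h.
have := congr1 (@complex.Re R) h; rewrite ReD Re_nat/= => e.
by rewrite -leNgt -(subr0 (Re s)) subr_le0 //; have := ler0n R i; move: e; clear; lra.
Qed.

Lemma gam_neq0 s n : 0 < Re s -> gam n s != 0.
Proof.
move=> s0; apply: mulf_neq0; last by rewrite invr_eq0 gam_den.
by apply: mulf_neq0 (cpow_neq0 _ _); rewrite pnatr_eq0 -lt0n fact_gt0.
Qed.

Lemma cabs_gam s n : (0 < n)%N ->
  cabs (gam n s) = n`!%:R * powR n%:R (Re s) / \prod_(i < n.+1) cabs (s + i%:R).
Proof.
by move=> n0; rewrite /gam cabsM cabsM cabs_nat cabs_cpow ?ltr0n// cabsV cabs_prod.
Qed.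

Lemma gam_step s n : (0 < n)%N -> 0 < Re s ->
  gam n.+1 s = gam n s * (cexp (s * (ln (n.+1%:R / n%:R))%:C) / (1 + s / n.+1%:R)).
Proof.
move=> n0 s0; have nR : (0 : R) < n%:R by rewrite ltr0n.
have n1 : (n.+1%:R : C) != 0 by rewrite pnatr_eq0.
have d0 := gam_den n.+1 s0.
have sn : s + n.+1%:R != 0.
  have := gam_den n.+2 s0; rewrite big_ord_recr/= mulf_eq0 negb_or => /andP[_].
  by [].
have sn' : n.+1%:R + s != 0 by rewrite addrC.
have e : cpow n.+1%:R s = cpow n%:R s * cexp (s * (ln (n.+1%:R / n%:R))%:C).
  have e2 : n.+1%:R = n%:R * (n.+1%:R / n%:R) :> R.
    by rewrite mulrC divfK// gt_eqF.
  by rewrite [in LHS]e2 cpowM// divr_gt0// ltr0n.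
rewrite /gam e big_ord_recr/= factS natrM.
move: (cpow _ _) (cexp _) (n`!%:R) (\prod_(i < n.+1) _) d0 => a b c d d0.
move: (n.+1%:R : C) n1 sn sn' => m m0 p1 p2.
by field; rewrite ?m0 ?d0 ?p1 ?p2.
Qed.

Lemma ln_ratio (n : nat) : (0 < n)%N ->
  (n.+1%:R^-1 <= ln (n.+1%:R / n%:R) :> R) * (ln (n.+1%:R / n%:R) <= n%:R^-1 :> R).
Proof.
move=> n0; have nR : (0 : R) < n%:R by rewrite ltr0n.
have n1 : (0 : R) < n.+1%:R by rewrite ltr0n.
have q0 : (0 : R) < n.+1%:R / n%:R by rewrite divr_gt0.
split; last first.
  rewrite -ler_expR lnK ?posrE//; apply: le_trans (expR_ge1Dx _).
  by rewrite mulrSr mulrDl mulfV ?gt_eqF// mul1r.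
rewrite -lerN2 -lnV ?posrE// -ler_expR lnK ?posrE ?invr_gt0//.
apply: le_trans (expR_ge1Dx _); rewrite invf_div mulrSr.
have e : (n%:R + 1 : R) != 0 by rewrite -mulrSr gt_eqF.
by rewrite le_eqVlt; apply/orP; left; apply/eqP; field.
Qed.

(** The ratio of consecutive approximants is exp(s h) / (1 + s/(n+1)) with h = ln((n+1)/n). The
    first-order terms cancel up to O(1/n^2). *)
Lemma gam_ratio s n (B : R) : 1 <= B -> cabs s <= B -> 2 * B <= n%:R -> 0 < Re s ->
  cabs (gam n.+1 s - gam n s) <= 22 * B ^+ 2 / n%:R ^+ 2 * cabs (gam n s).
Proof.
move=> B1 sB nB s0.
have B0 : 0 < B := lt_le_trans ltr01 B1.
have nR : (0 : R) < n%:R by move: B0 nB; clear; lra.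
have n0 : (0 < n)%N by rewrite -(ltr0n R).
have n1R : (0 : R) < n.+1%:R by rewrite ltr0n.
have nn1 : n%:R <= n.+1%:R :> R by rewrite ler_nat.
rewrite gam_step// -{2}[gam n s]mulr1 -mulrBr cabsM mulrC ler_wpM2r ?cabs_ge0//.
set h := ln _; have [h1 h2] := ln_ratio n0; rewrite -/h in h1 h2.
have n1 : (n.+1%:R : C) != 0 by rewrite pnatr_eq0.
have h0 : 0 <= h by apply: le_trans h1; rewrite invr_ge0.
have csh : cabs (s * h%:C) <= B / n%:R.
  rewrite cabsM cabs_real (ger0_norm h0); apply: ler_pM => //; exact: cabs_ge0.
have half : B / n%:R <= 1 / 2 by rewrite ler_pdivrMr//; move: nB; clear; lra.
have cs1 : cabs (s / n.+1%:R) <= 1 / 2.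
  rewrite cabsM cabsV cabs_nat; apply: le_trans half.
  by apply: ler_pM; rewrite ?cabs_ge0 ?invr_ge0// lef_pV2.
have d0 : 1 / 2 <= cabs (1 + s / n.+1%:R).
  have := cabsB_ge 1 (- (s / n.+1%:R)); rewrite cabs1 cabsN opprK.
  by move: cs1; clear; lra.
have dn0 : 1 + s / n.+1%:R != 0 by rewrite -cabs_gt0; apply: lt_le_trans d0.
have -> : cexp (s * h%:C) / (1 + s / n.+1%:R) - 1 =
   ((cexp (s * h%:C) - 1 - s * h%:C) + s * (h%:C - n.+1%:R^-1)) / (1 + s / n.+1%:R).
  move: (cexp _) => E; apply: (mulIf dn0); rewrite divfK// mulrBl divfK//; ring.
rewrite cabsM cabsV ler_pdivrMr; last exact: lt_le_trans d0.
have e1 := cexp_sub1 (le_trans csh half).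
have e2 : cabs (s * (h%:C - n.+1%:R^-1)) <= B * n%:R ^- 2.
  have -> : (n.+1%:R^-1 : C) = (n.+1%:R^-1)%:C by rewrite fmorphV rmorph_nat.
  rewrite -rmorphB/= cabsM cabs_real ger0_norm ?subr_ge0//.
  apply: ler_pM; rewrite ?cabs_ge0 ?subr_ge0//.
  apply: (@le_trans _ _ (n%:R^-1 - n.+1%:R^-1)); first by rewrite lerD2r.
  have -> : n%:R^-1 - n.+1%:R^-1 = (n%:R * n.+1%:R)^-1 :> R.
    rewrite mulrSr; have : (n%:R + 1 : R) != 0 by rewrite -mulrSr gt_eqF.
    by move=> q0; field; rewrite ?q0 ?gt_eqF.
  by rewrite expr2 lef_pV2 ?posrE ?mulr_gt0// ler_wpM2l// ltW.
have e3 : 10 * cabs (s * h%:C) ^+ 2 <= 10 * (B / n%:R) ^+ 2.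
  by rewrite ler_wpM2l// lerXn2r ?nnegrE ?cabs_ge0 ?divr_ge0// ltW.
rewrite exprMn exprVn in e3.
have n2 : 0 < n%:R ^- 2 :> R by rewrite invr_gt0 exprn_gt0.
have e4 : B * n%:R ^- 2 <= B ^+ 2 * n%:R ^- 2.
  by rewrite (ler_wpM2r (ltW n2))// expr2 -[leLHS]mulr1 (ler_wpM2l (ltW B0)).
have e5 : 0 <= 22 * B ^+ 2 / n%:R ^+ 2.
  by rewrite divr_ge0 ?mulr_ge0 ?exprn_ge0// ltW.
have e6 : 22 * B ^+ 2 / n%:R ^+ 2 * (1 / 2) <= 22 * B ^+ 2 / n%:R ^+ 2 * cabs (1 + s / n.+1%:R).
  by rewrite ler_wpM2l.
apply: le_trans (cabsD _ _) _; apply: le_trans e6.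
by move: e1 e2 e3 e4; clear; lra.
Qed.

(* The tails of Euler's limit, controlled uniformly on bounded sets. *)
Lemma gam_control (B : R) : 1 <= B -> exists n0 : nat, exists eps : nat -> R,
  [/\ forall n, 0 <= eps n,
      forall e : R, 0 < e -> exists N, forall n, (N <= n)%N -> eps n <= e &
      forall s, cabs s <= B -> 0 < Re s -> forall n, (n0 <= n)%N ->
      [/\ cabs (gam n s) <= 2 * cabs (gam n0 s), cabs (gam n0 s) / 2 <= cabs (gam n s) &
          forall m, (n <= m)%N -> cabs (gam m s - gam n s) <= 2 * cabs (gam n0 s) * eps n]].
Proof.
move=> B1; have B0 : 0 < B := lt_le_trans ltr01 B1.
(* 44 = 2 * 22: the decrements of c/n are c/(n (n+1)) >= c/(2 n^2), which dominates the relative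
   increment 22 B^2/n^2 of [gam_ratio]. *)
pose c := 44 * B ^+ 2; have c0 : 0 < c by rewrite mulr_gt0// exprn_gt0.
pose eps (n : nat) : R := c / n%:R.
have small e : 0 < e -> exists N, forall n, (N <= n)%N -> eps n <= e.
  move=> e0; exists (Num.truncn (c / e)).+1 => n nN.
  have h : c / e < n%:R by apply: lt_le_trans (truncnS_gt _) _; rewrite ler_nat.
  have n0 : (0 : R) < n%:R by apply: le_lt_trans h; rewrite divr_ge0// ltW.
  by rewrite /eps ler_pdivrMr// mulrC -ler_pdivrMr// ltW.
have h12 : (0 : R) < 1 / 2 by rewrite divr_gt0.
have [N hN] := small _ h12.
exists (maxn N 1), eps; split=> //.
  by move=> n; rewrite divr_ge0// ltW.
move=> s sB s0; apply: product_control.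
- by move=> n; rewrite divr_ge0// ltW.
- by apply: hN; rewrite leq_maxl.
move=> n; rewrite geq_max => /andP[nN n1].
have nR : (0 : R) < n%:R by rewrite ltr0n.
have n1R : (0 : R) < n.+1%:R by rewrite ltr0n.
split; first by rewrite /eps ler_wpM2l ?(ltW c0)// lef_pV2// ler_nat.
have nB : 2 * B <= n%:R.
  have := hN n nN; rewrite /eps ler_pdivrMr// /c.
  have : B <= B ^+ 2 by rewrite expr2 -[leLHS]mulr1 ler_wpM2l// ltW.
  by move: B0; clear; lra.
apply: le_trans (gam_ratio B1 sB nB s0) _; rewrite ler_wpM2r ?cabs_ge0//.
have -> : eps n - eps n.+1 = c / (n%:R * n.+1%:R).
  rewrite /eps mulrSr; have : (n%:R + 1 : R) != 0 by rewrite -mulrSr gt_eqF.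
  by move=> q0; field; rewrite ?q0 ?gt_eqF.
have -> : 22 * B ^+ 2 / n%:R ^+ 2 = c / (2 * n%:R ^+ 2).
  by rewrite /c; field; rewrite gt_eqF.
rewrite ler_wpM2l ?(ltW c0)// lef_pV2 ?posrE ?mulr_gt0 ?exprn_gt0//.
have -> : 2 * n%:R ^+ 2 = n%:R * (2 * n%:R) :> R by ring.
rewrite (ler_wpM2l (ltW nR))// mulrSr.
by have : (1 : R) <= n%:R by [rewrite ler1n]; clear; lra.
Qed.

Lemma Gamma_cvg s : 0 < Re s -> forall e : R, 0 < e -> exists N, forall n, (N <= n)%N ->
  cabs (gam n s - Gamma s) <= e.
Proof.
move=> s0; pose B := cabs s + 1.
have B1 : 1 <= B by rewrite lerDr cabs_ge0.
have sB : cabs s <= B by rewrite lerDl.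
have [n0 [eps [e0 small ctl]]] := gam_control B1.
have {}ctl := ctl s sB s0.
have K0 : 0 < 2 * cabs (gam n0 s) by rewrite mulr_gt0// cabs_gt0 gam_neq0.
pose u n := gam n.+1 s - gam n s.
have su n : \sum_(i < n) u i = gam n s - gam 0 s.
  elim: n => [|n IH]; first by rewrite big_ord0 subrr.
  by rewrite big_ord_recr/= IH /u addrC addrA subrK.
have [|l hl] := @csum_ex R u.
  move=> e e1; have [N hN] := small _ (divr_gt0 e1 K0).
  exists (maxn n0 N) => m n hm hn; rewrite !su.
  wlog mn : m n hm hn / (n <= m)%N.
    by move=> H; have [/H|/ltnW /H] := leqP n m; [apply|rewrite cabs_distC; apply].
  have -> : gam m s - gam 0 s - (gam n s - gam 0 s) = gam m s - gam n s by ring.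
  move: hn; rewrite geq_max => /andP[/ctl[_ _ /(_ m mn) h] /hN].
  rewrite ler_pdivlMr// => h2; apply: le_trans h _; by rewrite mulrC.
have lim : forall e : R, 0 < e -> exists N, forall n, (N <= n)%N ->
    cabs (gam n s - (l + gam 0 s)) <= e.
  move=> e /hl[N hN]; exists N => n /hN; rewrite su.
  by congr (cabs _ <= _); ring.
suff -> : Gamma s = l + gam 0 s by [].
rewrite /Gamma; apply: (@cvg_lim C^o) => //.
apply/cvgrPdist_le => /= e e1.
have eR : e = (Re e)%:C by rewrite RRe_real// gtr0_real.
have e0' : 0 < Re e by rewrite -ltcR -eR.
have [N hN] := lim _ e0'; exists N => // m /= Nm.
by rewrite cabsE eR lecR cabs_distC; exact: hN.
Qed.

(** [Gamma_le], [Gamma_ratio] and [Gamma_ge] are proved factor by factor in Euler's product and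
    passed to the limit by this lemma. *)
Lemma cabs_lim_le (u v : nat -> C) l l' (a b : R) :
  (forall e : R, 0 < e -> exists N, forall n, (N <= n)%N -> cabs (u n - l) <= e) ->
  (forall e : R, 0 < e -> exists N, forall n, (N <= n)%N -> cabs (v n - l') <= e) ->
  0 <= a -> 0 <= b ->
  (exists N, forall n, (N <= n)%N -> a * cabs (u n) <= b * cabs (v n)) ->
  a * cabs l <= b * cabs l'.
Proof.
move=> hu hv a0 b0 [N0 h]; apply/ler_addgt0Pr => e e0.
have k0 : 0 < a + b + 1 by rewrite ltr_wpDl// addr_ge0.
have d0 : 0 < e / (a + b + 1) by rewrite divr_gt0.
have [N1 h1] := hu _ d0; have [N2 h2] := hv _ d0.
pose n := maxn N0 (maxn N1 N2).
have n0 : (N0 <= n)%N by rewrite leq_maxl.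
have n1 : (N1 <= n)%N by rewrite /n maxnC -maxnA leq_maxl.
have n2 : (N2 <= n)%N by rewrite /n maxnA leq_maxr.
have := h n n0; have := h1 n n1; have := h2 n n2; set d := e / _ in d0 *.
have de : d * (a + b + 1) = e by rewrite divfK// gt_eqF.
have := cabsB_ge l (u n); have := cabsB_ge (v n) l'; rewrite (cabs_distC l).
move=> p1 p2 p3 p4 p5.
have q1 : a * cabs l <= a * (cabs (u n) + d).
  by rewrite ler_wpM2l//; move: p2 p4; clear; lra.
have q2 : b * cabs (v n) <= b * (cabs l' + d).
  by rewrite ler_wpM2l//; move: p1 p3; clear; lra.
rewrite -de; move: q1 q2 p5 d0; clear; lra.
Qed.

Lemma Gamma_neq0 s : 0 < Re s -> Gamma s != 0.
Proof.
move=> s0; pose B := cabs s + 1.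
have B1 : 1 <= B by rewrite lerDr cabs_ge0.
have sB : cabs s <= B by rewrite lerDl.
have [n0 [eps [e0 small ctl]]] := gam_control B1.
have g0 : 0 < cabs (gam n0 s) by rewrite cabs_gt0 gam_neq0.
have : (1 / 2) * cabs (gam n0 s) <= 1 * cabs (Gamma s).
  apply: (@cabs_lim_le (fun=> gam n0 s) (gam^~ s)) => //.
  - by move=> e e1; exists 0 => n _; rewrite subrr cabs0 ltW.
  - exact: Gamma_cvg.
  by exists n0 => n nn; have [_ h _] := ctl s sB s0 n nn; move: h; clear; lra.
by rewrite -cabs_gt0; move: g0; clear; lra.
Qed.

Lemma cdiff_gam n s : 0 < Re s -> cdiff (gam n) s.
Proof.
move=> s0; apply: cdiffM.
  by apply: cdiffM; [exact: cdiff_cst|exact: cdiff_cpow].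
apply: cdiffV; last exact: gam_den.
apply: cdiff_prod => i _; exact: cdiffD (cdiff_id _) (cdiff_cst _ _).
Qed.

Lemma cdiff_Gamma s : 0 < Re s -> cdiff (@Gamma R) s.
Proof.
move=> s0; pose r := Re s / 2; have r0 : 0 < r by rewrite divr_gt0.
pose inR w := rect (Re s - r) (Re s + r) (Im s - r) (Im s + r) w.
have posR w : inR w -> 0 < Re w.
  by move=> /andP[/andP[h _] _]; move: h r0; rewrite /r; clear; lra.
have [||w /posR w0|M M0 hM] := @rect_bounded _ (fun w => w) (Re s - r) (Re s + r) (Im s - r) (Im s + r).
- by move: r0; clear; lra.
- by move: r0; clear; lra.
- exact: ccont_id.
pose B := M + 1; have B1 : 1 <= B by rewrite lerDr ltW.
have [n0 [eps [e0 small ctl]]] := gam_control B1.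
have [||w /posR w0|K K0 hK] := @rect_bounded _ (gam n0) (Re s - r) (Re s + r) (Im s - r) (Im s + r).
- by move: r0; clear; lra.
- by move: r0; clear; lra.
- exact: cdiff_cont (cdiff_gam _ _).
apply: (@weierstrass _ gam _ s r r0); first by move=> n w /posR; exact: cdiff_gam.
move=> e e1; have K2 : 0 < 2 * K by rewrite mulr_gt0.
have [N hN] := small _ (divr_gt0 e1 K2).
exists (maxn n0 N) => n; rewrite geq_max => /andP[nn /hN hn] w hw.
have w0 := posR w hw; have wB : cabs w <= B by rewrite (le_trans (hM w hw))// lerDl.
have [_ _ h] := ctl w wB w0 n nn.
have : 1 * cabs (gam n w - Gamma w) <= e * cabs (1 : C); last by rewrite mul1r cabs1 mulr1.
apply: (@cabs_lim_le (fun m => gam n w - gam m w) (fun=> 1)) => //; last 2 first.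
- exact: ltW.
- exists n => m nm; rewrite mul1r cabs1 mulr1 cabs_distC; apply: le_trans (h m nm) _.
  move: hn; rewrite ler_pdivlMr// => hn.
  apply: le_trans hn; rewrite mulrC ler_wpM2l// ler_wpM2l//; exact: hK.
- move=> d d0; have [N1 h1] := Gamma_cvg w0 d0; exists N1 => m /h1.
  by rewrite cabs_distC; congr (cabs _ <= _); ring.
- by move=> d d0; exists 0 => m _; rewrite subrr cabs0 ltW.
Qed.

Lemma Gamma_conj s : 0 < Re s -> Gamma (cj s) = cj (Gamma s).
Proof.
move=> s0; have s0' : 0 < Re (cj s) by rewrite ReJ.
apply/eqP; rewrite -subr_eq0 -cabs_eq0; apply/eqP/le_anti; rewrite cabs_ge0 andbT.
apply/ler_addgt0Pr => e e0; rewrite add0r.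
have e2 : 0 < e / 2 by rewrite divr_gt0.
have [N1 h1] := Gamma_cvg s0 e2; have [N2 h2] := Gamma_cvg s0' e2.
have := h1 _ (leq_maxl N1 N2); have := h2 _ (leq_maxr N1 N2).
set n := maxn _ _.
have -> : gam n (cj s) = cj (gam n s).
  have cn (m : nat) : cj m%:R = m%:R :> C by exact: conjc_nat.
  rewrite /gam cpow_conj [RHS]rmorphM [X in _ = X * _]rmorphM fmorphV rmorph_prod/= cn.
  by congr (_ / _); apply: eq_bigr => i _; rewrite [RHS]rmorphD/= cn.
move=> a1; rewrite -cabs_conj rmorphB => a2.
have := cabsB (cj (gam n s) - cj (Gamma s)) (cj (gam n s) - Gamma (cj s)).
have -> : cj (gam n s) - cj (Gamma s) - (cj (gam n s) - Gamma (cj s)) =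
  Gamma (cj s) - cj (Gamma s) by ring.
by move: a1 a2; rewrite /=; clear; lra.
Qed.

Lemma Gamma_shift s : 0 < Re s -> Gamma (s + 1) = s * Gamma s.
Proof.
move=> s0; have s1 : 0 < Re (s + 1) by rewrite ReD addr_gt0.
have sn (n : nat) : 0 < n%:R + (1 + Re s) by rewrite ltr_wpDl// addr_gt0.
have e n : (0 < n)%N -> gam n (s + 1) = s * gam n s * (1 + (s + 1) / n%:R)^-1.
  move=> n0; have nR : (0 : R) < n%:R by rewrite ltr0n.
  have nC : (n%:R : C) != 0 by rewrite pnatr_eq0 -lt0n.
  have c1 : cpow n%:R (1%:R) = n%:R :> C by rewrite cpow_nat// expr1 rmorph_nat.
  rewrite /gam cpowD [cpow _ 1]c1.
  have -> : \prod_(i < n.+1) (s + 1 + i%:R) = \prod_(i < n.+1) (s + i.+1%:R).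
    by apply: eq_bigr => i _; rewrite mulrS; ring.
  have := gam_den n.+1 s0; rewrite big_ord_recl/= addr0 => d0.
  have -> : \prod_(i < n) (s + (bump 0 i)%:R) = \prod_(i < n) (s + i.+1%:R).
    by apply: eq_bigr => i _.
  have d1 : \prod_(i < n) (s + (i.+1)%:R) != 0.
    by move: d0; rewrite mulf_eq0 negb_or => /andP[].
  have s00 : s != 0 by apply: contraTneq s0 => ->; rewrite ltxx.
  rewrite big_ord_recr/=.
  have d2 : s + n.+1%:R != 0.
    have := gam_den n.+2 s0; rewrite big_ord_recr/= mulf_eq0 negb_or => /andP[_].
    by [].
  have -> : 1 + (s + 1) / n%:R = (s + n.+1%:R) / n%:R.
    by rewrite [n.+1%:R]mulrSr; field.
  move: (\prod_(i < n) _) d1 (n.+1%:R : C) d2 (n%:R : C) nC => P P0 m m0 l l0.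
  by move: (cpow _ _) (n`!%:R) => u v; field; rewrite ?l0 ?s00 ?P0 ?m0.
apply/eqP; rewrite -subr_eq0 -cabs_eq0; apply/eqP/le_anti; rewrite cabs_ge0 andbT.
apply/ler_addgt0Pr => e' e0; rewrite add0r.
pose K := cabs (s + 1) + 1; have K0 : 0 < K by rewrite ltr_wpDl ?cabs_ge0.
pose L := cabs (Gamma (s + 1)) + 1; have L0 : 0 < L by rewrite ltr_wpDl ?cabs_ge0.
pose S := cabs s + 1; have S0 : 0 < S by rewrite ltr_wpDl ?cabs_ge0.
have e3 : 0 < e' / 3 by rewrite divr_gt0.
have [N1 h1] := Gamma_cvg s0 (divr_gt0 e3 S0).
have [N2 h2] := Gamma_cvg s1 e3; have [N3 h3] := Gamma_cvg s1 ltr01.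
pose N4 := (Num.truncn (3 * L * K / e')).+1.
pose n := maxn (maxn N1 N2) (maxn N3 N4).
have n1 : (N1 <= n)%N by rewrite (leq_trans _ (leq_maxl _ _))// leq_maxl.
have n2 : (N2 <= n)%N by rewrite (leq_trans _ (leq_maxl _ _))// leq_maxr.
have n3 : (N3 <= n)%N by rewrite (leq_trans _ (leq_maxr _ _))// leq_maxl.
have n4 : (N4 <= n)%N by rewrite (leq_trans _ (leq_maxr _ _))// leq_maxr.
have n0 : (0 < n)%N by apply: leq_trans n4.
have nR : (0 : R) < n%:R by rewrite ltr0n.
have nC : (n%:R : C) != 0 by rewrite pnatr_eq0 -lt0n.
have x0 : 1 + (s + 1) / n%:R != 0.
  apply/eqP => h; have := congr1 (@complex.Re R) h.
  have -> : (s + 1) / n%:R = (n%:R^-1)%:C * (s + 1) by rewrite fmorphV rmorph_nat mulrC.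
  rewrite ReD ReZ/=; have : 0 < n%:R^-1 * Re (s + 1) by rewrite mulr_gt0 ?invr_gt0.
  by clear; lra.
have e5 : s * gam n s = gam n (s + 1) + gam n (s + 1) * ((s + 1) / n%:R).
  by rewrite -[X in X + _]mulr1 -mulrDr e// divfK.
have a1 := h1 n n1; have a2 := h2 n n2; have a3 := h3 n n3.
have a4 : cabs (gam n (s + 1)) <= L.
  have := cabsB_ge (gam n (s + 1)) (Gamma (s + 1)); rewrite /L.
  by move: a3; clear; lra.
have a5 : cabs (gam n (s + 1) * ((s + 1) / n%:R)) <= e' / 3.
  rewrite [cabs (gam _ _ * _)]cabsM [cabs ((s + 1) / _)]cabsM cabsV cabs_nat.
  have : 3 * L * K / e' < n%:R by apply: lt_le_trans (truncnS_gt _) _; rewrite ler_nat.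
  rewrite ltr_pdivrMr// => h.
  have gen (x y : R) : x * (y / n%:R) = x * y / n%:R by rewrite mulrA.
  rewrite gen ler_pdivrMr//.
  apply: (@le_trans _ _ (L * K)); last by move: h; clear; lra.
  by apply: ler_pM; rewrite ?cabs_ge0// /K lerDl.
have a6 : cabs (s * (gam n s - Gamma s)) <= e' / 3.
  rewrite cabsM mulrC; move: a1; rewrite ler_pdivlMr//; apply: le_trans.
  by rewrite ler_wpM2l ?cabs_ge0// /S lerDl.
have -> : Gamma (s + 1) - s * Gamma s = - (gam n (s + 1) - Gamma (s + 1)) +
   s * (gam n s - Gamma s) - gam n (s + 1) * ((s + 1) / n%:R).
  by rewrite mulrBr e5; ring.
apply: le_trans (cabsB _ _) _.
have := cabsD (- (gam n (s + 1) - Gamma (s + 1))) (s * (gam n s - Gamma s)).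
by rewrite cabsN; move: a2 a5 a6; clear; lra.
Qed.

Lemma Gamma1 : Gamma 1 = 1 :> C.
Proof.
have s0 : 0 < Re (1 : C) by rewrite /= ltr01.
apply/eqP; rewrite -subr_eq0 -cabs_eq0; apply/eqP/le_anti; rewrite cabs_ge0 andbT.
apply/ler_addgt0Pr => e e0; rewrite add0r.
have e2 : 0 < e / 2 by rewrite divr_gt0.
have [N1 h1] := Gamma_cvg s0 e2.
pose N4 := (Num.truncn (2 / e)).+1; pose n := maxn N1 N4.
have n0 : (0 < n)%N by apply: leq_trans (leq_maxr _ _).
have nR : (0 : R) < n%:R by rewrite ltr0n.
have n1C : (n.+1%:R : C) != 0 by rewrite pnatr_eq0.
have g : gam n 1 = n%:R / n.+1%:R.
  have c1 : cpow n%:R (1%:R) = n%:R :> C by rewrite cpow_nat// expr1 rmorph_nat.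
  rewrite /gam [cpow _ 1]c1.
  have -> : \prod_(i < n.+1) (1 + i%:R) = (n.+1)`!%:R :> C.
    elim: n.+1 => [|m IH]; first by rewrite big_ord0 fact0.
    by rewrite big_ord_recr/= IH factS natrM mulrC mulrS.
  have f0 : (n`!%:R : C) != 0 by rewrite pnatr_eq0 -lt0n fact_gt0.
  rewrite factS natrM; move: (n.+1%:R : C) n1C (n`!%:R : C) f0 => m m0 u u0.
  by field; rewrite ?m0 ?u0.
have a1 := h1 n (leq_maxl _ _).
have a2 : cabs (gam n 1 - 1) <= e / 2.
  have -> : gam n 1 - 1 = - n.+1%:R^-1.
    by rewrite g; rewrite mulrSr in n1C *; field.
  rewrite cabsN cabsV cabs_nat.
  have : 2 / e < n%:R by apply: lt_le_trans (truncnS_gt _) _; rewrite ler_nat leq_maxr.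
  rewrite ltr_pdivrMr// => h.
  rewrite invf_ple ?posrE ?ltr0n// invf_div ler_pdivrMr// mulrSr.
  by move: h e0; clear; lra.
have := cabsB (gam n 1 - 1) (gam n 1 - Gamma 1).
have -> : gam n 1 - 1 - (gam n 1 - Gamma 1) = Gamma 1 - 1 by ring.
by move: a1 a2; clear; lra.
Qed.

Lemma Gamma_nat n : Gamma n.+1%:R = n`!%:R :> C.
Proof.
elim: n => [|n IH]; first exact: Gamma1.
rewrite mulrSr Gamma_shift ?Re_nat ?ltr0n// IH factS natrM//.
Qed.

Lemma Gamma_le s : 0 < Re s -> cabs (Gamma s) <= cabs (Gamma (Re s)%:C).
Proof.
move=> s0; rewrite -[leLHS]mul1r -[leRHS]mul1r.
apply: (@cabs_lim_le (gam^~ s) (gam^~ (Re s)%:C)) => //; try exact: Gamma_cvg.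
exists 1%N => n n1; rewrite !mul1r !cabs_gam//=.
rewrite ler_wpM2l ?mulr_ge0 ?powR_ge0//.
rewrite lef_pV2 ?posrE -?cabs_prod ?cabs_gt0 ?gam_den// !cabs_prod; apply: ler_prod => i _.
rewrite cabs_ge0/= -(rmorph_nat (real_complex R)) -rmorphD/= cabs_real.
by have := cabs_Re (s + i%:R%:C); rewrite ReD.
Qed.

(** Factor by factor: (B - h + i) |s + i| <= (B + i) |s - h + i|, because |s + i| <= |s - h + i| + h
    and |s - h + i| >= B - h + i. The bound on a shift by h is thus uniform in Im s. *)
Lemma Gamma_ratio s (B h : R) : 0 <= h -> h < B -> B <= Re s ->
  cabs (Gamma B%:C) * cabs (Gamma (s - h%:C)) <= cabs (Gamma (B - h)%:C) * cabs (Gamma s).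
Proof.
move=> h0 hB Bs; have B0 : 0 < B := le_lt_trans h0 hB.
have s0 : 0 < Re s := lt_le_trans B0 Bs.
have sh : 0 < Re (s - h%:C) by rewrite ReD ReN/=; move: hB Bs; clear; lra.
have Bh : 0 < Re (B - h)%:C by rewrite /= subr_gt0.
have B0' : 0 < Re B%:C by [].
rewrite -!cabsM -[leLHS]mul1r -[leRHS]mul1r.
have cvM (u v : nat -> C) l l' :
    (forall e : R, 0 < e -> exists N, forall n, (N <= n)%N -> cabs (u n - l) <= e) ->
    (forall e : R, 0 < e -> exists N, forall n, (N <= n)%N -> cabs (v n - l') <= e) ->
    forall e : R, 0 < e -> exists N, forall n, (N <= n)%N -> cabs (u n * v n - l * l') <= e.
  move=> hu hv e e0; pose K := cabs l + cabs l' + 1.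
  have K0 : 0 < K by rewrite ltr_wpDl// addr_ge0 ?cabs_ge0.
  pose d := Num.min 1 (e / K / 2).
  have d0 : 0 < d by rewrite lt_min ltr01 !divr_gt0.
  have [N1 h1] := hu d d0; have [N2 h2] := hv d d0.
  exists (maxn N1 N2) => n; rewrite geq_max => /andP[/h1 a1 /h2 a2].
  have -> : u n * v n - l * l' = (u n - l) * (v n - l') + (l * (v n - l') + (u n - l) * l') by ring.
  apply: le_trans (cabsD _ _) _; have := cabsD (l * (v n - l')) ((u n - l) * l').
  rewrite !cabsM => a3.
  have b1 : cabs (u n - l) * cabs (v n - l') <= d * 1.
    apply: ler_pM; rewrite ?cabs_ge0//; apply: le_trans a2 _; by rewrite ge_min lexx.
  have b2 : cabs l * cabs (v n - l') <= cabs l * d by rewrite ler_wpM2l ?cabs_ge0.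
  have b3 : cabs (u n - l) * cabs l' <= d * cabs l' by rewrite ler_wpM2r ?cabs_ge0.
  have b4 : d * K <= e / 2.
    rewrite -ler_pdivlMr//; have -> : e / 2 / K = e / K / 2 by rewrite mulrAC.
    by rewrite ge_min lexx orbT.
  by move: a3 b1 b2 b3 b4 e0; rewrite /K; clear; lra.
apply: (@cabs_lim_le (fun n => gam n B%:C * gam n (s - h%:C))
                     (fun n => gam n (B - h)%:C * gam n s)) => //;
  try by apply: cvM; exact: Gamma_cvg.
exists 1%N => n n1; have nR : (0 : R) < n%:R by rewrite ltr0n.
rewrite !mul1r [cabs (_ * _)]cabsM [cabs (gam n (B - h)%:C * _)]cabsM !cabs_gam//.
rewrite ReD ReN /=.
have pd (x y : R) : powR n%:R (x + y) = powR n%:R x * powR n%:R y.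
  by rewrite powRD//; apply/implyP => _; rewrite gt_eqF.
set c := n`!%:R.
have -> : c * powR n%:R B / (\prod_(i < n.+1) cabs (B%:C + i%:R)) *
   (c * powR n%:R (Re s - h) / (\prod_(i < n.+1) cabs (s - h%:C + i%:R))) =
   c * c * powR n%:R (Re s + B - h) *
   (\prod_(i < n.+1) (cabs (B%:C + i%:R) * cabs (s - h%:C + i%:R)))^-1.
  have -> : Re s + B - h = B + (Re s - h) by ring.
  by rewrite (pd B (Re s - h)) big_split/= invfM; ring.
have -> : c * powR n%:R (B - h) / (\prod_(i < n.+1) cabs ((B - h)%:C + i%:R)) *
   (c * powR n%:R (Re s) / (\prod_(i < n.+1) cabs (s + i%:R))) =
   c * c * powR n%:R (Re s + B - h) *
   (\prod_(i < n.+1) (cabs ((B - h)%:C + i%:R) * cabs (s + i%:R)))^-1.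
  have -> : Re s + B - h = (B - h) + Re s by ring.
  by rewrite (pd (B - h) (Re s)) big_split/= invfM; ring.
rewrite ler_wpM2l ?mulr_ge0 ?powR_ge0//.
have gp (w : C) (i : 'I_n.+1) : 0 < Re w -> 0 < cabs (w + i%:R).
  move=> w0; apply: lt_le_trans (le_trans (ler_norm _) (cabs_Re _)).
  by rewrite ReD Re_nat ltr_pwDl.
rewrite lef_pV2 ?posrE; try by apply: prodr_gt0 => i _; rewrite mulr_gt0// gp.
apply: ler_prod => i _; rewrite mulr_ge0 ?cabs_ge0//=.
rewrite -(rmorph_nat (real_complex R)) -!rmorphD/= !cabs_real.
have b1 : 0 < B - h + i%:R by rewrite ltr_pwDl// subr_gt0.
have b2 : 0 < B + i%:R by rewrite ltr_pwDl.
rewrite (gtr0_norm b1) (gtr0_norm b2).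
set w := s - h%:C + i%:R%:C.
have -> : s + i%:R%:C = w + h%:C by rewrite /w; ring.
have wc : B - h + i%:R <= cabs w.
  apply: le_trans (le_trans (ler_norm _) (cabs_Re _)); rewrite !ReD ReN/=.
  by move: Bs; clear; lra.
have := cabsD w h%:C; rewrite cabs_real (ger0_norm h0) => wh.
apply: le_trans (ler_wpM2l (ltW b1) wh) _.
have : h * (B - h + i%:R) <= h * cabs w by rewrite ler_wpM2l.
by clear; lra.
Qed.

(** Factor by factor: |s + i| <= (Re s + i) exp(t^2 / (Re s + i)^2), and the sum of the (Re s +
    i)^(-2) is at most s1^(-2) + 2. A Gaussian lower bound suffices for [xi_lower]. *)
Lemma Gamma_ge s (s1 : R) : 0 < s1 -> s1 <= Re s ->
  cabs (Gamma (Re s)%:C) * expR (- ((s1 ^- 2 + 2) * Im s ^+ 2)) <= cabs (Gamma s).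
Proof.
move=> s10 s1s; have s0 : 0 < Re s := lt_le_trans s10 s1s.
set t := Im s; rewrite mulrC -[leRHS]mul1r.
apply: (@cabs_lim_le (gam^~ (Re s)%:C) (gam^~ s)) => //; try exact: Gamma_cvg.
exists 1%N => n n1; rewrite mul1r !cabs_gam//=.
rewrite mulrCA ler_wpM2l ?mulr_ge0 ?powR_ge0//.
have gp (w : C) (i : 'I_n.+1) : 0 < Re w -> 0 < cabs (w + i%:R).
  move=> w0; apply: lt_le_trans (le_trans (ler_norm _) (cabs_Re _)).
  by rewrite ReD Re_nat ltr_pwDl.
rewrite expRN -invfM lef_pV2 ?posrE -?cabs_prod ?mulr_gt0 ?expR_gt0 ?cabs_gt0 ?gam_den//.
rewrite !cabs_prod.
pose x (i : nat) : R := (Re s + i%:R) ^- 2.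
have step (i : 'I_n.+1) : cabs (s + i%:R) <= cabs ((Re s)%:C + i%:R) * expR (x i * t ^+ 2).
  rewrite -(rmorph_nat (real_complex R)) -rmorphD/= cabs_real.
  have si : 0 < Re s + i%:R by rewrite ltr_pwDl.
  rewrite (gtr0_norm si) -(@ler_pXn2r _ 2)// ?nnegrE ?cabs_ge0 ?mulr_ge0 ?expR_ge0 ?(ltW si)//.
  rewrite cabs_sq ReD ImD/= addr0 exprMn -/t.
  have e1 := expR_ge1Dx (x i * t ^+ 2).
  have x0 : 0 <= x i * t ^+ 2 by rewrite mulr_ge0 ?sqr_ge0// invr_ge0 sqr_ge0.
  have : (Re s + i%:R) ^+ 2 * (1 + x i * t ^+ 2) <= (Re s + i%:R) ^+ 2 * expR (x i * t ^+ 2) ^+ 2.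
    rewrite ler_wpM2l ?sqr_ge0//; apply: le_trans e1 _.
    by rewrite expr2 ler_peMr ?expR_ge0// -[leLHS]expR0 ler_expR.
  rewrite mulrDr mulr1 mulrA /x mulfV ?expf_neq0 ?gt_eqF// mul1r//.
apply: (@le_trans _ _ (\prod_(i < n.+1) (cabs ((Re s)%:C + i%:R) * expR (x i * t ^+ 2)))).
  by apply: ler_prod => i _; rewrite cabs_ge0 step.
rewrite big_split/= mulrC ler_wpM2r ?prodr_ge0// => [i _|]; first exact: cabs_ge0.
have -> : \prod_(i < n.+1) expR (x i * t ^+ 2) = expR ((\sum_(i < n.+1) x i) * t ^+ 2).
  by rewrite mulr_suml expR_sum.
rewrite ler_expR ler_wpM2r ?sqr_ge0// big_ord_recl/=; apply: lerD.
  by rewrite /x addr0 lef_pV2 ?posrE ?exprn_gt0// lerXn2r ?nnegrE// ltW.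
(* The term of index m + 1 is at most 2/(m+1) - 2/(m+2), so the sum telescopes. *)
have tel m : \sum_(i < m) x i.+1 <= 2 - 2 / m.+1%:R.
  elim: m => [|m IH]; first by rewrite big_ord0 divr1 subrr.
  rewrite big_ord_recr/=.
  have p1 : (0 : R) < m.+1%:R by rewrite ltr0n.
  have p2 : (0 : R) < m.+2%:R by rewrite ltr0n.
  have xm : x m.+1 <= 2 / m.+1%:R - 2 / m.+2%:R.
    have -> : 2 / m.+1%:R - 2 / m.+2%:R = (m.+1%:R * m.+2%:R / 2)^-1 :> R.
      rewrite [m.+2%:R]mulrSr; have : (m.+1%:R + 1 : R) != 0 by rewrite -mulrSr gt_eqF.
      by move=> q0; field; rewrite ?q0 ?gt_eqF.
    have q1 : 0 < Re s + m.+1%:R by rewrite ltr_wpDl// ltW.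
    have q2 : 0 < (Re s + m.+1%:R) ^+ 2 by rewrite exprn_gt0.
    have q3 : 0 < m.+1%:R * m.+2%:R / 2 :> R by rewrite divr_gt0// mulr_gt0.
    rewrite /x lef_pV2 ?posrE//.
    have : m.+1%:R ^+ 2 <= (Re s + m.+1%:R) ^+ 2.
      by rewrite lerXn2r ?nnegrE ?addr_ge0 ?lerDr// ltW.
    have : m.+1%:R * m.+2%:R <= 2 * m.+1%:R ^+ 2 :> R.
      rewrite expr2 mulrCA ler_wpM2l ?(ltW p1)// mulrSr.
      by have : (1 : R) <= m.+1%:R by [rewrite ler1n]; clear; lra.
    by clear; lra.
  move: IH xm; move: (2 / m.+1%:R) (2 / m.+2%:R) (\sum_(i < m) _) (x m.+1); clear => a b c d.
  by lra.
apply: le_trans (tel n) _; rewrite gerBl divr_ge0//.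
Qed.

End GammaFunction.

(** * Reindexing series along the multiples of an integer *)

Section Dilation.
Variable R : realType.
Local Notation C := R[i].
Implicit Types (u v : nat -> C) (l : C).

Lemma csum_dilate u l p : (0 < p)%N -> csum u l ->
  csum (fun m => if (p %| m)%N then u (m %/ p)%N else 0) l.
Proof.
move=> p0 h.
have e M : \sum_(m < M) (if (p %| m)%N then u (m %/ p)%N else 0) =
    \sum_(n < (M + p.-1) %/ p) u n.
  elim: M => [|M IH].
    by rewrite add0n divn_small ?prednK// !big_ord0.
  rewrite big_ord_recr/= IH; have [pM|npM] := boolP (p %| M)%N.
    have [m ->] := dvdnP pM; rewrite mulnK//.
    have -> : ((m * p + p.-1) %/ p = m)%N.
      by rewrite divnMDl// divn_small ?addn0// prednK.
    have -> : (((m * p).+1 + p.-1) %/ p = m.+1)%N.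
      by rewrite addSn -addnS prednK// -mulSnr mulnK.
    by rewrite big_ord_recr.
  rewrite addr0; congr (\sum_(n < _) u n).
  have r0 : (0 < M %% p)%N by rewrite lt0n.
  have e1 : (M + p.-1 = (M %/ p).+1 * p + (M %% p).-1)%N.
    by rewrite {1}(divn_eq M p) mulSn; move: r0 p0; lia.
  have e2 : (M.+1 + p.-1 = (M %/ p).+1 * p + (M %% p))%N.
    by rewrite {1}(divn_eq M p) mulSn; move: r0 p0; lia.
  have lt1 := ltn_pmod M p0.
  have lt2 : ((M %% p).-1 < p)%N by apply: leq_ltn_trans (leq_pred _) lt1.
  by rewrite e1 e2 !divnMDl// (divn_small lt1) (divn_small lt2).
move=> d /h[N hN]; exists (N * p)%N => n nN; rewrite e; apply: hN.
rewrite leq_divRL//; apply: leq_trans nN (leq_addr _ _).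
Qed.

Lemma csum_undilate v l p : (0 < p)%N ->
  csum (fun n => if (p %| n)%N then v n else 0) l -> csum (fun m => v (p * m)%N) l.
Proof.
move=> p0 h.
have e M : \sum_(n < p * M) (if (p %| n)%N then v n else 0) = \sum_(m < M) v (p * m)%N.
  elim: M => [|M IH]; first by rewrite muln0 !big_ord0.
  rewrite big_ord_recr/= -IH mulnS addnC.
  rewrite -(big_mkord xpredT (fun n => if (p %| n)%N then v n else 0)).
  rewrite (big_cat_nat (n := (p * M)%N))//=; last exact: leq_addr.
  rewrite big_mkord; congr (_ + _).
  rewrite big_ltn; last by rewrite -addn1 leq_add2l.
  rewrite dvdn_mulr// big_nat big1 ?addr0// => i /andP[i1 i2].
  case: ifP => // /dvdnP[j ej]; move: i1 i2; rewrite ej (mulnC p M) -mulSnr.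
  by rewrite ltn_pmul2r// ltn_pmul2r// => h1; rewrite ltnNge h1.
move=> d /h[N hN]; exists N => n nN; rewrite -e; apply: hN.
by apply: leq_trans nN _; rewrite leq_pmull.
Qed.

Lemma csum_sum (I : Type) (r : seq I) (F : I -> nat -> C) (L : I -> C) :
  (forall i, csum (F i) (L i)) ->
  csum (fun n => \sum_(i <- r) F i n) (\sum_(i <- r) L i).
Proof.
move=> h; elim: r => [|i r IH].
  rewrite big_nil; apply: (@csum_ext _ (fun=> 0)); last exact: csum0.
  by move=> n; rewrite big_nil.
rewrite big_cons; apply: csum_ext (csumD (h i) IH) => n.
by rewrite big_cons.
Qed.

End Dilation.

(** * Hecke operators on Fourier coefficients *)

Section HeckeRelations.
Variable R : realType.
Local Notation C := R[i].
Local Notation Re := complex.Re.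
Local Notation Im := complex.Im.
Implicit Types (f : C -> C) (a : nat -> C) (z : C).

Lemma fourierI f a : (forall z, upper z -> csum (fun n => a n * qpar z ^+ n) (f z)) ->
  fourier_expansion f a.
Proof.
move=> h z z0; have h3 := h z z0.
apply/cvgrPdist_le => /= e e0.
have eR : e = (Re e)%:C by rewrite RRe_real// gtr0_real.
have e0' : 0 < Re e by rewrite -ltcR -eR.
have [N hN] := h3 _ e0'; exists N => // m /= Nm.
have := hN m Nm; rewrite cabsE eR lecR cabs_distC.
congr (cabs (_ - _) <= _); rewrite /series/= big_mkord.
apply: eq_bigr => i _; congr (_ * _).
rewrite -qparMn /qpar; congr cexp.
rewrite -complexiE rmorphM/= rmorph_nat; ring.
Qed.

Lemma hecke_prime k N p f z : prime p -> hecke k N p f z =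
  p%:R ^+ k.-1 * ((if coprime p N then f (p%:R * z) else 0) +
    p%:R ^- k * \sum_(b < p) f ((z + b%:R) / p%:R)).
Proof.
move=> pp; rewrite /hecke; congr (_ * _).
have p0 : (0 < p)%N := prime_gt0 pp.
have -> : divisors p = [:: 1%N; p].
  apply: (irr_sorted_eq ltn_trans ltnn); first exact: sorted_divisors_ltn.
    by rewrite /= andbT prime_gt1.
  move=> d; rewrite -dvdn_divisors// !inE; apply/idP/orP; last first.
    by case=> /eqP ->; rewrite ?dvd1n.
  by case/primeP: pp => _ H /H /orP.
rewrite big_cons big_cons big_nil divn1 divnn p0/= coprime1n addr0.
have -> : 1%:R ^- k * (\sum_(b < 1) f ((p%:R * z + b%:R) / 1%:R)) = f (p%:R * z).
  by rewrite big_ord1 expr1n invr1 mul1r addr0 mulr1.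
have -> : \sum_(b < p) f ((1%:R * z + b%:R) / p%:R) = \sum_(b < p) f ((z + b%:R) / p%:R).
  by apply: eq_bigr => b _; rewrite mul1r.
by case: ifP => //; rewrite add0r.
Qed.

Lemma sum_rootu p n : (0 < p)%N ->
  \sum_(b < p) (rootu R p ^+ b) ^+ n = if (p %| n)%N then p%:R else 0.
Proof.
move=> p0; have e (b : 'I_p) : (rootu R p ^+ b) ^+ n = (rootu R p ^+ n) ^+ b.
  by rewrite -!exprM mulnC.
rewrite (eq_bigr _ (fun b _ => e b)).
have en : rootu R p ^+ n = rootu R p ^+ (n %% p).
  by rewrite {1}(divn_eq n p) exprD mulnC exprM rootu_pow// expr1n mul1r.
case: ifP => [/eqP pn|/negbT pn].
  rewrite en pn expr0; under eq_bigr do rewrite expr1n.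
  by rewrite sumr_const card_ord.
apply: sum_root_pow; first by rewrite -exprM mulnC exprM rootu_pow// expr1n.
by rewrite en rootu_neq1// ltn_pmod// andbT lt0n.
Qed.

Lemma qpar_rat p (b : nat) : (0 < p)%N -> qpar (b%:R / p%:R) = rootu R p ^+ b.
Proof.
move=> p0; have pC : (p%:R : C) = (p%:R)%:C by rewrite rmorph_nat.
rewrite mulrC qparMn; congr (_ ^+ _); rewrite /qpar /rootu; congr cexp.
by rewrite pC -fmorphV [in RHS]rmorphM mulrAC.
Qed.

(** Averaging over b modulo p selects the exponents divisible by p ([sum_rootu]), which gives a(pn);
    the other term of the operator replaces q by q^p. *)
Lemma hecke_fourier k N p f a : (0 < k)%N -> prime p -> fourier_expansion f a ->
  fourier_expansion (hecke k N p f)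
    (fun n => (if coprime p N && (p %| n)%N then p%:R ^+ k.-1 * a (n %/ p)%N else 0) +
              a (p * n)%N).
Proof.
move=> k0 pp hf; apply: fourierI => z z0.
have p0 : (0 < p)%N := prime_gt0 pp.
have pR : (0 : R) < p%:R by rewrite ltr0n.
have up0 (b : 'I_p) : upper (z + b%:R) by move: z0; rewrite /upper ImD Im_nat addr0.
have pC0 : (p%:R : C) != 0 by rewrite pnatr_eq0 -lt0n.
have pC : (p%:R : C) = (p%:R)%:C by rewrite rmorph_nat.
have up (w : C) : upper w -> upper (p%:R * w).
  by rewrite /upper pC ImZ => w0; rewrite mulr_gt0.
have dn (w : C) : upper w -> upper (w / p%:R).
  by rewrite /upper mulrC pC -fmorphV ImZ => w0; rewrite mulr_gt0// invr_gt0.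
rewrite hecke_prime// mulrDr.
have qz (n : nat) : qpar (p%:R * z) ^+ n = qpar z ^+ (p * n).
  by rewrite mulrC qparMn exprM.
have S1 : csum (fun n => (if coprime p N && (p %| n)%N then p%:R ^+ k.-1 * a (n %/ p)%N else 0)
    * qpar z ^+ n) (p%:R ^+ k.-1 * (if coprime p N then f (p%:R * z) else 0)).
  case: ifP => _ /=; last first.
    rewrite mulr0; apply: (@csum_ext _ (fun=> 0)); last exact: csum0.
    by move=> n; rewrite mul0r.
  have h := csumZ (p%:R ^+ k.-1) (csum_dilate p0 (fourierP hf (up _ z0))).
  apply: csum_ext h => n; case: ifP => pn; last by rewrite mulr0 mul0r.
  by rewrite qz mulnC divnK// mulrA.
have S2 : csum (fun n => a (p * n)%N * qpar z ^+ n)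
    (p%:R ^+ k.-1 * (p%:R ^- k * \sum_(b < p) f ((z + b%:R) / p%:R))).
  have hb (b : 'I_p) := fourierP hf (dn _ (up0 b)).
  have h := csumZ (p%:R^-1) (@csum_sum _ _ (index_enum 'I_p) _ _ hb).
  have -> : p%:R ^+ k.-1 * (p%:R ^- k * \sum_(b < p) f ((z + b%:R) / p%:R)) =
      p%:R^-1 * \sum_(b < p) f ((z + b%:R) / p%:R) :> C.
    rewrite mulrA; congr (_ * _); rewrite -{2}(prednK k0) exprS invfM mulrCA mulfV ?mulr1//.
    by rewrite expf_neq0.
  have h' : csum (fun n => if (p %| n)%N then a n * qpar (z / p%:R) ^+ n else 0)
      (p%:R^-1 * \sum_(b < p) f ((z + b%:R) / p%:R)).
    apply: csum_ext h => n.
    have e (b : 'I_p) : a n * qpar ((z + b%:R) / p%:R) ^+ n =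
        a n * qpar (z / p%:R) ^+ n * (rootu R p ^+ b) ^+ n.
      by rewrite mulrDl qparD qpar_rat// exprMn_comm ?mulrA//; exact: mulrC.
    rewrite (eq_bigr _ (fun b _ => e b)) -mulr_sumr sum_rootu//.
    case: ifP => _; last by rewrite !mulr0.
    by rewrite mulrCA mulVf// mulr1.
  apply: csum_ext (csum_undilate p0 h') => n; congr (_ * _).
  by rewrite exprM -qparMn divfK.
by apply: csum_ext (csumD S1 S2) => n; rewrite -mulrDl.
Qed.

Lemma fourier_ext f g a : (forall z, upper z -> f z = g z) ->
  fourier_expansion f a -> fourier_expansion g a.
Proof. by move=> fg h z z0; rewrite -fg//; exact: h. Qed.

(** On the line at height y the constant term is at most sup |f| <= C0 / y^K, and y may tend to
    infinity. *)
Lemma cusp_coef0 N f K a : (0 < N)%N -> (0 < K)%N -> cusp_form K.*2 N f ->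
  fourier_expansion f a -> a 0%N = 0.
Proof.
move=> N0 K0 cf hf; have [C0 C00 hC] := cusp_bound N0 cf.
have b (y : R) : 1 <= y -> cabs (a 0%N) * y <= C0.
  move=> y1; have y0 : 0 < y := lt_le_trans ltr01 y1.
  have S0 : 0 <= C0 / y ^+ K by rewrite divr_ge0 ?exprn_ge0 ?ltW.
  have S1 (x : R) : cabs (f (x +i* y)) <= C0 / y ^+ K.
    by rewrite ler_pdivlMr ?exprn_gt0//; apply: hC.
  have [_] := partial_sums_square hf y0 S0 (isT : (0 < 1)%N) S1.
  rewrite big_ord1 expr0 mulr1 ler_pXn2r ?nnegrE ?cabs_ge0// ler_pdivlMr ?exprn_gt0// => h.
  apply: le_trans h; rewrite ler_wpM2l ?cabs_ge0//.
  by rewrite -(prednK K0) exprS ler_peMr ?exprn_ege1// ltW.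
apply/eqP; rewrite -cabs_eq0; apply: contraT => c0.
have cp : 0 < cabs (a 0%N) by rewrite lt_def c0 cabs_ge0.
have := b (1 + C0 / cabs (a 0%N)); rewrite lerDl (divr_ge0 (ltW C00) (ltW cp)) => /(_ isT).
rewrite mulrDr mulr1 mulrC divfK// => h; exfalso; move: h cp; clear; lra.
Qed.

Definition hecke_relations (k N : nat) a := [/\ a 0%N = 0, a 1%N = 1 &
  forall p n, prime p -> a (p * n)%N =
    a p * a n - (if coprime p N && (p %| n)%N then p%:R ^+ k.-1 * a (n %/ p)%N else 0)].

Lemma hecke_eigen_coef k N p f a la : (0 < k)%N -> prime p -> fourier_expansion f a ->
  (forall z, upper z -> hecke k N p f z = la * f z) -> forall n,
  (if coprime p N && (p %| n)%N then p%:R ^+ k.-1 * a (n %/ p)%N else 0) + a (p * n)%N = la * a n.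
Proof.
move=> k0 pp hf hla n; have h1 := @hecke_fourier k N p f a k0 pp hf.
have h2 : fourier_expansion (hecke k N p f) (fun n => la * a n).
  apply: (@fourier_ext (fun z => la * f z)); first by move=> z /hla.
  apply: fourierI => z z0; apply: csum_ext (csumZ la (fourierP hf z0)) => m.
  by rewrite mulrA.
exact: (congr1 (fun h => h n) (coef_unique h1 h2)).
Qed.

Lemma hecke_eigenvalue_coef k N p f a la : (0 < k)%N -> prime p -> fourier_expansion f a ->
  a 1%N = 1 -> (forall z, upper z -> hecke k N p f z = la * f z) -> la = a p.
Proof.
move=> k0 pp hf a1 hla; have := hecke_eigen_coef k0 pp hf hla 1.
rewrite dvdn1 muln1 a1 mulr1 (negbTE (_ : p != 1%N)) ?andbF ?add0r//.
by rewrite neq_ltn prime_gt1 ?orbT.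
Qed.

Lemma newform_hecke N f K a : (0 < N)%N -> (0 < K)%N -> newform K.*2 N f ->
  fourier_expansion f a -> hecke_relations K.*2 N a.
Proof.
move=> N0 K0 [cf _ hT [b hb b1]] hf.
have ab := coef_unique hf hb; rewrite -{}ab {hb b} in b1.
split=> [||p n pp] //; first exact: cusp_coef0 cf hf.
have k0 : (0 < K.*2)%N by rewrite double_gt0.
have [la hla] := hT p (prime_gt0 pp).
have e := hecke_eigen_coef k0 pp hf hla n.
by rewrite -(hecke_eigenvalue_coef k0 pp hf b1 hla) -e/= addrC addKr.
Qed.

End HeckeRelations.

(** * Sieving a Dirichlet series by primes and the lower bound from the Euler product *)

Section EulerProduct.
Variable R : realType.
Local Notation C := R[i].
Local Notation Re := complex.Re.
Local Notation Im := complex.Im.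
Implicit Types (u v : nat -> C) (a : nat -> C) (s l x y : C).

Lemma csum_cons u l : csum (fun n => u n.+1) l -> csum u (u 0%N + l).
Proof.
move=> h e /h[N hN]; exists N.+1 => -[//|n] nN.
by have := hN n nN; rewrite big_ord_recl/= opprD addrACA subrr add0r.
Qed.

(** Multiplying by the Euler factor subtracts x times the series dilated by p and adds y times the
    series dilated twice. By the recursion all multiples of p cancel. *)
Lemma sieve_step u l p x y : prime p -> csum u l ->
  (forall n, u (p * n)%N = x * u n - (if (p %| n)%N then y * u (n %/ p)%N else 0)) ->
  csum (fun n => if (p %| n)%N then 0 else u n) ((1 - x + y) * l).
Proof.
move=> pp hu rel; have p0 := prime_gt0 pp.
have h1 := csum_dilate p0 hu; have h2 := csum_dilate p0 h1.
have h := csumD (csumD hu (csumZ (- x) h1)) (csumZ y h2).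
have -> : (1 - x + y) * l = l + - x * l + y * l by ring.
apply: csum_ext h => n /=; have [/dvdnP[m ->]|_] := boolP (p %| n)%N; last first.
  by rewrite !mulr0 !addr0.
rewrite mulnK// mulnC rel; case: ifP => _; rewrite ?mulr0; ring.
Qed.

Definition sifted (Q : pred nat) (M n : nat) := has (fun i => Q i.+1 && (i.+1 %| n)%N) (iota 0 M).

Lemma siftedS Q M n : sifted Q M.+1 n = sifted Q M n || (Q M.+1 && (M.+1 %| n)%N).
Proof. by rewrite /sifted -[in LHS]addn1 iotaD add0n has_cat/= orbF. Qed.

Lemma sifted_mul (Q : pred nat) M p n : (forall q, Q q -> prime q) -> prime p -> (M < p)%N ->
  sifted Q M (p * n) = sifted Q M n.
Proof.
move=> hQ pp; elim: M => [//|M IH] Mp; rewrite !siftedS IH 1?ltnW//.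
case: (boolP (Q M.+1)) => //= /hQ pM; rewrite Euclid_dvdM// dvdn_prime2//.
by rewrite (negbTE (_ : M.+1 != p)) // neq_ltn Mp.
Qed.

Lemma sieve (Q : pred nat) u l (x y : nat -> C) M : (forall q, Q q -> prime q) -> csum u l ->
  (forall p n, prime p -> u (p * n)%N =
     x p * u n - (if (p %| n)%N then y p * u (n %/ p)%N else 0)) ->
  csum (fun n => if sifted Q M n then 0 else u n)
    ((\prod_(i < M) (if Q i.+1 then 1 - x i.+1 + y i.+1 else 1)) * l).
Proof.
move=> hQ hu rel; elim: M => [|M IH].
  by rewrite big_ord0 mul1r; exact: hu.
rewrite big_ord_recr/=; case: ifP => QM; last first.
  by rewrite mulr1; apply: csum_ext IH => n; rewrite siftedS QM orbF.
have pM := hQ _ QM.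
rewrite [_ * (_ + _)]mulrC -mulrA.
apply: csum_ext (@sieve_step _ _ M.+1 (x M.+1) (y M.+1) pM IH _) => n.
  by rewrite siftedS QM/=; case: (M.+1 %| n)%N; rewrite ?orbT// orbF.
rewrite (sifted_mul _ hQ)//; case: ifP => hs; last first.
  rewrite rel//; congr (_ - _); case: ifP => // /dvdnP[m em]; move: hs.
  by rewrite em mulnK// mulnC (sifted_mul _ hQ)// => ->.
rewrite mulr0; case: ifP => [/dvdnP[m em]|_]; last by rewrite subrr.
by move: hs; rewrite em mulnK// mulnC (sifted_mul _ hQ)// => ->; rewrite mulr0 subrr.
Qed.

Lemma sifted1 M n : (0 < n <= M)%N -> ~~ sifted prime M n -> n = 1%N.
Proof.
move=> /andP[n0 nM]; apply: contraNeq => n1; apply/hasP.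
have pn : prime (pdiv n) by apply: pdiv_prime; rewrite ltn_neqAle eq_sym n1.
have pS : (pdiv n).-1.+1 = pdiv n by rewrite prednK// prime_gt0.
exists (pdiv n).-1; last by rewrite pS pn pdiv_dvd.
by rewrite mem_iota add0n /= pS; apply: leq_trans (pdiv_leq n0) nM.
Qed.

Lemma hecke_dirichlet a N k s p n : hecke_relations k N a -> prime p ->
  let u n := a n * cpow n%:R (- s) in
  u (p * n)%N = u p * u n -
    (if (p %| n)%N
     then (if coprime p N then p%:R ^+ k.-1 else 0) * (cpow p%:R (- s) * cpow p%:R (- s)) *
          u (n %/ p)%N
     else 0).
Proof.
move=> [a0 _ rel] pp u; have p0 := prime_gt0 pp; have pR : (0 : R) < p%:R by rewrite ltr0n.
case: n => [|n]; first by rewrite muln0 div0n /u a0 mul0r !mulr0 if_same subrr.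
rewrite {1}/u rel// natrM cpowM// ?ltr0n// mulrBl; congr (_ - _).
  by rewrite /u; move: (cpow _ _) (cpow _ _) => c1 c2; ring.
have [pn|] := boolP (p %| n.+1)%N; last by rewrite andbF mul0r.
rewrite andbT; have [m em] := dvdnP pn.
have m0 : (0 < m)%N by rewrite lt0n; apply: contra_eq_neq em => ->.
rewrite em mulnK// natrM cpowM// ?ltr0n// /u.
by case: ifP => _; move: (cpow _ _) (cpow _ _) => c1 c2; ring.
Qed.

(** Multiply the series by the Euler factors D of all primes up to M + 1. What remains is 1 plus a
    tail of size at most 1/2, so |D l| >= 1/2, while |D| <= exp(T + T2) by 1 + t <= exp(t). No
    factor depends on Im s, which gives a uniform bound. *)
Lemma euler_lower a N k l s (s0 T T2 : R) : hecke_relations k N a -> (0 < k)%N ->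
  s0 <= Re s ->
  rsum (fun n => cabs (a n.+1) * powR n.+1%:R (- s0)) T ->
  (forall n, \sum_(i < n) powR i.+1%:R (k.-1%:R - 2 * s0) <= T2) ->
  csum (fun n => a n.+1 * cpow n.+1%:R (- s)) l ->
  expR (- (T + T2)) / 2 <= cabs l.
Proof.
move=> hr; have [a0 a1 _] := hr => k0 ss0 hT hT2 hl.
pose u n := a n * cpow n%:R (- s).
pose x p := a p * cpow p%:R (- s).
pose y p := (if coprime p N then p%:R ^+ k.-1 else 0) * (cpow p%:R (- s) * cpow p%:R (- s)).
have u0 : u 0%N = 0 by rewrite /u a0 mul0r.
have hu : csum u l by rewrite -[l]add0r -u0; exact: csum_cons hl.
have relu p n : prime p -> u (p * n)%N =
    x p * u n - (if (p %| n)%N then y p * u (n %/ p)%N else 0).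
  by move=> pp; exact: (hecke_dirichlet s n hr pp).
have b0 n : 0 <= cabs (a n.+1) * powR n.+1%:R (- s0).
  by rewrite mulr_ge0 ?cabs_ge0 ?powR_ge0.
have ub n : cabs (u n.+1) <= cabs (a n.+1) * powR n.+1%:R (- s0).
  rewrite /u cabsM ler_wpM2l ?cabs_ge0// cabs_cpow ?ltr0n// ReN.
  by apply: ler_powR; [rewrite ler1n|rewrite lerN2].
have [M hM] := hT.2 (1 / 2) (divr_gt0 ltr01 (ltr0Sn _ 1)).
pose D := \prod_(i < M.+1) (if prime i.+1 then 1 - x i.+1 + y i.+1 else 1).
have hD : csum (fun n => if sifted prime M.+1 n then 0 else u n) (D * l) by exact: sieve.
have DL : 1 / 2 <= cabs (D * l).
  have h1 := csum_shift (csum_shift hD); rewrite u0 if_same subr0 in h1.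
  have s1 : sifted prime M.+1 1 = false.
    apply/hasP => -[i _ /andP[pi]]; rewrite dvdn1 => /eqP i1.
    by move: pi; rewrite i1.
  rewrite s1 /u a1 cpow1 mul1r in h1.
  (* An index from 2 to M has a prime factor at most M and is sifted out; only the tail beyond M is
     left to bound. *)
  pose b n := if (n < M)%N then 0 else cabs (a n.+1) * powR n.+1%:R (- s0).
  have sb n : (M <= n)%N -> \sum_(i < n) b i =
      \sum_(i < n) cabs (a i.+1) * powR i.+1%:R (- s0) -
      \sum_(i < M) cabs (a i.+1) * powR i.+1%:R (- s0).
    move=> Mn; rewrite -(subnKC Mn) big_split_ord/= big1 ?add0r => [|i _]; last first.
      by rewrite /b ltn_ord.
    rewrite [in RHS]big_split_ord/= addrC addrK; apply: eq_bigr => i _.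
    by rewrite /b ltnNge leq_addr.
  have sbT n : \sum_(i < n) b i <= 1 / 2.
    have bi i : 0 <= b i by rewrite /b; case: ifP.
    apply: (@le_trans _ _ (\sum_(i < n + M) b i)).
      by rewrite big_split_ord/= lerDl sumr_ge0.
    rewrite sb ?leq_addl//; have := hM M (leqnn M); have := hT.1 (n + M)%N.
    by clear; lra.
  have : cabs (D * l - 1) <= 1 / 2.
    apply: csum_bound h1 _ => n; apply: le_trans (cabs_sum _ _ _) _.
    apply: le_trans (sbT n.+1); rewrite big_ord_recl/= ler_wpDl//.
      by rewrite /b; case: ifP.
    apply: ler_sum => i _; rewrite /b /bump/= add1n.
    have [hs|/negbTE hs] := boolP (sifted prime M.+1 i.+2).
      by rewrite cabs0; case: ifP.
    case: ifP => iM; last by exact: ub.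
    by have := @sifted1 M.+1 i.+2; rewrite hs/= ltnS (ltnW iM) => /(_ isT isT).
  have := cabsB 1 (1 - D * l); rewrite subKr cabs1 -[cabs (1 - _)]cabs_distC => h2 h3.
  have := cabsB (D * l) (D * l - 1); rewrite subKr cabs1 => h4.
  by move: h3 h4; clear; lra.
have DT : cabs D <= expR (T + T2).
  pose t i := cabs (a i.+1) * powR i.+1%:R (- s0) + powR i.+1%:R (k.-1%:R - 2 * s0).
  have t0 i : 0 <= t i by rewrite addr_ge0 ?powR_ge0.
  apply: (@le_trans _ _ (expR (\sum_(i < M.+1) t i))); last first.
    by rewrite ler_expR big_split/= lerD ?hT2//; exact: hT.1.
  rewrite /D cabs_prod expR_sum; apply: ler_prod => i _; rewrite cabs_ge0/=.
  have eb : 1 + t i <= expR (t i) by exact: expR_ge1Dx.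
  case: ifP => pi; last by rewrite cabs1; apply: le_trans eb; rewrite lerDl.
  apply: le_trans eb; apply: le_trans (cabsD _ _) _.
  rewrite /t addrA; apply: lerD.
    by apply: le_trans (cabsB _ _) _; rewrite cabs1 lerD2l; exact: (ub i).
  have iR : (0 : R) < i.+1%:R by rewrite ltr0n.
  rewrite /y; case: ifP => _; last by rewrite mul0r cabs0 powR_ge0.
  rewrite cabsM cabsM cabsX cabs_nat cabs_cpow// -powR_mulrn ?ler0n// -!powRD; last 2 first.
  - by rewrite (gt_eqF iR) implybT.
  - by rewrite (gt_eqF iR) implybT.
  apply: ler_powR; first by rewrite ler1n.
  by rewrite ReN; move: ss0; clear; lra.
have Dp : 0 < cabs D.
  by rewrite cabs_gt0; apply: contraTneq DL => ->; rewrite mul0r cabs0 -ltNge; clear; lra.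
rewrite -(ler_pM2l Dp) -cabsM; apply: le_trans DL.
rewrite expRN mulrA ler_pM2r ?invr_gt0// ler_pdivrMr ?expR_gt0// mul1r//.
Qed.

End EulerProduct.

(** * The L-series beyond its first half-plane of convergence *)

Section DirichletContinuation.
Variable R : realType.
Local Notation C := R[i].
Local Notation Re := complex.Re.
Local Notation Im := complex.Im.
Implicit Types (L : C -> C) (a : nat -> C) (s w l p : C) (K N : nat).

Lemma rect_cabs p (r : R) w : 0 < r ->
  rect (Re p - r) (Re p + r) (Im p - r) (Im p + r) w ->
  cabs w <= `|Re p| + `|Im p| + 2 * r.
Proof.
move=> r0 /andP[/andP[h1 h2] /andP[h3 h4]]; apply: le_trans (cabs_le w) _.
have e (x y : R) : y - r <= x -> x <= y + r -> `|x| <= `|y| + r.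
  move=> a1 a2; rewrite ler_norml; have := ler_norm y; have := ler_norm (- y).
  by rewrite normrN; move: a1 a2; clear; lra.
by have := e _ _ h1 h2; have := e _ _ h3 h4; clear; lra.
Qed.

(** The series converges locally uniformly in the larger half-plane, so its sum is holomorphic
    there; it agrees with L far to the right, hence everywhere in that half-plane. *)
Lemma series_halfplane (u : nat -> C -> C) L (K0 K1 : R) :
  (forall n s, K0 < Re s -> cdiff (u n) s) ->
  (forall s1 B : R, K0 < s1 -> exists b : nat -> R, exists2 T, rsum b T &
     forall n s, s1 <= Re s -> cabs s <= B -> cabs (u n s) <= b n) ->
  (forall s, cdiff L s) ->
  (forall s, K1 < Re s -> csum (u^~ s) (L s)) ->
  forall s, K0 < Re s -> csum (u^~ s) (L s).
Proof.
move=> hu hb hL h1; pose F s := xget 0 [set l | csum (u^~ s) l].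
have hF s : K0 < Re s -> csum (u^~ s) (F s).
  move=> s0; have [b [T hT hbn]] := hb _ (cabs s) s0.
  have [l hl _] := mtest (fun n => hbn n s (lexx _) (lexx _)) hT.
  exact: (xgetPex 0 (ex_intro _ l hl)).
have dF p : K0 < Re p -> cdiff F p.
  move=> p0; pose r := (Re p - K0) / 2.
  have r0 : 0 < r by rewrite divr_gt0// subr_gt0.
  have k1 : K0 < Re p - r by rewrite /r; move: p0; clear; lra.
  have [b [T hT hbn]] := hb _ (`|Re p| + `|Im p| + 2 * r) k1.
  have inR w : rect (Re p - r) (Re p + r) (Im p - r) (Im p + r) w -> Re p - r <= Re w.
    by move=> /andP[/andP[]].
  apply: (@csum_diff _ u F b T p r r0) hT _ => [n w hw|n w hw|w hw].
  - exact: hu (lt_le_trans k1 (inR _ hw)).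
  - exact: hbn (inR _ hw) (rect_cabs r0 hw).
  - exact: hF (lt_le_trans k1 (inR _ hw)).
move=> s s0; suff -> : L s = F s by exact: hF.
apply/eqP; rewrite -subr_eq0; apply/eqP.
apply: (@identity_halfplane _ (fun s => L s - F s) K0 (Num.max K0 K1)) => // {s0}s.
  by move=> s0; apply: cdiffB; [exact: hL|exact: dF].
by rewrite gt_max => /andP[s0 s1]; rewrite (csum_unique (h1 s s1) (hF s s0)) subrr.
Qed.

Lemma abel_sum a (x : nat -> C) n : a 0%N = 0 ->
  \sum_(i < n) (\sum_(m < i.+2) a m) * (x i - x i.+1) =
  \sum_(i < n) a i.+1 * x i - (\sum_(m < n.+1) a m) * x n.
Proof.
move=> a0; elim: n => [|n IH].
  by rewrite !big_ord0 big_ord1 a0 mul0r subrr.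
rewrite !big_ord_recr/= in IH *; rewrite IH; ring.
Qed.

(** The properties of L and its coefficients that later arguments use in place of the modular
    form. *)
Definition Lseries K N a L := [/\ hecke_relations K.*2 N a,
  forall s : R, K%:R + 1 / 2 < s ->
    exists T, rsum (fun n => cabs (a n.+1) * powR n.+1%:R (- s)) T,
  exists2 A : R, 0 < A & forall s : R, K%:R < s -> forall n,
    \sum_(i < n) cabs (\sum_(m < i.+2) a m) * powR i.+1%:R (- (s + 1)) <=
    A / (1 - powR 2 (K%:R - s)),
  forall s, cdiff L s &
  forall s, K%:R + 1 < Re s -> csum (fun n => a n.+1 * cpow n.+1%:R (- s)) (L s)].

Lemma newform_Lseries K N f L : (0 < N)%N -> (0 < K)%N -> newform K.*2 N f ->
  is_Lfunction K.*2 f L -> exists2 a, fourier_expansion f a & Lseries K N a L.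
Proof.
move=> N0 K0 nf [eL [a ha hL]]; have cf := let: And4 h _ _ _ := nf in h.
have hC := cusp_bound N0 cf; exists a => //; split.
- exact: newform_hecke ha.
- exact: dirichlet_abs ha hC.
- exact: dirichlet_cond ha hC.
- by move=> s; exact: cdifferentiableP (eL s).
- move=> s hs; apply: csum_toP; apply: hL.
  by rewrite -mul2n natrM mulrC mulKf ?pnatr_eq0.
Qed.

Lemma Lseries_abs K N a L : Lseries K N a L -> forall s, K%:R + 1 / 2 < Re s ->
  csum (fun n => a n.+1 * cpow n.+1%:R (- s)) (L s).
Proof.
move=> [_ hT _ dL hL]; have n0 n : (0 : R) < n.+1%:R by rewrite ltr0n.
apply: (@series_halfplane (fun n s => a n.+1 * cpow n.+1%:R (- s)) L _ (K%:R + 1)) => //.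
  move=> n s _; apply: cdiffM; first exact: cdiff_cst.
  by apply: cdiff_comp; [exact: cdiffN (cdiff_id _)|exact: cdiff_cpow].
move=> s1 B h1; have [T rT] := hT _ h1.
exists (fun n => cabs (a n.+1) * powR n.+1%:R (- s1)); exists T => // n s s1s _.
rewrite cabsM ler_wpM2l ?cabs_ge0// cabs_cpow// ReN.
by apply: ler_powR; [rewrite ler1n|rewrite lerN2].
Qed.

Lemma Lseries_bound K N a L (s1 : R) : Lseries K N a L -> K%:R + 1 / 2 < s1 ->
  exists2 T : R, 0 < T & forall s, s1 <= Re s -> cabs (L s) <= T.
Proof.
move=> hL h1; have [_ /(_ _ h1)[T rT] _ _ _] := hL.
exists (T + 1).
  by rewrite ltr_wpDl// (rsum_ge0 _ rT)// => n; rewrite mulr_ge0 ?cabs_ge0 ?powR_ge0.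
move=> s s1s; apply: (@le_trans _ _ T); last by rewrite lerDl.
have hs := Lseries_abs hL (lt_le_trans h1 s1s).
apply: mtest_bound rT hs => n.
rewrite cabsM ler_wpM2l ?cabs_ge0// cabs_cpow ?ltr0n// ReN.
by apply: ler_powR; [rewrite ler1n|rewrite lerN2].
Qed.

Lemma Lseries_lower K N a L (s1 : R) : (0 < K)%N -> Lseries K N a L -> K%:R + 1 / 2 < s1 ->
  exists2 c : R, 0 < c & forall s, s1 <= Re s -> c <= cabs (L s).
Proof.
move=> K0 hL h1; have [hr /(_ _ h1)[T rT] _ _ _] := hL.
(* The second-order terms of the Euler factors have size p^(2K - 1 - 2 s1), which is summable for s1
   > K; [dyadic_sum] for the constant sequence 1 supplies the bound [T2]. *)
have [|||A A0 hA] := @dyadic_sum R (fun=> 1) 1 1 => //.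
  by move=> X X0; rewrite expr1n sumr_const card_ord expr1 mul1r.
have k1 : (1%:R + 1) / 2 < 2 * s1 - K.*2.-1%:R.
  rewrite -subn1 natrB ?double_gt0// -mul2n natrM; move: h1; clear; lra.
have hA' n := hA _ k1 n.
pose T2 := A / (1 - powR 2 ((1%:R + 1) / 2 - (2 * s1 - K.*2.-1%:R))); rewrite -/T2 in hA'.
exists (expR (- (T + T2)) / 2); first by rewrite divr_gt0 ?expR_gt0.
move=> s s1s; have hs := Lseries_abs hL (lt_le_trans h1 s1s).
apply: euler_lower hr _ s1s rT _ hs; first by rewrite double_gt0.
move=> n; apply: (le_trans _ (hA' n)); apply: ler_sum => i _.
by rewrite mul1r opprB.
Qed.

(** Abel summation. For Re s > K + 3 the boundary terms vanish, because the partial sums of the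
    coefficients are O(n^(K+2)); [series_halfplane] carries the formula to Re s > K. *)
Lemma Lseries_cond K N a L : Lseries K N a L -> forall s, K%:R < Re s ->
  csum (fun n => (\sum_(m < n.+2) a m) * (cpow n.+1%:R (- s) - cpow n.+2%:R (- s))) (L s).
Proof.
move=> [[a0 _ _] hT [A A0 hA] dL hL]; have n0 n : (0 : R) < n.+1%:R by rewrite ltr0n.
pose S n := cabs (\sum_(m < n.+2) a m).
have tail (s1 : R) : K%:R < s1 -> exists T, rsum (fun n => S n * powR n.+1%:R (- (s1 + 1))) T.
  move=> h1; apply: rsum_ex; first by move=> n; rewrite mulr_ge0 ?cabs_ge0 ?powR_ge0.
  by exists (A / (1 - powR 2 (K%:R - s1))) => n; exact: hA.
apply: (@series_halfplane (fun n s =>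
   (\sum_(m < n.+2) a m) * (cpow n.+1%:R (- s) - cpow n.+2%:R (- s))) L _ (K%:R + 3)) => //.
- move=> n s _; apply: cdiffM; first exact: cdiff_cst.
  by apply: cdiffB; apply: cdiff_comp; [exact: cdiffN (cdiff_id _)|exact: cdiff_cpow|
     exact: cdiffN (cdiff_id _)|exact: cdiff_cpow].
- move=> s1 B h1; have [T [rT1 rT2]] := tail _ h1.
  have B0 : 0 <= `|B| by [].
  exists (fun n => 2 * `|B| * (S n * powR n.+1%:R (- (s1 + 1)))).
  exists (2 * `|B| * T).
    split=> [n|e e0]; first by rewrite -mulr_sumr ler_wpM2l// mulr_ge0.
    have c0 : 0 < 2 * `|B| + 1 by rewrite ltr_wpDl// mulr_ge0.
    have [M hM] := rT2 _ (divr_gt0 e0 c0); exists M => n /hM.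
    rewrite -mulr_sumr -mulrBr ler_pdivlMr// mulrC; apply: le_trans.
    by rewrite ler_wpM2r ?subr_ge0// lerDl.
  move=> n s s1s sB; rewrite cabsM mulrCA ler_wpM2l ?cabs_ge0//.
  have s0 : 0 <= Re s by apply: le_trans s1s; apply: ltW; apply: le_lt_trans h1.
  apply: le_trans (cpow_diff n s0) _; apply: ler_pM; rewrite ?mulr_ge0 ?cabs_ge0 ?powR_ge0//.
    by rewrite ler_wpM2l//; apply: le_trans sB (ler_norm _).
  by apply: ler_powR; [rewrite ler1n|rewrite lerN2 lerD2r].
move=> s hs e e0.
have k1 : K%:R < (K%:R + 1 : R) by rewrite ltrDl.
have [T rT] := tail _ k1.
have T0 : 0 <= T by apply: rsum_ge0 rT => n; rewrite mulr_ge0 ?cabs_ge0 ?powR_ge0.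
have st n : S n * powR n.+1%:R (- (K%:R + 1 + 1)) <= T.
  apply: le_trans (rT.1 n.+1); rewrite big_ord_recr/= lerDr sumr_ge0// => i _.
  by rewrite mulr_ge0 ?cabs_ge0 ?powR_ge0.
have e2 : 0 < e / 2 by rewrite divr_gt0.
have hs' : K%:R + 1 < Re s by move: hs; clear; lra.
have [M1 hM1] := hL s hs' _ e2.
pose M2 := (Num.truncn (2 * T / e)).+1.
exists (maxn M1 M2).+1 => -[//|n]; rewrite ltnS geq_max => /andP[n1 n2].
rewrite (@abel_sum a (fun i => cpow i.+1%:R (- s)) n.+1 a0); have := hM1 n.+1 (leqW n1).
move: (\sum_(i < n.+1) _) => v hv; rewrite addrAC; apply: le_trans (cabsB _ _) _.
have : cabs ((\sum_(m < n.+2) a m) * cpow n.+2%:R (- s)) <= e / 2; last first.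
  by move: hv; clear; lra.
rewrite cabsM cabs_cpow// ReN -/(S n).
have h2 : 2 * T / e < n.+1%:R.
  by apply: lt_le_trans (truncnS_gt _) _; rewrite ler_nat ltnW.
apply: (@le_trans _ _ (T / n.+1%:R)); last first.
  rewrite ler_pdivrMr//; move: h2; rewrite ltr_pdivrMr// => h2.
  by move: h2; clear; lra.
rewrite -[n.+1%:R^-1]powR_inv1 ?ler0n//.
apply: (@le_trans _ _ (S n * (powR n.+1%:R (- (K%:R + 1 + 1)) * powR n.+1%:R (- 1)))); last first.
  by rewrite mulrA ler_wpM2r ?powR_ge0.
rewrite ler_wpM2l ?cabs_ge0// -powRD; last by rewrite (gt_eqF (n0 n)) implybT.
apply: (@le_trans _ _ (powR n.+1%:R (- Re s))); last first.
  by apply: ler_powR; [rewrite ler1n|move: hs; clear; lra].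
rewrite powRN powRN lef_pV2 ?posrE ?powR_gt0//.
apply: ge0_ler_powR; rewrite ?nnegrE ?ler0n ?ler_nat//.
by apply: le_trans (ltW hs); rewrite addr_ge0.
Qed.

Lemma one_sub_powR2 (x : R) : 0 < x -> x / (2 * (x + 1)) <= 1 - powR 2 (- x).
Proof.
move=> x0; have l2 : 1 / 2 <= ln (2 : R).
  have := @le_ln1Dx R (- (1 / 2)); rewrite -[1 - _](_ : 2^-1 = _); last by field.
  rewrite lnV ?posrE//; move=> h; have := h ltac:(lra); clear; lra.
have := expR_ge1Dx (x * ln 2); rewrite /powR pnatr_eq0/= mulNr expRN => h.
have y0 : x / 2 <= x * ln 2 by rewrite ler_wpM2l ?(ltW x0)//; move: l2; clear; lra.
have e1 : (expR (x * ln 2))^-1 <= (1 + x / 2)^-1.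
  rewrite lef_pV2 ?posrE ?expR_gt0//; last by move: x0; clear; lra.
  by move: h y0; clear; lra.
apply: (@le_trans _ _ (1 - (1 + x / 2)^-1)); last by rewrite lerD2l lerN2.
have -> : 1 - (1 + x / 2)^-1 = x / (2 + x) by field; rewrite !gt_eqF//; move: x0; clear; lra.
rewrite ler_pdivrMr; last by move: x0; clear; lra.
rewrite mulrAC ler_pdivlMr; last by move: x0; clear; lra.
by rewrite ler_pM2l//; move: x0; clear; lra.
Qed.

(** [Lseries_cond] with the explicit constant of [dyadic_sum]: near the line Re s = K the
    denominator 1 - 2^(K - Re s) is at least of the order of Re s - K. *)
Lemma Lseries_growth K N a L : Lseries K N a L -> exists2 A : R, 0 < A &
  forall s, K%:R < Re s -> (Re s - K%:R) * cabs (L s) <= A * (Re s - K%:R + 1) * cabs s.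
Proof.
move=> hL; have [_ _ [A A0 hA] _ _] := hL; exists (4 * A) => [|s hs].
  by rewrite mulr_gt0.
have s0 : 0 <= Re s by apply: ltW; apply: le_lt_trans hs.
pose x := Re s - K%:R; have x0 : 0 < x by rewrite subr_gt0.
have hx := one_sub_powR2 x0; have x1 : 0 < 2 * (x + 1) by move: x0; clear; lra.
set D := 1 - _ in hx; have D0 : 0 < D by apply: lt_le_trans hx; rewrite divr_gt0.
have b1 : cabs (L s) <= 2 * cabs s * (A / D).
  have h := Lseries_cond hL hs; apply: csum_bound h _ => n.
  apply: le_trans (cabs_sum _ _ _) _.
  have := hA _ hs n; rewrite -(opprB (Re s) K%:R) -/x -/D => h2.
  apply: (@le_trans _ _ (2 * cabs s * (\sum_(i < n) cabs (\sum_(m < i.+2) a m) *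
      powR i.+1%:R (- (Re s + 1))))); last by rewrite ler_wpM2l// mulr_ge0 ?cabs_ge0.
  rewrite mulr_sumr; apply: ler_sum => i _; rewrite cabsM [leRHS]mulrCA.
  by rewrite ler_wpM2l ?cabs_ge0//; exact: cpow_diff.
rewrite -/x; have b2 : x <= 2 * (x + 1) * D by move: hx; rewrite ler_pdivrMr// mulrC.
apply: (@le_trans _ _ (2 * (x + 1) * D * (2 * cabs s * (A / D)))).
  by apply: ler_pM; rewrite ?cabs_ge0 ?(ltW x0).
rewrite le_eqVlt; apply/orP; left; apply/eqP; field.
by rewrite gt_eqF.
Qed.

Lemma Lseries_conj K N a L : Lseries K N a L -> (forall n, cj (a n) = a n) ->
  forall s, L (cj s) = cj (L s).
Proof.
move=> [_ _ _ dL hL] ha s.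
pose H s := cj (L (cj s)) - L s.
have dH w : cdiff H w by apply: cdiffB => //; exact: cdiff_conj.
have H0 : H s = 0.
  apply: (@identity_halfplane _ H (Re s - 1) (K%:R + 1)); first by move=> w _.
    move=> w hw; have hw' : K%:R + 1 < Re (cj w) by rewrite ReJ.
    apply/eqP; rewrite subr_eq0; apply/eqP.
    apply: csum_unique (hL w hw); apply: csum_ext (csum_conj (hL _ hw')) => n.
    have -> : cpow n.+1%:R (- w) = cj (cpow n.+1%:R (- cj w)).
      by rewrite -cpow_conj rmorphN/= conjcK.
    by rewrite -[in RHS]ha -rmorphM.
  by rewrite ltrBlDr ltrDl.
by move/eqP: H0; rewrite subr_eq0 => /eqP <-; rewrite conjcK.
Qed.

End DirichletContinuation.

(** * The completed L-function, centred at its point of symmetry *)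

Section CompletedFunction.
Variable R : realType.
Local Notation C := R[i].
Local Notation Re := complex.Re.
Local Notation Im := complex.Im.
Implicit Types (L xi : C -> C) (a : nat -> C) (s w v eps : C) (K N : nat) (B d h : R).

(** The analytic input of the zero argument. The line Re w = 1/2 is the edge of absolute convergence
    of the L-series. Growth, shift ratio and Gaussian lower bound together make Phragmen-Lindelof
    applicable to quotients of such functions. *)
Record xi_like eps xi : Prop := XiLike {
  xi_diff : forall w, cdiff xi w;
  xi_symm : forall w, xi (- w) = eps * xi w;
  xi_neq0 : forall w, 1 / 2 < Re w -> xi w != 0;
  xi_growth : forall B, exists2 A : R, 0 < A & forall w, `|Re w| <= B ->
    cabs (xi w) <= A * (1 + `|Im w|);
  xi_ratio : forall h, 0 <= h -> exists B, exists2 A : R, 0 < A & forall v,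
    B <= Re v -> cabs (xi (v - h%:C)) <= A * cabs (xi v);
  xi_lower : forall d B, 0 < d -> exists2 c : R, 0 < c & exists2 A : R, 0 < A &
    forall v, 1 / 2 + d <= Re v <= B -> c * expR (- (A * Im v ^+ 2)) <= cabs (xi v) }.

(** Where Re w <= -K the Gamma factor meets its poles, at which Euler's limit is no meaningful
    value; there the function is defined through its functional equation. [Xi_left] shows that this
    second formula is valid for all Re w < K. *)
Definition Xi N K L eps w : C :=
  if 0 < Re w + K%:R then Lambda N L (K%:R + w) else eps * Lambda N L (K%:R - w).

Lemma not_pole s : 0 < Re s -> ~ Gamma_pole s.
Proof.
move=> s0 [n e]; move: s0; rewrite e ReN Re_nat oppr_gt0 ltNge ler0n//.
Qed.

Lemma eps_sq K N L eps : is_root_number K N L eps -> eps * eps = 1.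
Proof. by move=> [[->|->] _]; rewrite ?mulr1 ?mulrNN ?mulr1. Qed.

Lemma cabs_eps K N L eps : is_root_number K N L eps -> cabs eps = 1.
Proof. by move=> [[->|->] _]; rewrite ?cabsN cabs1. Qed.

Lemma Xi_right N K L eps w : 0 < Re w + K%:R -> Xi N K L eps w = Lambda N L (K%:R + w).
Proof. by rewrite /Xi => ->. Qed.

Lemma Xi_left N K L eps w : is_root_number K.*2 N L eps -> Re w < K%:R ->
  Xi N K L eps w = eps * Lambda N L (K%:R - w).
Proof.
move=> [_ he] wK; rewrite /Xi; case: ifP => // w0.
have e : K.*2%:R - (K%:R + w) = K%:R - w :> C by rewrite -addnn natrD; ring.
rewrite he ?e//; apply: not_pole; rewrite ?ReD ?ReN Re_nat ?subr_gt0//.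
by rewrite addrC.
Qed.

Lemma Xi_symm N K L eps w : is_root_number K.*2 N L eps -> (0 < K)%N ->
  Xi N K L eps (- w) = eps * Xi N K L eps w.
Proof.
move=> he K0; have K0R : (0 : R) < K%:R by rewrite ltr0n.
have [wK|Kw] := ltP (Re w) K%:R.
  rewrite (Xi_left he wK) mulrA (eps_sq he) mul1r Xi_right//.
  by rewrite ReN addrC subr_gt0.
have h1 : 0 < Re w + K%:R by move: Kw K0R; clear; lra.
have h2 : Re (- w) < K%:R by rewrite ReN; move: Kw K0R; clear; lra.
by rewrite (Xi_right _ _ _ h1) (Xi_left he h2) opprK.
Qed.

Lemma conductor_gt0 N : (0 < N)%N -> (0 : R) < Num.sqrt N%:R / (2 * pi).
Proof.
by move=> N0; rewrite divr_gt0 ?sqrtr_gt0 ?ltr0n// mulr_gt0// pi_gt0.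
Qed.

Lemma cdiff_Lambda N L s : (forall s, cdiff L s) -> 0 < Re s -> cdiff (Lambda N L) s.
Proof.
move=> dL s0; apply: cdiffM => //.
by apply: cdiffM; [exact: cdiff_cpow|exact: cdiff_Gamma].
Qed.

Lemma cdiff_affine (F : C -> C) (p q : C) w : cdiff F (p + q * w) ->
  cdiff (fun w => F (p + q * w)) w.
Proof.
move=> h; apply: (@cdiff_comp _ (fun w => p + q * w) F) => //.
by apply: cdiffD; [exact: cdiff_cst|apply: cdiffM; [exact: cdiff_cst|exact: cdiff_id]].
Qed.

Lemma Xi_diff N K L eps w : is_root_number K.*2 N L eps -> (forall s, cdiff L s) ->
  (0 < K)%N -> cdiff (Xi N K L eps) w.
Proof.
move=> he dL K0; have K0R : (0 : R) < K%:R by rewrite ltr0n.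
have near (v u : C) : cabs (v - u) < K%:R -> `|Re v - Re u| < K%:R.
  by apply: le_lt_trans; rewrite -ReN -ReD cabs_Re.
have [w0|w0] := leP 0 (Re w).
  apply: (@cdiff_ext _ (fun w => Lambda N L (K%:R + 1 * w)) _ _ _ K0R).
    move=> v /near; rewrite ltr_norml => /andP[h _]; rewrite mul1r Xi_right//.
    by move: h w0; clear; lra.
  apply: cdiff_affine; apply: cdiff_Lambda => //.
  by rewrite mul1r ReD Re_nat; move: K0R w0; clear; lra.
apply: (@cdiff_ext _ (fun w => eps * Lambda N L (K%:R + (- 1) * w)) _ _ _ K0R).
  move=> v /near; rewrite ltr_norml => /andP[_ h]; rewrite mulN1r (Xi_left he)//.
  by move: h w0; clear; lra.
apply: cdiffM; first exact: cdiff_cst.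
apply: cdiff_affine; apply: cdiff_Lambda => //.
by rewrite mulN1r ReD ReN Re_nat; move: K0R w0; clear; lra.
Qed.

Lemma cabs_Lambda N L s : (0 < N)%N -> cabs (Lambda N L s) =
  powR (Num.sqrt N%:R / (2 * pi)) (Re s) * cabs (Gamma s) * cabs (L s).
Proof. by move=> N0; rewrite /Lambda cabsM cabsM cabs_cpow// conductor_gt0. Qed.

Lemma Gamma_factor_bounds (Q x1 x2 : R) : 0 < Q -> 0 < x1 -> x1 <= x2 ->
  exists2 M : R, 0 < M & forall x, x1 <= x <= x2 ->
    powR Q x * cabs (Gamma (x%:C : C)) <= M /\ M^-1 <= powR Q x * cabs (Gamma (x%:C : C)).
Proof.
move=> Q0 x10 x12; pose G (s : C) := cpow Q s * Gamma s.
have inR (s : C) : rect x1 x2 0 0 s -> 0 < Re s.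
  by move=> /andP[/andP[h _] _]; exact: lt_le_trans h.
have dG s : 0 < Re s -> cdiff G s.
  by move=> s0; apply: cdiffM; [exact: cdiff_cpow|exact: cdiff_Gamma].
have G0 s : 0 < Re s -> G s != 0 by move=> s0; rewrite mulf_neq0 ?cpow_neq0 ?Gamma_neq0.
have [M1 M10 h1] := @rect_bounded _ G x1 x2 0 0 x12 (lexx _) (fun z hz => cdiff_cont (dG z (inR z hz))).
have [M2 M20 h2] := @rect_bounded _ (fun s => (G s)^-1) x1 x2 0 0 x12 (lexx _)
  (fun z hz => ccontV (cdiff_cont (dG z (inR z hz))) (G0 z (inR z hz))).
exists (M1 + M2) => [|x hx]; first exact: addr_gt0.
have rx : rect x1 x2 0 0 (x%:C : C) by rewrite /rect/= hx lexx.
have e : powR Q x * cabs (Gamma (x%:C : C)) = cabs (G x%:C).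
  by rewrite /G cabsM cabs_cpow.
have := h1 _ rx; have := h2 _ rx; rewrite e cabsV => a2 a1; split.
  by apply: le_trans a1 _; rewrite lerDl ltW.
rewrite -[leRHS]invrK lef_pV2 ?posrE ?addr_gt0// ?invr_gt0 ?cabs_gt0 ?G0 ?inR//.
by apply: le_trans a2 _; rewrite lerDr ltW.
Qed.

Lemma Xi_growth0 N K L eps a B : (0 < N)%N -> (0 < K)%N -> Lseries K N a L -> 0 < B ->
  exists2 A : R, 0 < A & forall w, 0 < Re w <= B ->
    Re w * cabs (Xi N K L eps w) <= A * (1 + `|Im w|).
Proof.
move=> N0 K0 hL B0; have K0R : (0 : R) < K%:R by rewrite ltr0n.
have Q0 := conductor_gt0 N0; set Q := _ / _ in Q0.
have [|M M0 hM] := @Gamma_factor_bounds Q K%:R (K%:R + B) Q0 K0R; first by rewrite lerDl ltW.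
have [A A0 hA] := Lseries_growth hL.
exists (M * (A * (B + 1) * (K%:R + B + 1))) => [|w /andP[w0 wB]].
  by rewrite !mulr_gt0// !addr_gt0.
have w1 : 0 < Re w + K%:R by rewrite addr_gt0.
have s0 : 0 < Re (K%:R + w) by rewrite ReD Re_nat addrC.
rewrite Xi_right// cabs_Lambda// -/Q mulrCA -mulrA.
have G0 : 0 <= powR Q (Re (K%:R + w)) * cabs (Gamma (K%:R + w)).
  by rewrite mulr_ge0 ?powR_ge0 ?cabs_ge0.
apply: ler_pM => //; first by rewrite mulr_ge0 ?cabs_ge0// ltW.
  apply: le_trans (hM (Re (K%:R + w)) _).1.
    by rewrite ler_wpM2l ?powR_ge0// Gamma_le.
  by rewrite ReD Re_nat lerDl lerD2l (ltW w0).
have Ks : K%:R < Re (K%:R + w) by rewrite ReD Re_nat ltrDl.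
have := hA _ Ks; rewrite ReD Re_nat addrC addKr => h; apply: le_trans h _.
rewrite -mulrA -mulrA -mulrA; apply: ler_wpM2l; first exact: ltW.
have c1 : cabs (K%:R + w) <= (K%:R + B + 1) * (1 + `|Im w|).
  apply: le_trans (cabs_le _) _; rewrite ReD ImD Re_nat Im_nat add0r.
  rewrite ger0_norm ?addr_ge0 ?ler0n ?ltW//.
  have := normr_ge0 (Im w); move: `|Im w| => t t0.
  have : 0 <= (K%:R + B) * t by rewrite mulr_ge0// addr_ge0 ?ler0n ?ltW.
  by move: wB; clear; lra.
apply: ler_pM; rewrite ?cabs_ge0 ?addr_ge0 ?(ltW w0)//; first by rewrite lerD2r.
Qed.

(** [Xi_growth0] bounds |Re w| |Xi(w)| and says nothing on the imaginary axis. There the maximum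
    principle is applied on the square of half-side 1 around i t, after multiplying by a factor that
    vanishes where the horizontal sides cross the axis. *)
Lemma Xi_growth N K L eps a B : (0 < N)%N -> (0 < K)%N -> Lseries K N a L ->
  is_root_number K.*2 N L eps -> exists2 A : R, 0 < A & forall w, `|Re w| <= B ->
    cabs (Xi N K L eps w) <= A * (1 + `|Im w|).
Proof.
move=> N0 K0 hL he; have [_ _ _ dL _] := hL.
pose B' := Num.max B 1; have B'0 : 0 < B' by rewrite lt_max ltr01 orbT.
have [A A0 hA] := Xi_growth0 eps N0 K0 hL B'0.
have E w : `|Re w| <= B' -> `|Re w| * cabs (Xi N K L eps w) <= A * (1 + `|Im w|).
  move=> wB; have [w0|w0|w0] := ltgtP (Re w) 0; last 2 first.
  - by rewrite gtr0_norm//; apply: hA; rewrite w0 -[leLHS]gtr0_norm.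
  - by rewrite w0 normr0 mul0r mulr_ge0 ?(ltW A0)// addr_ge0.
  have := hA (- w); rewrite ReN ImN normrN (Xi_symm _ he K0) cabsM (cabs_eps he) mul1r.
  by rewrite -ltr0_norm//; apply; rewrite wB normr_gt0 lt_eqF.
exists (6 * A) => [|w wB]; first by rewrite mulr_gt0.
have wB' : `|Re w| <= B' by rewrite le_max wB.
have t0 := normr_ge0 (Im w).
have [w1|w1] := leP 1 `|Re w|.
  apply: le_trans (@le_trans _ _ (A * (1 + `|Im w|)) _ _ _ _).
  - by apply: le_trans (E _ wB'); rewrite ler_peMl ?cabs_ge0.
  - by rewrite lexx.
  - by rewrite -mulrA ler_peMl ?ler1n// mulr_ge0 ?ltW// addr_ge0.
set t := Im w in t0 *.
(* On the sides Im u = t - 1 and Im u = t + 1 the factor (u - it)^2 + 1 is divisible by Re u, which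
   absorbs the loss; on Im u = t it is at least 1. *)
pose F u : C := ((u - t%:C * ii) ^+ 2 + 1) * Xi N K L eps u.
have dF u : cdiff F u.
  apply: cdiffM; last exact: Xi_diff.
  apply: cdiffD; last exact: cdiff_cst.
  by apply: cdiffX; apply: cdiffB; [exact: cdiff_id|exact: cdiff_cst].
have Ret : Re (t%:C * ii) = 0 by rewrite Re_im.
have Imt : Im (t%:C * ii) = t by rewrite Im_im.
have bd u : rect (-1) 1 (t - 1) (t + 1) u ->
    [|| Re u == -1, Re u == 1, Im u == t - 1 | Im u == t + 1] ->
    cabs (F u) <= 3 * A * (2 + `|t|).
  move=> /andP[hx hy] hb; have x1 : `|Re u| <= 1 by rewrite ler_norml.
  have xB : `|Re u| <= B' by rewrite le_max x1 orbT.
  have tu : `|Im u| <= `|t| + 1.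
    have := ler_normD t (Im u - t); rewrite addrC subrK => h; apply: le_trans h _.
    by rewrite lerD2l ler_norml; move: hy; clear; lra.
  suff q : cabs ((u - t%:C * ii) ^+ 2 + 1) <= 3 * `|Re u|.
    rewrite /F cabsM; apply: (@le_trans _ _ (3 * (`|Re u| * cabs (Xi N K L eps u)))).
      by rewrite mulrA ler_wpM2r ?cabs_ge0.
    rewrite -mulrA ler_wpM2l//; apply: le_trans (E _ xB) _.
    by apply: ler_wpM2l; [exact: ltW|move: tu; clear; lra].
  have cu : cabs (u - t%:C * ii) ^+ 2 <= 2.
    rewrite cabs_sq ReD ImD ReN ImN Ret Imt subr0.
    have a1 : Re u ^+ 2 <= 1 by rewrite -real_normK ?num_real// expr_le1.
    have a2 : (Im u - t) ^+ 2 <= 1.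
      by rewrite -real_normK ?num_real// expr_le1// ler_norml; move: hy; clear; lra.
    by move: a1 a2; clear; lra.
  have [re1|re1] := eqVneq `|Re u| 1.
    rewrite re1 mulr1; apply: le_trans (cabsD _ _) _; rewrite cabsX cabs1.
    by move: cu; clear; lra.
  have {}hb : (Im u - t) ^+ 2 = 1.
    case/or4P: hb => /eqP h.
    - by move: re1; rewrite h normrN1 eqxx.
    - by move: re1; rewrite h normr1 eqxx.
    - by rewrite h; ring.
    - by rewrite h; ring.
  have -> : (u - t%:C * ii) ^+ 2 + 1 = (Re u)%:C * (Re u +i* (2 * (Im u - t))).
    apply: complex_eqP; rewrite expr2 !(ReD, ImD, ReM, ImM, ReN, ImN, Ret, Imt)/=.
      by rewrite -[X in _ + X = _]hb; ring.
    by ring.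
  rewrite cabsM cabs_real mulrC ler_wpM2r//; apply: le_trans (cabs_le _) _ => /=.
  rewrite normrM (ger0_norm (ler0n _ 2)).
  have : `|Im u - t| <= 1 by rewrite ler_norml; move: hy; clear; lra.
  by move: x1; clear; lra.
have h : cabs (F w) <= 3 * A * (2 + `|t|).
  apply: (@max_principle _ F [::] (-1) 1 (t - 1) (t + 1)) => //.
  - by rewrite -ltr_norml.
  - by rewrite ltrBlDr ltrDl ltr01.
  - by move=> u _; exact: cdiff_cont.
have e : (w - t%:C * ii) ^+ 2 + 1 = (Re w ^+ 2 + 1)%:C.
  by apply: complex_eqP; rewrite expr2 !(ReD, ImD, ReM, ImM, ReN, ImN, Ret, Imt)/= /t; ring.
have h2 : cabs (Xi N K L eps w) <= cabs (F w).
  rewrite /F e cabsM cabs_real ger0_norm ?addr_ge0 ?sqr_ge0//.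
  by rewrite ler_peMl ?cabs_ge0// lerDr sqr_ge0.
apply: le_trans h2 _; apply: le_trans h _.
have -> : 6 * A * (1 + `|t|) = 3 * A * (2 + 2 * `|t|) by ring.
by rewrite ler_wpM2l ?mulr_ge0 ?(ltW A0)// lerD2l; move: t0; clear; lra.
Qed.

Lemma Xi_like N K L eps a : (0 < N)%N -> (0 < K)%N -> Lseries K N a L ->
  is_root_number K.*2 N L eps -> xi_like eps (Xi N K L eps).
Proof.
move=> N0 K0 hL he; have [_ _ _ dL _] := hL; have K0R : (0 : R) < K%:R by rewrite ltr0n.
have Q0 := conductor_gt0 N0; pose Q : R := Num.sqrt N%:R / (2 * pi); rewrite -/Q in Q0.
have half_pos v : 1 / 2 <= Re v -> [/\ 0 < Re v + K%:R, 0 < Re (K%:R + v) &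
    K%:R + Re v = Re (K%:R + v)].
  by rewrite ReD Re_nat => h; split=> //; move: h K0R; clear; lra.
split.
- by move=> w; exact: Xi_diff.
- by move=> w; exact: Xi_symm.
- move=> w hw; have [p1 p2 e] := half_pos w (ltW hw).
  have k1 : K%:R + 1 / 2 < Re (K%:R + w) by rewrite -e ltrD2l.
  have [c c0 hc] := Lseries_lower K0 hL k1.
  rewrite Xi_right// -cabs_gt0 cabs_Lambda// mulr_gt0//; last exact: lt_le_trans (hc _ (lexx _)).
  by rewrite mulr_gt0 ?powR_gt0// cabs_gt0 Gamma_neq0.
- by move=> B; exact: (@Xi_growth N K L eps a B).
- move=> h h0; pose B := h + 1.
  have k1 : K%:R + 1 / 2 < K%:R + 1 :> R by rewrite ltrD2l; clear; lra.
  have [T T0 hT] := Lseries_bound hL k1; have [c c0 hc] := Lseries_lower K0 hL k1.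
  pose G1 := cabs (Gamma ((K%:R + h + 1)%:C : C)).
  pose G2 := cabs (Gamma ((K%:R + h + 1 - h)%:C : C)).
  have G10 : 0 < G1 by rewrite cabs_gt0 Gamma_neq0//=; move: h0 K0R; clear; lra.
  have G20 : 0 < G2 by rewrite cabs_gt0 Gamma_neq0//=; move: h0 K0R; clear; lra.
  exists B; exists (powR Q (- h) * (G2 / G1) * (T / c)) => [|v hv].
    by rewrite !mulr_gt0 ?invr_gt0 ?powR_gt0.
  have v1 : 1 / 2 <= Re v by move: hv h0; rewrite /B; clear; lra.
  have v2 : 1 / 2 <= Re (v - h%:C) by rewrite ReD ReN/=; move: hv; rewrite /B; clear; lra.
  have [p1 p2 e1] := half_pos _ v1; have [p3 p4 e2] := half_pos _ v2.
  have e3 : K%:R + (v - h%:C) = K%:R + v - h%:C by rewrite addrA.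
  rewrite !Xi_right// !cabs_Lambda// -/Q e3.
  have r1 : K%:R + 1 <= Re (K%:R + v - h%:C).
    by rewrite ReD ReN -e1/=; move: hv; rewrite /B; clear; lra.
  have r2 : K%:R + 1 <= Re (K%:R + v) by rewrite -e1; move: hv h0; rewrite /B; clear; lra.
  have a1 := hT _ r1; have a2 := hc _ r2.
  have r3 : K%:R + h + 1 <= Re (K%:R + v) by rewrite -e1; move: hv; rewrite /B; clear; lra.
  have r4 : h < K%:R + h + 1 by move: K0R; clear; lra.
  have a3 := Gamma_ratio h0 r4 r3; rewrite -/G1 -/G2 in a3.
  have -> : powR Q (Re (K%:R + v - h%:C)) = powR Q (- h) * powR Q (Re (K%:R + v)).
    by rewrite -powRD ?(gt_eqF Q0) ?implybT// ReD ReN addrC.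
  move: (powR_ge0 Q (- h)) (powR_ge0 Q (Re (K%:R + v))) a1 a2 a3.
  move: (cabs_ge0 (Gamma (K%:R + v - h%:C))) (cabs_ge0 (Gamma (K%:R + v))).
  move: (cabs_ge0 (L (K%:R + v - h%:C))).
  move: (powR _ _) (powR _ _) (cabs _) (cabs _) (cabs _) (cabs _) => q2 q1 l2 g2 g1 l1.
  move=> l10 g10 g20 q10 q20 a1 a2 a3.
  have b1 : g1 <= G2 / G1 * g2 by rewrite mulrAC ler_pdivlMr// [g1 * _]mulrC.
  have b2 : l1 <= T / c * l2.
    by apply: le_trans a1 _; rewrite mulrAC ler_pdivlMr// ler_wpM2l// ltW.
  have -> : q1 * (G2 / G1) * (T / c) * (q2 * g2 * l2) =
     (q1 * q2 * (G2 / G1 * g2)) * (T / c * l2) by ring.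
  apply: ler_pM => //; first by rewrite !mulr_ge0.
  by rewrite ler_wpM2l// mulr_ge0.
- move=> d B d0; pose s1 : R := K%:R + 1 / 2 + d; pose B' := Num.max B (1 / 2 + d).
  have k1 : K%:R + 1 / 2 < s1 by rewrite ltrDl.
  have s10 : 0 < s1 by move: K0R d0; rewrite /s1; clear; lra.
  have [c c0 hc] := Lseries_lower K0 hL k1.
  have [|M M0 hM] := @Gamma_factor_bounds Q s1 (K%:R + B') Q0 s10.
    by rewrite /s1 -addrA lerD2l le_max lexx orbT.
  exists (c / M); first by rewrite divr_gt0.
  exists (s1 ^- 2 + 2) => [|v /andP[v1 v2]]; first by rewrite addr_gt0// invr_gt0 exprn_gt0.
  have v3 : 1 / 2 <= Re v by apply: le_trans v1; rewrite lerDl ltW.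
  have [p1 p2 e1] := half_pos _ v3.
  rewrite Xi_right// cabs_Lambda// -/Q.
  have r1 : s1 <= Re (K%:R + v) by rewrite -e1 /s1 -addrA lerD2l.
  have r2 : Re (K%:R + v) <= K%:R + B' by rewrite -e1 lerD2l le_max v2.
  have a1 := hc _ r1; have a2 := Gamma_ge s10 r1.
  have a3 := (hM (Re (K%:R + v)) (introT andP (conj r1 r2))).2.
  have Imv : Im (K%:R + v) = Im v by rewrite ImD Im_nat add0r.
  rewrite Imv in a2; move: (expR_ge0 (- ((s1 ^- 2 + 2) * Im v ^+ 2))) a1 a2 a3.
  move: (powR_ge0 Q (Re (K%:R + v))) (cabs_ge0 (Gamma (Re (K%:R + v))%:C)).
  move: (powR _ _) (expR _) (cabs _) (cabs _) (cabs _) => q E g2 l g1.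
  move=> q0 g10 E0 a1 a2 a3; apply: (@le_trans _ _ (q * g1 * E * c)).
    have -> : c / M * E = M^-1 * E * c by ring.
    by rewrite ler_wpM2r ?(ltW c0)// ler_wpM2r.
  apply: ler_pM => //; first by rewrite !mulr_ge0.
    exact: ltW.
  by rewrite -mulrA ler_wpM2l.
Qed.

Lemma Xi_conj N K L eps w : (0 < K)%N -> is_root_number K.*2 N L eps ->
  (forall s, L (cj s) = cj (L s)) -> Xi N K L eps (cj w) = cj (Xi N K L eps w).
Proof.
move=> K0 he hL; have K0R : (0 : R) < K%:R by rewrite ltr0n.
have ec : cj eps = eps by case: he => -[->|->] _; rewrite ?rmorphN ?rmorph1.
have eL s : 0 < Re s -> Lambda N L (cj s) = cj (Lambda N L s).
  by move=> s0; rewrite /Lambda hL Gamma_conj// cpow_conj -!rmorphM.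
have [w0|w0] := ltP 0 (Re w + K%:R).
  rewrite !Xi_right ?ReJ// -eL; last by rewrite ReD Re_nat addrC.
  by rewrite rmorphD/= conjc_nat.
rewrite /Xi ReJ ltNge w0/= rmorphM/= ec; congr (_ * _).
have e : K%:R - cj w = cj (K%:R - w) by rewrite rmorphB/= conjc_nat.
by rewrite e eL// ReD ReN Re_nat; move: w0 K0R; clear; lra.
Qed.

End CompletedFunction.

(** * Phragmen-Lindelof principles and the nonvanishing of binomial sums *)

Section PhragmenLindelof.
Variable R : realType.
Local Notation C := R[i].
Local Notation Re := complex.Re.
Local Notation Im := complex.Im.
Implicit Types (q xi : C -> C) (w u v z : C) (a b A B M : R).

Lemma expR_limit (x M W : R) : 0 < M -> (forall e : R, 0 < e -> x <= M * expR (e * W)) -> x <= M.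
Proof.
move=> Mp h; have M0 := ltW Mp; have W1 : 0 < `|W| + 1 by rewrite ltr_wpDl.
apply/ler_addgt0Pr => e e0.
pose d := ln (1 + e / M); have eM : 0 < e / M by rewrite divr_gt0.
have d0 : 0 < d by rewrite ln_gt0// ltrDl.
apply: le_trans (h (d / (`|W| + 1)) (divr_gt0 d0 W1)) _.
apply: (@le_trans _ _ (M * expR d)); last first.
  rewrite /d lnK ?posrE ?addr_gt0//; have -> : M * (1 + e / M) = M + e by field; rewrite gt_eqF.
  by [].
rewrite ler_wpM2l// ler_expR mulrAC ler_pdivrMr// ler_wpM2l ?(ltW d0)//.
by apply: le_trans (ler_norm _) _; rewrite lerDl.
Qed.

Lemma pow_unbounded (x Y : R) : 0 <= x -> (forall n, x ^+ n <= Y) -> x <= 1.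
Proof.
move=> x0 h; rewrite leNgt; apply/negP => x1.
have Y0 : 0 < Y by apply: lt_le_trans (h 0%N).
have xp : 0 < x := lt_trans ltr01 x1.
have [n hn] : exists n, x^-1 ^+ n <= 1 / (2 * Y).
  by apply: expr_small; rewrite ?invr_ge0 ?invf_lt1// divr_gt0// mulr_gt0.
have := h n; have xn : 0 < x ^+ n by rewrite exprn_gt0.
move: hn; rewrite exprVn mul1r lef_pV2 ?posrE ?mulr_gt0// => h1 h2.
by move: (le_trans h1 h2) Y0; clear; lra.
Qed.

Lemma Re_pow4 u : Re (u ^+ 4) = Re u ^+ 4 - 6 * (Re u ^+ 2 * Im u ^+ 2) + Im u ^+ 4.
Proof.
have -> : u ^+ 4 = u * u * (u * u) by ring.
by rewrite !(ReM, ImM); ring.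
Qed.

(** Multiply by exp(-e u^4): in a vertical strip Re(u^4) grows like Im(u)^4 and beats the Gaussian
    growth of q. The maximum principle on a tall rectangle applies, and then e tends to 0
    ([expR_limit]). *)
Lemma pl_strip q a b (M C2 A : R) : a < b -> 0 < M -> 0 < C2 -> 0 < A ->
  (forall u, a <= Re u <= b -> cdiff q u) ->
  (forall u, Re u = a -> cabs (q u) <= M) ->
  (forall u, Re u = b -> cabs (q u) <= M) ->
  (forall u, a <= Re u <= b -> cabs (q u) <= C2 * expR (A * Im u ^+ 2)) ->
  forall u, a <= Re u <= b -> cabs (q u) <= M.
Proof.
move=> ab M0 C20 A0 dq qa qb qs u0 /andP[]; rewrite le_eqVlt => /predU1P[/esym/qa//|au0].
rewrite le_eqVlt => /predU1P[/qb//|ub0].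
pose X := `|a| + `|b|; have X0 : 0 <= X by rewrite addr_ge0.
have hX x : a <= x <= b -> x ^+ 2 <= X ^+ 2.
  move=> /andP[h1 h2]; rewrite -real_normK ?num_real// lerXn2r ?nnegrE// ler_norml.
  have := ler_norm b; have := ler_norm (- a); have := normr_ge0 a; have := normr_ge0 b.
  by rewrite /X normrN; move: h1 h2; clear; lra.
apply: (@expR_limit _ M (9 * X ^+ 4 + Re (u0 ^+ 4))) => // e e0.
pose G u := q u * cexp (- e%:C * u ^+ 4).
have cG u : cabs (G u) = cabs (q u) * expR (- e * Re (u ^+ 4)).
  by rewrite /G cabsM cabs_cexp -rmorphN ReZ.
have up u : a <= Re u <= b ->
    - e * Re (u ^+ 4) <= e * (6 * X ^+ 2 * Im u ^+ 2 - Im u ^+ 4).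
  move=> /hX hx; rewrite mulNr -mulrN ler_pM2l// Re_pow4.
  have := ler_wpM2r (sqr_ge0 (Im u)) hx.
  have : 0 <= Re u ^+ 4 by rewrite (exprM _ 2 2) sqr_ge0.
  by move: (Re u ^+ 2 * _) => p; clear; lra.
have nine (y : R) : e * (6 * X ^+ 2 * y ^+ 2 - y ^+ 4) <= e * (9 * X ^+ 4).
  rewrite ler_pM2l// -subr_ge0.
  have -> : 9 * X ^+ 4 - (6 * X ^+ 2 * y ^+ 2 - y ^+ 4) = (y ^+ 2 - 3 * X ^+ 2) ^+ 2 by ring.
  exact: sqr_ge0.
pose c0 := `|ln (C2 / M)|.
have hc0 : C2 <= M * expR c0.
  rewrite mulrC -ler_pdivrMr// -[leLHS]lnK ?posrE ?divr_gt0// ler_expR.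
  exact: ler_norm.
(* With T at least 1 and at least D, the decay e T^4 exceeds (A + 6 e X^2) T^2 + c0, so |G| <= M on
   the sides Im u = T and Im u = -T. *)
pose D := (A + 6 * e * X ^+ 2 + c0) / e.
have D0 : 0 <= D by rewrite divr_ge0 ?(ltW e0)// addr_ge0 /c0// addr_ge0 ?(ltW A0)// mulr_ge0 ?sqr_ge0// mulr_ge0// ltW.
pose T := 1 + `|Im u0| + D.
have T1 : 1 <= T by rewrite /T -addrA lerDl addr_ge0.
have T2 : `|Im u0| < T by rewrite /T; move: D0; clear; lra.
have TD : D <= T by rewrite /T; have := normr_ge0 (Im u0); clear; lra.
have hT u : a <= Re u <= b -> Im u ^+ 2 = T ^+ 2 -> cabs (G u) <= M.
  move=> hu ht; rewrite cG.
  apply: (@le_trans _ _ (C2 * expR (A * Im u ^+ 2) *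
      expR (e * (6 * X ^+ 2 * Im u ^+ 2 - Im u ^+ 4)))).
    by apply: ler_pM; rewrite ?cabs_ge0 ?expR_ge0 ?ler_expR ?up ?qs.
  rewrite -mulrA -expRD (exprM _ 2 2) ht.
  apply: (@le_trans _ _ (M * expR c0 * expR (- c0))); last by rewrite -mulrA -expRD subrr expR0 mulr1.
  apply: ler_pM; rewrite ?(ltW C20) ?expR_ge0// ler_expR.
  have TT : T <= T ^+ 2 by rewrite expr2 ler_peMl// (le_trans ler01).
  have T21 : 1 <= T ^+ 2 by apply: le_trans TT.
  move: TT T21 TD; rewrite /D ler_pdivrMr//; move: (T ^+ 2) => P TP P1 h.
  have h' : A + 6 * e * X ^+ 2 + c0 <= P * e by apply: le_trans h _; rewrite ler_pM2r.
  have P0 : 0 <= P by apply: le_trans P1.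
  have := ler_wpM2r P0 h'; have : c0 * 1 <= c0 * P by apply: ler_wpM2l => //; exact: normr_ge0.
  have -> : e * (6 * X ^+ 2 * P - P ^+ 2) = 6 * e * X ^+ 2 * P - P * e * P by ring.
  rewrite !mulrDl mulr1; move: (6 * e * X ^+ 2 * P) (P * e * P) (c0 * P) (A * P).
  by clear; move=> *; lra.
have h : cabs (G u0) <= M * expR (e * (9 * X ^+ 4)).
  apply: (@max_principle _ G [::] a b (- T) T) => //.
  - by rewrite au0 ub0.
  - by rewrite -ltr_norml.
  - move=> u /andP[hu _]; apply: cdiff_cont; apply: cdiffM; first exact: dq.
    by apply: cdiff_comp; [apply: cdiffM; [exact: cdiff_cst|exact: cdiffX (cdiff_id _)]|exact: cdiff_cexp].
  - move=> u /andP[hu _] _; apply: cdiffM; first exact: dq.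
    by apply: cdiff_comp; [apply: cdiffM; [exact: cdiff_cst|exact: cdiffX (cdiff_id _)]|exact: cdiff_cexp].
  move=> u /andP[hu _] hb.
  have e9 : 1 <= expR (e * (9 * X ^+ 4)).
    by rewrite -[leLHS]expR0 ler_expR mulr_ge0 ?(ltW e0)// mulr_ge0// (exprM _ 2 2) sqr_ge0.
  have side : cabs (q u) <= M -> cabs (G u) <= M * expR (e * (9 * X ^+ 4)).
    move=> hq; rewrite cG; apply: ler_pM; rewrite ?cabs_ge0 ?expR_ge0// ler_expR.
    by apply: le_trans (up _ hu) _; exact: nine.
  case/or4P: hb => /eqP hb; first by apply: side; exact: qa.
  - by apply: side; exact: qb.
  - by apply: le_trans (hT u hu _) _; rewrite ?hb ?sqrrN// ler_peMr// ltW.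
  - by apply: le_trans (hT u hu _) _; rewrite ?hb// ler_peMr// ltW.
move: h; rewrite cG mulrDr expRD mulrA mulNr expRN ler_pdivrMr ?expR_gt0//.
Qed.

(** The maximum principle for q^n / (1 + u - a) on rectangles so large that the denominator absorbs
    M^n on the three far sides. It gives |q(u0)|^n <= |1 + u0 - a| for every n. *)
Lemma pl_half q a M : 1 <= M ->
  (forall u, a <= Re u -> cdiff q u) ->
  (forall u, Re u = a -> cabs (q u) <= 1) ->
  (forall u, a <= Re u -> cabs (q u) <= M) ->
  forall u, a < Re u -> cabs (q u) <= 1.
Proof.
move=> M1 dq qa qM u0 au0.
apply: (@pow_unbounded _ (cabs (1 + (u0 - a%:C)))); first exact: cabs_ge0.
move=> n; pose G u := q u ^+ n * (1 + (u - a%:C))^-1.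
have Rd u : Re (1 + (u - a%:C)) = 1 + (Re u - a) by rewrite !ReD ReN.
have Id u : Im (1 + (u - a%:C)) = Im u by rewrite !ImD ImN/= add0r subr0.
have d1 u : a <= Re u -> 1 <= cabs (1 + (u - a%:C)).
  move=> h; apply: le_trans (cabs_Re _); rewrite Rd; apply: le_trans (ler_norm _).
  by rewrite lerDl subr_ge0.
have d0 u : a <= Re u -> 1 + (u - a%:C) != 0.
  by move=> h; rewrite -cabs_gt0; apply: lt_le_trans (d1 _ h).
have dG u : a <= Re u -> cdiff G u.
  move=> h; apply: cdiffM; first by apply: cdiffX; exact: dq.
  apply: (@cdiffV _ (fun u => 1 + (u - a%:C))); last exact: d0.
  apply: cdiffD; first exact: cdiff_cst.
  by apply: cdiffB; [exact: cdiff_id|exact: cdiff_cst].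
have Mn : 0 < M ^+ n by rewrite exprn_gt0// (lt_le_trans ltr01).
pose T := M ^+ n + `|Im u0| + (Re u0 - a).
have i0 := normr_ge0 (Im u0).
have h : cabs (G u0) <= 1.
  apply: (@max_principle _ G [::] a (a + T) (- T) T) => //.
  - by rewrite au0 /T; move: au0 Mn i0; clear; lra.
  - by rewrite -ltr_norml /T; move: au0 Mn i0; clear; lra.
  - by move=> u /andP[/andP[hu _] _]; apply: cdiff_cont; exact: dG.
  - by move=> u /andP[/andP[hu _] _] _; exact: dG.
  move=> u /andP[/andP[hu _] _] hb; have dd := d1 _ hu.
  have dp : 0 < cabs (1 + (u - a%:C)) by apply: lt_le_trans dd.
  rewrite /G cabsM cabsV cabsX ler_pdivrMr// mul1r.
  have big : M ^+ n <= cabs (1 + (u - a%:C)) -> cabs (q u) ^+ n <= cabs (1 + (u - a%:C)).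
    by apply: le_trans; apply: lerXn2r; rewrite ?nnegrE ?cabs_ge0 ?qM// (le_trans ler01).
  case/or4P: hb => /eqP hb.
  - by apply: le_trans dd; rewrite exprn_ile1 ?cabs_ge0 ?qa.
  - apply: big; apply: le_trans (cabs_Re _); apply: le_trans (ler_norm _).
    by rewrite Rd hb /T; move: au0 i0; clear; lra.
  - apply: big; apply: le_trans (cabs_Im _); rewrite Id hb normrN.
    by apply: le_trans (ler_norm _); rewrite /T; move: au0 i0; clear; lra.
  - apply: big; apply: le_trans (cabs_Im _); apply: le_trans (ler_norm _).
    by rewrite Id hb /T; move: au0 i0; clear; lra.
have dd := d1 _ (ltW au0).
move: h; rewrite /G cabsM cabsV cabsX ler_pdivrMr ?mul1r//.
by apply: lt_le_trans dd.
Qed.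

Lemma binomial_step (G : nat -> C) z m :
  \sum_(j < m.+2) 'C(m.+1, j)%:R * z ^+ j * G j =
  \sum_(j < m.+1) 'C(m, j)%:R * z ^+ j * G j +
  z * \sum_(j < m.+1) 'C(m, j)%:R * z ^+ j * G j.+1.
Proof.
have e : \sum_(j < m.+1) 'C(m, j)%:R * z ^+ j * G j = \sum_(j < m.+2) 'C(m, j)%:R * z ^+ j * G j.
  by rewrite [RHS]big_ord_recr/= bin_small// !mul0r addr0.
rewrite e [LHS]big_ord_recl [X in _ = X + _]big_ord_recl/= !bin0 -addrA; congr (_ + _).
rewrite mulr_sumr -big_split/=; apply: eq_bigr => i _.
by rewrite /bump/= add1n binS natrD exprS; ring.
Qed.

Section Iteration.
Variables (xi : C -> C) (eps z : C).
Hypotheses (hxi : xi_like eps xi) (he : cabs eps = 1).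
Hypotheses (xiJ : forall w, xi (cj w) = cj (xi w)) (z1 : 1 < cabs z).

Local Notation hf := ((1 / 2)%:C : C).

(** The functions F_m of the iteration; [shiftedE] unfolds them into binomial sums over values of xi
    at unit spacing. *)
Fixpoint shifted m w : C :=
  if m is m'.+1 then shifted m' (w - hf) + z * shifted m' (w + hf) else xi (w + hf).

Lemma shifted_diff m w : cdiff (shifted m) w.
Proof.
have sh (F : C -> C) (p v : C) : (forall w, cdiff F w) -> cdiff (fun w => F (w + p)) v.
  move=> hF; apply: (@cdiff_comp _ (fun w => w + p) F) => //.
  by apply: cdiffD; [exact: cdiff_id|exact: cdiff_cst].
elim: m w => [|m IH] w /=; first by apply: sh; exact: xi_diff hxi.
by apply: cdiffD; [exact: sh|apply: cdiffM; [exact: cdiff_cst|exact: sh]].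
Qed.

Lemma shifted_growth m B : exists2 A : R, 0 < A & forall w, `|Re w| <= B ->
  cabs (shifted m w) <= A * (1 + `|Im w|).
Proof.
elim: m B => [|m IH] B /=; have [A A0 hA] := xi_growth hxi (B + 1 / 2); last first.
  have [A1 A10 h1] := IH (B + 1 / 2); exists (A1 + cabs z * A1) => [|w wB].
    by rewrite addr_gt0// mulr_gt0// (lt_trans ltr01).
  have b1 : `|Re (w - hf)| <= B + 1 / 2.
    by rewrite ReD ReN; apply: le_trans (ler_normB _ _) _; rewrite (ger0_norm (_ : 0 <= 1 / 2))// lerD2r.
  have b2 : `|Re (w + hf)| <= B + 1 / 2.
    by rewrite ReD; apply: le_trans (ler_normD _ _) _; rewrite (ger0_norm (_ : 0 <= 1 / 2))// lerD2r.
  have i1 : Im (w - hf) = Im w by rewrite ImD ImN/= subr0.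
  have i2 : Im (w + hf) = Im w by rewrite ImD/= addr0.
  apply: le_trans (cabsD _ _) _; rewrite cabsM mulrDl; apply: lerD.
    by rewrite -i1; exact: h1.
  by rewrite -mulrA ler_wpM2l ?cabs_ge0// -i2; exact: h1.
exists A => // w wB; have i2 : Im (w + hf) = Im w by rewrite ImD/= addr0.
rewrite -i2; apply: hA; rewrite ReD; apply: le_trans (ler_normD _ _) _.
by rewrite (ger0_norm (_ : 0 <= 1 / 2))// lerD2r.
Qed.

(** By the functional equation and conjugation, each term at h - conj u has the modulus of xi at u +
    g moved to the left; [xi_ratio] compares it with xi(u + g). The hypothesis says that the
    smallest of these moves is nonnegative. *)
Lemma shifted_reflect m (h g : R) : 0 <= g + h + 1 / 2 - m%:R / 2 ->
  exists B, exists2 A : R, 0 < A & forall u, B <= Re u ->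
    cabs (shifted m (h%:C - cj u)) <= A * cabs (xi (u + g%:C)).
Proof.
elim: m h => [|m IH] h hg /=.
  have k0 : 0 <= g + h + 1 / 2 by move: hg; rewrite mul0r subr0.
  have [B [A A0 hA]] := xi_ratio hxi k0.
  exists (B - g); exists A => // u hu.
  have -> : h%:C - cj u + hf = - cj (u + g%:C - (g + h + 1 / 2)%:C).
    by apply: complex_eqP; rewrite !(ReD, ImD, ReN, ImN, ReJ, ImJ)/=; ring.
  rewrite (xi_symm hxi) cabsM he mul1r xiJ cabs_conj; apply: hA.
  by rewrite ReD/=; move: hu; clear -R xi eps z hxi he xiJ z1; lra.
have k1 : 0 <= g + (h - 1 / 2) + 1 / 2 - m%:R / 2.
  by move: hg; rewrite -(natr1 m); clear -R xi eps z hxi he xiJ z1; lra.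
have k2 : 0 <= g + (h + 1 / 2) + 1 / 2 - m%:R / 2.
  by move: hg; rewrite -(natr1 m); clear -R xi eps z hxi he xiJ z1; lra.
have [B1 [A1 A10 h1]] := IH _ k1; have [B2 [A2 A20 h2]] := IH _ k2.
exists (Num.max B1 B2); exists (A1 + cabs z * A2) => [|u].
  by rewrite addr_gt0// mulr_gt0// (lt_trans ltr01).
rewrite ge_max => /andP[/h1 u1 /h2 u2].
have -> : h%:C - cj u - hf = (h - 1 / 2)%:C - cj u by rewrite rmorphB/= addrAC.
have -> : h%:C - cj u + hf = (h + 1 / 2)%:C - cj u by rewrite rmorphD/= addrAC.
apply: le_trans (cabsD _ _) _; rewrite cabsM mulrDl; apply: lerD => //.
by rewrite -mulrA ler_wpM2l ?cabs_ge0.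
Qed.

(** The induction hypothesis: |F_m| is bounded below by the value of xi at the rightmost of its
    arguments. *)
Definition shifted_lower m := forall w, 0 < Re w ->
  (cabs z - 1) ^+ m * cabs (xi (w + (1 / 2 + m%:R / 2)%:C)) <= cabs (shifted m w).

(* Reflection in the line Re u = a gives q(u) = conj(shifted m (2a - conj u)) /    *)
(* shifted m u of modulus 1 on that line; the functional equation of xi bounds q *)
(* to its right, so |q| <= 1 there by Phragmen-Lindelof.                         *)
Lemma shifted_compare m w : shifted_lower m -> 0 < Re w ->
  cabs (shifted m (w - hf)) <= cabs (shifted m (w + hf)).
Proof.
move=> hP; set a := Re w => a0; pose g : R := 1 / 2 + m%:R / 2.
have m0 : 0 <= m%:R / 2 :> R by rewrite divr_ge0 ?ler0n.
have Z0 : 0 < (cabs z - 1) ^+ m by rewrite exprn_gt0// subr_gt0.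
have xi0 u : a <= Re u -> 0 < cabs (xi (u + g%:C)).
  move=> h; rewrite cabs_gt0 (xi_neq0 hxi)// ReD /g/=; move: h a0 m0; clear -R xi eps z hxi he xiJ z1; lra.
have low u : a <= Re u -> (cabs z - 1) ^+ m * cabs (xi (u + g%:C)) <= cabs (shifted m u).
  by move=> h; apply: hP; exact: lt_le_trans h.
have s0 u : a <= Re u -> 0 < cabs (shifted m u).
  by move=> h; apply: lt_le_trans (low _ h); rewrite mulr_gt0 ?xi0.
pose q u := cj (shifted m ((2 * a)%:C - cj u)) / shifted m u.
have cq u : cabs (q u) = cabs (shifted m ((2 * a)%:C - cj u)) / cabs (shifted m u).
  by rewrite /q cabsM cabsV cabs_conj.
have dq u : a <= Re u -> cdiff q u.
  move=> h; apply: cdiffM; last by apply: cdiffV; [exact: shifted_diff|rewrite -cabs_gt0 s0].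
  apply: (@cdiff_conj _ (fun v => shifted m ((2 * a)%:C - v))).
  apply: (@cdiff_comp _ (fun v => (2 * a)%:C - v) (shifted m)); last exact: shifted_diff.
  by apply: cdiffB; [exact: cdiff_cst|exact: cdiff_id].
have qa u : Re u = a -> cabs (q u) <= 1.
  move=> ua; have -> : q u = cj (shifted m u) / shifted m u.
    rewrite /q; congr (cj (shifted m _) / _); apply: complex_eqP.
      by rewrite ReD ReN ReJ ua/=; ring.
    by rewrite ImD ImN ImJ/= opprK add0r.
  by rewrite cabsM cabsV cabs_conj mulfV// gt_eqF// s0 ?ua.
have kr : 0 <= g + 2 * a + 1 / 2 - m%:R / 2 by rewrite /g; move: a0; clear -R xi eps z hxi he xiJ z1; lra.
have [B1 [A1 A10 hA1]] := shifted_reflect kr.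
pose M := Num.max 1 (A1 / (cabs z - 1) ^+ m).
have M1 : 1 <= M by rewrite le_max lexx.
have M0 : 0 < M := lt_le_trans ltr01 M1.
have far u : a <= Re u -> B1 <= Re u -> cabs (q u) <= M.
  move=> ua /hA1 h; rewrite cq ler_pdivrMr ?s0//; apply: le_trans h _.
  apply: (@le_trans _ _ (A1 / (cabs z - 1) ^+ m * cabs (shifted m u))).
    rewrite -mulrA ler_wpM2l ?(ltW A10)// mulrC ler_pdivlMr// mulrC; exact: low.
  by rewrite ler_wpM2r ?cabs_ge0// le_max lexx orbT.
pose b := Num.max B1 (a + 1).
have ab : a < b by rewrite lt_max ltrDl ltr01 orbT.
have [A2 A20 hA2] := shifted_growth m (a + b).
have [c c0 [A3 A30 hA3]] := xi_lower hxi (b + g) a0.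
(* Far to the right [shifted_reflect] and the induction hypothesis bound q. In the remaining strip q
   has at most Gaussian growth, so [pl_strip] applies; [pl_half] finally improves M to 1. *)
have qM u : a <= Re u -> cabs (q u) <= M.
  move=> ua; have [ub|bu] := leP (Re u) b; last first.
    by apply: far => //; apply: le_trans (ltW bu); rewrite le_max lexx.
  apply: (@pl_strip q a b M (2 * A2 / ((cabs z - 1) ^+ m * c)) (A3 + 1)) => //.
  - by rewrite divr_gt0 ?mulr_gt0.
  - by rewrite addr_gt0.
  - by move=> v /andP[]; move=> h _; exact: dq.
  - by move=> v h; apply: le_trans M1; exact: qa.
  - by move=> v h; apply: far; rewrite h ?(ltW ab)// le_max lexx.
  - move=> v /andP[h1 h2]; rewrite cq ler_pdivrMr ?s0//.
    have n1 : cabs (shifted m ((2 * a)%:C - cj v)) <= A2 * (1 + `|Im v|).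
      have -> : `|Im v| = `|Im ((2 * a)%:C - cj v)| by rewrite ImD ImN ImJ/= opprK add0r.
      apply: hA2; rewrite ReD ReN ReJ/= ler_norml; move: h1 h2 a0; clear -R xi eps z hxi he xiJ z1; lra.
    have n2 : 1 + `|Im v| <= 2 * expR (Im v ^+ 2).
      have := expR_ge1Dx (Im v ^+ 2); have := sqr_ge0 (`|Im v| - 1).
      by rewrite sqrrB real_normK ?num_real// mulr1 expr1n; have := sqr_ge0 (Im v); clear -R xi eps z hxi he xiJ z1; lra.
    have n3 : c * expR (- (A3 * Im v ^+ 2)) <= cabs (xi (v + g%:C)).
      have -> : Im v = Im (v + g%:C) by rewrite ImD/= addr0.
      by apply: hA3; rewrite ReD/= /g; move: h1 h2 m0; clear -R xi eps z hxi he xiJ z1; lra.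
    apply: le_trans n1 _; apply: (@le_trans _ _ (A2 * (2 * expR (Im v ^+ 2)))).
      by rewrite ler_wpM2l ?(ltW A20).
    apply: (@le_trans _ _ (2 * A2 / ((cabs z - 1) ^+ m * c) * expR ((A3 + 1) * Im v ^+ 2) *
       ((cabs z - 1) ^+ m * (c * expR (- (A3 * Im v ^+ 2)))))); last first.
      apply: ler_wpM2l.
        by rewrite mulr_ge0 ?expR_ge0// divr_ge0 ?mulr_ge0 ?(ltW A20) ?(ltW Z0) ?(ltW c0).
      by apply: (le_trans _ (low v h1)); rewrite ler_wpM2l ?(ltW Z0).
    rewrite [(A3 + 1) * _]mulrDl mul1r expRD expRN.
    have E0 := expR_gt0 (A3 * Im v ^+ 2); move: E0.
    move: (expR (A3 * _)) (expR (Im v ^+ 2)) => E E' E0.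
    rewrite le_eqVlt; apply/orP; left; apply/eqP; field.
    by rewrite !gt_eqF.
  - by rewrite ua ub.
have aw : a < Re (w + hf) by rewrite ReD/= ltrDl.
have e : (2 * a)%:C - cj (w + hf) = w - hf.
  apply: complex_eqP; first by rewrite !(ReD, ReN, ReJ)/= /a; field.
  by rewrite !(ImD, ImN, ImJ)/=; ring.
have := pl_half M1 dq qa qM aw; rewrite cq e ler_pdivrMr ?[1 * cabs _]mul1r//.
exact: s0 (ltW aw).
Qed.

(** With D = |F_m(w + 1/2)|, the two terms of F_(m+1)(w) have moduli at most D ([shifted_compare])
    and exactly |z| D, which leaves at least (|z| - 1) D. *)
Lemma shifted_lowerP m : shifted_lower m.
Proof.
elim: m => [|m IH] w w0 /=; first by rewrite expr0 mul1r mul0r addr0.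
have h := shifted_compare IH w0.
have w1 : 0 < Re (w + hf) by rewrite ReD/= addr_gt0.
have := IH _ w1; set D := cabs (shifted m (w + hf)) in h *.
have -> : w + hf + (1 / 2 + m%:R / 2)%:C = w + (1 / 2 + m.+1%:R / 2)%:C.
  by rewrite -addrA -rmorphD/=; congr (_ + _%:C); rewrite -natr1; field.
rewrite exprS -mulrA; move: (_ * cabs (xi _)) => X hX.
have z0 : 0 < cabs z - 1 by rewrite subr_gt0.
apply: (@le_trans _ _ ((cabs z - 1) * D)); first by rewrite ler_wpM2l ?(ltW z0).
rewrite [X in _ <= cabs X]addrC mulrBl mul1r.
have := cabsB_ge (z * shifted m (w + hf)) (- shifted m (w - hf)).
by rewrite opprK cabsN cabsM -/D; apply: le_trans; rewrite lerB.
Qed.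

Lemma shiftedE m w : shifted m w =
  \sum_(j < m.+1) 'C(m, j)%:R * z ^+ j * xi (w + (1 / 2 + j%:R - m%:R / 2)%:C).
Proof.
elim: m w => [|m IH] w /=.
  by rewrite big_ord1 bin0 expr0 !mul1r mul0r addr0 subr0.
rewrite !IH (binomial_step (fun j => xi (w + (1 / 2 + j%:R - m.+1%:R / 2)%:C))).
congr (_ + z * _); apply: eq_bigr => j _; congr (_ * xi _).
  by rewrite -addrA -rmorphN -rmorphD/=; congr (_ + _%:C); rewrite -natr1; field.
by rewrite -addrA -rmorphD/=; congr (_ + _%:C); rewrite -!natr1; field.
Qed.

Lemma shifted_at0 m : (cabs z - 1) ^+ m * cabs (xi (1 / 2 + m%:R / 2)%:C) <= cabs (shifted m 0).
Proof.
pose F w := ((cabs z - 1) ^+ m)%:C * xi (w + (1 / 2 + m%:R / 2)%:C).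
have z0 : 0 <= cabs z - 1 by rewrite subr_ge0 ltW.
have cF w : cabs (F w) = (cabs z - 1) ^+ m * cabs (xi (w + (1 / 2 + m%:R / 2)%:C)).
  by rewrite /F cabsM cabs_real ger0_norm// exprn_ge0.
have dF : cdiff F 0.
  apply: cdiffM; first exact: cdiff_cst.
  apply: (@cdiff_comp _ (fun w => w + (1 / 2 + m%:R / 2)%:C) xi); last exact: xi_diff hxi _.
  by apply: cdiffD; [exact: cdiff_id|exact: cdiff_cst].
have := cF 0; rewrite add0r => <-; apply/ler_addgt0Pr => e e0.
have e2 : 0 < e / 2 by rewrite divr_gt0.
have [d1 d10 h1] := cdiff_cont dF e2; have [d2 d20 h2] := cdiff_cont (shifted_diff m 0) e2.
pose d := Num.min d1 d2 / 2.
have d0 : 0 < d by rewrite divr_gt0// lt_min d10.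
have dd : d < Num.min d1 d2 by rewrite ltr_pdivrMr// mulr2n mulrDr mulr1 ltrDl lt_min d10.
move: dd; rewrite lt_min => /andP[dd1 dd2].
have cd : cabs (d%:C - 0) = d by rewrite subr0 cabs_real gtr0_norm.
have /h1 a1 : cabs (d%:C - 0) < d1 by rewrite cd.
have /h2 a2 : cabs (d%:C - 0) < d2 by rewrite cd.
have a3 : cabs (F d%:C) <= cabs (shifted m d%:C) by rewrite cF; exact: shifted_lowerP.
have := cabsB_ge (F 0) (F d%:C); have := cabsB_ge (shifted m d%:C) (shifted m 0).
rewrite [cabs (F 0 - _)]cabs_distC; move: a1 a2 a3.
by clear -R xi eps z hxi he xiJ z1; lra.
Qed.

End Iteration.

(** The lower bound at w = 0 involves xi(1/2 + m/2), which is nonzero because m > 0 puts its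
    argument beyond 1/2. *)
Lemma binomial_transform_neq0 xi eps z m : xi_like eps xi -> cabs eps = 1 ->
  (forall w, xi (cj w) = cj (xi w)) -> 1 < cabs z -> (0 < m)%N ->
  \sum_(j < m.+1) 'C(m, j)%:R * xi (1 / 2 + j%:R - m%:R / 2)%:C * z ^+ j != 0.
Proof.
move=> hxi he xiJ z1 m0; have := shifted_at0 hxi he xiJ z1 m; rewrite shiftedE.
under eq_bigr do rewrite add0r mulrAC.
move=> h; rewrite -cabs_gt0; apply: lt_le_trans h.
rewrite mulr_gt0 ?exprn_gt0 ?subr_gt0// cabs_gt0 (xi_neq0 hxi)//= ltrDl divr_gt0 ?ltr0n//.
Qed.

End PhragmenLindelof.

(** * Roots of the coefficient polynomial and their effect on the transform *)

Section UnimodularRoots.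
Variable R : realType.
Local Notation C := R[i].
Local Notation Re := complex.Re.
Local Notation Im := complex.Im.
Implicit Types (xi : C -> C) (w s z eps rho : C) (p h : {poly C}).

(** A Blaschke factor has modulus at most 1: the difference of the squares is (|z|^2 - 1)(1 -
    |rho|^2). *)
Lemma reflect_factor z rho : 1 <= cabs z -> cabs rho <= 1 ->
  cabs z * cabs ((cj z)^-1 - rho) <= cabs (z - rho).
Proof.
move=> z1 r1; have z0 : cj z != 0.
  by rewrite -cabs_gt0 cabs_conj (lt_le_trans ltr01).
rewrite -[cabs z]cabs_conj -cabsM mulrBr mulfV//.
rewrite -[leRHS]ger0_norm ?cabs_ge0// -ler_sqr ?nnegrE ?cabs_ge0 ?normr_ge0// real_normK ?num_real//.
rewrite -subr_ge0 !cabs_sq !(ReD, ImD, ReN, ImN, ReM, ImM, ReJ, ImJ)/=.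
have -> : (Re z - Re rho) ^+ 2 + (Im z - Im rho) ^+ 2 -
    ((1 - (Re z * Re rho - - Im z * Im rho)) ^+ 2 + (0 - (Re z * Im rho + - Im z * Re rho)) ^+ 2) =
    (cabs z ^+ 2 - 1) * (1 - cabs rho ^+ 2) by rewrite !cabs_sq; ring.
by rewrite mulr_ge0// subr_ge0 ?exprn_ege1// exprn_ile1 ?cabs_ge0.
Qed.

Lemma poly_split p : exists rs : seq C,
  p = lead_coef p *: \prod_(r <- rs) ('X - r%:P) /\ (p != 0 -> size p = (size rs).+1).
Proof.
have [rs e] := closed_field_poly_normal p; exists rs; split=> // p0.
by rewrite {1}e size_scale ?lead_coef_eq0// size_prod_XsubC.
Qed.

Lemma root_split p rs r : p = lead_coef p *: \prod_(r <- rs) ('X - r%:P) -> r \in rs -> p.[r] = 0.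
Proof.
move=> -> rin; apply/eqP; rewrite hornerZ mulf_eq0; apply/orP; right.
by rewrite -/(root _ _) root_prod_XsubC.
Qed.

Lemma horner_split p rs x : p = lead_coef p *: \prod_(r <- rs) ('X - r%:P) ->
  cabs p.[x] = cabs (lead_coef p) * \prod_(r <- rs) cabs (x - r).
Proof.
move=> ->; rewrite hornerZ horner_prod cabsM cabs_prod; congr (_ * _).
  by rewrite lead_coefZ lead_coef_prod big1_seq ?mulr1// => r _; rewrite lead_coefXsubC.
by apply: eq_bigr => r _; rewrite hornerXsubC.
Qed.

Lemma reflect_prod z (rs : seq C) : 1 <= cabs z -> (forall r, r \in rs -> cabs r <= 1) ->
  cabs z ^+ size rs * \prod_(r <- rs) cabs ((cj z)^-1 - r) <= \prod_(r <- rs) cabs (z - r).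
Proof.
move=> z1; elim: rs => [|r rs IH] h; first by rewrite !big_nil mul1r.
rewrite !big_cons exprS mulrACA; apply: ler_pM; rewrite ?mulr_ge0 ?exprn_ge0 ?prodr_ge0 ?cabs_ge0//.
- by move=> *; exact: cabs_ge0.
- by apply: reflect_factor => //; apply: h; rewrite mem_head.
- by apply: IH => x xr; apply: h; rewrite inE xr orbT.
Qed.

(** Pascal's rule splits the polynomial as A(z) + z P(z). P has real coefficients and its roots lie
    in the closed disc by [binomial_transform_neq0]; the functional equation gives A(z) = eps z^m
    P(1/z). Hence |A(z)| <= |P(z)| < |z P(z)|. *)
Lemma xi_poly_outer xi eps m z : xi_like eps xi -> cabs eps = 1 ->
  (forall w, xi (cj w) = cj (xi w)) -> (0 < m)%N -> 1 < cabs z ->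
  \sum_(j < m.+2) 'C(m.+1, j)%:R * z ^+ j * xi (j%:R - m.+1%:R / 2)%:C != 0.
Proof.
move=> hxi he xiJ m0 z1.
pose x (j : nat) : R := 1 / 2 + j%:R - m%:R / 2.
pose P : {poly C} := \poly_(j < m.+1) ('C(m, j)%:R * xi (x j)%:C).
have PE w : P.[w] = \sum_(j < m.+1) 'C(m, j)%:R * xi (x j)%:C * w ^+ j.
  by rewrite horner_poly.
have Pz w : 1 < cabs w -> P.[w] != 0.
  by move=> w1; rewrite PE; exact: binomial_transform_neq0 hxi he xiJ w1 m0.
have xm : 1 / 2 < x m.
  have : (0 : R) < m%:R by rewrite ltr0n.
  by rewrite /x; clear; lra.
have lc : P`_m != 0.
  by rewrite coef_poly ltnSn binn mul1r; exact: (xi_neq0 hxi).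
have sP : size P = m.+1.
  apply/eqP; rewrite eqn_leq size_poly/= ltnNge; apply: contra lc => h.
  by rewrite nth_default.
have P0 : P != 0 by rewrite -size_poly_eq0 sP.
have [rs [ers /(_ P0)]] := poly_split P; rewrite sP => -[szr].
have hr r : r \in rs -> cabs r <= 1.
  move=> rin; rewrite leNgt; apply/negP => /Pz.
  by rewrite (root_split ers rin) eqxx.
have zp : 0 < cabs z := lt_trans ltr01 z1.
have z0 : z != 0 by rewrite -cabs_gt0.
have PJ w : P.[cj w] = cj P.[w].
  rewrite !PE rmorph_sum/=; apply: eq_bigr => j _.
  have xr : cj (xi (x j)%:C) = xi (x j)%:C by rewrite -xiJ conjc_real.
  by rewrite [RHS]rmorphM [in RHS]rmorphM rmorphXn/= xr conjc_nat.
have AE : \sum_(j < m.+1) 'C(m, j)%:R * z ^+ j * xi (j%:R - m.+1%:R / 2)%:C =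
    eps * (z ^+ m * P.[z^-1]).
  rewrite PE !mulr_sumr (reindex_inj rev_ord_inj)/=; apply: eq_bigr => j _.
  have jm : (j <= m)%N by rewrite -ltnS.
  have ez : z ^+ m = z ^+ (m - j) * z ^+ j by rewrite -exprD subnK.
  rewrite subSS bin_sub// exprVn ez.
  have -> : (((m - j)%:R - m.+1%:R / 2)%:C : C) = - (x j)%:C.
    by rewrite -rmorphN/=; congr (_%:C); rewrite natrB// /x -(natr1 m); field.
  rewrite (xi_symm hxi); have zj : z ^+ j != 0 by rewrite expf_neq0.
  move: (xi _) (z ^+ j) zj => X Y Y0; move: (z ^+ (m - j)) => W.
  by field.
have AP : cabs (\sum_(j < m.+1) 'C(m, j)%:R * z ^+ j * xi (j%:R - m.+1%:R / 2)%:C) <= cabs P.[z].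
  rewrite AE cabsM he mul1r cabsM cabsX.
  have -> : cabs P.[z^-1] = cabs P.[(cj z)^-1].
    by rewrite -[in LHS]cabs_conj -PJ; congr (cabs P.[_]); rewrite fmorphV.
  rewrite !(horner_split _ ers) mulrCA ler_wpM2l ?cabs_ge0//.
  by rewrite szr; exact: reflect_prod (ltW z1) hr.
rewrite (binomial_step (fun j => xi (j%:R - m.+1%:R / 2)%:C)).
have -> : \sum_(j < m.+1) 'C(m, j)%:R * z ^+ j * xi (j.+1%:R - m.+1%:R / 2)%:C = P.[z].
  rewrite PE; apply: eq_bigr => j _; rewrite mulrAC; congr (_ * xi _%:C * _).
  by rewrite /x -(natr1 j) -(natr1 m); field.
rewrite -cabs_gt0; move: AP; move: (\sum_(j < m.+1) _) => A AP.
have := cabsB_ge (z * P.[z]) (- A); rewrite opprK cabsN cabsM [X in _ <= cabs X]addrC => h.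
apply: lt_le_trans h; rewrite subr_gt0; apply: le_lt_trans AP _.
by rewrite ltr_pMl// cabs_gt0 Pz.
Qed.

(** The functional equation makes the polynomial self-reciprocal up to eps, so z is replaced by 1/z.
    At z = 0 the constant coefficient is, up to eps, the value of xi at (m + 1)/2 >= 1. *)
Lemma xi_poly_inner xi eps m z : xi_like eps xi -> cabs eps = 1 ->
  (forall w, xi (cj w) = cj (xi w)) -> (0 < m)%N -> cabs z < 1 ->
  \sum_(j < m.+2) 'C(m.+1, j)%:R * z ^+ j * xi (j%:R - m.+1%:R / 2)%:C != 0.
Proof.
move=> hxi he xiJ m0 z1.
have eps0 : eps != 0 by rewrite -cabs_gt0 he ltr01.
have [->|z0] := eqVneq z 0.
  rewrite big_ord_recl/= big1 ?addr0 => [|j _]; last by rewrite expr0n/= mulr0 mul0r.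
  rewrite bin0 expr0 !mul1r sub0r rmorphN/= (xi_symm hxi) mulf_neq0// (xi_neq0 hxi)//=.
  have : (1 : R) <= m%:R by rewrite ler1n.
  by rewrite -(natr1 m); clear; lra.
have zp : 0 < cabs z by rewrite cabs_gt0.
have := @xi_poly_outer xi eps m z^-1 hxi he xiJ m0.
rewrite cabsV invf_gt1// => /(_ z1); apply: contraNN => /eqP e.
rewrite -(mulrI_eq0 _ (mulfI (expf_neq0 m.+1 z0))) -(mulrI_eq0 _ (mulfI eps0)).
apply/eqP; rewrite -[RHS]e !mulr_sumr (reindex_inj rev_ord_inj)/=; apply: eq_bigr => j _.
have jm : (j <= m.+1)%N by rewrite -ltnS.
rewrite subSS bin_sub// exprVn -{1}(subnK jm) exprD.
have -> : (((m.+1 - j)%:R - m.+1%:R / 2)%:C : C) = - (j%:R - m.+1%:R / 2)%:C.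
  by rewrite -rmorphN/=; congr (_%:C); rewrite natrB//; field.
have ee : eps * eps = 1.
  have := xi_symm hxi (- (2%:R : C)); rewrite opprK (xi_symm hxi) mulrA => h.
  have x0 : xi 2%:R != 0 by apply: (xi_neq0 hxi); rewrite Re_nat; clear; lra.
  by apply/esym/(mulIf x0); rewrite mul1r.
rewrite (xi_symm hxi); have zj : z ^+ (m.+1 - j) != 0 by rewrite expf_neq0.
move: (xi _) (z ^+ j) => X Y; move: (z ^+ (m.+1 - j)) zj => W W0.
transitivity (eps * eps * ('C(m.+1, j)%:R * Y * X)); last by rewrite ee mul1r.
by field.
Qed.

(** To the right of c + 1/2 the point s is at least as far as s - 1 from every root r with Re r <=
    c; multiply over the roots. *)
Lemma shift_le h rho0 (c : R) s : h != 0 -> (forall r, h.[r] = 0 -> Re r <= c) ->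
  c + 1 / 2 < Re s -> rho0 = s - 1 -> cabs h.[rho0] <= cabs h.[s] /\ h.[s] != 0.
Proof.
move=> h0 hr hs ->; split; last first.
  by apply: contraTneq hs => /hr; rewrite -leNgt; clear; lra.
have [rs [e _]] := poly_split h; rewrite !(horner_split _ e) ler_wpM2l ?cabs_ge0//.
rewrite big_seq [leRHS]big_seq; apply: ler_prod => r rin; rewrite cabs_ge0/=.
have {}hr := hr _ (root_split e rin).
rewrite -ler_sqr ?nnegrE ?cabs_ge0// !cabs_sq !(ReD, ImD, ReN, ImN)/= subr0.
rewrite lerD2r -subr_ge0.
have -> : (Re s - Re r) ^+ 2 - (Re s - 1 - Re r) ^+ 2 = 2 * (Re s - Re r - 1 / 2) by field.
by rewrite mulr_ge0//; move: hr hs; clear; lra.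
Qed.

(* The action of U(T) on functions, T being the shift s |-> s - 1. *)
Definition pact (U : {poly C}) (F : C -> C) n s := \sum_(j < n) U`_j * F (s - j%:R).

Lemma pact_XsubC (U : {poly C}) (F : C -> C) n s (zt : C) : (size U <= n)%N ->
  pact (('X - zt%:P) * U) F n.+1 s = pact U (fun s => F (s - 1) - zt * F s) n s.
Proof.
move=> h; rewrite /pact; under eq_bigr => j _ do
  rewrite mulrBl coefB coefXM coefCM mulrBl.
rewrite sumrB big_ord_recl/= mul0r add0r big_ord_recr/= nth_default// mulr0 mul0r addr0.
rewrite -sumrB; apply: eq_bigr => j _; rewrite /bump/= add1n mulrBr; congr (_ - _).
  by rewrite -(natr1 j) opprD addrA addrAC.
by ring.
Qed.

Definition rising n s : C := \prod_(i < n) (s + i%:R).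

(* Each factor T - zt turns rising n * h into rising n.+1 * h', where the roots *)
(* of h' lie to the left of a line that has moved by 1/2 (Rodriguez-Villegas).  *)
Lemma pact_neq0 (zs : seq C) h s : (forall zt, zt \in zs -> 1 <= cabs zt) -> h != 0 ->
  (forall r, h.[r] = 0 -> Re r <= (1 - (size zs)%:R) / 2) -> 1 / 2 < Re s ->
  pact (\prod_(zt <- zs) ('X - zt%:P)) (fun s => rising (size zs) s * h.[s]) (size zs).+1 s != 0.
Proof.
elim: zs h => [|zt zs IH] h hz h0 hr hs.
  rewrite big_nil /pact big_ord1 coef1/= mul1r subr0 /rising big_ord0 mul1r.
  by apply: contraTneq hs => /hr; rewrite /= subr0 -leNgt.
rewrite big_cons pact_XsubC ?size_prod_XsubC//.
set m := size zs in IH *; rewrite /= -/m in hr *.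
have z1 : 1 <= cabs zt by apply: hz; rewrite mem_head.
(* Since rising (m+1) at x - 1 is (x - 1) times rising m at x, and rising (m+1) at x is (x + m)
   times it, [h'] is the cofactor left by T - zt. *)
pose h' := ('X - 1) * (h \Po ('X - 1)) - zt *: (('X + m%:R%:P) * h).
have h'E x : h'.[x] = (x - 1) * h.[x - 1] - zt * ((x + m%:R) * h.[x]).
  by rewrite /h' !(hornerE, horner_comp).
have n0 x : (1 - m%:R) / 2 < Re x -> h'.[x] != 0.
  move=> hx; have [||a1 a2] := @shift_le h (x - 1) ((1 - m.+1%:R) / 2) x h0 hr => //.
    by move: hx; rewrite -(natr1 m); clear; lra.
  have m0 : (0 : R) <= m%:R by [].
  have b1 : cabs (x - 1) < cabs (x + m%:R).
    rewrite -ltr_sqr ?nnegrE ?cabs_ge0// !cabs_sq !(ReD, ImD, ReN, ImN, Re_nat, Im_nat)/= subr0 addr0.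
    rewrite ltrD2r -subr_gt0.
    have -> : (Re x + m%:R) ^+ 2 - (Re x - 1) ^+ 2 = (m%:R + 1) * (2 * Re x + m%:R - 1) by ring.
    by rewrite mulr_gt0//; move: hx m0; clear; lra.
  rewrite h'E subr_eq0; apply/negP => /eqP /(congr1 (@cabs R)).
  rewrite !cabsM => e.
  have q : cabs (x - 1) * cabs h.[x - 1] < cabs zt * (cabs (x + m%:R) * cabs h.[x]).
    have p0 : 0 < cabs (x + m%:R) := le_lt_trans (cabs_ge0 _) b1.
    have p1 : 0 < cabs h.[x] by rewrite cabs_gt0.
    apply: (@lt_le_trans _ _ (cabs (x + m%:R) * cabs h.[x])).
      apply: (@le_lt_trans _ _ (cabs (x - 1) * cabs h.[x])); first by rewrite ler_wpM2l ?cabs_ge0.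
      by rewrite ltr_pM2r.
    by rewrite ler_peMl// mulr_ge0// ltW.
  by move: q; rewrite e ltxx.
have h'0 : h' != 0.
  apply/eqP => e; have := n0 1; rewrite e horner0 eqxx => H; have // := H _.
  have : (0 : R) <= m%:R by [].
  by rewrite /=; clear; lra.
have hz' x : x \in zs -> 1 <= cabs x by move=> h1; apply: hz; rewrite inE h1 orbT.
have hr' r : h'.[r] = 0 -> Re r <= (1 - m%:R) / 2.
  by move=> e; rewrite leNgt; apply/negP => /n0; rewrite e eqxx.
have := IH h' hz' h'0 hr' hs; rewrite /pact.
congr (_ != 0); apply: eq_bigr => j _; congr (_ * _).
set x := s - j%:R; rewrite h'E /rising.
rewrite [\prod_(i < m.+1) (x - 1 + _)]big_ord_recl [\prod_(i < m.+1) (x + _)]big_ord_recr/=.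
have -> : \prod_(i < m) (x - 1 + (bump 0 i)%:R) = \prod_(i < m) (x + i%:R) :> C.
  by apply: eq_bigr => i _; rewrite /bump/= add1n -natr1; ring.
by rewrite addr0; ring.
Qed.

Definition zeta_sum (c : nat -> C) n s := \sum_(j < n.+1) c j * rising n (s - j%:R).

(** The roots of U have modulus at least 1 by [xi_poly_inner]; [pact_neq0] applies with h = 1, which
    has no roots. *)
Lemma zeta_sum_neq0 xi eps m s : xi_like eps xi -> cabs eps = 1 ->
  (forall w, xi (cj w) = cj (xi w)) -> (0 < m)%N -> 1 / 2 < Re s ->
  zeta_sum (fun j => 'C(m.+1, j)%:R * xi (j%:R - m.+1%:R / 2)%:C) m.+1 s != 0.
Proof.
move=> hxi he xiJ m0 hs.
pose U : {poly C} := \poly_(j < m.+2) ('C(m.+1, j)%:R * xi (j%:R - m.+1%:R / 2)%:C).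
have lc : U`_m.+1 != 0.
  rewrite coef_poly ltnSn binn mul1r; apply: (xi_neq0 hxi) => /=.
  have : (1 : R) <= m%:R by rewrite ler1n.
  by rewrite -(natr1 m); clear; lra.
have sU : size U = m.+2.
  apply/eqP; rewrite eqn_leq size_poly/= ltnNge; apply: contra lc => h.
  by rewrite nth_default.
have U0 : U != 0 by rewrite -size_poly_eq0 sU.
have [zs [ezs /(_ U0)]] := poly_split U; rewrite sU => -[szs].
have hz zt : zt \in zs -> 1 <= cabs zt.
  move=> zin; rewrite leNgt; apply/negP => z1.
  have := xi_poly_inner hxi he xiJ m0 z1; have := root_split ezs zin.
  by rewrite horner_poly; under eq_bigr do rewrite mulrAC; move=> ->; rewrite eqxx.
have hr r : (1 : {poly C}).[r] = 0 -> Re r <= (1 - (size zs)%:R) / 2.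
  by rewrite hornerC => /eqP; rewrite oner_eq0.
have := @pact_neq0 zs 1 s hz (oner_neq0 _) hr hs; rewrite -szs => h.
have -> : zeta_sum (fun j => 'C(m.+1, j)%:R * xi (j%:R - m.+1%:R / 2)%:C) m.+1 s =
    lead_coef U * pact (\prod_(zt <- zs) ('X - zt%:P)) (fun s => rising m.+1 s * (1 : {poly C}).[s]) m.+2 s.
  rewrite /zeta_sum /pact mulr_sumr; apply: eq_bigr => j _.
  rewrite hornerC mulr1 mulrA -coefZ -ezs coef_poly ltn_ord//.
by rewrite mulf_neq0// lead_coef_eq0.
Qed.

End UnimodularRoots.

(** * The zeta polynomial as a sum of rising factorials *)

Section ZetaPolynomial.
Variable R : realType.
Local Notation C := R[i].
Local Notation Re := complex.Re.
Local Notation Im := complex.Im.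
Implicit Types (L : C -> C) (s eps : C) (c w : nat -> C) (k n K N : nat).

Lemma rising_reflect n (x : C) : ~~ odd n -> rising n (1 - n%:R - x) = rising n x.
Proof.
move=> en; rewrite /rising (reindex_inj rev_ord_inj)/=.
transitivity (\prod_(i < n) (-1 * (x + i%:R))).
  apply: eq_bigr => i _; have hi := ltn_ord i.
  by rewrite natrB// -(natr1 i); ring.
by rewrite big_split/= prodr_const card_ord -signr_odd (negbTE en) expr0 mul1r.
Qed.

Lemma zeta_sum_symm c eps n s : ~~ odd n ->
  (forall j, (j <= n)%N -> c (n - j)%N = eps * c j) ->
  zeta_sum c n (1 - s) = eps * zeta_sum c n s.
Proof.
move=> en hc; rewrite /zeta_sum (reindex_inj rev_ord_inj) mulr_sumr/=; apply: eq_bigr => j _.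
have jn : (j <= n)%N by rewrite -ltnS.
rewrite subSS hc// -mulrA; congr (_ * (_ * _)).
by rewrite -[RHS]rising_reflect// natrB//; congr rising; ring.
Qed.

Lemma stirling1_sum n (x : C) :
  \sum_(l < n.+1) (stirling1 n l)%:~R * x ^+ l = \prod_(i < n) (x - i%:R).
Proof.
pose P : {poly int} := \prod_(0 <= i < n) ('X - i%:Z%:P).
have sP : size P = n.+1 by rewrite /P size_prod_XsubC size_iota subn0.
have <- : (map_poly intr P).[x] = \prod_(i < n) (x - i%:R) :> C.
  rewrite /P rmorph_prod/= horner_prod big_mkord; apply: eq_bigr => i _.
  by rewrite rmorphB/= map_polyX map_polyC/= hornerXsubC.
rewrite (horner_coef_wide (n := n.+1)) ?(leq_trans (size_poly _ _)) ?sP//.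
by apply: eq_bigr => l _; rewrite coef_map.
Qed.

(** With l = m + h the sum over h is the binomial expansion of (j - s)^l; summed against the
    Stirling numbers it gives the falling factorial of j - s. *)
Lemma stirling_expand n w s :
  \sum_(0 <= h < n.+1) (- s) ^+ h *
    \sum_(0 <= m < (n - h).+1) ('C(m + h, h))%:R * (stirling1 n (m + h))%:~R *
      (\sum_(0 <= j < n.+1) w j * j%:R ^+ m) =
  \sum_(j < n.+1) w j * \prod_(i < n) (j%:R - s - i%:R).
Proof.
pose G h l := \sum_(j < n.+1) w j * ((stirling1 n l)%:~R * ('C(l, h)%:R * ((- s) ^+ h * j%:R ^+ (l - h)))).
transitivity (\sum_(h < n.+1) \sum_(l < n.+1) G h l).
  rewrite big_mkord; apply: eq_bigr => h _; rewrite mulr_sumr.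
  have hn : (h <= n)%N by rewrite -ltnS.
  rewrite -(big_mkord xpredT (G h)) (big_cat_nat (n := h) _ (leqW hn))//=.
  rewrite [X in _ = X + _]big_nat [X in _ = X + _]big1 => [|l /andP[_ lh]]; last first.
    by rewrite /G big1// => j _; rewrite bin_small// mul0r !mulr0.
  rewrite add0r -[X in \sum_(X <= _ < n.+1) _]add0n big_addn subSn//; apply: eq_bigr => m _.
  rewrite /G addnK big_mkord !mulr_sumr; apply: eq_bigr => j _.
  by move: (w j) (_%:~R) => x y; ring.
rewrite exchange_big/= /G.
under eq_bigr => l _ do rewrite exchange_big/=.
rewrite exchange_big/=; apply: eq_bigr => j _.
rewrite -stirling1_sum mulr_sumr; apply: eq_bigr => l _.
rewrite -!mulr_sumr; congr (_ * (_ * _)).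
have ln : (l <= n)%N by rewrite -ltnS.
rewrite exprDn -(big_mkord xpredT (fun h => 'C(l, h)%:R * ((- s) ^+ h * j%:R ^+ (l - h)))).
rewrite (big_cat_nat (n := l.+1))//= [X in _ + X]big_nat [X in _ + X]big1 ?addr0 => [|h /andP[lh _]]; last first.
  by rewrite bin_small// mul0r.
rewrite big_mkord; apply: eq_bigr => h _.
by rewrite mulr_natl mulrC.
Qed.

(** Writing the weight as m + 3 makes k - 2 = m + 1 hold by computation. The falling factorial of j
    - s has even length and equals the rising factorial of s - j; Gamma(j + 1) = j! completes 1/(m +
    1 - j)! to a binomial coefficient. *)
Lemma Zf_zeta_sum m K N L eps s : (0 < N)%N -> m.+3 = K.*2 ->
  is_root_number K.*2 N L eps ->
  Zf m.+3 N L eps s = eps / (m.+1)`!%:R *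
    zeta_sum (fun j => 'C(m.+1, j)%:R * Xi N K L eps (j%:R - m.+1%:R / 2)%:C) m.+1 s.
Proof.
move=> N0 eK he; have en : ~~ odd m.+1 by have := odd_double K; rewrite -eK/= negbK => ->.
have nf : (m.+1)`!%:R != 0 :> C by rewrite pnatr_eq0 -lt0n fact_gt0.
pose Q : R := Num.sqrt N%:R / (2 * pi).
pose w j := (Q ^+ j.+1)%:C * (L j.+1%:R / ((m.+1 - j)`!)%:R) : C.
rewrite -mulrA; congr (_ * _); rewrite /zeta_sum mulr_sumr.
transitivity (\sum_(j < m.+2) w j * \prod_(i < m.+1) (j%:R - s - i%:R)).
  exact: (stirling_expand m.+1 w s).
 apply: eq_bigr => j _.
have jn : (j <= m.+1)%N by rewrite -ltnS.
rewrite mulrA; congr (_ * _); last first.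
  transitivity (\prod_(i < m.+1) (-1 * (s - j%:R + i%:R))).
    by apply: eq_bigr => i _; ring.
  by rewrite big_split/= prodr_const card_ord -signr_odd (negbTE en) expr0 mul1r.
have eR : (m.+3%:R : R) = 2 * K%:R by rewrite eK -mul2n natrM.
have r0 : 0 < Re ((j%:R - m.+1%:R / 2)%:C : C) + K%:R.
  have e : j%:R - m.+1%:R / 2 + K%:R = j%:R + 1 :> R.
    by have := eR; rewrite -(natr1 m.+2) -(natr1 m.+1)/=; lra.
  by rewrite /= e ltr_wpDl.
rewrite Xi_right//.
have -> : K%:R + (j%:R - m.+1%:R / 2)%:C = j.+1%:R :> C.
  rewrite -(rmorph_nat (real_complex R)) -(rmorph_nat (real_complex R) j.+1) -rmorphD/=.
  by congr (_%:C); have := eR; rewrite -(natr1 m.+2) -(natr1 m.+1) -(natr1 j); lra.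
rewrite /Lambda cpow_nat ?conductor_gt0// Gamma_nat -/Q /w.
have bf : ('C(m.+1, j) * (j`! * (m.+1 - j)`!))%:R = (m.+1)`!%:R :> C by rewrite bin_fact.
rewrite -bf !natrM invfM.
have b0 : 'C(m.+1, j)%:R != 0 :> C by rewrite pnatr_eq0 -lt0n bin_gt0.
have f1 : (j`!)%:R != 0 :> C by rewrite pnatr_eq0 -lt0n fact_gt0.
have f2 : ((m.+1 - j)`!)%:R != 0 :> C by rewrite pnatr_eq0 -lt0n fact_gt0.
move: (_ ^+ _)%:C (L _) => q l.
move: b0 f1 f2; move: ('C(_, _)%:R) (_`!%:R) (_`!%:R) => x y z b0 f1 f2.
by field; rewrite b0 f1 f2.
Qed.

Lemma Xi_central_symm m K N L eps j : (0 < K)%N -> is_root_number K.*2 N L eps -> (j <= m)%N ->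
  'C(m, m - j)%:R * Xi N K L eps ((m - j)%:R - m%:R / 2)%:C =
  eps * ('C(m, j)%:R * Xi N K L eps (j%:R - m%:R / 2)%:C).
Proof.
move=> K0 he jm; rewrite bin_sub// mulrCA; congr (_ * _).
rewrite -Xi_symm// -rmorphN/=; congr (Xi _ _ _ _ _%:C).
by rewrite natrB//; field.
Qed.

(** The symmetry moves a zero left of the critical line to one right of it, where [zeta_sum_neq0]
    excludes zeros. *)
Theorem zeta_polynomial_RH m K N L eps a : (0 < N)%N -> (0 < m)%N -> m.+3 = K.*2 ->
  Lseries K N a L -> (forall n, cj (a n) = a n) -> is_root_number K.*2 N L eps ->
  (forall s, Zf m.+3 N L eps s = eps * Zf m.+3 N L eps (1 - s)) /\
  (forall rho, Zf m.+3 N L eps rho = 0 -> Re rho = 1 / 2).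
Proof.
move=> N0 m0 eK hL ha he.
have K0 : (0 < K)%N by rewrite -double_gt0 -eK.
have en : ~~ odd m.+1 by have := odd_double K; rewrite -eK/= negbK => ->.
have hx := Xi_like N0 K0 hL he; have ce := cabs_eps he; have ee := eps_sq he.
have xJ (w : C) := Xi_conj w K0 he (Lseries_conj hL ha).
have symm s : Zf m.+3 N L eps s = eps * Zf m.+3 N L eps (1 - s).
  rewrite !(Zf_zeta_sum _ N0 eK he) (@zeta_sum_symm _ eps) => [|//|j jn].
    by rewrite [eps * (_ * _)]mulrCA [eps * (eps * _)]mulrA ee mul1r.
  exact: Xi_central_symm.
split=> // rho e.
have f0 : eps / (m.+1)`!%:R != 0 :> C.
  by rewrite mulf_neq0 ?invr_eq0 ?pnatr_eq0 -?lt0n ?fact_gt0// -cabs_gt0 ce.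
have nz s : 1 / 2 < Re s -> Zf m.+3 N L eps s != 0.
  by move=> hs; rewrite (Zf_zeta_sum _ N0 eK he) mulf_neq0//; exact: zeta_sum_neq0 hx ce xJ m0 hs.
have [h|h|//] := ltgtP (Re rho) (1 / 2); last by have := nz _ h; rewrite e eqxx.
have h' : 1 / 2 < Re (1 - rho) by rewrite ReD ReN/=; move: h; clear; lra.
by have := nz _ h'; have := symm (1 - rho); rewrite subKr e mulr0 => ->; rewrite eqxx.
Qed.

End ZetaPolynomial.

(** * Affine changes of variable for Lebesgue measure *)

Section AffineInvariance.
Variable R : realType.
Local Notation mu := (@lebesgue_measure R).
Local Open Scope ereal_scope.

Lemma measurable_affine (r c : R) : measurable_fun [set: R] (fun x : R => r * x + c)%R.
Proof. by apply: measurable_funD => //; apply: measurable_funM. Qed.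

(** The rescaled image of Lebesgue measure agrees with it on half-open intervals, hence everywhere
    by uniqueness. *)
Lemma integral_affine (r c : R) (f : R -> \bar R) : (0 < r)%R ->
  measurable_fun [set: R] f -> (forall x, 0 <= f x) ->
  \int[mu]_x f x = \int[mu]_x (r%:E * f (r * x + c)%R).
Proof.
move=> r0 mf f0.
pose phi : measurableTypeR R -> measurableTypeR R := fun x => (r * x + c)%R.
have mphi : measurable_fun [set: measurableTypeR R] phi := measurable_affine r c.
pose mixin := isMeasurableFun.Build _ _ _ _ _ mphi.
pose Phi : {mfun measurableTypeR R >-> measurableTypeR R} := HB.pack phi mixin.
pose k : {nonneg R} := NngNum (ltW r0).
have hm (A : set R) : measurable A -> mu A = mscale k (pushforward mu Phi) A.
  apply: lebesgue_measure_unique => _ [[a b] _ <-].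
  change (mu `]a, b]%classic = r%:E * mu ((fun x : R => (r * x + c)%R) @^-1` `]a, b]%classic)).
  have -> : (fun x : R => (r * x + c)%R) @^-1` `]a, b]%classic = `]((a - c) / r)%R, ((b - c) / r)%R]%classic.
    apply/seteqP; split=> x /=; rewrite !in_itv/= ltr_pdivrMr// ler_pdivlMr// ltrBlDr lerBrDr;
      by rewrite mulrC.
  rewrite !lebesgue_measure_itv/= !lte_fin ltr_pM2r ?invr_gt0// ltrD2r.
  case: ifP => _; last by rewrite mule0.
  by rewrite -!EFinD -EFinM; congr (_%:E); field; rewrite gt_eqF.
rewrite ge0_integralZl//; first last.
- by rewrite lee_fin ltW.
- exact: (measurableT_comp mf mphi).
rewrite [LHS](eq_measure_integral (mscale k (pushforward mu Phi))) => [|A mA _]; last exact: hm.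
rewrite ge0_integral_mscale//; congr (_ * _).
have := ge0_integral_pushforward mphi mu measurableT mf (fun x (_ : x \in setT) => f0 x).
by rewrite preimage_setT.
Qed.

Lemma integral_opp (f : R -> \bar R) : measurable_fun [set: R] f -> (forall x, 0 <= f x) ->
  \int[mu]_x f x = \int[mu]_x f (- x)%R.
Proof.
move=> mf f0.
rewrite [LHS](eq_measure_integral (pushforward mu (-%R : _ -> measurableTypeR R))); last first.
  by move=> A mA _; apply/esym; exact: lebesgue_measureN.
by rewrite ge0_integral_pushforward.
Qed.

End AffineInvariance.

(** * Measurability of continuous functions on the upper half-plane *)

Section PlaneMeasurability.
Variable R : realType.
Local Notation C := R[i].
Local Notation Re := complex.Re.
Local Notation Im := complex.Im.

Lemma measurable_countable d (T : measurableType d) (I : countType) (q : T -> I) (u : I -> R) :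
  (forall i, measurable (q @^-1` [set i])) -> measurable_fun [set: T] (u \o q).
Proof.
move=> hq _ Y mY; rewrite setTI.
have -> : (u \o q) @^-1` Y = \bigcup_n (if unpickle n is Some i then
    (if i \in u @^-1` Y then q @^-1` [set i] else set0) else set0).
  apply/seteqP; split => [x /= hx|x [n _]].
    by exists (pickle (q x)) => //=; rewrite pickleK mem_set.
  case: (unpickle n) => [i|//]; case: ifPn => [|//]; rewrite inE => hi /= qi.
  by rewrite /preimage/= qi.
apply: bigcupT_measurable => n; case: (unpickle n) => [i|//]; by case: ifP.
Qed.

Definition upper_ext (g : C -> R) (p : R * R) : R := if (0 < p.2)%R then g (p.1 +i* p.2) else 0%R.

Lemma measurable_pos_snd : measurable_fun [set: R * R] (fun p : R * R => 0 < p.2).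
Proof. by apply: measurable_fun_ltr => //; exact: measurable_snd. Qed.

(** The function is a pointwise limit of samples on ever finer grids, each of which factors through
    a countable set of cells. *)
Lemma continuous_upper_measurable (g : C -> R) :
  (forall z, upper z -> forall e : R, 0 < e -> exists2 d : R, 0 < d &
     forall w, cabs (w - z) < d -> `|g w - g z| <= e) ->
  measurable_fun [set: R * R] (upper_ext g).
Proof.
move=> hg; pose fl n (x : R) : int := Num.floor (n.+1%:R * x).
pose q n (p : R * R) : int * int := (fl n p.1, fl n p.2).
pose pt n (ij : int * int) : C :=
  (ij.1%:~R / n.+1%:R) +i* ((ij.2%:~R + 1) / n.+1%:R).
pose G n (p : R * R) : R := if 0 < p.2 then g (pt n (q n p)) else 0.
have n0 n : (0 : R) < n.+1%:R by rewrite ltr0n.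
apply: (@measurable_fun_cvg _ _ _ _ G).
  move=> n; apply: measurable_fun_ifT => //.
    exact: measurable_pos_snd.
  apply: (@measurable_countable _ _ _ (q n) (fun ij => g (pt n ij))) => -[i j].
  pose iv (i : int) : set R := `[i%:~R / n.+1%:R, (i%:~R + 1) / n.+1%:R[%classic.
  have -> : q n @^-1` [set (i, j)] = iv i `*` iv j.
    have e (x : R) (m : int) : (fl n x = m) <-> iv m x.
      rewrite /iv/= in_itv/= ler_pdivrMr// ltr_pdivlMr// [(x * _)%R]mulrC.
      have -> : m%:~R + 1 = (m + 1)%:~R :> R by rewrite intrD.
      by rewrite -floor_eq; split=> /eqP.
    apply/seteqP; split=> -[x y] /=; first by case=> /e h1 /e h2.
    by case=> /e h1 /e h2; rewrite /q/= h1 h2.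
  by apply: measurableX; exact: measurable_itv.
move=> [x y] _; rewrite /G /upper_ext/=; case: ifP => [y0|_]; last exact: cvg_cst.
have fx n (t : R) : (fl n t)%:~R / n.+1%:R <= t < ((fl n t)%:~R + 1) / n.+1%:R.
  rewrite ler_pdivrMr// ltr_pdivlMr// [(t * _)%R]mulrC.
  by have := floor_itv (n.+1%:R * t); rewrite intrD.
apply/cvgrPdist_le => /= e e0; have [d d0 hd] := hg (x +i* y) y0 e e0.
exists (Num.truncn (2 / d)).+1 => // n /= hn; rewrite distrC; apply: hd.
have nd : 2 / d < n.+1%:R.
  by apply: lt_le_trans (truncnS_gt _) _; rewrite ler_nat; exact: leqW.
have nd' : n.+1%:R^-1 < d / 2.
  by rewrite -[d / 2]invrK invf_div ltf_pV2 ?posrE ?divr_gt0.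
have step (t : R) : (fl n t)%:~R / n.+1%:R <= t /\ t <= (fl n t)%:~R / n.+1%:R + n.+1%:R^-1.
  by have /andP[h1 h2] := fx n t; split=> //; by move: h2; rewrite mulrDl mul1r; exact: ltW.
have [x1 x2] := step x; have [y1 y2] := step y.
apply: le_lt_trans (cabs_le _) _; rewrite /pt ReD ImD ReN ImN/= mulrDl mul1r.
have nn : 0 <= n.+1%:R^-1 :> R by rewrite invr_ge0.
have b1 : `|(fl n x)%:~R / n.+1%:R - x| <= n.+1%:R^-1.
  by rewrite ler_norml; move: nn x1 x2; move: (n.+1%:R^-1) (_ / n.+1%:R) => X Y; clear; lra.
have b2 : `|(fl n y)%:~R / n.+1%:R + n.+1%:R^-1 - y| <= n.+1%:R^-1.
  by rewrite ler_norml; move: nn y1 y2; move: (n.+1%:R^-1) (_ / n.+1%:R) => X Y; clear; lra.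
apply: le_lt_trans (lerD b1 b2) _.
by move: nd'; move: (n.+1%:R^-1) => Y; clear; lra.
Qed.

Lemma measurable_inv_pos : measurable_fun [set: R] (fun y : R => if 0 < y then y^-1 else 0).
Proof.
have hc z : upper z -> forall e : R, 0 < e -> exists2 d : R, 0 < d &
    forall w, cabs (w - z) < d -> `|(Im w)^-1 - (Im z)^-1| <= e.
  move=> z0 e e0.
  have z1 : (Im z)%:C != 0 by rewrite -cabs_gt0 cabs_real normr_gt0 gt_eqF.
  have [d d0 hd] := ccontV (ccont_id _) z1 e0.
  exists d => // w hw; have h : cabs ((Im w)%:C - (Im z)%:C) < d.
    apply: le_lt_trans hw; rewrite -rmorphB cabs_real -ImN -ImD; exact: cabs_Im.
  have := hd _ h; congr (_ <= _); rewrite -cabs_real; congr cabs.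
  by rewrite rmorphB/= !fmorphV.
exact: (measurable_fun_pair2 (0 : R) (continuous_upper_measurable hc)).
Qed.

End PlaneMeasurability.

(** * The invariant integral on the half-plane *)

Section InvariantIntegral.
Variable R : realType.
Local Notation C := R[i].
Local Notation Re := complex.Re.
Local Notation Im := complex.Im.
Local Notation mu := (@lebesgue_measure R).
Implicit Types (h g : C -> \bar R) (p : (R * R) * R) (q : R * R).
Local Open Scope ereal_scope.

(* The invariant measure of the half-plane is realised as the image of Lebesgue *)
(* measure on the quadratic forms of discriminant between 1 and 2, on which     *)
(* SL_2(R) acts by unimodular shears and swaps; no density y^-2 is needed.      *)
Definition inner (F : (R * R) * R -> \bar R) q := \int[mu]_c F (q, c).

Definition triple (F : (R * R) * R -> \bar R) := \int[(mu \x mu)]_q inner F q.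

Lemma measurable_inner F : measurable_fun [set: (R * R) * R] F -> (forall p, 0 <= F p) ->
  measurable_fun [set: R * R] (inner F).
Proof. by move=> mF F0; exact: (@measurable_fun_fubini_tonelli_F _ _ _ _ _ mu F mF F0). Qed.

Lemma inner_ge0 F q : (forall p, 0 <= F p) -> 0 <= inner F q.
Proof. by move=> F0; exact: integral_ge0. Qed.

Lemma tripleE F : measurable_fun [set: (R * R) * R] F -> (forall p, 0 <= F p) ->
  triple F = \int[mu]_b \int[mu]_a inner F (b, a).
Proof.
move=> mF F0; have mi := measurable_inner mF F0; have i0 q := inner_ge0 q F0.
exact: (@fubini_tonelli1 _ _ _ _ _ mu mu (inner F) mi i0).
Qed.

(** The substitution z -> z + t on quadratic forms: a translation in c for fixed (b, a), followed by
    a translation in b for fixed a. *)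
Lemma triple_shear F (t : R) : measurable_fun [set: (R * R) * R] F -> (forall p, 0 <= F p) ->
  triple (fun p => F ((p.1.1 - p.1.2 * t, p.1.2), p.2 - 2 * p.1.1 * t + p.1.2 * t ^+ 2)%R) = triple F.
Proof.
move=> mF F0; pose F' p := F ((p.1.1 - p.1.2 * t, p.1.2), p.2 - 2 * p.1.1 * t + p.1.2 * t ^+ 2)%R.
have m11 : measurable_fun [set: (R * R) * R] (fun p : (R * R) * R => p.1.1).
  exact: measurableT_comp.
have m12 : measurable_fun [set: (R * R) * R] (fun p : (R * R) * R => p.1.2).
  exact: measurableT_comp.
have mF' : measurable_fun [set: (R * R) * R] F'.
  apply: measurableT_comp => //; apply: measurable_fun_pair.
    apply: measurable_fun_pair => //.
    by apply: measurable_funB => //; apply: measurable_funM.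
  apply: measurable_funD; last by apply: measurable_funM.
  apply: measurable_funB => //.
  by apply: measurable_funM => //; apply: measurable_funM.
have iF' b a : inner F' (b, a) = inner F (b - a * t, a)%R.
  rewrite /inner /F'/= [RHS](@integral_affine _ 1 (- (2 * b * t) + a * t ^+ 2))//.
    by apply: eq_integral => c _; rewrite mul1e mul1r addrA.
  exact: (measurable_fun_pair2 _ mF).
rewrite (tripleE mF F0) (tripleE mF' (fun p => F0 _)).
have mG := measurable_inner mF F0; have G0 q := inner_ge0 q F0.
have mG' := measurable_inner mF' (fun p => F0 _).
have G0' q := inner_ge0 q (fun p => F0 _ : 0 <= F' p).
rewrite (@fubini_tonelli _ _ _ _ _ mu mu (inner F') mG' G0').
rewrite (@fubini_tonelli _ _ _ _ _ mu mu (inner F) mG G0).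
apply: eq_integral => a _; rewrite [RHS](@integral_affine _ 1 (- (a * t)))//.
  by apply: eq_integral => b _; rewrite mul1e mul1r iF'.
exact: (measurable_fun_pair1 a mG).
Qed.

Lemma triple_scale F (r : R) : (0 < r)%R -> measurable_fun [set: (R * R) * R] F ->
  (forall p, 0 <= F p) -> triple (fun p => F ((p.1.1, r^-1 * p.1.2), r * p.2)%R) = triple F.
Proof.
move=> r0 mF F0; pose F' p := F ((p.1.1, r^-1 * p.1.2), r * p.2)%R.
have m11 : measurable_fun [set: (R * R) * R] (fun p : (R * R) * R => p.1.1).
  exact: measurableT_comp.
have m12 : measurable_fun [set: (R * R) * R] (fun p : (R * R) * R => p.1.2).
  exact: measurableT_comp.
have mF' : measurable_fun [set: (R * R) * R] F'.
  apply: measurableT_comp => //; apply: measurable_fun_pair; last by apply: measurable_funM.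
  by apply: measurable_fun_pair => //; apply: measurable_funM.
have mG := measurable_inner mF F0; have G0 q := inner_ge0 q F0.
have iF' b a : inner F (b, r^-1 * a)%R = r%:E * inner F' (b, a).
  rewrite /inner /F'/= [LHS](@integral_affine _ r 0)//; last exact: (measurable_fun_pair2 (b, (r^-1 * a)%R) mF).
  under eq_integral do rewrite addr0.
  rewrite ge0_integralZl//.
  - exact: (measurable_fun_pair2 (b, a) mF').
  - by rewrite lee_fin ltW.
rewrite (tripleE mF F0) (tripleE mF' (fun p => F0 _)); apply: eq_integral => b _.
rewrite [RHS](@integral_affine _ r^-1 0) ?invr_gt0//; last exact: (measurable_fun_pair2 b mG).
apply: eq_integral => a _; rewrite addr0 iF' muleA -EFinM mulVf ?gt_eqF// mul1e//.
Qed.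

Lemma triple_swap F : measurable_fun [set: (R * R) * R] F -> (forall p, 0 <= F p) ->
  triple (fun p => F ((- p.1.1, p.2), p.1.2)%R) = triple F.
Proof.
move=> mF F0; pose F' p := F ((- p.1.1, p.2), p.1.2)%R.
have m11 : measurable_fun [set: (R * R) * R] (fun p : (R * R) * R => p.1.1).
  exact: measurableT_comp.
have m12 : measurable_fun [set: (R * R) * R] (fun p : (R * R) * R => p.1.2).
  exact: measurableT_comp.
have mF' : measurable_fun [set: (R * R) * R] F'.
  apply: measurableT_comp => //; apply: measurable_fun_pair => //.
  by apply: measurable_fun_pair => //; apply: measurableT_comp.
have mG := measurable_inner mF F0; have G0 q := inner_ge0 q F0.
rewrite (tripleE mF F0) (tripleE mF' (fun p => F0 _)).
have mH := @measurable_fun_fubini_tonelli_F _ _ _ _ _ mu (inner F) mG G0.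
rewrite [RHS](integral_opp mH); last by move=> b; apply: integral_ge0.
apply: eq_integral => b _; rewrite /inner /fubini_F.
have mFb : measurable_fun [set: R * R] (fun q => F ((- b, q.1), q.2)%R).
  apply: (measurableT_comp mF); apply: measurable_fun_pair => //.
  by apply: measurable_fun_pair.
exact/esym/(@fubini_tonelli _ _ _ _ _ mu mu (fun q => F ((- b, q.1), q.2)%R) mFb (fun q => F0 _)).
Qed.

Definition disc p : R := (p.1.2 * p.2 - p.1.1 ^+ 2)%R.

(** A slab of discriminants, in place of a single level set, makes this a domain for
    three-dimensional Lebesgue measure. *)
Definition form_domain p : bool := (0 < p.1.2)%R && (1 <= disc p <= 2)%R.

(* The root in the upper half-plane of the form a z^2 + 2 b z + c, p = ((b, a), c). *)
Definition form_root p : C := ((- p.1.1 / p.1.2)%R +i* (Num.sqrt (disc p) / p.1.2)%R)%C.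

Definition hmeas h := measurable_fun [set: R * R]
  (fun q : R * R => if (0 < q.2)%R then h (q.1 +i* q.2)%C else 0).

Definition lift h p : \bar R := if form_domain p then h (form_root p) else 0.

Definition Inv h := triple (lift h).

Lemma form_root_upper p : form_domain p -> upper (form_root p).
Proof.
move=> /andP[a0 /andP[d1 _]]; rewrite /upper/= divr_gt0// sqrtr_gt0.
exact: lt_le_trans d1.
Qed.

Lemma measurable_disc : measurable_fun [set: (R * R) * R] disc.
Proof.
have m11 : measurable_fun [set: (R * R) * R] (fun p : (R * R) * R => p.1.1).
  exact: measurableT_comp.
have m12 : measurable_fun [set: (R * R) * R] (fun p : (R * R) * R => p.1.2).
  exact: measurableT_comp.
apply: measurable_funB; first by apply: measurable_funM.
by apply: measurable_funX.
Qed.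

Lemma measurable_lift h : hmeas h -> measurable_fun [set: (R * R) * R] (lift h).
Proof.
move=> mh.
have m11 : measurable_fun [set: (R * R) * R] (fun p : (R * R) * R => p.1.1).
  exact: measurableT_comp.
have m12 : measurable_fun [set: (R * R) * R] (fun p : (R * R) * R => p.1.2).
  exact: measurableT_comp.
have minv := @measurable_inv_pos R.
pose rt p : R * R := (- p.1.1 * (if (0 < p.1.2)%R then p.1.2^-1 else 0),
  Num.sqrt (disc p) * (if (0 < p.1.2)%R then p.1.2^-1 else 0))%R.
have mrt : measurable_fun [set: (R * R) * R] rt.
  apply: measurable_fun_pair; apply: measurable_funM.
  - exact: measurableT_comp.
  - exact: (measurableT_comp minv m12).
  - by apply: measurableT_comp; [apply: continuous_measurable_fun; exact: sqrt_continuous|exact: measurable_disc].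
  - exact: (measurableT_comp minv m12).
have e p : lift h p = if form_domain p then
    (if (0 < (rt p).2)%R then h ((rt p).1 +i* (rt p).2)%C else 0) else 0.
  rewrite /lift; case: ifP => // hp; have := form_root_upper hp.
  have /andP[a0 _] := hp.
  by rewrite /upper/form_root/rt/= a0 => ->.
rewrite (funext e); apply: measurable_fun_ifT => //.
  apply: measurable_and; first exact: measurable_fun_ltr.
  apply: measurable_and; first by apply: measurable_fun_ler => //; exact: measurable_disc.
  by apply: measurable_fun_ler => //; exact: measurable_disc.
exact: (measurableT_comp mh mrt).
Qed.


Lemma lift_ge0 h p : (forall z, 0 <= h z) -> 0 <= lift h p.
Proof. by move=> h0; rewrite /lift; case: ifP. Qed.

Lemma Inv_ext h g : (forall z, upper z -> h z = g z) -> Inv h = Inv g.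
Proof.
move=> hg; rewrite /Inv; congr triple; apply/funext => p; rewrite /lift.
by case: ifP => // /form_root_upper /hg.
Qed.

Lemma hmeas_ext h g : (forall z, upper z -> h z = g z) -> hmeas h -> hmeas g.
Proof.
move=> hg; congr measurable_fun; apply/funext => q; case: ifPn => // q0.
exact: hg.
Qed.

Lemma hmeas_comp h (f : C -> C) : (forall z, upper z -> upper (f z)) ->
  (forall z, upper z -> ccont f z) -> hmeas h -> hmeas (fun z => h (f z)).
Proof.
move=> fu fc mh.
have m1 : measurable_fun [set: R * R] (upper_ext (fun z => Re (f z))).
  apply: continuous_upper_measurable => z z0 e e0; have [d d0 hd] := fc z z0 e e0.
  exists d => // w /hd; apply: le_trans; rewrite -ReN -ReD; exact: cabs_Re.
have m2 : measurable_fun [set: R * R] (upper_ext (fun z => Im (f z))).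
  apply: continuous_upper_measurable => z z0 e e0; have [d d0 hd] := fc z z0 e e0.
  exists d => // w /hd; apply: le_trans; rewrite -ImN -ImD; exact: cabs_Im.
have := measurableT_comp mh (measurable_fun_pair m1 m2).
congr measurable_fun; apply/funext => q /=; rewrite /upper_ext.
case: (ltP 0%R q.2) => [q0|_]; last by rewrite ltxx.
have := fu (q.1 +i* q.2)%C q0; rewrite /upper; case: (f _) => u v /= v0.
by rewrite v0.
Qed.

Lemma hmeas_cont (g : C -> R) :
  (forall z, upper z -> forall e : R, (0 < e)%R -> exists2 d : R, (0 < d)%R &
     forall w, (cabs (w - z) < d)%R -> (`|g w - g z| <= e)%R) ->
  hmeas (fun z => (g z)%:E).
Proof.
move=> hg; have := continuous_upper_measurable hg => /measurable_EFinP.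
by congr measurable_fun; apply/funext => q /=; rewrite /upper_ext; case: ifP.
Qed.

Lemma hmeasM h g : hmeas h -> hmeas g -> hmeas (fun z => h z * g z).
Proof.
move=> mh mg; have := emeasurable_funM mh mg.
by congr measurable_fun; apply/funext => q; case: ifP => //; rewrite mule0.
Qed.

Lemma hmeas_series (h : nat -> C -> \bar R) : (forall n z, 0 <= h n z) -> (forall n, hmeas (h n)) ->
  hmeas (fun z => \sum_(n <oo) h n z).
Proof.
move=> h0 mh.
have := @ge0_emeasurable_sum _ (R * R)%type R setT
  (fun n q => if (0 < q.2)%R then h n (q.1 +i* q.2)%C else 0) xpredT.
have e : (fun q : R * R => if (0 < q.2)%R then \sum_(n <oo) h n (q.1 +i* q.2)%C else 0) =
    (fun q => \sum_(n <oo | n \in xpredT) (if (0 < q.2)%R then h n (q.1 +i* q.2)%C else 0)).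
  apply/funext => q; case: ifP => // _.
  by rewrite eseries0.
rewrite /hmeas e => H; apply: H => [k q _ _|k _]; [by case: ifP|exact: mh].
Qed.

Lemma Inv_translate h (t : R) : hmeas h -> (forall z, 0 <= h z) ->
  Inv (fun z => h (z + t%:C%C)%R) = Inv h.
Proof.
move=> mh h0.
rewrite /Inv -[RHS](triple_shear t (measurable_lift mh) (fun p => lift_ge0 p h0)).
congr triple; apply/funext => -[[b a] c]; rewrite /lift /form_domain/=.
have dE : disc ((b - a * t, a), c - 2 * b * t + a * t ^+ 2)%R = disc ((b, a), c).
  by rewrite /disc/=; ring.
rewrite dE; case: ifP => // /andP[a0 _]; congr h; rewrite /form_root/= dE.
apply: complex_eqP; rewrite ?ReD ?ImD/= ?addr0//.
by field; rewrite gt_eqF.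
Qed.

Lemma Inv_scale h (r : R) : (0 < r)%R -> hmeas h -> (forall z, 0 <= h z) ->
  Inv (fun z => h (r%:C%C * z)%R) = Inv h.
Proof.
move=> r0 mh h0.
rewrite /Inv -[RHS](triple_scale r0 (measurable_lift mh) (fun p => lift_ge0 p h0)).
congr triple; apply/funext => -[[b a] c]; rewrite /lift /form_domain/=.
have dE : disc ((b, r^-1 * a), r * c)%R = disc ((b, a), c).
  by rewrite /disc/=; field; rewrite gt_eqF.
rewrite dE pmulr_rgt0 ?invr_gt0//; case: ifP => // /andP[a0 _]; congr h; rewrite /form_root/= dE.
by apply: complex_eqP; rewrite ?ReZ ?ImZ/=; field; rewrite !gt_eqF.
Qed.

Lemma Inv_inversion h : hmeas h -> (forall z, 0 <= h z) ->
  Inv (fun z => h (- z^-1)%R) = Inv h.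
Proof.
move=> mh h0.
rewrite /Inv -[RHS](triple_swap (measurable_lift mh) (fun p => lift_ge0 p h0)).
congr triple; apply/funext => -[[b a] c]; rewrite /lift /form_domain/=.
have dE : disc ((- b, c), a)%R = disc ((b, a), c) by rewrite /disc/=; ring.
rewrite dE; have [/andP[d1 d2]|] := boolP (1 <= disc (b, a, c) <= 2)%R; last by rewrite !andbF.
rewrite !andbT; have ac : (0 < a * c)%R.
  have : (1 <= a * c - b ^+ 2)%R := d1.
  by have := sqr_ge0 b; clear; lra.
have -> : (0 < c)%R = (0 < a)%R.
  by apply/idP/idP => x0; move: ac; rewrite ?(pmulr_lgt0 _ x0) ?(pmulr_rgt0 _ x0).
case: ifP => // a0; congr h; rewrite /form_root/= dE.
have c0 : (0 < c)%R by move: ac; rewrite pmulr_rgt0.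
set s := Num.sqrt _; have s2 : (s ^+ 2 = a * c - b ^+ 2)%R.
  by rewrite sqr_sqrtr//; apply: le_trans d1.
have s0 : (0 < s)%R by rewrite sqrtr_gt0; apply: lt_le_trans d1.
set z := ((- b / a)%R +i* (s / a)%R)%C; set w := ((- - b / c)%R +i* (s / c)%R)%C.
have zw : (z * w = - 1)%R.
  apply: complex_eqP; rewrite ?ReM ?ImM ?ReN ?ImN/=; last by field; rewrite !gt_eqF.
  have -> : (- b / a * (- - b / c) - s / a * (s / c) = - (s ^+ 2 + b ^+ 2) / (a * c))%R.
    by field; rewrite !gt_eqF.
  by rewrite s2 subrK mulNr mulfV// gt_eqF.
have z0 : z != 0%R.
  by apply: contraTneq s0 => /(congr1 (@complex.Im R))/= /eqP; rewrite mulf_eq0 invr_eq0 (gt_eqF a0) orbF => /eqP ->; rewrite ltxx.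
by apply: (mulfI z0); rewrite zw mulrN mulfV.
Qed.

(** For c <> 0, Mz = a/c - det M / (c^2 z + cd) is composed of scalings, translations and one
    inversion z -> -1/z; for c = 0 it is affine. *)
Lemma Inv_mobius h (M : 'M[int]_2) : (0 < \det M)%R -> hmeas h -> (forall z, 0 <= h z) ->
  Inv (fun z => h (mobius M z)) = Inv h.
Proof.
move=> dM mh h0.
have sc (r : R) (g : C -> \bar R) : (0 < r)%R -> hmeas g -> hmeas (fun z => g (r%:C%C * z)%R).
  move=> r0; apply: hmeas_comp => z; first by rewrite /upper ImZ => ?; rewrite mulr_gt0.
  by move=> _; apply: ccontM; [exact: ccont_cst|exact: ccont_id].
have tr (t : R) (g : C -> \bar R) : hmeas g -> hmeas (fun z => g (z + t%:C%C)%R).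
  apply: hmeas_comp => z; first by rewrite /upper ImD/= addr0.
  by move=> _; apply: ccontD; [exact: ccont_id|exact: ccont_cst].
have inv (g : C -> \bar R) : hmeas g -> hmeas (fun z => g (- z^-1)%R).
  have un z : upper z -> z != 0%R by apply: contraTneq => ->; rewrite /upper/= ltxx.
  apply: hmeas_comp => z z0; last first.
    by apply: cdiff_cont; apply: (@cdiffN _ (fun w => w^-1%R));
      apply: (@cdiffV _ (fun w => w)); [exact: cdiff_id|exact: un].
  move: z0; rewrite /upper; case: z => x y /= y0; rewrite opprK.
  by rewrite divr_gt0// ltr_wpDl ?sqr_ge0// exprn_gt0.
have dE := det22 M; pose a : R := (M 0 0)%:~R; pose b : R := (M 0 1)%:~R.
pose c : R := (M 1 0)%:~R; pose d : R := (M 1 1)%:~R.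
have aE : ((M 0 0)%:~R = a%:C%C :> C) by rewrite rmorph_int.
have bE : ((M 0 1)%:~R = b%:C%C :> C) by rewrite rmorph_int.
have cE : ((M 1 0)%:~R = c%:C%C :> C) by rewrite rmorph_int.
have dE' : ((M 1 1)%:~R = d%:C%C :> C) by rewrite rmorph_int.
have det0 : (0 < a * d - b * c)%R.
  by move: dM; rewrite dE -(ltr0z R) rmorphB/= !rmorphM.
have [c0|c0] := eqVneq c 0%R.
  have ad : (0 < a * d)%R by move: det0; rewrite c0 mulr0 subr0.
  have d0 : d != 0%R by apply: contraTneq ad => ->; rewrite mulr0 ltxx.
  have r0 : (0 < a / d)%R.
    have -> : (a / d = a * d / d ^+ 2)%R by field.
    by rewrite divr_gt0// lt_def sqr_ge0 andbT expf_neq0.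
  have e1 := Inv_translate (b / d) mh h0.
  have e2 := Inv_scale r0 (tr (b / d)%R h mh) (fun z => h0 _).
  apply: etrans e1; apply: etrans e2.
  apply: Inv_ext => z z0; congr h; rewrite /mobius /autfactor aE bE cE dE' c0.
  rewrite mul0r add0r mulrDl !fmorph_div/=.
  by congr (_ + _)%R; rewrite mulrAC.
have c2 : (0 < c ^+ 2)%R by rewrite lt_def sqr_ge0 andbT expf_neq0.
have m1 := tr (a / c)%R h mh; have m2 := sc _ _ det0 m1; have m3 := inv _ m2.
have m4 := tr (c * d)%R _ m3.
apply: etrans (Inv_translate (a / c) mh h0).
apply: etrans (Inv_scale det0 m1 (fun z => h0 _)).
apply: etrans (Inv_inversion m2 (fun z => h0 _)).
apply: etrans (Inv_translate (c * d) m3 (fun z => h0 _)).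
apply: etrans (Inv_scale c2 m4 (fun z => h0 _)).
apply: Inv_ext => z z0; congr h.
have M0 : \det M != 0%R by rewrite gt_eqF.
have := autfactor_neq0 M0 z0; rewrite /mobius /autfactor aE bE cE dE'.
have c0' : c%:C%C != 0%R :> C by rewrite -cabs_gt0 cabs_real normr_gt0.
rewrite rmorphB rmorphM rmorphM rmorphXn rmorphM fmorph_div/=.
move: (a%:C)%C (b%:C)%C (c%:C)%C (d%:C)%C c0' => A B D E D0 q0.
field; rewrite D0 q0 andbT/=.
have -> : (D ^+ 2 * z + D * E = D * (D * z + E))%R by ring.
by rewrite mulf_neq0.
Qed.

Lemma Inv_series (h : nat -> C -> \bar R) : (forall n z, 0 <= h n z) -> (forall n, hmeas (h n)) ->
  Inv (fun z => \sum_(n <oo) h n z) = \sum_(n <oo) Inv (h n).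
Proof.
move=> h0 mh; rewrite /Inv /triple.
have ml n := measurable_lift (mh n); have l0 n p := lift_ge0 p (h0 n).
rewrite -integral_nneseries//; last 2 first.
- by move=> n; exact: measurable_inner.
- by move=> n q _; exact: inner_ge0.
apply: eq_integral => q _; rewrite /inner -integral_nneseries//; last first.
  by move=> n; exact: (measurable_fun_pair2 q (ml n)).
apply: eq_integral => c _; rewrite /lift; case: ifP => // _.
by rewrite eseries0.
Qed.

Lemma triple_le F G : (forall p, 0 <= F p) -> (forall p, F p <= G p) ->
  measurable_fun [set: (R * R) * R] F -> measurable_fun [set: (R * R) * R] G ->
  triple F <= triple G.
Proof.
move=> F0 FG mF mG; have G0 p := le_trans (F0 p) (FG p).
apply: ge0_le_integral => //.
- by move=> q _; exact: inner_ge0.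
- exact: measurable_inner mF F0.
- exact: measurable_inner mG G0.
- move=> q _; apply: ge0_le_integral => //.
    exact: (measurable_fun_pair2 q mF).
  exact: (measurable_fun_pair2 q mG).
Qed.

Lemma Inv_le h g : (forall z, 0 <= h z) -> (forall z, 0 <= g z) ->
  (forall z, upper z -> h z <= g z) -> hmeas h -> hmeas g -> Inv h <= Inv g.
Proof.
move=> h0 g0 hg mh mg; apply: triple_le; try exact: measurable_lift.
  by move=> p; exact: lift_ge0.
by move=> p; rewrite /lift; case: ifP => // /form_root_upper /hg.
Qed.

Lemma InvZ h (k : R) : (0 <= k)%R -> (forall z, 0 <= h z) -> hmeas h ->
  Inv (fun z => k%:E * h z) = k%:E * Inv h.
Proof.
move=> k0 h0 mh; have ml := measurable_lift mh; have l0 p := lift_ge0 p h0.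
rewrite /Inv /triple -ge0_integralZl//; last 2 first.
- exact: measurable_inner.
- by move=> q _; exact: inner_ge0.
apply: eq_integral => q _; rewrite /inner -ge0_integralZl//; last exact: (measurable_fun_pair2 q ml).
by apply: eq_integral => c _; rewrite /lift; case: ifP => //; rewrite mule0.
Qed.

End InvariantIntegral.

(** * Finite volume of a Siegel strip and positivity of the integral *)

Section InvariantVolume.
Variable R : realType.
Local Notation C := R[i].
Local Notation Re := complex.Re.
Local Notation Im := complex.Im.
Local Notation mu := (@lebesgue_measure R).
Implicit Types (p : (R * R) * R) (q : R * R).
Local Open Scope ereal_scope.

Definition seg (u v k x : R) : R := if (u <= x <= v)%R then k else 0%R.

Lemma segE (u v k : R) : (fun x => (seg u v k x)%:E) = (fun x => k%:E * (\1_(`[u, v]%classic : set R) x)%:E).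
Proof.
apply/funext => x; rewrite /seg indicE; have [/= xi|xi] := boolP (x \in `[u, v]%classic).
  by rewrite inE/= in_itv/= in xi; rewrite xi mule1.
by rewrite mule0; case: ifPn => // h; case/negP: xi; rewrite inE/= in_itv/= h.
Qed.

Lemma measurable_seg (u v k : R) : measurable_fun [set: R] (fun x => (seg u v k x)%:E).
Proof.
rewrite segE; apply: emeasurable_funM => //; apply/measurable_EFinP.
by apply: measurable_indic; exact: measurable_itv.
Qed.

Lemma seg_ge0 (u v k x : R) : (0 <= k)%R -> 0 <= (seg u v k x)%:E.
Proof. by move=> k0; rewrite lee_fin /seg; case: ifP. Qed.

Lemma integral_seg (u v k : R) : (u <= v)%R -> (0 <= k)%R ->
  \int[mu]_x (seg u v k x)%:E = (k * (v - u))%:E.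
Proof.
move=> uv k0; have mI : measurable_fun [set: R] (fun x => (\1_(`[u, v]%classic : set R) x : R)%:E).
  by apply: measurableT_comp => //; apply: measurable_indic; exact: measurable_itv.
rewrite segE (ge0_integralZl mu measurableT mI) ?lee_fin//.
rewrite integral_indic ?setIT; last exact: measurable_itv.
transitivity (k%:E * mu `[u, v]%classic) => //.
rewrite lebesgue_measure_itv/= lte_fin; case: ltP => [_|vu].
  by rewrite -EFinB -EFinM.
by rewrite (le_anti (introT andP (conj uv vu))) subrr mulr0 mule0.
exact: measurableT.
Qed.

Lemma integral_lower (F : R -> \bar R) (u v k : R) : (u <= v)%R -> (0 <= k)%R ->
  measurable_fun [set: R] F -> (forall x, 0 <= F x) ->
  (forall x, (u <= x <= v)%R -> k%:E <= F x) -> (k * (v - u))%:E <= \int[mu]_x F x.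
Proof.
move=> uv k0 mF F0 hF; rewrite -integral_seg//; apply: ge0_le_integral => //.
- by move=> x _; exact: seg_ge0.
- exact: measurable_seg.
- by move=> x _; rewrite /seg; case: ifP => [/hF//|_]; exact: F0.
Qed.

Lemma integral_upper (F : R -> \bar R) (u v k : R) : (u <= v)%R -> (0 <= k)%R ->
  measurable_fun [set: R] F -> (forall x, 0 <= F x) ->
  (forall x, F x <= (seg u v k x)%:E) -> \int[mu]_x F x <= (k * (v - u))%:E.
Proof.
move=> uv k0 mF F0 hF; rewrite -integral_seg//; apply: ge0_le_integral => //.
exact: measurable_seg.
Qed.

Definition strip (z : C) : bool := (`|Re z| <= 1 / 2)%R && (1 / 2 <= Im z)%R.

Definition strip_ind (z : C) : \bar R := if strip z then 1 else 0.

Lemma strip_ind_ge0 z : 0 <= strip_ind z.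
Proof. by rewrite /strip_ind; case: ifP. Qed.

Lemma hmeas_strip : hmeas strip_ind.
Proof.
have mf : measurable_fun [set: R * R] (fun q : R * R => q.1) by exact: measurable_fst.
have ms : measurable_fun [set: R * R] (fun q : R * R => q.2) by exact: measurable_snd.
apply: measurable_fun_ifT => //; first exact: measurable_pos_snd.
apply: measurable_fun_ifT => //; apply: measurable_and.
  by apply: measurable_fun_ler => //; exact: measurableT_comp.
by apply: measurable_fun_ler.
Qed.

(** Forms with root in the strip have 0 < a <= 3 and |b| <= a/2, and c in an interval of length 1/a.
    Integrating over c, b and a in turn bounds the volume by 3. *)
Lemma Inv_strip : Inv strip_ind < +oo.
Proof.
have ml := measurable_lift hmeas_strip.
have l0 p : 0 <= lift strip_ind p by apply: lift_ge0; exact: strip_ind_ge0.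
have mi := measurable_inner ml l0; have i0 q := inner_ge0 q l0.
have key b a c : strip_ind (form_root ((b, a), c)) != 0 -> form_domain ((b, a), c) ->
    [/\ (0 < a <= 3)%R, (- (a / 2) <= b <= a / 2)%R &
        ((1 + b ^+ 2) / a <= c <= (2 + b ^+ 2) / a)%R].
  rewrite /strip_ind /strip; case: ifP => [/andP[h1 h2] _|_]; last by rewrite eqxx.
  move=> /andP[a0 /andP[d1 d2]]; rewrite /disc/= in a0 d1 d2 h1 h2.
  have ia : (0 < a^-1)%R by rewrite invr_gt0.
  split.
  - rewrite a0/=; move: h2; rewrite ler_pdivlMr// => h2.
    have s2 : (Num.sqrt (a * c - b ^+ 2) ^+ 2 <= 2)%R by rewrite sqr_sqrtr// (le_trans ler01).
    rewrite leNgt; apply/negP => a3.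
    have : (3 / 2 < Num.sqrt (a * c - b ^+ 2))%R by move: h2 a3; clear; lra.
    by move: s2; move: (Num.sqrt _) => s; clear; nra.
  - move: h1; rewrite normrM normrN (ger0_norm (ltW ia)) ler_pdivrMr// mulrC.
    by rewrite ler_norml; move: a0; clear; lra.
  - by rewrite ler_pdivrMr// ler_pdivlMr// [(c * a)%R]mulrC; move: d1 d2; clear; lra.
have inb b a : inner (lift strip_ind) (b, a) <=
    (if (0 < a <= 3)%R then (seg (- (a / 2)) (a / 2) a^-1 b)%:E else 0).
  have z0 : (forall c, lift strip_ind ((b, a), c) = 0) -> inner (lift strip_ind) (b, a) = 0.
    by move=> h; rewrite /inner; under eq_integral do rewrite h; rewrite integral0.
  have lz c : lift strip_ind ((b, a), c) != 0 ->
      strip_ind (form_root ((b, a), c)) != 0 /\ form_domain ((b, a), c).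
    by rewrite /lift; case: ifP => //; rewrite eqxx.
  case: ifPn => ha; last first.
    rewrite z0// => c; apply/eqP; apply: contraNT ha => /lz[h1 h2].
    by have [] := key _ _ _ h1 h2.
  rewrite /seg; case: ifPn => hb; last first.
    rewrite z0// => c; apply/eqP; apply: contraNT hb => /lz[h1 h2].
    by have [] := key _ _ _ h1 h2.
  have /andP[a0 _] := ha.
  have e : (1 * ((2 + b ^+ 2) / a - (1 + b ^+ 2) / a))%R = a^-1%R.
    by field; rewrite gt_eqF.
  rewrite -e; apply: integral_upper => //.
  - by rewrite ler_pM2r ?invr_gt0// lerD2r; clear; lra.
  - exact: (measurable_fun_pair2 (b, a) ml).
  - move=> c; have [->|h] := eqVneq (lift strip_ind ((b, a), c)) 0; first exact: seg_ge0.
    have [h1 h2] := lz _ h; have [_ _ hc] := key _ _ _ h1 h2.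
    rewrite /seg hc /lift h2 /strip_ind; by case: (strip _); rewrite ?lexx ?lee01.
apply: (@le_lt_trans _ _ 3%:E); last exact: ltry.
rewrite /Inv /triple (@fubini_tonelli2 _ _ _ _ _ mu mu _ mi i0).
have -> : (3%:E = (1 * (3 - 0))%:E :> \bar R) by rewrite mul1r subr0.
apply: integral_upper => //.
- exact: (@measurable_fun_fubini_tonelli_G _ _ _ _ _ mu _ mi i0).
- by move=> a; apply: integral_ge0.
move=> a; rewrite /fubini_G /seg.
case: (boolP (0 < a <= 3)%R) => ha; last first.
  have -> : \int[mu]_x inner (lift strip_ind) (x, a) = 0.
    apply: integral0_eq => b _; apply/le_anti; rewrite i0 andbT.
    by apply: le_trans (inb b a) _; rewrite (negbTE ha).
  by case: ifP.
have /andP[a0 a3] := ha; rewrite (ltW a0) a3/=.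
have -> : 1%R = (a^-1 * (a / 2 - - (a / 2)))%R by field; rewrite gt_eqF.
apply: integral_upper => //.
- by move: a0; clear; lra.
- by rewrite invr_ge0 ltW.
- exact: (measurable_fun_pair1 a mi).
- by move=> b; apply: le_trans (inb b a) _; rewrite ha.
Qed.

(** The form with root z0 and discriminant 3/2 is interior to the domain, so the forms in a small
    box next to it have roots where g >= g(z0)/2. *)
Lemma Inv_pos (g : C -> R) z0 : (forall z, (0 <= g z)%R) ->
  (forall z, upper z -> forall e : R, (0 < e)%R -> exists2 d : R, (0 < d)%R &
     forall w, (cabs (w - z) < d)%R -> (`|g w - g z| <= e)%R) ->
  upper z0 -> (0 < g z0)%R -> 0 < Inv (fun z => (g z)%:E).
Proof.
move=> g0 gc z00 gz; pose e := (g z0 / 2)%R; have e0 : (0 < e)%R by rewrite divr_gt0.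
have [d d0 hd] := gc z0 z00 e e0.
have mg := hmeas_cont gc.
have ml := measurable_lift mg.
have l0 p : 0 <= lift (fun z => (g z)%:E) p by apply: lift_ge0 => z; rewrite lee_fin.
have mi := measurable_inner ml l0; have i0 q := inner_ge0 q l0.
pose a0 : R := (Num.sqrt (3 / 2) / Im z0)%R.
have s0 : (0 < Num.sqrt (3 / 2 : R))%R by rewrite sqrtr_gt0; clear; lra.
have a00 : (0 < a0)%R by rewrite divr_gt0.
pose b0 : R := (- (Re z0) * a0)%R.
pose c0 : R := ((3 / 2 + b0 ^+ 2) / a0)%R.
pose p0 : (R * R) * R := ((b0, a0), c0).
have D0 : disc p0 = (3 / 2)%R by rewrite /disc/= /c0; field; rewrite gt_eqF.
have f11 : (fun p : (R * R) * R => p.1.1) @ nbhs p0 --> b0.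
  by apply: (cvg_comp _ _ (@cvg_fst _ _ _ _ _)); exact: cvg_fst.
have f12 : (fun p : (R * R) * R => p.1.2) @ nbhs p0 --> a0.
  by apply: (cvg_comp _ _ (@cvg_fst _ _ _ _ _)); exact: cvg_snd.
have f2 : (fun p : (R * R) * R => p.2) @ nbhs p0 --> c0 by exact: cvg_snd.
have fD : disc p @[p --> p0] --> (3 / 2 : R)%R.
  by rewrite -D0; apply: cvgB; [exact: cvgM|apply: cvgM].
have fi : (p.1.2^-1)%R @[p --> p0] --> a0^-1%R by apply: cvgV => //; rewrite gt_eqF.
have fx : (- p.1.1 / p.1.2)%R @[p --> p0] --> Re z0.
  have -> : Re z0 = (- b0 / a0)%R by rewrite /b0; field; rewrite gt_eqF.
  by apply: cvgM fi; exact: cvgN.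
have fy : (Num.sqrt (disc p) / p.1.2)%R @[p --> p0] --> Im z0.
  have -> : Im z0 = (Num.sqrt (3 / 2) / a0)%R.
    by rewrite /a0 invf_div mulrC divfK// gt_eqF.
  by apply: cvgM fi; exact: (cvg_comp _ _ fD (@sqrt_continuous R (3 / 2)%R)).
have d2 : (0 < d / 2)%R by rewrite divr_gt0.
have [r r0 hr] : exists2 r : R, (0 < r)%R & forall b a c, (b0 <= b <= b0 + r)%R ->
    (a0 <= a <= a0 + r)%R -> (c0 <= c <= c0 + r)%R ->
    form_domain ((b, a), c) /\ (e <= g (form_root ((b, a), c)))%R.
  have : \forall p \near p0, form_domain p /\ (e <= g (form_root p))%R.
    near=> p.
    have h1 : (`|Re z0 - (- p.1.1 / p.1.2)| < d / 2)%R by near: p; exact: cvgr_dist_lt fx _ d2.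
    have h2 : (`|Im z0 - Num.sqrt (disc p) / p.1.2| < d / 2)%R by near: p; exact: cvgr_dist_lt fy _ d2.
    split.
      apply/andP; split; first by near: p; exact: cvgr_gt f12 _ a00.
      apply/andP; split; apply: ltW; near: p.
        by apply: cvgr_gt fD _ _; clear; lra.
      by apply: cvgr_lt fD _ _; clear; lra.
    have : (cabs (form_root p - z0) < d)%R.
      rewrite cabs_distC; apply: le_lt_trans (cabs_le _) _.
      rewrite ReD ImD ReN ImN /form_root/= [ltRHS](splitr d); exact: ltrD.
    move=> /hd; rewrite ler_distl => /andP[h _]; apply: le_trans h.
    by rewrite /e; move: gz; clear; lra.
  move=> /nbhs_ballP[r /= r0 hr]; exists (r / 2)%R; first by rewrite divr_gt0.
  have bl (x y : R) : (x <= y <= x + r / 2)%R -> ball x r y.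
    move=> /andP[h1 h2]; rewrite /ball/= ltr_norml; move: h1 h2 r0; clear; lra.
  move=> b a c hb ha hc; apply: (hr ((b, a), c)); split; last exact: bl.
  by split; exact: bl.
apply: (@lt_le_trans _ _ (e * (c0 + r - c0) * (a0 + r - a0) * (b0 + r - b0))%:E).
  by rewrite lte_fin ![(_ + r - _)%R]addrAC !subrr !add0r !mulr_gt0.
have w x : (x <= x + r)%R by rewrite lerDl ltW.
have k1 : (0 <= e * (c0 + r - c0))%R by rewrite mulr_ge0 ?(ltW e0)// subr_ge0.
have k2 : (0 <= e * (c0 + r - c0) * (a0 + r - a0))%R by rewrite mulr_ge0// subr_ge0.
rewrite /Inv tripleE//; apply: integral_lower => //.
- exact: (@measurable_fun_fubini_tonelli_F _ _ _ _ _ mu _ mi i0).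
- by move=> b; exact: integral_ge0.
move=> b hb; apply: integral_lower => //; first exact: (measurable_fun_pair2 b mi).
move=> a ha; apply: integral_lower => //; first exact: ltW.
  exact: (measurable_fun_pair2 (b, a) ml).
by move=> c hc; have [h1 h2] := hr b a c hb ha hc; rewrite /lift h1 lee_fin.
Unshelve. all: by end_near. Qed.

End InvariantVolume.

(** * Exchanging countable sums with the invariant integral *)

Section CountableSums.
Variable R : realType.
Local Notation C := R[i].
Local Notation Re := complex.Re.
Local Notation Im := complex.Im.
Local Open Scope ereal_scope.

Definition enumerated (T : countType) (X : set T) (F : T -> \bar R) (n : nat) : \bar R :=
  if @pickle_inv T n is Some t then (if t \in X then F t else 0) else 0.

Lemma enumerated_ge0 (T : countType) (X : set T) F n : (forall t, 0 <= F t) -> 0 <= @enumerated T X F n.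
Proof. by move=> F0; rewrite /enumerated; case: pickle_inv => // t; case: ifP. Qed.

Lemma esum_series (T : countType) (X : set T) (F : T -> \bar R) : (forall t, 0 <= F t) ->
  \esum_(t in X) F t = \sum_(n <oo) enumerated X F n.
Proof.
move=> F0; rewrite nneseries_esumT; last by move=> n; exact: enumerated_ge0.
have e n : enumerated X F n = if n \in (pickle @` X) then enumerated X F n else 0.
  case: ifPn => // hn; rewrite /enumerated; case e : (@pickle_inv T n) => [t|//].
  case: ifPn => // tX; case/negP: hn; rewrite inE; exists t; first by rewrite inE in tX.
  by have := @pickle_invK T n; rewrite /ocancel e.
rewrite (eq_esum (fun n _ => e n)) -esum_mkcond esum_image; last first.
  by move=> x y _ _; exact: (pcan_inj (@pickleK T)).
apply: eq_esum => t tX; rewrite /enumerated pickleK_inv ifT// inE//.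
Qed.

Lemma esumZ (T : countType) (X : set T) (F : T -> \bar R) (k : R) : (0 <= k)%R -> (forall t, 0 <= F t) ->
  \esum_(t in X) (k%:E * F t) = k%:E * \esum_(t in X) F t.
Proof.
move=> k0 F0; rewrite !esum_series => [|//|t]; last by rewrite mule_ge0.
rewrite -nneseriesZl => [|n _]; last exact: enumerated_ge0.
apply: eq_eseriesr => n _; rewrite /enumerated; case: pickle_inv => [t|]; last by rewrite mule0.
by case: ifP; rewrite ?mule0.
Qed.

Lemma hmeas0 : hmeas (fun _ : C => 0 : \bar R).
Proof.
have -> : hmeas (fun _ : C => 0 : \bar R) = measurable_fun [set: R * R] (cst 0 : R * R -> \bar R).
  by congr measurable_fun; apply/funext => q; rewrite if_same.
exact: measurable_cst.
Qed.

Lemma hmeas_enumerated (T : countType) (X : set T) (h : T -> C -> \bar R) n :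
  (forall t, X t -> hmeas (h t)) -> hmeas (fun z => enumerated X (h^~ z) n).
Proof.
move=> mh; have h0 := hmeas0; rewrite /enumerated; case: pickle_inv => [t|//].
by have [|_] := boolP (t \in X); [rewrite inE => /mh|].
Qed.

Lemma hmeas_esum (T : countType) (X : set T) (h : T -> C -> \bar R) : (forall t z, 0 <= h t z) ->
  (forall t, X t -> hmeas (h t)) -> hmeas (fun z => \esum_(t in X) h t z).
Proof.
move=> h0 mh; apply: (@hmeas_ext _ (fun z => \sum_(n <oo) enumerated X (h^~ z) n)).
  by move=> z _; rewrite esum_series.
apply: hmeas_series => [n z|n]; first exact: enumerated_ge0.
exact: hmeas_enumerated.
Qed.

Lemma Inv0 : Inv (fun _ : C => 0 : \bar R) = 0.
Proof.
rewrite /Inv /triple; apply: integral0_eq => q _; apply: integral0_eq => c _.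
by rewrite /lift if_same.
Qed.

Lemma Inv_esum (T : countType) (X : set T) (h : T -> C -> \bar R) : (forall t z, 0 <= h t z) ->
  (forall t, X t -> hmeas (h t)) -> (forall t, 0 <= Inv (h t)) ->
  Inv (fun z => \esum_(t in X) h t z) = \esum_(t in X) Inv (h t).
Proof.
move=> h0 mh i0; rewrite [RHS]esum_series//.
rewrite (@Inv_ext _ _ (fun z => \sum_(n <oo) enumerated X (h^~ z) n)); last first.
  by move=> z _; rewrite esum_series.
rewrite Inv_series => [|n z|n]; last exact: hmeas_enumerated.
  apply: eq_eseriesr => n _; rewrite /enumerated; case: pickle_inv => [t|]; last exact: Inv0.
  by case: ifP => // _; exact: Inv0.
exact: enumerated_ge0.
Qed.

Lemma Inv_ge0 (h : C -> \bar R) : (forall z, 0 <= h z) -> 0 <= Inv h.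
Proof. by move=> h0; apply: integral_ge0 => q _; apply: inner_ge0 => p; exact: lift_ge0. Qed.

Lemma InvD (h g : C -> \bar R) : (forall z, 0 <= h z) -> (forall z, 0 <= g z) -> hmeas h -> hmeas g ->
  Inv (fun z => h z + g z) = Inv h + Inv g.
Proof.
move=> h0 g0 mh mg; have mlh := measurable_lift mh; have mlg := measurable_lift mg.
have lh0 p := lift_ge0 p h0; have lg0 p := lift_ge0 p g0.
rewrite /Inv /triple -ge0_integralD//; first last.
- exact: measurable_inner.
- by move=> q _; exact: inner_ge0.
- exact: measurable_inner.
- by move=> q _; exact: inner_ge0.
apply: eq_integral => q _; rewrite /inner -ge0_integralD//; first last.
- exact: (measurable_fun_pair2 q mlg).
- exact: (measurable_fun_pair2 q mlh).
by apply: eq_integral => c _; rewrite /lift; case: ifP; rewrite // adde0.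
Qed.

Lemma hmeasD (h g : C -> \bar R) : hmeas h -> hmeas g -> hmeas (fun z => h z + g z).
Proof.
move=> mh mg; have := emeasurable_funD mh mg.
by congr measurable_fun; apply/funext => q /=; case: ifP => //; rewrite adde0.
Qed.

Lemma Inv_sum (I : Type) (r : seq I) (h : I -> C -> \bar R) : (forall i z, 0 <= h i z) ->
  (forall i, hmeas (h i)) ->
  hmeas (fun z => \sum_(i <- r) h i z) /\
  Inv (fun z => \sum_(i <- r) h i z) = \sum_(i <- r) Inv (h i).
Proof.
move=> h0 mh; elim: r => [|i r [IH1 IH2]].
  have e : (fun z => \sum_(i <- [::]) h i z) = (fun=> 0) by apply/funext => z; rewrite big_nil.
  by rewrite e Inv0 big_nil; split=> //; exact: hmeas0.
have e : (fun z => \sum_(i <- i :: r) h i z) = (fun z => h i z + \sum_(i <- r) h i z).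
  by apply/funext => z; rewrite big_cons.
rewrite e; split; first exact: hmeasD.
by rewrite InvD// ?IH2 ?big_cons// => z; exact: sume_ge0.
Qed.

Lemma esum_finite_support (T : choiceType) (I X : set T) (a : T -> \bar R) : finite_set X ->
  (forall t, 0 <= a t < +oo) -> (forall t, I t -> ~ X t -> a t = 0) -> \esum_(t in I) a t < +oo.
Proof.
move=> fX ha hz; have a0 t : 0 <= a t by case/andP: (ha t).
have -> : \esum_(t in I) a t = \esum_(t in I `&` X) a t.
  rewrite esum_mkcondr; apply: eq_esum => t It; case: ifPn => // tX.
  by apply: hz => // Xt; case/negP: tX; rewrite inE.
have fI : finite_set (I `&` X) by apply: sub_finite_set fX => t [].
rewrite esum_fset// fsbig_finite//=; apply: lte_sum_pinfty => t _.
by case/andP: (ha t).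
Qed.

End CountableSums.

(** * A partition of unity for the action of Gamma0(N) *)

Section PartitionOfUnity.
Variable R : realType.
Local Notation C := R[i].
Local Notation Re := complex.Re.
Local Notation Im := complex.Im.
Implicit Types (z : C) (M A B : 'M[int]_2).

Lemma bounded_matrices (B : nat) : finite_set [set M : 'M[int]_2 | forall i j, (`|M i j| <= B%:Z)%R].
Proof.
pose T := (('I_(B + B).+1 * 'I_(B + B).+1) * ('I_(B + B).+1 * 'I_(B + B).+1))%type.
pose e (x : 'I_(B + B).+1) : int := x%:Z - B%:Z.
pose F (t : T) := mx2 (e t.1.1) (e t.1.2) (e t.2.1) (e t.2.2).
apply: (@sub_finite_set _ _ (F @` setT)); last by apply: finite_image; exact: finite_finset.
have inv (x : int) : `|x| <= B%:Z -> exists y, e y = x.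
  move=> hx; have h : (`|(x + B%:Z)%R| < (B + B).+1)%N by lia.
  by exists (Ordinal h); rewrite /e/=; lia.
move=> M /= hM; have [a ea] := inv _ (hM 0 0); have [b eb] := inv _ (hM 0 1).
have [c ec] := inv _ (hM 1 0); have [d ed] := inv _ (hM 1 1).
exists ((a, b), (c, d)) => //; apply: mx2P; rewrite !mx2E/=; [exact: ea|exact: eb|exact: ec|exact: ed].
Qed.

(** Im(Mz) >= 1/2 bounds |cz + d| from above and [m] bounds it from below, so |az + b| = |Mz| |cz +
    d| is bounded as well; these bounds confine the four entries to a finite box. *)
Lemma finite_strip z : upper z -> finite_set [set M | SL2Z M /\ strip (mobius M z)].
Proof.
move=> z0; set y := Im z; pose m := Num.min 1 y.
have m0 : 0 < m by rewrite lt_min ltr01.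
pose W : R := (1 + 2 * y) + y / m.
have yp : 0 < y := z0.
have W0 : 0 < W by rewrite /W addr_gt0 ?divr_gt0// addr_gt0// mulr_gt0.
pose B := (Num.truncn (W / y + W + W / y * cabs z)).+1.
apply: sub_finite_set (bounded_matrices B) => M [hM /andP[hx hy]].
have M0 : \det M != 0 by rewrite hM.
have j0 := autfactor_neq0 M0 z0; set j := autfactor M z in j0.
have cj0 : 0 < cabs j by rewrite cabs_gt0.
have hI := Im_mobius M0 z0; rewrite hM mul1r -/j -/y in hI.
have key (a b : int) : cabs (a%:~R * z + b%:~R) <= W -> `|a|%:~R <= B%:R :> R /\ `|b|%:~R <= B%:R :> R.
  move=> h; have ha : `|a%:~R : R| <= W / y.
    rewrite ler_pdivlMr// -{1}(ger0_norm (ltW yp)) -normrM.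
    apply: le_trans h; apply: le_trans (cabs_Im _).
    by rewrite ImD ImM Re_int !Im_int mul0r !addr0.
  have hb : `|b%:~R : R| <= W + W / y * cabs z.
    have -> : `|b%:~R : R| = cabs (b%:~R : C) by rewrite -cabs_real rmorph_int.
    have -> : (b%:~R : C) = (a%:~R * z + b%:~R) - a%:~R * z by ring.
    apply: le_trans (cabsB _ _) _; apply: lerD => //; rewrite cabsM ler_wpM2r ?cabs_ge0//.
    by apply: le_trans ha; rewrite -cabs_real rmorph_int.
  have hB : W / y + W + W / y * cabs z <= B%:R by apply: ltW; exact: truncnS_gt.
  have p1 : 0 <= W / y * cabs z by rewrite mulr_ge0 ?cabs_ge0// divr_ge0 ?(ltW W0) ?(ltW yp).
  have p2 : 0 <= W / y by rewrite divr_ge0 ?(ltW W0) ?(ltW yp).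
  rewrite !intr_norm; split; apply: le_trans hB.
    by apply: le_trans ha _; move: p1 (ltW W0); clear; lra.
  by apply: le_trans hb _; move: p2; clear; lra.
have j2 : cabs j ^+ 2 <= 2 * y.
  have := hy; rewrite hI ler_pdivlMr ?exprn_gt0//; clear; lra.
have jW : cabs j <= 1 + 2 * y.
  by move: j2 yp (sqr_ge0 (cabs j - 1)); rewrite sqrrB; move: (cabs j) => x; rewrite mulr1 expr1n; clear; lra.
have jm : m <= cabs j.
  rewrite /m ge_min; have [c0|c0] := eqVneq (M 1 0) 0.
    have d1 : M 1 1 != 0 by apply: contra_neq M0 => d0; rewrite det22 c0 d0 !mulr0 subrr.
    apply/orP; left; rewrite /j /autfactor c0 mul0r add0r -(rmorph_int (real_complex R)) cabs_real.
    by rewrite -intr_norm ler1z; move: d1; clear; lia.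
  apply/orP; right; apply: le_trans (cabs_Im _); rewrite /j /autfactor ImD ImM Re_int !Im_int mul0r !addr0.
  rewrite normrM (ger0_norm (ltW yp)) ler_peMl ?(ltW yp)//.
  by rewrite -intr_norm ler1z; move: c0; clear; lia.
have [|ka kb] := key (M 0 0) (M 0 1).
  have -> : (M 0 0)%:~R * z + (M 0 1)%:~R = mobius M z * j by rewrite /mobius divfK.
  rewrite cabsM; apply: (@le_trans _ _ ((1 / 2 + y / cabs j ^+ 2) * cabs j)).
    rewrite ler_wpM2r ?cabs_ge0//; apply: le_trans (cabs_le _) _; apply: lerD => //.
    by rewrite ger0_norm ?hI// divr_ge0 ?exprn_ge0 ?cabs_ge0 ?(ltW yp).
  rewrite mulrDl; have -> : y / cabs j ^+ 2 * cabs j = y / cabs j by field; rewrite gt_eqF.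
  apply: lerD; last by rewrite ler_wpM2l ?(ltW yp)// lef_pV2.
  by move: jW (ltW cj0); clear; lra.
have [|kc kd] := key (M 1 0) (M 1 1).
  apply: le_trans jW _; rewrite /W lerDl divr_ge0 ?(ltW yp) ?(ltW m0)//.
have cv (a : int) : `|a|%:~R <= B%:R :> R -> `|a| <= B%:Z.
  by rewrite -[B%:R](_ : B%:Z%:~R = _)// ler_int.
by move=> i i'; case/orP: (ord2P i) => /eqP ->; case/orP: (ord2P i') => /eqP ->; exact: cv.
Qed.

Variable N : nat.
Hypothesis N0 : (0 < N)%N.
Local Open Scope ereal_scope.

Local Notation Gam := [set M | Gamma0 N M].
Local Notation res := (('I_N.+1 * 'I_N.+1) * ('I_N.+1 * 'I_N.+1))%type.

(** One matrix of SL2(Z) in each residue class modulo N; the identity stands in for classes that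
    contain none. *)
Definition coset_rep (r : res) : 'M[int]_2 := xget (1%:M)%R [set M | SL2Z M /\ residue N M = r].

Lemma coset_rep_SL r : SL2Z (coset_rep r).
Proof. by rewrite /coset_rep; case: xgetP => [M _ []//|_]; rewrite /SL2Z det1. Qed.

Lemma coset_repP M : SL2Z M -> residue N (coset_rep (residue N M)) = residue N M.
Proof.
move=> hM; rewrite /coset_rep; case: xgetP => [M' _ []//|/(_ M) h].
by exfalso; apply: h.
Qed.

Lemma SL_gt0 M : SL2Z M -> (0 < \det M)%R. Proof. by move=> ->. Qed.

Lemma SL_neq0 M : SL2Z M -> \det M != 0%R. Proof. by move=> ->. Qed.

(* theta is positive somewhere on every Gamma_0(N)-orbit and has finite integral; *)
(* normalised by its orbit sums it becomes psi, a substitute for the              *)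
(* indicator of a fundamental domain.                                             *)
Definition theta z : \bar R := \sum_(r : res) strip_ind (mobius (coset_rep r) z).

Lemma theta_ge0 z : 0 <= theta z.
Proof. by apply: sume_ge0 => r _; exact: strip_ind_ge0. Qed.

Lemma hmeas_mobius (h : C -> \bar R) M : (0 < \det M)%R -> hmeas h -> hmeas (fun z => h (mobius M z)).
Proof.
move=> dM; apply: hmeas_comp => z z0; first exact: upper_mobius.
by apply: cdiff_cont; apply: cdiff_mobius => //; rewrite gt_eqF.
Qed.

Lemma hmeas_theta : hmeas theta.
Proof.
have [] // := @Inv_sum _ _ (index_enum res) (fun r z => strip_ind (mobius (coset_rep r) z)).
  by move=> r z; exact: strip_ind_ge0.
by move=> r; apply: hmeas_mobius; [exact: SL_gt0 (coset_rep_SL r)|exact: hmeas_strip].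
Qed.

Lemma Inv_theta : Inv theta < +oo.
Proof.
have [||_] := @Inv_sum _ _ (index_enum res) (fun r z => strip_ind (mobius (coset_rep r) z)).
- by move=> r z; exact: strip_ind_ge0.
- by move=> r; apply: hmeas_mobius; [exact: SL_gt0 (coset_rep_SL r)|exact: hmeas_strip].
rewrite /theta => ->; apply: lte_sum_pinfty => r _.
rewrite Inv_mobius; [exact: Inv_strip|exact: SL_gt0 (coset_rep_SL r)|exact: hmeas_strip|].
exact: strip_ind_ge0.
Qed.

Definition Phi z : \bar R := \esum_(g in Gam) theta (mobius g z).

(** Some M of SL2(Z) moves z into the strip; M = D g with D the representative of its class and g in
    Gamma0(N), so one term of the orbit sum is at least 1. *)
Lemma Phi_ge1 z : upper z -> 1 <= Phi z.
Proof.
move=> z0; have [M [hM h1 h2]] := reduction z0.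
pose r := residue N M; have hD := coset_rep_SL r.
have [_ hg] := congr_Gamma0 (residue_congr N0 (esym (coset_repP hM))) hM hD.
set g := (adj2 (coset_rep r) *m M)%R in hg.
have eM : mobius (coset_rep r) (mobius g z) = mobius M z.
  rewrite -mobius_mul//; [|exact: SL_neq0|exact: SL_gt0 hg.1].
  by rewrite /g mulmxA (SL2Z_mulV hD) mul1mx.
apply: esum_ge; exists [set g]; first by split; [exact: finite_set1|move=> _ ->].
rewrite fsbig_set1 /theta (bigD1 r)//= eM {1}/strip_ind /strip h1 h2/=.
by rewrite leeDl// sume_ge0// => *; exact: strip_ind_ge0.
Qed.

Lemma Phi_lt z : upper z -> Phi z < +oo.
Proof.
move=> z0; rewrite /Phi /theta esum_sum; last by move=> *; exact: strip_ind_ge0.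
apply: lte_sum_pinfty => r _; have hD := coset_rep_SL r.
pose X := (fun M => adj2 (coset_rep r) *m M)%R @` [set M | SL2Z M /\ strip (mobius M z)].
apply: (@esum_finite_support _ _ _ X).
- by apply: finite_image; exact: finite_strip.
- by move=> g; rewrite strip_ind_ge0/= /strip_ind; case: ifP => _; rewrite ltry.
move=> g [hg _] hX; rewrite /strip_ind; case: ifP => // hs; case: hX.
exists (coset_rep r *m g)%R; last by rewrite mulmxA (SL2Z_Vmul hD) mul1mx.
split; first exact: SL2Z_mul.
rewrite mobius_mul//; [exact: SL_neq0|exact: SL_gt0].
Qed.

Lemma Gam_mulr_bij g : Gamma0 N g -> set_bij Gam Gam (fun x => x *m g)%R.
Proof.
move=> hg; split.
- by move=> x hx; exact: Gamma0_mul.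
- move=> x y _ _ e; have := congr1 (fun M => M *m adj2 g)%R e.
  by rewrite -!mulmxA (SL2Z_mulV hg.1) !mulmx1.
- move=> x hx; exists (x *m adj2 g)%R; first by apply: Gamma0_mul => //; exact: Gamma0_adj.
  by rewrite -mulmxA (SL2Z_Vmul hg.1) mulmx1.
Qed.

Lemma Phi_invariant g z : Gamma0 N g -> upper z -> Phi (mobius g z) = Phi z.
Proof.
move=> hg z0; rewrite /Phi [RHS](reindex_esum _ _ _ _ (Gam_mulr_bij hg)).
apply: eq_esum => x hx; rewrite mobius_mul//; [exact: SL_neq0 hx.1|exact: SL_gt0 hg.1].
Qed.

Definition psi z : \bar R := theta z * ((fine (Phi z))^-1)%:E.

Lemma fine_Phi z : upper z -> [/\ Phi z = (fine (Phi z))%:E & (1 <= fine (Phi z))%R].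
Proof.
move=> z0; have e : Phi z = (fine (Phi z))%:E.
  by rewrite fineK// ge0_fin_numE ?Phi_lt// (le_trans _ (Phi_ge1 z0)).
by split=> //; have := Phi_ge1 z0; rewrite e lee_fin.
Qed.

Lemma Phi_ge0 z : 0 <= Phi z.
Proof. by apply: esum_ge0 => g _; exact: theta_ge0. Qed.

Lemma psi_ge0 z : 0 <= psi z.
Proof. by rewrite mule_ge0 ?theta_ge0// lee_fin invr_ge0 fine_ge0// Phi_ge0. Qed.

Lemma psi_le z : upper z -> psi z <= theta z.
Proof.
move=> z0; have [_ h] := fine_Phi z0; rewrite /psi -[leRHS]mule1.
rewrite lee_wpmul2l ?theta_ge0// lee_fin invf_le1//; exact: lt_le_trans h.
Qed.

Lemma hmeas_psi : hmeas psi.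
Proof.
apply: hmeasM; first exact: hmeas_theta.
have mP : hmeas Phi.
  apply: hmeas_esum => [g z|g hg]; first exact: theta_ge0.
  by apply: hmeas_mobius; [exact: SL_gt0 hg.1|exact: hmeas_theta].
have := measurableT_comp (@measurable_inv_pos R) (measurableT_comp (fine_measurable (D := setT) measurableT) mP).
move=> /measurable_EFinP; rewrite /hmeas.
congr measurable_fun; apply/funext => q /=; case: (ltP 0%R q.2) => [q0|_]; last by rewrite /= ltxx.
have [_ h] := fine_Phi (q0 : upper (q.1 +i* q.2)%C).
by rewrite (lt_le_trans _ h).
Qed.

(** [Phi] is constant on orbits and lies in [1, oo), so the orbit sum of psi is Phi / Phi. *)
Lemma psi_sum z : upper z -> \esum_(g in Gam) psi (mobius g z) = 1.
Proof.
move=> z0; have [e h] := fine_Phi z0.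
have k0 : (0 <= (fine (Phi z))^-1)%R by rewrite invr_ge0 (le_trans _ h).
have hE g : Gam g -> psi (mobius g z) = ((fine (Phi z))^-1)%:E * theta (mobius g z).
  by move=> hg; rewrite /psi (Phi_invariant hg z0) muleC.
rewrite (eq_esum hE) esumZ//; last by move=> g; exact: theta_ge0.
rewrite -/(Phi z) e -EFinM mulVf// gt_eqF//; exact: lt_le_trans h.
Qed.

Lemma Inv_psi : Inv psi < +oo.
Proof.
apply: le_lt_trans Inv_theta; apply: Inv_le.
- exact: psi_ge0.
- exact: theta_ge0.
- exact: psi_le.
- exact: hmeas_psi.
- exact: hmeas_theta.
Qed.

End PartitionOfUnity.

(** * Cosets of Gamma0(N) in the integral matrices of determinant p *)

Section HeckeRepresentatives.
Variable R : realType.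
Local Notation C := R[i].
Implicit Types (f : C -> C) (z : C) (M A B g : 'M[int]_2) (k N p : nat).

Definition hecke_rep p (i : 'I_p.+1) : 'M[int]_2 :=
  if (i : nat) is b.+1 then mx2 1 b%:Z 0 p%:Z else mx2 p%:Z 0 0 1.

Definition Delta N p : set 'M[int]_2 := [set M : 'M[int]_2 | \det M = p%:Z /\ (N%:Z %| M 1%R 0%R)%Z].

Lemma hecke_reps k N p f z : (0 < k)%N -> prime p -> coprime p N ->
  hecke k N p f z = p%:R ^+ k.-1 * \sum_(i < p.+1) slash k (hecke_rep i) f z.
Proof.
move=> k0 pp pN; rewrite hecke_prime// pN; congr (_ * _); rewrite big_ord_recl/=.
congr (_ + _).
  rewrite /slash /mobius /autfactor /hecke_rep/= !mx2E.
  by rewrite !mulr0z !mulr1z mul0r add0r expr1n invr1 mul1r addr0 mulr1 -pmulrn.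
rewrite mulr_sumr; apply: eq_bigr => b _.
rewrite /slash /mobius /autfactor /hecke_rep/= !mx2E.
by rewrite !mulr0z !mulr1z mul0r add0r mul1r -!pmulrn.
Qed.

Lemma hecke_rep_det p i : \det (@hecke_rep p i) = p%:Z.
Proof.
by rewrite /hecke_rep; case: (i : nat) => [|b]; rewrite det_mx2 ?mulr1 ?mul1r mulr0 subr0.
Qed.

Lemma hecke_rep10 p i : @hecke_rep p i 1 0 = 0.
Proof. by rewrite /hecke_rep; case: (i : nat) => [|b]; rewrite mx2E. Qed.

Lemma mul_rep_Delta N p g i : Gamma0 N g -> Delta N p (g *m @hecke_rep p i).
Proof.
move=> [dg Ng]; split; first by rewrite det_mulmx dg mul1r hecke_rep_det.
by rewrite mul22E hecke_rep10 mulr0 addr0 dvdz_mulr.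
Qed.

Lemma mul_neq1 (x t : int) : 1 < x -> x * t = 1 -> False.
Proof.
move=> x1 e; have [h|h] : t <= 0 \/ 1 <= t by lia.
  by nia.
by nia.
Qed.

Lemma coprimez_prime p (x : int) : prime p -> ~~ (p%:Z %| x)%Z -> coprimez p%:Z x.
Proof. by move=> pp; rewrite coprimezE/= prime_coprime// dvdzE. Qed.

(** Distinct representatives generate distinct cosets: otherwise p would divide 1, or two residues
    below p would be congruent modulo p. *)
Lemma mul_rep_inj p g g' i j : prime p -> SL2Z g -> SL2Z g' ->
  g *m @hecke_rep p i = g' *m hecke_rep j -> i = j /\ g = g'.
Proof.
move=> pp; rewrite /SL2Z !det22 => hg hg' e.
have p1 : 1 < p%:Z by have := prime_gt1 pp; lia.
have E r s := congr1 (fun M : 'M[int]_2 => M r s) e.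
have := E 0 0; have := E 0 1; have := E 1 0; have := E 1 1.
rewrite !mul22E /hecke_rep.
have hi := ltn_ord i; have hj := ltn_ord j.
case ei : (i : nat) hi => [|b] hi; case ej : (j : nat) hj => [|b'] hj; rewrite !mx2E;
  rewrite ?mulr0 ?mulr1 ?addr0 ?add0r => e4 e3 e2 e1.
- split; first by apply: val_inj; rewrite /= ei ej.
  have p0 : p%:Z != 0 by lia.
  by apply: mx2P => //; apply: (mulIf p0).
- exfalso; have : p%:Z * (g 0 0 * g' 1 1 - g' 0 1 * g 1 0) = 1.
    by rewrite -[RHS]hg' -e1 -e3; ring.
  exact: mul_neq1.
- exfalso; have : p%:Z * (g' 0 0 * g 1 1 - g 0 1 * g' 1 0) = 1.
    by rewrite -[RHS]hg e1 e3; ring.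
  exact: mul_neq1.
have bb : b%:Z - b'%:Z = p%:Z * (g' 0 1 * g 1 1 - g 0 1 * g' 1 1).
  have q1 : g 0 0 * (b%:Z - b'%:Z) = p%:Z * (g' 0 1 - g 0 1).
    by move: e2; rewrite -e1; lia.
  have q2 : g 1 0 * (b%:Z - b'%:Z) = p%:Z * (g' 1 1 - g 1 1).
    by move: e4; rewrite -e3; lia.
  transitivity ((g 0 0 * (b%:Z - b'%:Z)) * g 1 1 - g 0 1 * (g 1 0 * (b%:Z - b'%:Z))).
    by rewrite -[LHS]mul1r -hg; ring.
  by rewrite q1 q2; ring.
have eb : b = b'.
  move: bb; move: (_ - g 0 1 * _) => t; move: hi hj p1; rewrite !ltnS; clear => h1 h2 h3 h4.
  have [h|[h|h]] : t <= -1 \/ t = 0 \/ 1 <= t by lia.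
  - by exfalso; nia.
  - by move: h4; rewrite h mulr0; lia.
  - by exfalso; nia.
split; first by apply: val_inj; rewrite /= ei ej eb.
have p0 : p%:Z != 0 by lia.
rewrite -eb in e2 e4.
apply: mx2P => //; apply: (mulIf p0).
  by move: e2; rewrite -e1; lia.
by move: e4; rewrite -e3; lia.
Qed.

Lemma inverse_modp p (x y : int) : prime p -> ~~ (p%:Z %| x)%Z ->
  exists2 b : nat, (b < p)%N & (p%:Z %| y - x * b%:Z)%Z.
Proof.
move=> pp nx; have co := coprimez_prime pp nx.
have [u [v e]] := Bezoutz x p%:Z.
have {}e : u * x + v * p%:Z = 1 by rewrite e gcdzC; apply/eqP.
have p0 : p%:Z != 0 by have := prime_gt0 pp; lia.
pose b := ((u * y) %% p%:Z)%Z.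
have b0 : 0 <= b by exact: modz_ge0.
have bp : b < p%:Z by have := ltz_mod (u * y) p0; rewrite /b; lia.
exists `|b|%N; first by lia.
have eb : (`|b|%N : int) = u * y - ((u * y) %/ p%:Z)%Z * p%:Z.
  by rewrite gez0_abs// /b {2}(divz_eq (u * y) p%:Z) addrC addKr.
apply/dvdzP; exists (y * v + x * ((u * y) %/ p%:Z)%Z).
rewrite eb; move: ((u * y) %/ _)%Z => q; have h : v * p%:Z = 1 - u * x by rewrite -e addrC addKr.
transitivity (y * (1 - u * x) + x * q * p%:Z); first by ring.
by rewrite -h; ring.
Qed.

(** If p divides the first column, diag(p, 1) splits off, and coprimality keeps N dividing the lower
    left entry. Otherwise the determinant condition makes the second column b times the first modulo
    p, with one b for both rows. *)
Lemma Delta_rep N p M : prime p -> coprime p N -> Delta N p M ->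
  exists g i, Gamma0 N g /\ M = g *m @hecke_rep p i.
Proof.
move=> pp pN [dM NM]; rewrite det22 in dM.
have p0 : p%:Z != 0 by have := prime_gt0 pp; lia.
have coNp : coprimez N%:Z p%:Z by rewrite /coprimez /gcdz/= gcdnC; move: pN; rewrite /coprime.
have [/andP[/dvdzP[a1 ea] /dvdzP[c1 ec]]|npp] := boolP ((p%:Z %| M 0%R 0%R)%Z && (p%:Z %| M 1%R 0%R)%Z).
  exists (mx2 a1 (M 0 1) c1 (M 1 1)); exists ord0; split.
    split; last by move: NM; rewrite mx2E ec Gauss_dvdzl.
    by rewrite /SL2Z det_mx2; apply: (mulIf p0); rewrite mul1r -[RHS]dM ea ec; ring.
  by rewrite /hecke_rep/=; apply: mx2P; rewrite mul22E !mx2E ?mulr0 ?mulr1 ?addr0 ?add0r.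
have [b bp [h1 h2]] : exists2 b : nat, (b < p)%N & (p%:Z %| M 0%R 1%R - M 0%R 0%R * b%:Z)%Z /\
    (p%:Z %| M 1%R 1%R - M 1%R 0%R * b%:Z)%Z.
  have co x : ~~ (p%:Z %| x)%Z -> coprimez p%:Z x by exact: coprimez_prime.
  move: npp; rewrite negb_and => /orP[na|nc].
    have [b bp h] := inverse_modp (M 0 1) pp na; exists b => //; split=> //.
    rewrite -(Gauss_dvdzr _ (co _ na)).
    have -> : M 0 0 * (M 1 1 - M 1 0 * b%:Z) = p%:Z + M 1 0 * (M 0 1 - M 0 0 * b%:Z).
      by rewrite -dM; ring.
    by apply: rpredD; [exact: dvdzz|exact: dvdz_mull].
  have [b bp h] := inverse_modp (M 1 1) pp nc; exists b => //; split=> //.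
  rewrite -(Gauss_dvdzr _ (co _ nc)).
  have -> : M 1 0 * (M 0 1 - M 0 0 * b%:Z) = M 0 0 * (M 1 1 - M 1 0 * b%:Z) - p%:Z.
    by rewrite -dM; ring.
  by apply: rpredB; [exact: dvdz_mull|exact: dvdzz].
have [b1 e1] := dvdzP h1; have [d1 e2] := dvdzP h2.
have i : (b.+1 < p.+1)%N by [].
exists (mx2 (M 0 0) b1 (M 1 0) d1); exists (Ordinal i); split.
  split; last by rewrite mx2E.
  rewrite /SL2Z det_mx2; apply: (mulIf p0); rewrite mul1r -[RHS]dM.
  have -> : M 0 1 = b1 * p%:Z + M 0 0 * b%:Z by rewrite -e1 subrK.
  have -> : M 1 1 = d1 * p%:Z + M 1 0 * b%:Z by rewrite -e2 subrK.
  by ring.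
rewrite /hecke_rep/=; apply: mx2P; rewrite mul22E !mx2E ?mulr0 ?mulr1 ?addr0//.
  by rewrite -e1 addrC subrK.
by rewrite -e2 addrC subrK.
Qed.

Lemma Delta_adj N p : set_bij (Delta N p) (Delta N p) adj2.
Proof.
have ad M : Delta N p M -> Delta N p (adj2 M).
  by move=> [h1 h2]; split; rewrite ?adj2_det// /adj2 mx2E dvdzE abszN -dvdzE.
split=> [M|M M' _ _ e|M /ad h]; first exact: ad.
  by rewrite -(adj2K M) e adj2K.
by exists (adj2 M); rewrite ?adj2K.
Qed.

End HeckeRepresentatives.

(** * Mass transport: Hecke eigenvalues at primes not dividing N are real *)

Section MassTransport.
Variable R : realType.
Local Notation C := R[i].
Local Notation Re := complex.Re.
Local Notation Im := complex.Im.
Implicit Types (z : C) (M g : 'M[int]_2) (s : R).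
Variables (N K p : nat) (f : C -> C).
Hypotheses (N0 : (0 < N)%N) (K0 : (0 < K)%N) (pp : prime p) (pN : coprime p N).
Hypothesis cf : cusp_form K.*2 N f.

(* The imaginary part of (f|M)(z) conj(f(z)) y^k. Its sum over representatives of *)
(* Gamma_0(N) \ Delta is Im(lambda) |f|^2 y^k, up to a positive factor.           *)
Definition kap M z : R := Im (slash K.*2 M f z * cj (f z)) * Im z ^+ K.*2.

(* M |-> adj M is an involution of Delta that exchanges the two endpoints of the *)
(* edge z -> Mz, so the flux kap is antisymmetric along edges.                   *)
Lemma kap_adj M z : 0 < \det M -> upper z -> kap (adj2 M) (mobius M z) = - kap M z.
Proof.
move=> dM z0; have M0 : \det M != 0 by rewrite gt_eqF.
have aM : \det (adj2 M) != 0 by rewrite adj2_det.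
pose q : R := (\det M)%:~R; have q0 : 0 < q by rewrite ltr0z.
set J := autfactor M z; have J0 : J != 0 := autfactor_neq0 M0 z0.
have JJ : autfactor (adj2 M) (mobius M z) = q%:C / J.
  apply: (mulIf J0); rewrite divfK// -autfactor_mul// adj2_mul /autfactor !mx2E.
  by rewrite mul0r add0r rmorph_int.
have zz : mobius (adj2 M) (mobius M z) = z.
  rewrite -mobius_mul// adj2_mul /mobius /autfactor !mx2E mul0r add0r addr0 mulrAC mulfV ?mul1r//.
  by rewrite intr_eq0.
have fw : f (mobius M z) = J ^+ K.*2 * slash K.*2 M f z.
  by rewrite /slash -/J mulrA mulfV ?mul1r// expf_neq0.
have cJ : 0 < cabs J by rewrite cabs_gt0.
have qC : q%:C != 0 :> C by rewrite -cabs_gt0 cabs_real normr_gt0 gt_eqF.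
have e1 : slash K.*2 (adj2 M) f (mobius M z) * cj (f (mobius M z)) =
    ((cabs J ^+ 2 / q) ^+ K.*2)%:C * (f z * cj (slash K.*2 M f z)).
  have eA : (q%:C / J) ^- K.*2 = J ^+ K.*2 / q%:C ^+ K.*2 by rewrite expr_div_n invf_div.
  have eB : ((cabs J ^+ 2 / q) ^+ K.*2)%:C = J ^+ K.*2 * cj J ^+ K.*2 / q%:C ^+ K.*2 :> C.
    by rewrite rmorphXn/= fmorph_div/= cabs2E expr_div_n exprMn.
  have eC : cj (J ^+ K.*2 * slash K.*2 M f z) = cj J ^+ K.*2 * cj (slash K.*2 M f z).
    by rewrite rmorphM rmorphXn.
  rewrite {1}/slash JJ zz eA fw eC eB; ring.
rewrite /kap e1 ImZ (Im_mobius M0 z0) -/J -/q.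
have -> : Im (f z * cj (slash K.*2 M f z)) = - Im (slash K.*2 M f z * cj (f z)).
  by move: (slash _ _ _ _) (f z) => X Y; rewrite !ImM !ReJ !ImJ; ring.
have eAB : (cabs J ^+ 2 / q) ^+ K.*2 * (q * Im z / cabs J ^+ 2) ^+ K.*2 = Im z ^+ K.*2.
  by rewrite -exprMn; congr (_ ^+ _); field; rewrite !gt_eqF.
by rewrite -eAB; move: (Im (_ * _)) => I; ring.
Qed.

Definition side s M z : R := Num.max 0 (s * kap M z).

Lemma side_ge0 s M z : 0 <= side s M z.
Proof. by rewrite /side le_max lexx. Qed.

Lemma kap_bound : exists2 B : R, 0 < B & forall s M z, `|s| <= 1 -> 0 < \det M -> upper z ->
  side s M z <= B.
Proof.
have [C0 C00 hC] := cusp_bound N0 cf.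
exists (C0 * C0) => [|s M z s1 dM z0]; first exact: mulr_gt0.
have q1 : (1 : R) <= ((\det M)%:~R) ^+ K by rewrite exprn_ege1// ler1z; move: dM; clear; lia.
have h1 := hC _ (upper_mobius dM z0); rewrite slash_norm// in h1.
have h2 := hC _ z0; have y0 : 0 <= Im z := ltW z0.
have h3 : cabs (slash K.*2 M f z) * Im z ^+ K <= C0.
  by apply: le_trans h1; rewrite ler_peMl// mulr_ge0 ?cabs_ge0 ?exprn_ge0.
rewrite /side ge_max mulr_ge0 ?(ltW C00)//=; apply: le_trans (ler_norm _) _.
rewrite normrM -[leRHS]mul1r; apply: ler_pM => //.
rewrite /kap normrM (ger0_norm (exprn_ge0 _ y0)).
apply: (@le_trans _ _ ((cabs (slash K.*2 M f z) * Im z ^+ K) * (cabs (f z) * Im z ^+ K))).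
  rewrite mulrACA -exprD addnn ler_wpM2r ?exprn_ge0//; apply: le_trans (cabs_Im _) _.
  by move: (slash _ _ _ _) => X; rewrite cabsM cabs_conj.
by apply: ler_pM; rewrite ?mulr_ge0 ?cabs_ge0 ?exprn_ge0.
Qed.

Lemma flux_cont M z : 0 < \det M -> upper z ->
  ccont (fun w => slash K.*2 M f w * cj (f w) * (Im w)%:C ^+ K.*2) z.
Proof.
move=> dM z0; have fc w : upper w -> cdiff f w by exact: cusp_form_diff cf.
have c1 : ccont (slash K.*2 M f) z := cdiff_cont (cdiff_slash K.*2 dM z0 fc).
have c2 : ccont (fun w => cj (f w)) z.
  move=> e /(cdiff_cont (fc z z0))[d d0 hd]; exists d => // w /hd.
  by rewrite -rmorphB cabs_conj.
have c3 : ccont (fun w => (Im w)%:C) z.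
  move=> e e0; exists e => // w hw; rewrite -rmorphB cabs_real -ImN -ImD.
  exact: le_trans (cabs_Im _) (ltW hw).
exact: ccontM (ccontM c1 c2) (@ccontX _ _ K.*2 _ c3).
Qed.

Lemma kap_cont M z : 0 < \det M -> upper z -> forall e : R, 0 < e -> exists2 d : R, 0 < d &
  forall w, cabs (w - z) < d -> `|kap M w - kap M z| <= e.
Proof.
move=> dM z0 e /(flux_cont dM z0)[d d0 hd]; exists d => // w /hd; apply: le_trans.
have kE v : kap M v = Im (slash K.*2 M f v * cj (f v) * (Im v)%:C ^+ K.*2).
  by rewrite /kap -rmorphXn mulrC -ImZ [(_%:C) * _]mulrC.
by rewrite !kE -ImN -ImD; exact: cabs_Im.
Qed.

Lemma side_cont s M z : 0 < \det M -> upper z -> `|s| <= 1 ->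
  forall e : R, 0 < e -> exists2 d : R, 0 < d &
  forall w, cabs (w - z) < d -> `|side s M w - side s M z| <= e.
Proof.
move=> dM z0 s1 e /(kap_cont dM z0)[d d0 hd]; exists d => // w /hd; apply: le_trans.
have mx (x y : R) : `|Num.max 0 x - Num.max 0 y| <= `|x - y|.
  wlog xy : x y / x <= y.
    by move=> H; have [/H//|/ltW/H] := leP x y; rewrite distrC [leRHS]distrC.
  rewrite !maxEle; case: (leP 0 x) => x0; case: (leP 0 y) => y0 //.
  - by move: x0 xy y0; lra.
  - by rewrite !ler0_norm ?opprB; move: x0 xy y0; lra.
  - by rewrite subr0 normr0.
by apply: le_trans (mx _ _) _; rewrite -mulrBr normrM ler_piMl.
Qed.

Local Open Scope ereal_scope.
Local Notation Gam := [set M | Gamma0 N M].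
Local Notation rho := (@hecke_rep p).

Lemma rho_gt0 i : (0 < \det (rho i))%R.
Proof. by rewrite hecke_rep_det; have := prime_gt0 pp; lia. Qed.

Lemma Delta_gt0 M : Delta N p M -> (0 < \det M)%R.
Proof. by move=> [-> _]; have := prime_gt0 pp; lia. Qed.

Lemma side_mul s g M z : Gamma0 N g -> (0 < \det M)%R -> upper z -> side s (g *m M) z = side s M z.
Proof.
move=> hg dM z0; rewrite /side /kap slash_mul//; last by rewrite hg.1.
rewrite (@slash_ext _ _ _ _ f)// => w w0.
by have [_ h _] := cf; exact: h.
Qed.

Lemma hmeas_side s M : (`|s| <= 1)%R -> (0 < \det M)%R -> hmeas (fun z => (side s M z)%:E).
Proof. by move=> s1 dM; apply: hmeas_cont => z z0; exact: side_cont. Qed.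

(** [Delta] is the disjoint union of the cosets Gamma0(N) rho_i, [side] is unchanged when M is
    multiplied by Gamma0(N) on the left, and psi sums to 1 over each orbit. *)
Lemma transport_sum s z : upper z ->
  \esum_(M in Delta N p) (psi N (mobius M z) * (side s M z)%:E) =
  \sum_(i < p.+1) (side s (rho i) z)%:E.
Proof.
move=> z0; pose F M := psi N (mobius M z) * (side s M z)%:E.
have F0 M : 0 <= F M by rewrite mule_ge0 ?psi_ge0// lee_fin side_ge0.
pose G i : set 'M[int]_2 := (fun g => g *m rho i)%R @` Gam.
have split_F M : Delta N p M -> F M = \sum_(i < p.+1) (if M \in G i then F M else 0).
  move=> /(Delta_rep pp pN)[g [i [hg eM]]].
  rewrite (bigD1 i)//= big1 ?adde0 => [|j ji].
    by rewrite mem_set//; exists g.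
  case: ifPn => //; rewrite inE => -[g' hg' e']; case/eqP: ji.
  rewrite eM in e'; by have [] := mul_rep_inj pp hg'.1 hg.1 e'.
rewrite (eq_esum split_F) esum_sum; last by move=> M i _ _; case: ifP.
apply: eq_bigr => i _; rewrite -esum_mkcondr.
have -> : Delta N p `&` G i = G i.
  by apply/seteqP; split=> [M []//|_ [g hg <-]]; split; [exact: mul_rep_Delta|exists g].
rewrite esum_image; last first.
  move=> g g'; rewrite !inE => hg hg' e.
  by have [] := mul_rep_inj pp hg.1 hg'.1 e.
have e g : Gam g -> F (g *m rho i)%R = (side s (rho i) z)%:E * psi N (mobius g (mobius (rho i) z)).
  move=> hg; rewrite /F side_mul ?rho_gt0// mobius_mul ?rho_gt0//; last by rewrite hg.1.
  by rewrite muleC.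
rewrite (eq_esum e) esumZ ?side_ge0//; last by move=> g; exact: psi_ge0.
by rewrite psi_sum ?mule1//; apply: upper_mobius => //; exact: rho_gt0.
Qed.

Lemma psi_fin z : upper z -> psi N z = (fine (psi N z))%:E.
Proof.
move=> z0; rewrite fineK// ge0_fin_numE ?psi_ge0//; apply: le_lt_trans (psi_le N0 z0) _.
by apply: lte_sum_pinfty => r _; rewrite /strip_ind; case: ifP => _; rewrite ltry.
Qed.

(* Only the positive part of s * kap is transported, so that the integrals and *)
(* sums below may be exchanged without integrability conditions.               *)
Definition flow s M z := psi N z * (psi N (mobius M z) * (side s M z)%:E).

Lemma flow_ge0 s M z : 0 <= flow s M z.
Proof.
apply: mule_ge0; first exact: psi_ge0.
by apply: mule_ge0; [exact: psi_ge0|rewrite lee_fin side_ge0].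
Qed.

Lemma hmeas_flow s M : (`|s| <= 1)%R -> (0 < \det M)%R -> hmeas (flow s M).
Proof.
move=> s1 dM; apply: hmeasM; first exact: hmeas_psi.
apply: hmeasM; last exact: hmeas_side.
by apply: hmeas_mobius => //; exact: hmeas_psi.
Qed.

Definition total s : \bar R := Inv (fun z => psi N z * \sum_(i < p.+1) (side s (rho i) z)%:E).

Lemma total_flow s : (`|s| <= 1)%R -> total s = \esum_(M in Delta N p) Inv (flow s M).
Proof.
move=> s1; rewrite -Inv_esum => [|M z|M hM|M].
- apply: Inv_ext => z z0; rewrite /flow -(transport_sum _ z0) (psi_fin z0) esumZ//.
    by rewrite fine_ge0 ?psi_ge0.
  by move=> M; rewrite mule_ge0 ?psi_ge0// lee_fin side_ge0.
- exact: flow_ge0.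
- by apply: hmeas_flow => //; exact: Delta_gt0.
- by apply: Inv_ge0 => z; exact: flow_ge0.
Qed.

(** The change of variables z -> Mz preserves [Inv], exchanges the two factors psi, and reverses the
    sign of the flux by [kap_adj]. *)
Lemma flow_adj s M : (`|s| <= 1)%R -> Delta N p M -> Inv (flow (- s) (adj2 M)) = Inv (flow s M).
Proof.
move=> s1 hM; have dM := Delta_gt0 hM.
have dA : (0 < \det (adj2 M))%R by rewrite adj2_det.
have hm : hmeas (flow (- s) (adj2 M)) by apply: hmeas_flow => //; rewrite normrN.
apply: (etrans (esym (Inv_mobius dM hm (fun z => flow_ge0 _ _ z)))).
apply: Inv_ext => z z0; rewrite /flow -mobius_mul ?adj2_det ?gt_eqF// adj2_mul.
have -> : mobius (mx2 (\det M) 0 0 (\det M)) z = z.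
  rewrite /mobius /autfactor !mx2E mul0r add0r addr0 mulrAC mulfV ?mul1r//.
  by rewrite intr_eq0 gt_eqF.
by rewrite /side kap_adj// mulrNN muleCA.
Qed.

Lemma total_opp s : (`|s| <= 1)%R -> total (- s) = total s.
Proof.
move=> s1; have s1' : (`|- s| <= 1)%R by rewrite normrN.
apply: (etrans (total_flow s1')); apply: (etrans _ (esym (total_flow s1))).
apply: (etrans (reindex_esum _ _ _ _ (Delta_adj N p))).
by apply: eq_esum => M hM; exact: flow_adj.
Qed.

Lemma total_lt s : (`|s| <= 1)%R -> total s < +oo.
Proof.
move=> s1; have [B B0 hB] := kap_bound.
have hsum z : upper z -> \sum_(i < p.+1) (side s (rho i) z)%:E <= ((p.+1)%:R * B)%:E.
  move=> z0; rewrite sumEFin lee_fin; apply: (@le_trans _ _ (\sum_(i < p.+1) B)%R); last first.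
    by rewrite sumr_const card_ord mulr_natl.
  by apply: ler_sum => i _; apply: hB => //; exact: rho_gt0.
have sum0 z : 0 <= \sum_(i < p.+1) (side s (rho i) z)%:E.
  by apply: sume_ge0 => i _; rewrite lee_fin side_ge0.
have kB : (0 <= p.+1%:R * B)%R by rewrite mulr_ge0// ltW.
apply: (@le_lt_trans _ _ (Inv (fun z => (p.+1%:R * B)%:E * psi N z))).
  apply: Inv_le => [z|z|z z0||].
  - by rewrite mule_ge0 ?psi_ge0.
  - by rewrite mule_ge0 ?psi_ge0.
  - by rewrite muleC lee_wpmul2r ?psi_ge0 ?hsum.
  - apply: hmeasM; first exact: hmeas_psi.
    have [] // := @Inv_sum _ _ (index_enum 'I_p.+1) (fun i z => (side s (rho i) z)%:E).
      by move=> i z; rewrite lee_fin side_ge0.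
    by move=> i; apply: hmeas_side => //; exact: rho_gt0.
  - have mk : hmeas (fun _ : C => (p.+1%:R * B)%:E : \bar R).
      by apply: hmeas_cont => z _ e e0; exists 1%R => // w _; rewrite subrr normr0 ltW.
    by apply: hmeasM => //; exact: hmeas_psi.
rewrite InvZ//; [|exact: psi_ge0|exact: hmeas_psi].
by rewrite lte_mul_pinfty// Inv_psi.
Qed.

Definition energy z : R := (cabs (f z) ^+ 2 * Im z ^+ K.*2)%R.

Lemma energy_invariant g z : Gamma0 N g -> upper z -> energy (mobius g z) = energy z.
Proof.
move=> hg z0; have [_ hs _] := cf; have g0 : (0 < \det g)%R by rewrite hg.1.
have h := slash_norm K f g0 z0; rewrite hs// hg.1 expr1n mul1r in h.
have e w : energy w = ((cabs (f w) * Im w ^+ K) ^+ 2)%R by rewrite /energy exprMn -exprM muln2.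
by rewrite !e h.
Qed.

(** Termwise max(0, x) = max(0, -x) + x; the eigenvalue equation evaluates the sum of the fluxes
    over the representatives. *)
Lemma side_balance (la : C) s z : upper z -> hecke K.*2 N p f z = (la * f z)%R ->
  (\sum_(i < p.+1) side s (rho i) z =
   \sum_(i < p.+1) side (- s) (rho i) z + s * Im la / p%:R ^+ K.*2.-1 * energy z)%R.
Proof.
move=> z0 hT; have k0 : (0 < K.*2)%N by rewrite double_gt0.
have q0 : (p%:R ^+ K.*2.-1 != 0 :> R)%R by rewrite expf_neq0// pnatr_eq0 -lt0n prime_gt0.
have eS : (la * f z = (p%:R ^+ K.*2.-1)%:C%C * \sum_(i < p.+1) slash K.*2 (rho i) f z)%R.
  by rewrite -hT hecke_reps// rmorphXn/= rmorph_nat.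
have eI : (p%:R ^+ K.*2.-1 * Im ((\sum_(i < p.+1) slash K.*2 (rho i) f z) * cj (f z)) =
    Im la * cabs (f z) ^+ 2)%R.
  rewrite -ImZ mulrA -eS -mulrA -cabs2E; move: (cabs (f z) ^+ 2)%R => x.
  by rewrite ImM/= mulr0 add0r.
have kE : (s * Im la / p%:R ^+ K.*2.-1 * energy z = \sum_(i < p.+1) s * kap (rho i) z)%R.
  rewrite /kap -mulr_sumr -mulr_suml -Im_sum -mulr_suml /energy.
  move: q0 eI; move: (Im (_ * _)%R) (p%:R ^+ _)%R => I q q0 eI; apply: (mulfI q0).
  transitivity (s * (Im la * cabs (f z) ^+ 2) * Im z ^+ K.*2)%R; first by field.
  by rewrite -eI; ring.
rewrite kE -big_split/=; apply: eq_bigr => i _; rewrite /side mulNr.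
by move: (s * kap _ _)%R => x; rewrite !maxEle; case: (leP 0%R x) => x0; case: (leP 0%R (- x)%R) => y0; move: x0 y0; lra.
Qed.

Lemma energy_ge0 z : (0 <= energy z)%R.
Proof. by rewrite /energy mulr_ge0 ?sqr_ge0// -muln2 exprM sqr_ge0. Qed.

Lemma energy_cont z : upper z -> forall e : R, (0 < e)%R -> exists2 d : R, (0 < d)%R &
  forall w, (cabs (w - z) < d)%R -> (`|energy w - energy z| <= e)%R.
Proof.
move=> z0 e e0; have d1 : (0 < \det (1%:M : 'M[int]_2))%R by rewrite det1.
have [d d0 hd] := flux_cont d1 z0 e0; exists d => // w /hd; apply: le_trans.
have kE v : energy v = Re (slash K.*2 1%:M f v * cj (f v) * (Im v)%:C%C ^+ K.*2)%R.
  by rewrite slash1 -cabs2E -rmorphXn -rmorphM.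
by rewrite !kE -ReN -ReD; exact: cabs_Re.
Qed.

(** Let s be the sign of Im la. By [side_balance] the outflow [total s] exceeds [total (- s)] by the
    integral of psi times a nonnegative multiple of the energy. The two totals are equal and finite,
    so that integral is 0, contrary to [Inv_pos] at z1. *)
Lemma hecke_eigenvalue_real (la : C) z1 :
  (forall z, upper z -> hecke K.*2 N p f z = (la * f z)%R) -> upper z1 -> f z1 != 0%R -> Im la = 0%R.
Proof.
move=> hT z10 fz1; apply/eqP; apply: contraT => la0.
pose s : R := Num.sg (Im la).
have s1 : (`|s| <= 1)%R by rewrite /s normr_sg la0.
have sl : (s * Im la = `|Im la|)%R by rewrite /s -normrEsg.
have q0 : (0 < p%:R ^+ K.*2.-1 :> R)%R by rewrite exprn_gt0// ltr0n prime_gt0.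
pose c : R := (s * Im la / p%:R ^+ K.*2.-1)%R.
have c0 : (0 < c)%R by rewrite /c sl divr_gt0// normr_gt0.
pose g z : R := (c * energy z)%R.
have g0 z : (0 <= g z)%R by rewrite mulr_ge0 ?(ltW c0) ?energy_ge0.
have gc z : upper z -> forall e : R, (0 < e)%R -> exists2 d : R, (0 < d)%R &
    forall w, (cabs (w - z) < d)%R -> (`|g w - g z| <= e)%R.
  move=> z0 e e0; have [d d0 hd] := energy_cont z0 (divr_gt0 e0 c0).
  exists d => // w /hd; rewrite -mulrBr normrM (gtr0_norm c0) ler_pdivlMr// mulrC//.
have mg := hmeas_cont gc; have mpsi : hmeas (@psi R N) := @hmeas_psi R N N0.
have pg0 z : 0 <= psi N z * (g z)%:E by rewrite mule_ge0 ?psi_ge0 ?lee_fin.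
have mpg := hmeasM mpsi mg.
have sum0 s' z : 0 <= \sum_(i < p.+1) (side s' (rho i) z)%:E.
  by apply: sume_ge0 => i _; rewrite lee_fin side_ge0.
have s1' : (`|- s| <= 1)%R by rewrite normrN.
have X0 : Inv (fun z => psi N z * (g z)%:E) = 0.
  have eX : total s = total (- s) + Inv (fun z => psi N z * (g z)%:E).
    rewrite /total -InvD => [|z|//||//].
    - apply: Inv_ext => z z0; rewrite -ge0_muleDr ?lee_fin// !sumEFin -EFinD.
      by congr (_ * _%:E); exact: side_balance (hT z z0).
    - by rewrite mule_ge0 ?psi_ge0.
    - apply: hmeasM => //.
      have [] // := @Inv_sum _ _ (index_enum 'I_p.+1) (fun i z => (side (- s) (rho i) z)%:E).
        by move=> i z; rewrite lee_fin side_ge0.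
      by move=> i; apply: hmeas_side => //; exact: rho_gt0.
  rewrite total_opp// in eX.
  have tf : total s \is a fin_num.
    rewrite ge0_fin_numE ?total_lt// /total; apply: Inv_ge0 => z.
    by rewrite mule_ge0 ?psi_ge0.
  move: eX tf; move: (total s) (Inv _) => [t||] [x||]//= [e] _.
  by congr (_%:E); move: e; lra.
(* Unfolding: the energy is invariant and psi sums to 1 over orbits, so the full integral is a sum
   of copies of the one that vanishes. *)
have G0 : Inv (fun z => (g z)%:E) = 0.
  pose h M z := psi N (mobius M z) * (g (mobius M z))%:E.
  have h0 M z : 0 <= h M z by rewrite mule_ge0 ?psi_ge0 ?lee_fin.
  have hm M : Gam M -> hmeas (h M).
    by move=> hM; apply: (hmeas_mobius (h := fun z => psi N z * (g z)%:E)); [exact: SL_gt0 hM.1|].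
  have -> : Inv (fun z => (g z)%:E) = Inv (fun z => \esum_(M in Gam) h M z).
    apply: Inv_ext => z z0.
    have e M : Gam M -> h M z = (g z)%:E * psi N (mobius M z).
      by move=> hM; rewrite /h muleC /g energy_invariant.
    by rewrite (eq_esum e) esumZ ?psi_sum ?mule1// => M; exact: psi_ge0.
  rewrite Inv_esum//; last by move=> M; apply: Inv_ge0 => z; exact: h0.
  apply: esum1 => M hM; rewrite -[RHS]X0.
  exact: (Inv_mobius (SL_gt0 hM.1) mpg pg0).
have gz1 : (0 < g z1)%R.
  by rewrite mulr_gt0// /energy mulr_gt0 ?exprn_gt0// cabs_gt0.
by have := Inv_pos g0 gc z10 gz1; rewrite G0 ltxx.
Qed.

End MassTransport.

(** * Logarithms and periods of complex powers *)

Section ComplexPowers.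
Variable R : realType.
Local Notation C := R[i].
Local Notation Re := complex.Re.
Local Notation Im := complex.Im.
Implicit Types (s w c z : C).

Lemma cexp_surj c : c != 0 -> exists z, cexp z = c.
Proof.
move=> c0; have r0 : 0 < cabs c by rewrite cabs_gt0.
pose x := Re c / cabs c; pose y := Im c / cabs c.
have xy : x ^+ 2 + y ^+ 2 = 1.
  by rewrite !exprMn -mulrDl -cabs_sq exprVn divff// expf_neq0// gt_eqF.
have x1 : `|x| <= 1.
  by rewrite -ler_sqr ?nnegrE// expr1n real_normK ?num_real// -xy lerDl sqr_ge0.
have xI : -1 <= x <= 1 by rewrite -ler_norml.
have st : sin (acos x) = `|y|.
  by rewrite sin_acos// -xy addrAC subrr add0r sqrtr_sqr.
have [t ct st'] : exists2 t, cos t = x & sin t = y.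
  have [y0|y0] := leP 0 y.
    by exists (acos x); rewrite ?acosK// st ger0_norm.
  by exists (- acos x); rewrite ?cosN ?acosK// sinN st ltr0_norm// opprK.
exists (ln (cabs c) +i* t); rewrite /cexp/= lnK ?posrE// ct st' /x /y.
rewrite [RHS]complexE; case: c c0 r0 {x y xy x1 xI st ct st'} => p q c0 r0.
move: (cabs _) r0 => r r0; have rn : r != 0 by rewrite gt_eqF.
by apply/eqP; rewrite eq_complex/=; apply/andP; split; apply/eqP; field.
Qed.

Lemma cexp_period (x : R) : 0 <= x -> cexp ((2 * pi * x)%:C * ii) = 1 ->
  exists n : nat, x = n%:R.
Proof.
move=> x0; pose n := Num.truncn x; pose r := x - n%:R.
have /andP[n1 n2] : n%:R <= x < n.+1%:R by rewrite truncn_itv.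
have r0 : 0 <= r by rewrite subr_ge0.
have r1 : r < 1 by rewrite ltrBlDl natr1.
have -> : (2 * pi * x)%:C * ii = (2 * pi)%:C * ii * n%:R + (2 * (pi * r))%:C * ii :> C.
  have -> : x = n%:R + r by rewrite /r addrC subrK.
  by rewrite mulrDr rmorphD/= rmorphM/= rmorph_nat mulrA; ring.
rewrite cexpD cexpMn cexp_2pi expr1n mul1r cexp_im => /(congr1 (@complex.Re R))/=.
rewrite mulr_natl cos_mulr2n cos2sin2 => h.
have s0 : sin (pi * r) = 0.
  by apply/eqP; rewrite -sqrf_eq0; apply/eqP; move: h; rewrite mulr2n; lra.
exists n; apply/eqP; rewrite -subr_eq0 -/r; apply: contra_eqT s0 => rn.
have rp : 0 < r by rewrite lt_neqAle eq_sym rn.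
rewrite gt_eqF// sin_gt0_pi// mulr_gt0 ?pi_gt0//=.
by rewrite -[ltRHS]mulr1 ltr_pM2l ?pi_gt0.
Qed.

(* The powers of distinct primes have no common period: a common period would *)
(* make their logarithms commensurable. *)
Lemma cpow_prime_periods p b d : prime p -> prime b -> p != b -> (0 < d)%N ->
  cpow p%:R ((2 * pi * d%:R / ln b%:R)%:C * ii) <> 1 :> C.
Proof.
move=> pp pb npb d0.
have lp : 0 < ln (p%:R : R) by rewrite ln_gt0// ltr1n prime_gt1.
have lb : 0 < ln (b%:R : R) by rewrite ln_gt0// ltr1n prime_gt1.
have e : (2 * pi * d%:R / ln b%:R)%:C * ii * (ln p%:R)%:C =
    (2 * pi * (d%:R * ln p%:R / ln b%:R))%:C * ii :> C.
  by rewrite mulrAC -rmorphM; congr (_%:C * _); field; rewrite gt_eqF.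
rewrite /cpow e => /cexp_period[|n hn].
  by rewrite divr_ge0 ?mulr_ge0// ltW.
have hn' : d%:R * ln (p%:R : R) = n%:R * ln b%:R by rewrite -hn divfK// gt_eqF.
have lpd : ln ((p%:R : R) ^+ d) = ln ((b%:R : R) ^+ n).
  by rewrite !lnXn ?ltr0n ?prime_gt0//; move: hn'; rewrite !mulr_natl.
have /eqP : (p%:R : R) ^+ d = b%:R ^+ n.
  by apply: ln_inj lpd; rewrite posrE exprn_gt0// ltr0n prime_gt0.
rewrite -!natrX eqr_nat => /eqP/(congr1 (logn p)); rewrite !lognX !logn_prime// eqxx.
by rewrite muln1 (negbTE npb) muln0 => d1; rewrite d1 in d0.
Qed.

End ComplexPowers.

(** * Reality of the coefficients at primes dividing N *)

Section RealCoefficients.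
Variable R : realType.
Local Notation C := R[i].
Local Notation Re := complex.Re.
Local Notation Im := complex.Im.
Implicit Types (s w c : C) (a : nat -> C) (L : C -> C) (K N k : nat).

Definition ramified N : pred nat := fun q => prime q && ~~ coprime q N.

(** The product of the Euler factors at the primes dividing N, where the Hecke recursion has no
    second-order term. *)
Definition bad_euler N a s : C :=
  \prod_(i < N) (if ramified N i.+1 then 1 - a i.+1 * cpow i.+1%:R (- s) else 1).

Lemma ramified_le N p : (0 < N)%N -> ramified N p -> (p <= N)%N.
Proof.
by move=> N0 /andP[pp]; rewrite prime_coprime// negbK => /dvdn_leq ->.
Qed.

Lemma cdiff_bad_euler N a s : cdiff (bad_euler N a) s.
Proof.
apply: (@cdiff_prod _ _ _ _ (fun (i : 'I_N) w =>
  if ramified N i.+1 then 1 - a i.+1 * cpow i.+1%:R (- w) else 1)) => i _.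
case: (ramified N i.+1); last exact: cdiff_cst.
apply: cdiffB; first exact: cdiff_cst.
apply: cdiffM; first exact: cdiff_cst.
by apply: (@cdiff_comp _ (fun w => - w) (cpow i.+1%:R)); [apply: (@cdiffN _ id); exact: cdiff_id|exact: cdiff_cpow].
Qed.

Lemma bad_euler_eq0 N a s : bad_euler N a s = 0 ->
  exists i : 'I_N, ramified N i.+1 /\ a i.+1 = cpow i.+1%:R s.
Proof.
move/eqP/prodf_eq0 => -[i _]; case: ifP => ri; last by rewrite oner_eq0.
move=> /eqP h; exists i; split=> //; move/eqP: h; rewrite subr_eq0 => /eqP h.
by rewrite cpowN in h; rewrite -[RHS]mul1r h divfK// cpow_neq0.
Qed.

Lemma bad_euler0 N a s p : (0 < N)%N -> ramified N p -> a p = cpow p%:R s ->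
  bad_euler N a s = 0.
Proof.
move=> N0 rp e; have pN := ramified_le N0 rp.
have p0 : (0 < p)%N by case/andP: rp => /prime_gt0.
have iN : (p.-1 < N)%N by rewrite prednK.
apply/eqP/prodf_eq0; exists (Ordinal iN) => //=.
by rewrite prednK// rp e -cpowD subrr cpow0 subrr.
Qed.

Lemma sieve_ramified a N k l s : hecke_relations k N a ->
  csum (fun n => a n.+1 * cpow n.+1%:R (- s)) l ->
  csum (fun n => if sifted (ramified N) N n then 0 else a n * cpow n%:R (- s))
    (bad_euler N a s * l).
Proof.
move=> hr hl; have [a0 _ _] := hr; pose u n := a n * cpow n%:R (- s).
pose x p := a p * cpow p%:R (- s).
pose y p := (if coprime p N then p%:R ^+ k.-1 else 0) * (cpow p%:R (- s) * cpow p%:R (- s)).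
have u0 : u 0%N = 0 by rewrite /u a0 mul0r.
have hu : csum u l by rewrite -[l]add0r -u0; exact: csum_cons hl.
have relu p n : prime p -> u (p * n)%N =
    x p * u n - (if (p %| n)%N then y p * u (n %/ p)%N else 0).
  by move=> pp; exact: (hecke_dirichlet s n hr pp).
have := @sieve _ (ramified N) u l x y N (fun q h => proj1 (andP h)) hu relu.
congr (csum _ (_ * _)); apply: eq_bigr => i _; case: ifP => // /andP[_ /negbTE iN].
by rewrite /y iN mul0r addr0.
Qed.

Lemma hecke_real a N k (Q : pred nat) : hecke_relations k N a ->
  (forall p, prime p -> Q p -> cj (a p) = a p) ->
  forall n, (forall p, prime p -> (p %| n)%N -> Q p) -> cj (a n) = a n.
Proof.
move=> [a0 a1 rel] h n; elim/ltn_ind: n => -[_ _|[_ _|n IH hn]].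
- by rewrite a0 rmorph0.
- by rewrite a1 rmorph1.
have pp : prime (pdiv n.+2) by exact: pdiv_prime.
move: (pdiv n.+2) pp (pdiv_dvd n.+2) => p pp pn.
have [m em] := dvdnP pn; rewrite mulnC in em.
have m0 : (0 < m)%N by rewrite lt0n; apply: contra_eq_neq em => ->; rewrite muln0.
have mn : (m < n.+2)%N by rewrite em ltn_Pmull// prime_gt1.
have real d : (d %| m)%N -> cj (a d) = a d.
  move=> dm; apply: IH; first by apply: leq_ltn_trans mn; exact: dvdn_leq.
  by move=> q qq qd; apply: hn => //; rewrite em dvdn_mull// (dvdn_trans qd).
rewrite em rel// rmorphB/= rmorphM/= h// ?real//; last by apply: hn.
case: ifP => [/andP[_ pm]|_]; last by rewrite rmorph0.
rewrite rmorphM/= rmorphXn/= conjc_nat real//.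
by apply: dvdn_div.
Qed.

Lemma hecke_relations_conj a N k : hecke_relations k N a ->
  hecke_relations k N (fun n => cj (a n)).
Proof.
move=> [a0 a1 rel]; split=> [||p n pp]; rewrite ?a0 ?a1 ?rmorph0 ?rmorph1//.
rewrite rel// rmorphB/= rmorphM/=; congr (_ - _); case: ifP => _; last by rewrite rmorph0.
by rewrite rmorphM/= rmorphXn/= conjc_nat.
Qed.

(* The left-hand side vanishes at every root of its factor at b, which form an *)
(* arithmetic progression; a factor at another prime vanishes at most once on  *)
(* it, so some factor at b on the right-hand side vanishes there as well.      *)
Lemma ramified_real a N K (b : nat) : (0 < N)%N -> ramified N b ->
  (forall s, bad_euler N a s * bad_euler N (fun n => cj (a n)) (K%:R - s) =
             bad_euler N (fun n => cj (a n)) s * bad_euler N a (K%:R - s)) ->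
  cj (a b) = a b.
Proof.
move=> N0 rb hT; have [->|ab0] := eqVneq (a b) 0; first by rewrite rmorph0.
have pb : prime b by case/andP: rb.
have lb : 0 < ln (b%:R : R) by rewrite ln_gt0// ltr1n prime_gt1.
have [z ez] := cexp_surj ab0.
pose del (d : nat) : C := (2 * pi * d%:R / ln b%:R)%:C * ii.
pose s0 := z / (ln b%:R)%:C; pose s d := s0 + del d.
have bl : (ln (b%:R : R))%:C != 0 by rewrite eq_complex/= eqxx andbT gt_eqF.
have bs d : cpow b%:R (s d) = a b.
  rewrite /s cpowD /cpow /s0 divfK// ez.
  have -> : del d * (ln b%:R)%:C = (2 * pi)%:C * ii * d%:R.
    rewrite /del mulrAC -rmorphM/= divfK ?gt_eqF// rmorphM/= rmorph_nat; ring.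
  by rewrite cexpMn cexp_2pi expr1n mulr1.
(* A zero of the right-hand side comes from a prime [j.1 + 1] in one of its two products, told apart
   by [j.2]; [v j] is the value this forces on the power of that prime. *)
pose v (j : 'I_N * bool) := if j.2 then cj (a j.1.+1) else j.1.+1%:R ^+ K / a j.1.+1.
have hz d : exists j : 'I_N * bool,
    ramified N j.1.+1 && (cpow j.1.+1%:R (s d) == v j).
  have /eqP : bad_euler N (fun n => cj (a n)) (s d) * bad_euler N a (K%:R - s d) = 0.
    by rewrite -hT (@bad_euler0 _ _ _ b) ?mul0r.
  rewrite mulf_eq0 => /orP[]/eqP/bad_euler_eq0[i [ri ei]].
    by exists (i, true); rewrite ri/= -ei /v eqxx.
  exists (i, false); rewrite ri/= /v/=; move: (s d) ei => w ->.
  rewrite cpowD cpowN cpow_nat ?ltr0n// rmorphXn/= rmorph_nat.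
  by rewrite invfM invrK mulrA divff ?mul1r// expf_neq0// pnatr_eq0.
have [[d [j [rj ej jb]]]|none] :=
    pselect (exists d, exists j : 'I_N * bool, [/\ ramified N j.1.+1, cpow j.1.+1%:R (s d) = v j & j.1.+1 = b]).
  (* The vanishing factor belongs to b itself: either a_b equals its conjugate, or a_b^2 = b^K > 0.
     Either way a_b is real. *)
  move: ej; rewrite /v jb bs; case: j.2 => // e.
  have : a b ^+ 2 = ((b%:R : R) ^+ K)%:C.
    by rewrite rmorphXn/= rmorph_nat expr2 {1}e divfK.
  case: (a b) ab0 => x y ab0.
  rewrite expr2 => /eqP; rewrite eq_complex/= => /andP[/eqP h1 /eqP h2].
  have b0 : 0 < (b%:R : R) ^+ K by rewrite exprn_gt0// ltr0n prime_gt0.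
  suff -> : y = 0 by rewrite oppr0.
  have /eqP : x * y = 0 by move: h2; rewrite [y * x]mulrC; lra.
  rewrite mulf_eq0 => /orP[]/eqP// x0.
  by move: h1 b0; rewrite x0; have := sqr_ge0 y; rewrite expr2; lra.
(* Pigeonhole: 2N + 1 points of the progression against 2N indices. Two points share an index at a
   prime other than b, whose powers would then have a period that [cpow_prime_periods] forbids. *)
pose g (d : 'I_(N * 2).+1) := xchoose (hz d).
have /injectivePn[d [d' dd' eg]] : ~~ injectiveb g.
  apply/negP => /injectiveP/leq_card; rewrite card_ord card_prod card_ord card_bool.
  by rewrite ltnn.
wlog lt : d d' dd' eg / (d < d')%N.
  move=> h; have [l|l|/val_inj e] := ltngtP d d'; first exact: (h d d').
    by apply: (h d' d) => //; rewrite eq_sym.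
  by rewrite e eqxx in dd'.
have /andP[r1 /eqP e1] := xchooseP (hz d); have /andP[_ /eqP e2] := xchooseP (hz d').
rewrite -/(g d) in r1 e1; rewrite -/(g d') -eg in e2.
have nb : (g d).1.+1 != b by apply/eqP => e; apply: none; exists d, (g d).
have dd : (0 < d' - d)%N by rewrite subn_gt0.
have pp : prime (g d).1.+1 by case/andP: r1.
case: (@cpow_prime_periods R _ _ _ pp pb nb dd).
rewrite -/(del _); have -> : del (d' - d)%N = s d' - s d.
  by rewrite /s /del natrB 1?ltnW// mulrBr mulrBl rmorphB/= mulrBl opprD addrACA subrr add0r.
by rewrite cpowD cpowN e1 e2 divff// -e1 cpow_neq0.
Qed.

Lemma Lambda_conj N L s : 0 < Re s ->
  Lambda N (fun s => cj (L (cj s))) s = cj (Lambda N L (cj s)).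
Proof.
move=> s0; rewrite /Lambda Gamma_conj// cpow_conj.
move: (cpow _ _) (Gamma s) (L _) => x y z.
by rewrite !rmorphM /= !conjcK.
Qed.

(** L and its conjugate satisfy the same functional equation, and they agree after multiplication by
    their Euler factors at the primes dividing N. Eliminating both L-functions leaves a relation
    between the finite products. *)
Lemma bad_euler_symm K N a L eps : (0 < N)%N -> (1 < K)%N ->
  Lseries K N a L -> is_root_number K.*2 N L eps ->
  (forall p, prime p -> coprime p N -> cj (a p) = a p) ->
  forall s, bad_euler N a s * bad_euler N (fun n => cj (a n)) (K.*2%:R - s) =
            bad_euler N (fun n => cj (a n)) s * bad_euler N a (K.*2%:R - s).
Proof.
move=> N0 K1 hL he ha; have K0 : (0 < K)%N by apply: ltnW.
have K1R : (2%:R : R) <= K%:R by rewrite ler_nat.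
have [hr _ _ dL sL] := hL; pose Lc s := cj (L (cj s)); pose ac n := cj (a n).
have dLc s : cdiff Lc s by exact: cdiff_conj.
have sLc s : K%:R + 1 < Re s -> csum (fun n => ac n.+1 * cpow n.+1%:R (- s)) (Lc s).
  move=> hs; have hs' : K%:R + 1 < Re (cj s) by rewrite ReJ.
  apply: csum_ext (csum_conj (sL _ hs')) => n.
  have -> : cpow n.+1%:R (- s) = cj (cpow n.+1%:R (- cj s)).
    by rewrite -cpow_conj rmorphN/= conjcK.
  by rewrite -rmorphM.
(* Sifting out the primes dividing N leaves coefficients that are real by hypothesis, so both sides
   are sums of the same series. *)
have BL s : bad_euler N a s * L s = bad_euler N ac s * Lc s.
  apply/eqP; rewrite -subr_eq0; apply/eqP.
  apply: (@identity_halfplane _ (fun s => bad_euler N a s * L s - bad_euler N ac s * Lc s)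
    (Re s - 1) (K%:R + 1)); last by rewrite ltrBlDl ltrDr.
    move=> w _; apply: cdiffB; apply: cdiffM => //; exact: cdiff_bad_euler.
  move=> w hw; apply/eqP; rewrite subr_eq0; apply/eqP.
  apply: csum_unique (sieve_ramified (hecke_relations_conj hr) (sLc w hw)).
  apply: csum_ext (sieve_ramified hr (sL w hw)) => -[|n].
    by have [a0 _ _] := hr; rewrite /= /ac a0; set X := sifted _ _ _; case: X => //; rewrite conjc0 !mul0r.
  have [//|ns] := boolP (sifted _ _ _).
  rewrite /ac (hecke_real (Q := fun p => coprime p N) hr)// => p pp pn.
  apply: contraNT ns => pN; have rp : ramified N p by rewrite /ramified pp.
  apply/hasP; exists p.-1; last by rewrite prednK ?prime_gt0// rp.
  by rewrite mem_iota/= add0n prednK ?prime_gt0// ramified_le.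
have fe s : 0 < Re s -> Re s < K.*2%:R ->
    Lambda N L s = eps * Lambda N L (K.*2%:R - s).
  by move=> s0 s1; apply: he.2; apply: not_pole; rewrite // ReD ReN Re_nat subr_gt0.
have ec : cj eps = eps by case: he => -[->|->] _; rewrite ?rmorphN ?rmorph1.
have fec s : 0 < Re s -> Re s < K.*2%:R ->
    Lambda N Lc s = eps * Lambda N Lc (K.*2%:R - s).
  move=> s0 s1; rewrite !Lambda_conj//; last by rewrite ReD ReN Re_nat subr_gt0.
  by rewrite fe ?ReJ// rmorphM/= ec rmorphB/= conjc_nat.
pose g s := cpow (Num.sqrt N%:R / (2 * pi)) s * Gamma s.
have g0 s : 0 < Re s -> g s != 0 by move=> s0; rewrite mulf_neq0 ?cpow_neq0 ?Gamma_neq0.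
have e0 : eps != 0 by case: he => -[->|->] _; rewrite ?oppr_eq0 oner_eq0.
move=> s; apply/eqP; rewrite -subr_eq0; apply/eqP; move: s.
(* On this disc K + 1 < Re s < K + 2 <= 2K, which is where K > 1 enters: L(s) does not vanish by
   [Lseries_lower], and the functional equation holds at s. *)
apply: (@identity_entire _ _ (K%:R + 3%:R / 2%:R) (1 / 2)) => //.
  have refl b w : cdiff (fun w => bad_euler N b (K.*2%:R - w)) w.
    apply: (@cdiff_comp _ (fun w => K.*2%:R - w) (bad_euler N b)).
      by apply: cdiffB; [exact: cdiff_cst|exact: cdiff_id].
    exact: cdiff_bad_euler.
  by move=> s; apply: cdiffB; apply: cdiffM;
    [exact: cdiff_bad_euler|exact: refl|exact: cdiff_bad_euler|exact: refl].
move=> s hs; have hRe : `|Re s - (K%:R + 3%:R / 2)| < 1 / 2.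
  apply: le_lt_trans hs; have := cabs_Re (s - (K%:R + 3%:R / 2%:R)).
  congr (`|_| <= _); rewrite ReD ReN ReD Re_nat; congr (_ - (_ + _)).
  have -> : 3%:R / 2%:R = (3%:R / 2)%:C :> C by rewrite rmorphM/= rmorphV ?unitfE// !rmorph_nat.
  by [].
have [r1 r2] : K%:R + 1 < Re s /\ Re s < K%:R + 2.
  by move: hRe; rewrite ltr_norml => /andP[]; clear; lra.
have s0 : 0 < Re s by move: r1 K1R; clear; lra.
have s1 : Re s < K.*2%:R by rewrite -addnn natrD; move: r2 K1R; clear; lra.
have s0' : 0 < Re (K.*2%:R - s) by rewrite ReD ReN Re_nat subr_gt0.
have hK : K%:R + 1 / 2 < K%:R + 1 :> R by clear; lra.
have [c c0 hc] := Lseries_lower K0 hL hK.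
have Ls : L s != 0 by rewrite -cabs_gt0 (lt_le_trans c0)// hc// ltW.
have Lcs : Lc s != 0.
  by rewrite -cabs_gt0 cabs_conj (lt_le_trans c0)// hc// ReJ ltW.
have F1 := fe s s0 s1; have F2 := fec s s0 s1.
rewrite /Lambda -/(g s) -/(g _) in F1 F2.
have gs := g0 _ s0; have gs' := g0 _ s0'.
have Lcs' : Lc (K.*2%:R - s) != 0.
  by apply: contraNneq (mulf_neq0 gs Lcs) => e; rewrite F2 e !mulr0.
have B1 := BL s; have B2 := BL (K.*2%:R - s);
apply/eqP; rewrite subr_eq0; apply/eqP.
pose s' := K.*2%:R - s; rewrite -/s' in B1 B2 F1 F2 Lcs' gs' *.
rewrite -/ac in B1 B2 *; move: (bad_euler N a s) (bad_euler N ac s') (bad_euler N ac s) (bad_euler N a s')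
  (L s) (L s') (Lc s) (Lc s') (g s) (g s') B1 B2 F1 F2 Ls Lcs' gs gs'.
move=> b1 b2 b3 b4 l1 l2 l3 l4 g1 g2.
move=> B1 B2 F1 F2 n1 n4 ng1 ng2.
have X : l1 * l4 = l2 * l3.
  have E : g1 * (g2 * eps) * (l1 * l4) = g1 * (g2 * eps) * (l2 * l3).
    transitivity ((g1 * l1) * (eps * (g2 * l4))); first by ring.
    by rewrite -F2 F1; ring.
  exact: (mulfI (mulf_neq0 ng1 (mulf_neq0 ng2 e0)) E).
have E : l1 * l4 * (b1 * b2) = l1 * l4 * (b3 * b4).
  transitivity ((b1 * l1) * (b2 * l4)); first by ring.
  by rewrite B1 -B2 X; ring.
exact: (mulfI (mulf_neq0 n1 n4) E).
Qed.

Lemma Lseries_real K N a L eps : (0 < N)%N -> (1 < K)%N ->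
  Lseries K N a L -> is_root_number K.*2 N L eps ->
  (forall p, prime p -> coprime p N -> cj (a p) = a p) -> forall n, cj (a n) = a n.
Proof.
move=> N0 K1 hL he ha n; have [hr _ _ _ _] := hL.
apply: (hecke_real (Q := predT) hr) => // p pp _.
have [pN|pN] := boolP (coprime p N); first exact: ha.
apply: (@ramified_real _ N K.*2) => //; first by rewrite /ramified pp.
exact: bad_euler_symm hL he ha.
Qed.

End RealCoefficients.

Theorem theorem1p1 (R : realType) (k N : nat) (f L : complex R -> complex R)
    (eps : complex R) (hk : (4 <= k)%N) (hk_even : ~~ odd k) (hN : (0 < N)%N)
    (hf : newform k N f) (hL : is_Lfunction k f L)
    (heps : is_root_number k N L eps) :
  (forall s : complex R, Zf k N L eps s = eps * Zf k N L eps (1 - s)) /\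
  (forall rho : complex R,
     Zf k N L eps rho = 0 -> complex.Re rho = 1 / 2).
Proof.
have [K kK] : exists K, k = K.*2 by exists k./2; rewrite -[LHS]odd_double_half (negbTE hk_even).
subst k; have K1 : (1 < K)%N by move: hk; rewrite -(leq_double 2).
have K0 : (0 < K)%N := ltnW K1.
have [a fa La] := newform_Lseries hN K0 hf hL.
have [hr _ _ _ _] := La; have [a0 a1 _] := hr.
(* f is not identically zero, as its first coefficient is 1. *)
have [z1 z10 fz1] : exists2 z1, upper z1 & f z1 != 0.
  apply: contrapT => none.
  have f0 : fourier_expansion f (fun n => 0 * a n).
    apply: (@fourier_ext R (fun z => 0 * f z)) => [z z0|].
      have [->|nz] := eqVneq (f z) 0; first by rewrite mulr0.
      by case: none; exists z.
    apply: fourierI => z z0; apply: csum_ext (csumZ 0 (fourierP fa z0)) => m.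
    by rewrite mulrA.
  have := congr1 (fun h => h 1%N) (coef_unique fa f0).
  by rewrite /= a1 mul0r => /eqP; rewrite oner_eq0.
have [cf _ hT _] := hf.
have real_p p : prime p -> coprime p N -> cj (a p) = a p.
  move=> pp pN; have [la hla] := hT p (prime_gt0 pp).
  have k0 : (0 < K.*2)%N by rewrite double_gt0.
  rewrite -(hecke_eigenvalue_coef k0 pp fa a1 hla).
  have := hecke_eigenvalue_real hN K0 pp pN cf hla z10 fz1.
  by case: la {hla} => x y /= ->; rewrite oppr0.
have real := Lseries_real hN K1 La heps real_p.
have [m em] : exists m, K.*2 = m.+3 by exists (K.*2 - 3)%N; lia.
have m0 : (0 < m)%N by lia.
have := @zeta_polynomial_RH R m K N L eps a hN m0 (esym em) La real heps.
by rewrite -em.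
Qed.
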